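(* Let $\{\psi_v\}_{v\in V_N}$ be the $(\boldsymbol\sigma,\boldsymbol\lambda)$-GFF on $V_N$ and let $\gamma$ satisfy $\gamma^{l-1}\le\gamma<\gamma^l$ for some $l\in\{1,\dots,m\}$. Let $\mathcal H_N^\gamma=\{v\in V_N:\psi_v\ge\gamma\log N^2\}$. Then $$\lim_{N\to\infty}\frac{\log|\mathcal H_N^\gamma|}{\log N^2}=(1-\lambda^{l-1})-\frac{\big(\gamma-\mathcal J_{\sigma^2/\bar\sigma}(\lambda^{l-1})\big)^2}{\mathcal J_{\sigma^2}(\lambda^{l-1},1)}\qquad\text{in probability.}$$
   Context: Boxes and GFF. Let $N\ge 1$ be an integer and $V_N=\{0,1,\dots,N\}^2\subseteq\mathbb Z^2$. For a finite $B\subseteq\mathbb Z^2$ put $\partial B=\{v\in B:\exists z\in\mathbb{Z}^2\setminus B,\ \|v-z\|_2=1\}$ and $B^o=B\setminus\partial B$. Let $(W_k)_{k\ge0}$ be the simple random walk on $\mathbb Z^2$ started at $u$ under $\mathscr P_u$ (expectation $\mathscr E_u$), and $\tau_{\partial B}=\min\{k\ge0:W_k\in\partial B\}$. Set $G_B(u,v)=\frac{\pi}{2}\,\mathscr E_u\big[\sum_{k=0}^{\tau_{\partial B}-1}1_{\{W_k=v\}}\big]$ for $u,v\in B$ (empty sums are $0$). The Gaussian free field (GFF) on $V_N$ is the centered Gaussian vector $\{\phi_v\}_{v\in V_N}$ with covariance matrix $G_{V_N}$. Neighborhoods. For $v=(v_1,v_2)\in V_N$ and $\lambda\in(0,1)$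 let $[v]_\lambda=\big([v_1-\tfrac12N^{1-\lambda},v_1+\tfrac12N^{1-\lambda}]\times[v_2-\tfrac12N^{1-\lambda},v_2+\tfrac12N^{1-\lambda}]\big)\cap V_N$; also $[v]_0=V_N$ and $[v]_1=\{v\}$. Let $\mathcal F_{v,\lambda}=\sigma(\{\phi_w: w\in V_N,\ w\notin[v]_\lambda^o\})$ and $\phi_v(\lambda)=\mathbb E[\phi_v\mid\mathcal F_{v,\lambda}]$. Scale-inhomogeneous GFF. Fix $M\in\mathbb N$, $\boldsymbol\sigma=(\sigma_1,\dots,\sigma_M)\in(0,\infty)^M$ and $\boldsymbol\lambda=(\lambda_1,\dots,\lambda_M)$ with $0=\lambda_0<\lambda_1<\dots<\lambda_M=1$. The $(\boldsymbol\sigma,\boldsymbol\lambda)$-GFF on $V_N$ is $\psi_v=\sum_{i=1}^M\sigma_i(\phi_v(\lambda_i)-\phi_v(\lambda_{i-1}))$, $v\in V_N$. Let $\sigma(s)=\sigma_1 1_{\{0\}}(s)+\sum_{i=1}^M\sigma_i1_{(\lambda_{i-1},\lambda_i]}(s)$, $s\in[0,1]$. Effective variance and critical levels. For positive measurable $f$ on $[0,1]$ write $\mathcal J_f(s)=\int_0^sf(r)\,dr$ and $\mathcal J_f(s_1,s_2)=\int_{s_1}^{s_2}f(r)\,dr$. Let $\hat{\mathcal J}_{\sigma^2}$ be the least concave majorant on $[0,1]$ of $\mathcal J_{\sigma^2}$ (its graph is the concave hull). $\bar\sigma$ denotes the unique positive, non-increasing, left-continuous step function with $\hat{\mathcal J}_{\sigma^2}(s)=\int_0^s\bar\sigma^2(r)\,dr$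 for all $s\in(0,1]$. Let $0=\lambda^0<\lambda^1<\dots<\lambda^m=1$ be such that $\lambda^1,\dots,\lambda^{m-1}$ are the jump points of $\bar\sigma$ in $(0,1)$, and $\bar\sigma_l=\bar\sigma(\lambda^l)$ (superscripts are indices, not powers). The critical levels are $\gamma^0=0$ and, for $1\le l\le m$, $\gamma^l=\int_0^1\frac{\sigma^2(s)}{\bar\sigma(s\wedge\lambda^l)}ds=\mathcal J_{\sigma^2/\bar\sigma}(\lambda^l)+\frac{\mathcal J_{\sigma^2}(\lambda^l,1)}{\bar\sigma_l}$. *)

(* Defs.v *)
From mathcomp Require Export all_boot all_order all_algebra.
From mathcomp Require Export all_classical all_reals all_analysis.

Set Implicit Arguments.
Unset Strict Implicit.
Unset Printing Implicit Defensive.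

Export Order.TTheory GRing.Theory Num.Theory.
Export numFieldNormedType.Exports.

#[export] Set Implicit Arguments.
#[export] Unset Strict Implicit.
#[export] Unset Printing Implicit Defensive.

#[global] Open Scope classical_set_scope.
#[global] Open Scope ring_scope.

Definition lattice : Type := (int * int)%type.

(* For integer points, being at Euclidean distance 1 is the same as being at
   squared Euclidean distance 1. *)
Definition adjacent (x y : lattice) : bool :=
  (x.1 - y.1) ^+ 2 + (x.2 - y.2) ^+ 2 == 1.

Definition boundary (B : set lattice) : set lattice :=
  [set v | B v /\ exists2 z, ~ B z & adjacent v z].

Definition inner (B : set lattice) : set lattice := B `\` boundary B.

Definition box_set (N : nat) : set lattice :=
  [set z | (0 <= z.1 <= N%:Z) /\ (0 <= z.2 <= N%:Z)].

(* The points of [box_set N], as a finite type indexing the fields. *)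
Definition box (N : nat) : finType := ('I_N.+1 * 'I_N.+1)%type.

Definition point N (v : box N) : lattice := ((v.1 : nat)%:Z, (v.2 : nat)%:Z).

Definition neighborhood (R : realType) (N : nat) (lam : R) (v : lattice) :
    set lattice :=
  if lam == 0 then box_set N
  else if lam == 1 then [set v]
  else
    let r : R := 2^-1 * N%:R `^ (1 - lam) in
    [set w | w.1%:~R \in `[v.1%:~R - r, v.1%:~R + r] /\
             w.2%:~R \in `[v.2%:~R - r, v.2%:~R + r]] `&` box_set N.

Definition srw_kernel (R : realType) (x y : lattice) : R :=
  if adjacent x y then 4^-1 else 0.

Definition simple_random_walk (R : realType) d (T : measurableType d)
    (P : probability T R) (u : lattice) (W : nat -> T -> lattice) : Prop :=
  (forall k x, measurable (W k @^-1` [set x])) /\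
  (forall (n : nat) (x : nat -> lattice),
     P [set t | forall k, (k <= n)%N -> W k t = x k] =
     ((x 0%N == u)%:R * \prod_(k < n) srw_kernel R (x k) (x k.+1))%:E).

(* First hitting time of [A]; it is [+oo] when [A] is never hit. *)
Definition hitting_time (R : realType) (A : set lattice) (w : nat -> lattice) :
    \bar R :=
  ereal_inf [set (k%:R)%:E | k in [set k : nat | A (w k)]].

Definition green (R : realType) d (T : measurableType d)
    (P : lattice -> probability T R) (W : nat -> T -> lattice)
    (B : set lattice) (u v : lattice) : \bar R :=
  ((pi / 2)%:E *
   \int[P u]_t
     \sum_(0 <= k <oo | (k%:R)%:E < hitting_time R (boundary B) (W ^~ t))
        (\1_[set v] (W k t))%:E)%E.

(* Normal law with mean [m] and standard deviation [s], including the
   degenerate case, for which [normal_prob m 0] has a different meaning. *)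
Definition gaussian_law (R : realType) (m s : R) (A : set R) : \bar R :=
  if s == 0 then \d_m A else normal_prob m s A.

Definition gaussian_vector (R : realType) d (T : measurableType d)
    (P : probability T R) (I : finType) (X : I -> {RV P >-> R}) : Prop :=
  forall a : I -> R, exists m s : R, forall A : set R, measurable A ->
    P ((fun t => \sum_i a i * X i t) @^-1` A) = gaussian_law m s A.

Definition GFF (R : realType) dW (TW : measurableType dW)
    (PW : lattice -> probability TW R) (W : nat -> TW -> lattice)
    d (T : measurableType d) (P : probability T R) (N : nat)
    (phi : box N -> {RV P >-> R}) : Prop :=
  [/\ gaussian_vector phi,
      forall v, ('E_P[phi v] = 0)%E &
      forall u v, covariance P (phi u) (phi v) =
                  green PW W (box_set N) (point u) (point v)].

(* [Y] is a version of the conditional expectation of [X] given the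
   sigma-algebra [F]. *)
Definition cond_expectation (R : realType) d (T : measurableType d)
    (P : probability T R) (F : set (set T)) (X Y : T -> R) : Prop :=
  [/\ forall B : set R, measurable B -> F (Y @^-1` B),
      P.-integrable setT (EFin \o Y) &
      forall A, F A -> (\int[P]_(t in A) (Y t)%:E = \int[P]_(t in A) (X t)%:E)%E].

Definition outer_sigma_algebra (R : realType) d (T : measurableType d)
    (P : probability T R) (N : nat) (phi : box N -> {RV P >-> R})
    (v : box N) (lam : R) : set (set T) :=
  <<s \bigcup_(w in [set w | ~ inner (neighborhood N lam (point v)) (point w)])
        preimage_set_system setT (phi w) measurable >>.

(* The parameters are [sigma 1 .. sigma M] and [lambda 0 .. lambda M]; values
   of these sequences at other indices are irrelevant. *)
Definition inhomogeneous_GFF (R : realType) (M : nat) (sigma lambda : nat -> R)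
    d (T : measurableType d) (P : probability T R) (N : nat)
    (phi : box N -> {RV P >-> R}) (psi : box N -> T -> R) : Prop :=
  exists Phi : box N -> R -> T -> R,
    (forall v i, (i <= M)%N ->
       cond_expectation P (outer_sigma_algebra phi v (lambda i))
         (phi v) (Phi v (lambda i))) /\
    (forall v t, psi v t =
       \sum_(1 <= i < M.+1)
          sigma i * (Phi v (lambda i) t - Phi v (lambda i.-1) t)).

Definition variance_profile (R : realType) (M : nat) (sigma lambda : nat -> R)
    (s : R) : R :=
  sigma 1%N * \1_[set 0%R] s +
  \sum_(1 <= i < M.+1) sigma i * \1_`]lambda i.-1, lambda i] s.

Definition J (R : realType) (f : R -> R) (s1 s2 : R) : R :=
  (\int[lebesgue_measure]_(r in `[s1, s2]) f r)%R.

Definition concave01 (R : realType) (f : R -> R) : Prop :=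
  @convex_function R R^o `[0, 1] (fun x => - f x).

Definition least_concave_majorant (R : realType) (f g : R -> R) : Prop :=
  [/\ concave01 g,
      {in `[0, 1], forall s, f s <= g s} &
      forall h, concave01 h -> {in `[0, 1], forall s, f s <= h s} ->
        {in `[0, 1], forall s, g s <= h s}].

Definition step_function01 (R : realType) (f : R -> R) : Prop :=
  exists (n : nat) (t c : nat -> R),
    [/\ t 0%N = 0, t n = 1,
        forall i, (i < n)%N -> t i < t i.+1 &
        forall i, (i < n)%N -> {in `]t i, t i.+1[, forall s, f s = c i}].

(* These conditions determine [sbar] on ]0, 1]; its value at 0 plays no role. *)
Definition effective_profile (R : realType) (sig sbar : R -> R) : Prop :=
  [/\ {in `[0, 1], forall s, 0 < sbar s},
      {in `[0, 1] &, {homo sbar : x y /~ x <= y}},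
      {in `]0, 1], forall s, sbar x @[x --> s^'-] --> sbar s},
      step_function01 sbar &
      exists2 hatJ : R -> R,
        least_concave_majorant (J (fun r => sig r ^+ 2) 0) hatJ &
        {in `]0, 1], forall s, hatJ s = J (fun r => sbar r ^+ 2) 0 s}].

(* [lam 0 < .. < lam m] consists of 0, the jump points of [f] in ]0, 1[, and 1. *)
Definition jump_subdivision (R : realType) (f : R -> R) (m : nat)
    (lam : nat -> R) : Prop :=
  [/\ lam 0%N = 0, lam m = 1,
      forall l, (l < m)%N -> lam l < lam l.+1 &
      [set lam l | l in [set l | (0 < l < m)%N]] =
      [set s | 0 < s < 1 /\ ~ {for s, continuous f}]].

Definition critical_level (R : realType) (sig sbar : R -> R) (lam : nat -> R)
    (l : nat) : R :=
  if l == 0%N then 0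
  else J (fun s => sig s ^+ 2 / sbar (Num.min s (lam l))) 0 1.

Definition high_points (R : realType) (T : Type) (N : nat)
    (psi : box N -> T -> R) (gamma : R) (t : T) : {set box N} :=
  [set v | gamma * ln (N%:R ^+ 2) <= psi v t]%SET.

(* The variables may live on different probability spaces and may take infinite
   values, such as [lne 0 = -oo]. *)
Definition cvg_in_probability (R : realType) (d : nat -> measure_display)
    (T : forall N, measurableType (d N)) (P : forall N, probability (T N) R)
    (X : forall N, T N -> \bar R) (c : R) : Prop :=
  forall eps : R, 0 < eps ->
    (fun N => P N [set t | (eps%:E < `|X N t - c%:E|)%E]) @ \oo --> 0%E.

(* Main.v *)
(* Conditioning a Gaussian vector on some of its coordinates is an orthogonal
   projection, so [psi v] is a combination of the increments
   [phi_v(mu_(k+1)) - phi_v(mu_k)] along any grid [mu] of [0, 1] that refines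
   [sigma] and [sbar].  Comparing Green functions of lattice domains with the
   kernel [1/2 log (1 + |x|^2)], these increments have variance close to
   [(mu_(k+1) - mu_k) log N]; they are uncorrelated at a fixed point, and at two
   points whose neighbourhoods are disjoint.  A reflection and a quadratic
   barrier show that [phi_v(mu)] hardly changes when [v] moves by much less
   than [N^(1 - mu)].

   The concave hull enters through two facts: [J_(sigma^2) <= J_(sbar^2)], with
   equality at each jump of [sbar], since otherwise the corner of the hull there
   could be cut off.  By Abel summation the sum of [(sigma / sbar)^2] over
   [0, mu_k] is at most [mu_k], with equality at [lam l.-1].  Write
   [gamma = A + c B] with [A] the integral of [sigma^2 / sbar] before [lam l.-1]
   and [B] that of [sigma^2] after it.  The bounds on [gamma] place [c] between
   the values of [1 / sbar] before and after [lam l.-1], and the exponent is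
   [1 - V] with [V = lam l.-1 + c^2 B].

   Upper bound: Chernoff's inequality for [c psi v] minus a nonnegative
   combination of coarse fields; the latter are controlled by a union bound over
   about [N^(2 mu_k)] representatives.  Lower bound: the second moment method
   for the events that every increment but the first exceeds a level slightly
   below [sigma^2 (mu_(k+1) - mu_k) theta log N^2], where [theta = 1 / sbar]
   before [lam l.-1] and [theta] is slightly above [c] afterwards; a fine mesh
   makes the contribution of nearby pairs of points negligible. *)

From HB Require Import structures.
Require Import Defs.
From mathcomp Require Import measurable_realfun zify ring lra.

(** * Gaussian laws *)

(** [gaussian_vector] speaks of linear combinations one at a time, so independence and the form of
    conditional expectations have to be derived: sines of linear combinations determine the joint
    law, and iterating one cubic polynomial turns sines into indicators of rays. The Green function
    is handled through its discrete Poisson equation and the maximum principle. Errors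
    [delta * ln N] in variances are harmless, so crude kernels and barriers replace sharp
    asymptotics. In the upper bound the plain first moment is too large when [1 < l]: rare
    configurations in which a coarse field is abnormally high dominate the expected count.
    Subtracting coarse fields removes their effect. In the lower bound the first increment is shared
    even by distant points and would spoil the second moment, so it is left unconstrained and
    bounded from below over the whole box. Its scale interval has to be short for that, whereas the
    total error of the mesh has to stay below a fraction of this same length; hence the length
    [kappa] of the first step is fixed before the mesh of the others. *)

Section normal.
Context {R : realType}.
Implicit Types (m s t u b : R).
Local Notation mu := (@lebesgue_measure R).

Import HBNNSimple.

(** Monotone convergence along simple functions reduces this to indicators, where it is the
    definition of [normal_prob] as an integral of the density. *)
Lemma ge0_integral_normal_prob m s (f : R -> R) :
  measurable_fun setT f -> (forall x, 0 <= f x) ->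
  (\int[normal_prob m s]_x (f x)%:E =
   \int[mu]_x (f x * normal_pdf m s x)%:E)%E.
Proof.
move=> mf f0.
have mf' : measurable_fun setT (fun x => (f x)%:E) by exact/measurable_EFinP.
have mp := @measurable_normal_pdf R m s.
have mp' : measurable_fun setT (fun x => (normal_pdf m s x)%:E) by exact/measurable_EFinP.
pose h := nnsfun_approx measurableT mf'.
have mh n : measurable_fun [set: R] (h n) by exact: measurable_funPT.
have mhs n r : measurable_fun [set: R] (\1_(h n @^-1` [set r]) : R -> R).
  by apply: measurable_indic; rewrite -[X in measurable X]setTI; exact: mh.
have muleindic_ge0 n r x : (0 <= (r * \1_(h n @^-1` [set r]) x)%:E)%E.
  by rewrite EFinM; exact: nnfun_muleindic_ge0.
have ndh x a c : (a <= c)%N -> h a x <= h c x.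
  by move=> ac; exact/lefP/nd_nnsfun_approx.
transitivity (lim (\int[normal_prob m s]_x (EFin \o h n) x @[n --> \oo])%E).
  have fE x : (f x)%:E = lim ((EFin \o h n) x @[n --> \oo]).
    apply/esym/cvg_lim => //; apply: cvg_nnsfun_approx => // y _.
    by rewrite lee_fin.
  transitivity (\int[normal_prob m s]_x (lim ((EFin \o h n) x @[n --> \oo])))%E.
    by apply: eq_integral => x _; exact: fE.
  apply: monotone_convergence => //.
  - by move=> n; apply/measurable_EFinP; exact: mh.
  - by move=> n x Ex //=; rewrite lee_fin.
  - by move=> x Ex a c ac; rewrite lee_fin; exact: ndh.
transitivity (lim (\int[mu]_x (h n x * normal_pdf m s x)%:E @[n --> \oo])%E); last first.
  have fE x : (f x * normal_pdf m s x)%:E = lim ((h n x * normal_pdf m s x)%:E @[n --> \oo]).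
    apply/esym/cvg_lim => //; rewrite EFinM; under eq_fun do rewrite EFinM.
    apply: cvgeZr => //; apply: (cvg_nnsfun_approx measurableT mf' _ (x := x)) => // y _.
    by rewrite lee_fin.
  transitivity (\int[mu]_x (lim ((h n x * normal_pdf m s x)%:E @[n --> \oo])))%E; last first.
    by apply: eq_integral => x _; rewrite fE.
  apply/esym/monotone_convergence => //.
  - move=> n; apply/measurable_EFinP; apply: measurable_funM => //.
    exact: mh.
  - by move=> n x Ex //=; rewrite lee_fin mulr_ge0// normal_pdf_ge0.
  - move=> x Ex a c ac; rewrite lee_fin ler_wpM2r ?normal_pdf_ge0//.
    exact: ndh.
suff suf n : (\int[normal_prob m s]_x (EFin \o h n) x = \int[mu]_x (h n x * normal_pdf m s x)%:E)%E.
  by under eq_fun do rewrite suf.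
rewrite (_ : (fun x => (EFin \o h n) x) = (fun x => \sum_(y \in range (h n)) (y * \1_(h n @^-1` [set y]) x)%:E)%E); last first.
  by apply/funext => x; rewrite /= fimfunE -fsumEFin.
rewrite ge0_integral_fsum//; last first.
  by move=> r; apply/measurable_EFinP; apply: measurable_funM => //; exact: mhs.
rewrite (_ : (fun x => (h n x * _)%:E) = (fun x => \sum_(y \in range (h n)) (y * \1_(h n @^-1` [set y]) x)%:E * (normal_pdf m s x)%:E)%E); last first.
  apply/funext => x; rewrite /= EFinM {1}fimfunE -fsumEFin// ge0_mule_fsuml//.
  by move=> r; exact: muleindic_ge0.
rewrite ge0_integral_fsum//; last 2 first.
  - move=> r; apply: emeasurable_funM => //.
    by apply/measurable_EFinP; apply: measurable_funM => //; exact: mhs.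
  - by move=> r x _; rewrite mule_ge0 ?lee_fin ?normal_pdf_ge0//; exact: muleindic_ge0.
apply: eq_fsbigr => r; rewrite inE => -[y _ hy].
have r0 : 0 <= r by rewrite -hy.
under eq_integral do rewrite EFinM.
rewrite ge0_integralZl//; last first.
  by apply/measurable_EFinP; exact: mhs.
rewrite integral_indic//; last by rewrite -[X in measurable X]setTI; exact: mh.
under [RHS]eq_integral do rewrite EFinM -muleA.
rewrite ge0_integralZl//; last 2 first.
  - by apply: emeasurable_funM => //; apply/measurable_EFinP; exact: mhs.
  - by move=> x _; rewrite mule_ge0// lee_fin ?normal_pdf_ge0.
congr (_ * _)%E; rewrite setIT /normal_prob [LHS]integral_mkcond.
apply: eq_integral => x _; rewrite patchE indicE.
by case: (x \in _); rewrite /= ?mul1e ?mul0e.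
Qed.

(** Completing the square: the exponential times the density is a constant times the density with
    mean [m + t * s ^+ 2]. *)
Lemma normal_prob_mgf m s t : s != 0 ->
  (\int[normal_prob m s]_x (expR (t * x))%:E = (expR (t * m + (t * s) ^+ 2 / 2))%:E)%E.
Proof.
move=> s0.
have mexp : measurable_fun setT (fun x : R => expR (t * x)).
  by apply: measurableT_comp => //; exact: measurable_funM.
rewrite ge0_integral_normal_prob//.
rewrite (_ : (fun x => _) =
    fun x => ((expR (t * m + (t * s) ^+ 2 / 2))%:E * (normal_pdf (m + t * s ^+ 2) s x)%:E)%E); last first.
  apply/funext => x; rewrite -EFinM; congr EFin.
  rewrite !normal_pdfE// /normal_fun mulrCA [RHS]mulrCA; congr (_ * _).
  by rewrite -!expRD; congr expR; field.
rewrite integralZl ?integral_normal_pdf ?mule1//.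
exact: integrable_normal_pdf.
Qed.

End normal.

(** Domination is asked on a unit interval around [a] only, since derivatives such as
    [x * expR (u * x)] have no bound uniform in [u]. *)
Lemma is_derive_under_integral {R : realType} d (Y : measurableType d)
    (mu : {measure set Y -> \bar R}) (f df : R -> Y -> R) (G : Y -> R) (a : R) :
  (forall x, mu.-integrable setT (EFin \o f x)) ->
  (forall x y, is_derive x (1 : R) (f ^~ y) (df x y)) ->
  mu.-integrable setT (EFin \o G) ->
  (forall x y, a - 1 < x < a + 1 -> `|df x y| <= G y) ->
  is_derive a (1 : R) (fun x => \int[mu]_y f x y) (\int[mu]_y df a y).
Proof.
move=> fi fd Gi fG.
have aI : [set` `]a - 1, a + 1[] a by rewrite /= in_itv/= ltrBlDr !ltrDl ltr01.
have dfE x y : partial1of2 f x y = df x y.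
  by rewrite partial1of2E; exact: (@derive_val _ _ _ _ _ _ _ (fd x y)).
have G0 y : 0 <= G y.
  by apply: le_trans (fG a y _); rewrite ?normr_ge0// ltrBlDr !ltrDl ltr01.
have fG' x y : [set` `]a - 1, a + 1[] x -> [set: Y] y -> `|partial1of2 f x y| <= G y.
  by rewrite /= in_itv/= dfE => xI _; exact: fG.
have fdi x y : [set` `]a - 1, a + 1[] x -> [set: Y] y -> derivable (f ^~ y) x 1.
  by move=> _ _; exact: (@ex_derive _ _ _ _ _ _ _ (fd x y)).
apply: DeriveDef.
  exact: (derivable_under_integral measurableT aI (fun x _ => fi x) fdi G0 Gi fG').
rewrite -derive1E (differentiation_under_integral measurableT aI (fun x _ => fi x) fdi G0 Gi fG').
by apply: eq_Rintegral => y _; rewrite dfE.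
Qed.

(** The function is the right-hand side of [normal_tilt_sin], with [A] and [Y] for the sine and
    cosine integrals and [k] for [t * s ^+ 2]. *)
Lemma is_derive_tilt {R : realType} (s A Y k u : R) :
  is_derive u (1 : R) (fun u => expR ((u * s) ^+ 2 / 2) * (A * cos (u * k) + Y * sin (u * k)))
    (u * s ^+ 2 * expR ((u * s) ^+ 2 / 2) * (A * cos (u * k) + Y * sin (u * k)) +
     expR ((u * s) ^+ 2 / 2) * (Y * cos (u * k) - A * sin (u * k)) * k).
Proof. by apply: is_derive_eq; rewrite /GRing.scale/=; field. Qed.

Section normal_chf.
Context {R : realType} (s : R) (s0 : s != 0).
Implicit Types (t u b : R).
Local Notation mu := (@lebesgue_measure R).
Local Notation nu := (normal_prob 0 s : probability _ R).

Lemma integrable_normal_expR t : nu.-integrable setT (EFin \o (fun x => expR (t * x))).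
Proof.
have mexp : measurable_fun setT (fun x : R => expR (t * x)).
  by apply: measurableT_comp => //; exact: measurable_funM.
apply/integrableP; split; first exact/measurable_EFinP.
under eq_integral do rewrite /= ger0_norm ?expR_ge0//.
by rewrite normal_prob_mgf// ltry.
Qed.

Lemma le_integrable_normal (f : R -> R) t : measurable_fun setT f ->
  (forall x, `|f x| <= expR (t * x) + expR (- t * x)) ->
  nu.-integrable setT (EFin \o f).
Proof.
move=> mf fle; apply: le_integrable (integrableD _ (integrable_normal_expR t) (integrable_normal_expR (- t))) => //.
  exact/measurable_EFinP.
move=> x _ /=; rewrite lee_fin (le_trans (fle x))// ler_norm//.
Qed.

Lemma integrable_normal_bounded (f : R -> R) : measurable_fun setT f ->
  (forall x, `|f x| <= 2) -> nu.-integrable setT (EFin \o f).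
Proof.
by move=> mf fle; apply: (@le_integrable_normal _ 0) => // x; rewrite oppr0 mul0r expR0.
Qed.

Lemma measurable_sin_affine t b : measurable_fun setT (fun x : R => sin (t * x + b)).
Proof.
apply: measurable_funS measurableT _ _ => //; apply: continuous_measurable_fun.
move=> x; apply: (@continuous_comp _ _ _ (fun x => t * x + b) sin); last exact: continuous_sin.
by apply: cvgD; [apply: cvgMr; exact: cvg_id|exact: cvg_cst].
Qed.

(** Cameron-Martin shift: after completing the square the tilted density is centred at [u * s ^+ 2],
    and a translation recentres it. *)
Lemma normal_tilt (g : R -> R) u : continuous g -> (forall x, 0 <= g x) ->
  (\int[nu]_x (expR (u * x) * g x)%:E =
   (expR ((u * s) ^+ 2 / 2))%:E * \int[nu]_x (g (x + u * s ^+ 2))%:E)%E.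
Proof.
move=> cg g0.
have mg : measurable_fun setT g by exact: continuous_measurable_fun.
have mexp : measurable_fun setT (fun x : R => expR (u * x)).
  by apply: measurableT_comp => //; exact: measurable_funM.
have mg' : measurable_fun setT (fun x : R => g (x + u * s ^+ 2)).
  by apply: measurableT_comp => //; exact: measurable_funD.
rewrite !ge0_integral_normal_prob//; last 2 first.
- exact: measurable_funM.
- by move=> x; rewrite mulr_ge0// expR_ge0.
pose G x := g x * normal_pdf (u * s ^+ 2) s x.
transitivity (\int[mu]_x ((expR ((u * s) ^+ 2 / 2))%:E * (G x)%:E))%E.
  apply: eq_integral => x _; rewrite -EFinM; congr EFin.
  rewrite /G !normal_pdfE// /normal_fun.
  rewrite [LHS](_ : _ = g x * normal_peak s * (expR (u * x) * expR (- (x - 0) ^+ 2 / (s ^+ 2 *+ 2)))); last by ring.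
  rewrite [RHS](_ : _ = g x * normal_peak s * (expR ((u * s) ^+ 2 / 2) * expR (- (x - u * s ^+ 2) ^+ 2 / (s ^+ 2 *+ 2)))); last by ring.
  by rewrite -!expRD; congr (_ * expR _); field.
have G0 x : 0 <= G x by rewrite mulr_ge0// normal_pdf_ge0.
have cG : continuous G.
  by move=> x; apply: cvgM; [exact: cg|exact: continuous_normal_pdf].
have mG : measurable_fun [set: R] (EFin \o G).
  by apply/measurable_EFinP; exact: continuous_measurable_fun.
have G0' (x : R) : [set: R] x -> (0 <= (EFin \o G) x)%E by rewrite lee_fin.
have e0 : (0 <= (expR ((u * s) ^+ 2 / 2))%:E)%E by rewrite lee_fin expR_ge0.
have -> := @ge0_integralZl _ _ R mu setT measurableT _ mG _ G0' e0.
apply: (congr1 (mule _)).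
pose F (x : R^o) : R^o := x + u * s ^+ 2.
have F'E : F^`()%classic = cst 1.
  apply/funext => x; rewrite /F derive1E deriveD// derive_id derive_cst addr0//.
rewrite (@increasing_ge0_integration_by_substitutionT _ F G)//.
- apply: eq_integral => x _; rewrite F'E /= fctE mulr1 /G /F; congr (_ * _)%:E.
  by rewrite !normal_pdfE// /normal_fun addrK subr0.
- by move=> x y xy; rewrite ltrD2r.
- by rewrite F'E => ?; exact: cvg_cst.
- by rewrite F'E; exact: is_cvg_cst.
- by rewrite F'E; exact: is_cvg_cst.
- exact: cvg_addrr_Ny.
- exact: cvg_addrr.
Qed.


Lemma continuous_sin_affine t b : continuous (fun x : R => sin (t * x + b)).
Proof.
move=> x; apply: (@continuous_comp _ _ _ (fun x => t * x + b) sin); last exact: continuous_sin.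
by apply: cvgD; [apply: cvgMr; exact: cvg_id|exact: cvg_cst].
Qed.

Lemma cos_sinD (x : R) : cos x = sin (x + pi / 2).
Proof. by rewrite sinD cos_pihalf sin_pihalf mulr0 add0r mulr1. Qed.

Lemma integrable_normal_sin t b : nu.-integrable setT (EFin \o (fun x => sin (t * x + b))).
Proof.
apply: integrable_normal_bounded; first exact: measurable_sin_affine.
by move=> x; rewrite (le_trans (sin_max _))// ler1n.
Qed.

Lemma integrable_normal_cos t b : nu.-integrable setT (EFin \o (fun x => cos (t * x + b))).
Proof.
rewrite (_ : (fun x => _) = (fun x => sin (t * x + (b + pi / 2)))); first exact: integrable_normal_sin.
by apply/funext => x; rewrite cos_sinD addrA.
Qed.

Lemma integrable_normal_expR_sin u t b :
  nu.-integrable setT (EFin \o (fun x => expR (u * x) * sin (t * x + b))).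
Proof.
apply: (@le_integrable_normal _ u).
  apply: measurable_funM; last exact: measurable_sin_affine.
  by apply: measurableT_comp => //; exact: measurable_funM.
move=> x; rewrite normrM ger0_norm ?expR_ge0// (@le_trans _ _ (expR (u * x)))//.
  by rewrite ler_piMr ?expR_ge0// sin_max.
by rewrite lerDl expR_ge0.
Qed.

(** [normal_tilt] needs a nonnegative function, hence is applied to [1 + sin]; the contribution of
    the constant cancels at the end, and the addition formula expands the shifted sine. *)
Lemma normal_tilt_sin t b u : \int[nu]_x (expR (u * x) * sin (t * x + b)) =
  expR ((u * s) ^+ 2 / 2) * (\int[nu]_x sin (t * x + b) * cos (u * (t * s ^+ 2))
     + \int[nu]_x cos (t * x + b) * sin (u * (t * s ^+ 2))).
Proof.
have cg : continuous (fun x : R => 1 + sin (t * x + b)).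
  by move=> x; apply: cvgD; [exact: cvg_cst|exact: continuous_sin_affine].
have g0 (x : R) : 0 <= 1 + sin (t * x + b) by rewrite addrC -lerBlDr sub0r sin_geN1.
have := normal_tilt u cg g0.
have i1 : nu.-integrable setT (EFin \o (fun x => expR (u * x))) by exact: integrable_normal_expR.
have ic : nu.-integrable setT (EFin \o (fun x => 1 : R)).
  by apply: integrable_normal_bounded => // x; rewrite normr1 ler1n.
have is1 := integrable_normal_sin t b.
have ic1 := integrable_normal_cos t b.
have iZ (f : R -> R) k : nu.-integrable setT (EFin \o f) -> nu.-integrable setT (EFin \o (fun x => f x * k)).
  move=> fi; rewrite (_ : _ \o _ = (fun x => (f x)%:E * k%:E)%E); last by apply/funext => x; rewrite /= EFinM.
  exact: integrableZr.
have iD (f g : R -> R) : nu.-integrable setT (EFin \o f) -> nu.-integrable setT (EFin \o g) ->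
    nu.-integrable setT (EFin \o (fun x => f x + g x)).
  move=> fi gi; rewrite (_ : _ \o _ = (fun x => (f x)%:E + (g x)%:E)%E); last by apply/funext => x; rewrite /= EFinD.
  exact: integrableD.
move=> /(congr1 fine); rewrite fineM//; last first.
  apply: integrable_fin_num => //=.
  rewrite (_ : (fun x => _) = EFin \o (fun x => 1 + (sin (t * x + b) * cos (u * (t * s ^+ 2)) + cos (t * x + b) * sin (u * (t * s ^+ 2))))); last first.
    apply/funext => x /=; congr (EFin (1 + _)).
    by rewrite -sinD; congr sin; ring.
  exact: (iD _ _ ic (iD _ _ (iZ _ _ is1) (iZ _ _ ic1))).
rewrite -!/(Rintegral _ _ _) /=.
rewrite (_ : (fun x => _ * (1 + _)) = (fun x => expR (u * x) + expR (u * x) * sin (t * x + b))); last first.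
  by apply/funext => x; rewrite mulrDr mulr1.
rewrite RintegralD//; last exact: integrable_normal_expR_sin.
rewrite (_ : (fun x => 1 + _) = (fun x => 1 + (sin (t * x + b) * cos (u * (t * s ^+ 2)) + cos (t * x + b) * sin (u * (t * s ^+ 2))))); last first.
  by apply/funext => x; congr (1 + _); rewrite -sinD; congr sin; ring.
rewrite RintegralD//; last exact: (iD _ _ (iZ _ _ is1) (iZ _ _ ic1)).
rewrite RintegralD//; [|exact: iZ|exact: iZ].
rewrite !RintegralZr//.
rewrite mulrDr [X in X + _ = _ -> _](_ : _ = expR ((u * s) ^+ 2 / 2)); last first.
  by rewrite /Rintegral normal_prob_mgf//= mulr0 add0r.
rewrite [X in _ = _ * X + _ -> _](_ : _ = 1); last first.
  rewrite Rintegral_cst// mul1r; exact: (congr1 fine (probability_setT nu)).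
by rewrite mulr1 => /addrI.
Qed.

(** Stein's identity (Gaussian integration by parts), obtained by differentiating [normal_tilt_sin]
    at [u = 0]. *)
Lemma normal_stein_sin t b : \int[nu]_x (x * sin (t * x + b)) =
  t * s ^+ 2 * \int[nu]_x cos (t * x + b).
Proof.
pose f u x := expR (u * x) * sin (t * x + b).
pose df u x := x * expR (u * x) * sin (t * x + b).
have fd u x : is_derive u (1 : R) (f ^~ x) (df u x).
  rewrite /f /df; apply: is_derive_eq; rewrite /GRing.scale/=; ring.
have le_exp (x : R) : `|x| * expR `|x| <= expR (2 * x) + expR (- 2 * x).
  apply: (@le_trans _ _ (expR `|x| * expR `|x|)).
    by rewrite ler_wpM2r ?expR_ge0// (le_trans _ (expR_ge1Dx _))// lerDr.
  rewrite -expRD; case: (ger0P x) => x0.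
    by rewrite (_ : x + x = 2 * x) ?lerDl ?expR_ge0//; ring.
  by rewrite (_ : - x - x = - 2 * x) ?lerDr ?expR_ge0//; ring.
have mabs : measurable_fun [set: R] (fun x : R => `|x| * expR `|x|).
  apply: measurable_funM; first exact: normr_measurable.
  by apply: measurableT_comp => //; exact: normr_measurable.
have iG : nu.-integrable setT (EFin \o (fun x => `|x| * expR `|x|)).
  apply: (@le_integrable_normal _ 2) => // x.
  by rewrite ger0_norm ?mulr_ge0// ?expR_ge0.
have dG u x : 0 - 1 < u < 0 + 1 -> `|df u x| <= `|x| * expR `|x|.
  move=> u1; rewrite /df !normrM -[leRHS]mulr1 ler_pM ?mulr_ge0 ?sin_max//.
  rewrite ler_wpM2l// (ger0_norm (expR_ge0 _)) ler_expR (le_trans (ler_norm _))//.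
  by rewrite normrM ler_piMl// ler_norml; move/andP: u1 => [? ?]; apply/andP; split; lra.
have := is_derive_under_integral (fun u => integrable_normal_expR_sin u t b) fd iG dG.
rewrite (_ : (fun u => _) = (fun u => expR ((u * s) ^+ 2 / 2) * (\int[nu]_x sin (t * x + b) * cos (u * (t * s ^+ 2))
     + \int[nu]_x cos (t * x + b) * sin (u * (t * s ^+ 2))))); last first.
  by apply/funext => u; exact: normal_tilt_sin.
set A := \int[nu]_x sin _; set Y := \int[nu]_x cos _; set k := t * s ^+ 2.
move=> /(@derive_val _ _ _ _ _ _ _) E1.
clearbody A Y.
move: (is_derive_tilt s A Y k 0) => /(@derive_val _ _ _ _ _ _ _); rewrite E1.
rewrite !mul0r expr0n/= mul0r sin0 cos0 expR0 add0r mul1r mulr1 mulr0 subr0 [Y * _]mulrC => <-.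
by apply: eq_Rintegral => x _; rewrite /df mul0r expR0 mulr1.
Qed.

(** The characteristic function in real form. By Stein's identity [y] solves
    [y' = - u * s ^+ 2 * y], so [y u * expR ((u * s) ^+ 2 / 2)] is constant. *)
Lemma normal_cos t b : \int[nu]_x cos (t * x + b) = cos b * expR (- (t * s) ^+ 2 / 2).
Proof.
pose y u := \int[nu]_x cos (u * x + b).
have iG : nu.-integrable setT (EFin \o (fun x => `|x|)).
  apply: (@le_integrable_normal _ 1); first exact: measurableT_comp.
  move=> x; rewrite normr_id mul1r mulN1r.
  have := expR_ge1Dx x; have := expR_ge1Dx (- x).
  by have := expR_ge0 x; have := expR_ge0 (- x); case: (ger0P x); lra.
have yd u : is_derive u (1 : R) y (- (u * s ^+ 2) * y u).
  have fd v x : is_derive v (1 : R) (fun v => cos (v * x + b)) (- x * sin (v * x + b)).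
    by apply: is_derive_eq; rewrite /GRing.scale/=; ring.
  have fG v x : u - 1 < v < u + 1 -> `|- x * sin (v * x + b)| <= `|x|.
    by move=> _; rewrite normrM normrN ler_piMr// sin_max.
  have := is_derive_under_integral (fun v => integrable_normal_cos v b) fd iG fG.
  rewrite (_ : \int[nu]_y0 _ = - (u * s ^+ 2) * y u)//.
  rewrite -[RHS](_ : - (\int[nu]_x (x * sin (u * x + b))) = _); last first.
    by rewrite normal_stein_sin mulNr.
  rewrite -mulN1r -RintegralZl//; last first.
    apply: (le_integrable _ _ _ iG) => //.
      by apply/measurable_EFinP; apply: measurable_funM => //; exact: measurable_sin_affine.
    by move=> x _ /=; rewrite lee_fin normr_id normrM ler_piMr// sin_max.
  by apply: eq_Rintegral => x _; rewrite mulN1r mulNr.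
have : y t * expR ((t * s) ^+ 2 / 2) = y 0 * expR ((0 * s) ^+ 2 / 2).
  apply: (is_derive_0_is_cst (f := fun u => y u * expR ((u * s) ^+ 2 / 2))) => u.
  apply: is_derive_eq; rewrite /GRing.scale/=; by field.
rewrite mul0r expr0n/= mul0r expR0 mulr1 {2}/y.
rewrite (_ : (fun x => _) = cst (cos b)); last by apply/funext => x; rewrite mul0r add0r.
rewrite Rintegral_cst// [fine _](_ : _ = 1) ?mulr1; last exact: (congr1 fine (probability_setT nu)).
move=> <-.
by rewrite mulNr expRN mulfK// gt_eqF// expR_gt0.
Qed.

End normal_chf.

(** * Indicators of rays as limits of polynomials in sines *)

Section sgn_iteration.
Context {R : realType}.

(** The Newton-Schulz iteration for the sign: [x] goes to [(3 * x - x ^+ 3) / 2], whose fixed points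
    1 and -1 attract all of [-1, 1] except 0. *)
Definition cube_poly : {poly R} := (3 / 2)%:P * 'X - (2^-1)%:P * 'X^3.

Fixpoint sgn_poly (k : nat) : {poly R} :=
  if k is k'.+1 then cube_poly \Po sgn_poly k' else 'X.

Lemma horner_sgn_polyS k (x : R) :
  (sgn_poly k.+1).[x] = (3 * (sgn_poly k).[x] - (sgn_poly k).[x] ^+ 3) / 2.
Proof.
change ((cube_poly \Po sgn_poly k).[x] = (3 * (sgn_poly k).[x] - (sgn_poly k).[x] ^+ 3) / 2).
rewrite horner_comp /cube_poly; move: ((sgn_poly k).[x]) => z; 
by rewrite hornerD hornerN hornerM hornerX hornerC hornerM hornerXn hornerC; field.
Qed.

Lemma horner_sgn_polyN k (x : R) : (sgn_poly k).[- x] = - (sgn_poly k).[x].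
Proof.
by elim: k => [|k IH]; [rewrite /= !hornerE|rewrite !horner_sgn_polyS IH; field].
Qed.

(** One step multiplies the error [1 - z] by [(1 - z) * (2 + z) / 2], which is at most [1 - z / 2],
    hence at most [1 - x / 2] because the iterates stay above [x]. *)
Lemma sgn_poly_bound k (x : R) : 0 < x <= 1 ->
  x <= (sgn_poly k).[x] <= 1 /\ 1 - (sgn_poly k).[x] <= (1 - x / 2) ^+ k.
Proof.
move=> /andP[x0 x1]; elim: k => [|k [/andP[IH1 IH2] IH3]].
  by rewrite /= hornerX lexx x1 expr0; split=> //; rewrite gerBl ltW.
rewrite horner_sgn_polyS exprS; set z := (sgn_poly k).[x] in IH1 IH2 IH3 *.
have z0 : 0 < z by rewrite (lt_le_trans x0).
have e1 : (3 * z - z ^+ 3) / 2 - z = z * ((1 - z) * (1 + z)) / 2 by field.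
have e2 : 1 - (3 * z - z ^+ 3) / 2 = (1 - z) * ((1 - z) * (2 + z)) / 2 by field.
have z1 : 0 <= 1 - z by rewrite subr_ge0.
split; first (apply/andP; split).
- rewrite (le_trans IH1)// -subr_ge0 e1 divr_ge0// mulr_ge0 ?(ltW z0)//.
  by rewrite mulr_ge0// addr_ge0// ltW.
- by rewrite -subr_ge0 e2 divr_ge0// mulr_ge0// mulr_ge0// addr_ge0// ltW.
have -> : 1 - (3 * z - z ^+ 3) / 2 = (1 - z) * (2 + z) / 2 * (1 - z) by field.
rewrite [leRHS]exprS ler_pM//.
  by rewrite divr_ge0// mulr_ge0// addr_ge0// ltW.
have : 0 <= z * z by rewrite mulr_ge0// ltW.
by lra.
Qed.

Lemma normr_sgn_poly k (x : R) : `|x| <= 1 -> `|(sgn_poly k).[x]| <= 1.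
Proof.
have pos (y : R) : 0 < y <= 1 -> `|(sgn_poly k).[y]| <= 1.
  move=> /[dup] /andP[y0 _] /(sgn_poly_bound k) [/andP[h1 h2] _].
  by rewrite ger0_norm// (le_trans (ltW y0)).
have [x0|x0|->] := ltgtP x 0; last first.
- move=> _; suff -> : (sgn_poly k).[0] = 0 by rewrite normr0.
  by have := horner_sgn_polyN k 0; rewrite oppr0; lra.
- by rewrite gtr0_norm// => x1; rewrite pos// x0.
- by rewrite ltr0_norm// => x1; rewrite -normrN -horner_sgn_polyN pos// oppr_gt0 x0.
Qed.

Lemma cvg_sgn_poly (x : R) : `|x| <= 1 -> (fun k => (sgn_poly k).[x]) @ \oo --> Num.sg x.
Proof.
have pos (y : R) : 0 < y <= 1 -> (fun k => (sgn_poly k).[y]) @ \oo --> (1 : R).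
  move=> y01; have /andP[y0 y1] := y01.
  have cg : (fun k => 1 - (1 - y / 2) ^+ k) @ \oo --> (1 : R).
    rewrite -[X in _ --> X]subr0; apply: cvgB; first exact: cvg_cst.
    by apply: cvg_expr; rewrite ger0_norm; lra.
  apply: (squeeze_cvgr _ cg (@cvg_cst _ (1 : R) _ \oo _)); apply: nearW => k.
  by have [/andP[_ ->] h] := sgn_poly_bound k y01; rewrite andbT; lra.
have [x0|x0|->] := ltgtP x 0; last first.
- move=> _; rewrite sgr0; rewrite (_ : (fun _ => _) = cst 0); first exact: cvg_cst.
  apply/funext => k /=.
  by have := horner_sgn_polyN k 0; rewrite oppr0; lra.
- by rewrite gtr0_norm// => x1; rewrite gtr0_sg//; apply: pos; rewrite x0.
- rewrite ltr0_norm// => x1; rewrite ltr0_sg//.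
  rewrite (_ : (fun _ => _) = (fun k => - (sgn_poly k).[- x])); last first.
    by apply/funext => k; rewrite horner_sgn_polyN opprK.
  by apply: cvgN; apply: pos; rewrite oppr_gt0 x0.
Qed.

Lemma nbhs_infty_gtr_succ (r : R) : \forall n \near \oo, r < n.+1%:R.
Proof.
by have := nbhs_infty_gtr r; apply: filterS => n rn; rewrite (lt_trans rn)// ltr_nat.
Qed.

(** Dividing by [k.+1] eventually brings [x] into the interval from [- pi] to [pi], where the sine
    has the sign of its argument; the sine in turn provides the bounded argument that the iteration
    needs. *)
Lemma cvg_sg_sin (x : R) : (fun k : nat => Num.sg (sin (x / k.+1%:R))) @ \oo --> Num.sg x.
Proof.
have pos (y : R) : 0 < y -> \forall k \near \oo, Num.sg (sin (y / k.+1%:R)) = 1.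
  move=> y0; near=> k; apply: gtr0_sg; apply: sin_gt0_pi.
  rewrite divr_gt0//= ltr_pdivrMr//.
  rewrite -ltr_pdivrMl ?pi_gt0//; near: k; exact: nbhs_infty_gtr_succ.
have [x0|x0|->] := ltgtP x 0; last first.
- rewrite sgr0; rewrite (_ : (fun _ => _) = cst 0); first exact: cvg_cst.
  by apply/funext => k /=; rewrite mul0r sin0 sgr0.
- by rewrite gtr0_sg//; apply: cvg_near_cst; exact: pos.
- rewrite ltr0_sg//; apply: cvg_near_cst; near=> k.
  rewrite -[x]opprK mulNr sinN sgrN; congr (- _); near: k.
  by apply: pos; rewrite oppr_gt0.
Unshelve. all: by end_near. Qed.

(** The shift by [k.+1%:R^-1] makes the limit equal to 1 at [x = 0], as closed rays require. *)
Lemma cvg_sg_indic (x : R) :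
  (fun k : nat => 2^-1 * Num.sg (x + k.+1%:R^-1) + 2^-1) @ \oo --> ((0 <= x)%R%:R : R).
Proof.
case: (leP 0 x) => x0.
  apply: cvg_near_cst; apply: nearW => k.
  by rewrite gtr0_sg ?ltr_wpDl// /=; field.
apply: cvg_near_cst; near=> k.
rewrite ltr0_sg; first by rewrite /=; field.
rewrite -ltrBrDl sub0r invf_plt ?posrE// ?oppr_gt0//.
near: k; exact: nbhs_infty_gtr_succ.
Unshelve. all: by end_near. Qed.

End sgn_iteration.

Section trig_test.
Context {R : realType} d (T : measurableType d) (P : probability T R).
Variables (J : finType) (X : T -> R) (Y : J -> T -> R).
Hypothesis (iX : P.-integrable setT (EFin \o X)).
Hypothesis (mY : forall j, measurable_fun setT (Y j)).

Let mX : measurable_fun setT X.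
Proof. by move/integrableP: iX => [/measurable_EFinP]. Qed.

Let wave (a : J -> R) (c : R) (t : T) := sin (\sum_j a j * Y j t + c).

Let m_wave a c : measurable_fun setT (wave a c).
Proof.
rewrite /wave; apply: (measurableT_comp (f := sin)).
  by apply: continuous_measurable_fun; exact: continuous_sin.
apply: measurable_funD => //; apply: measurable_sum => j.
exact: measurable_funM.
Qed.

Let wave_le1 a c t : `|wave a c t| <= 1. Proof. exact: sin_max. Qed.

(** Bounded weights [g] for which the signed measure with density [X * g] annihilates all waves.
    This class is stable under linear combinations, products with a sine and bounded limits, so it
    reaches the indicators of rays from the constant 1. *)
Definition trig_null (g : T -> R) := [/\ measurable_fun setT g,
  exists K, forall t, `|g t| <= K &
  forall a c, \int[P]_t (X t * g t * wave a c t) = 0].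

Let iXg (g : T -> R) K a c : measurable_fun setT g -> (forall t, `|g t| <= K) ->
  P.-integrable setT (EFin \o (fun t => X t * g t * wave a c t)).
Proof.
move=> mg gK; apply: (le_integrable _ _ _ (integrableZl measurableT K iX)) => //.
  by apply/measurable_EFinP; apply: measurable_funM => //; exact: measurable_funM.
move=> t _ /=; rewrite lee_fin !normrM.
have K0 : 0 <= K by rewrite (le_trans _ (gK t)).
rewrite (ger0_norm K0) -[leRHS]mulr1 [K * _]mulrC ler_pM//.
by rewrite ler_wpM2l.
Qed.

Lemma trig_null_lin (g h : T -> R) k : trig_null g -> trig_null h ->
  trig_null (fun t => k * g t + h t).
Proof.
move=> [mg [K gK] g0] [mh [L hL] h0]; split.
- by apply: measurable_funD => //; exact: measurable_funM.
- by exists (`|k| * K + L) => t; rewrite (le_trans (ler_normD _ _))// lerD// normrM ler_wpM2l.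
move=> a c; rewrite (_ : (fun t => _) =
    fun t => k * (X t * g t * wave a c t) + X t * h t * wave a c t); last first.
  by apply/funext => t; ring.
rewrite RintegralD//; last 2 first.
- rewrite (_ : _ \o _ = fun t => (k%:E * (EFin \o (fun t => X t * g t * wave a c t)%R) t)%E)//.
  by apply: integrableZl => //; exact: iXg gK.
- exact: iXg hL.
rewrite RintegralZl//; last exact: iXg gK.
by rewrite g0 h0 mulr0 addr0.
Qed.

(** Product-to-sum formula: the product of two sines is a difference of two waves, with the
    coefficient at [j] shifted by [- a] and by [a]; the phase [pi / 2] turns cosines into sines. *)
Lemma trig_null_sin (g : T -> R) j a b : trig_null g ->
  trig_null (fun t => g t * sin (a * Y j t + b)).
Proof.
move=> [mg [K gK] g0]; split.
- apply: measurable_funM => //; apply: (measurableT_comp (f := sin)).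
    by apply: continuous_measurable_fun; exact: continuous_sin.
  by apply: measurable_funD => //; exact: measurable_funM.
- exists K => t; rewrite normrM -[leRHS]mulr1 ler_pM// sin_max//.
move=> e c.
pose e1 i := (if i == j then - a else 0) + e i.
pose e2 i := (if i == j then a else 0) + e i.
have sumE (x : R) t : \sum_i ((if i == j then x else 0) + e i) * Y i t =
    x * Y j t + \sum_i e i * Y i t.
  under eq_bigr do rewrite mulrDl.
  rewrite big_split/= (bigD1 j)//= eqxx big1 ?addr0// => i /negbTE ->.
  by rewrite mul0r.
rewrite (_ : (fun t => _) = fun t => 2^-1 * (X t * g t * wave e1 (c - b + pi / 2) t) +
    (- 2^-1) * (X t * g t * wave e2 (c + b + pi / 2) t)); last first.
  apply/funext => t; rewrite /wave !sumE; set S := \sum_i _; set y := Y j t.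
  have -> : - a * y + S + (c - b + pi / 2) = (S + c - (a * y + b)) + pi / 2 by ring.
  have -> : a * y + S + (c + b + pi / 2) = (S + c + (a * y + b)) + pi / 2 by ring.
  by rewrite -!cos_sinD; move: (S + c) (a * y + b) => u v; rewrite cosB cosD; field.
rewrite RintegralD//; last 2 first.
- rewrite (_ : _ \o _ = fun t => ((2^-1)%:E * (EFin \o (fun t => X t * g t * wave e1 (c - b + pi / 2) t)%R) t)%E)//.
  by apply: integrableZl => //; exact: iXg gK.
- rewrite (_ : _ \o _ = fun t => ((- 2^-1)%:E * (EFin \o (fun t => X t * g t * wave e2 (c + b + pi / 2) t)%R) t)%E)//.
  by apply: integrableZl => //; exact: iXg gK.
rewrite !RintegralZl//; [|exact: iXg gK|exact: iXg gK].
by rewrite !g0 !mulr0 addr0.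
Qed.

Lemma trig_null_lim (g_ : nat -> T -> R) (g : T -> R) K :
  (forall n, trig_null (g_ n)) -> (forall n t, `|g_ n t| <= K) ->
  (forall t, g_ ^~ t @ \oo --> g t) -> trig_null g.
Proof.
move=> g0 gK gc.
have mg_ n : measurable_fun setT (g_ n) by have [] := g0 n.
have mg : measurable_fun setT g by apply: (measurable_fun_cvg mg_) => t _; exact: gc.
have gK' t : `|g t| <= K.
  have /cvg_lim <- // : `|g_ n t| @[n --> \oo] --> `|g t| by apply: cvg_norm; exact: gc.
  by apply: limr_le; [apply/cvg_ex; exists `|g t|; apply: cvg_norm; exact: gc|apply: nearW].
split => //; first by exists K.
move=> a c; pose f n t := (X t * g_ n t * wave a c t)%:E.
have iG := integrableZl measurableT K iX.
have [] := @dominated_convergence _ _ _ P setT measurableT f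
    (fun t => (X t * g t * wave a c t)%:E) (fun t => (`|X t| * K)%:E).
- by move=> n; apply/measurable_EFinP; apply: measurable_funM => //; exact: measurable_funM.
- by apply/measurable_EFinP; apply: measurable_funM => //; exact: measurable_funM.
- apply: aeW => t _; apply: cvg_EFin; first exact: nearW.
  by apply: cvgMl; apply: cvgMr; exact: gc.
- have -> : (fun t => (`|X t| * K)%:E) = (fun t => (K%:E * `|(X t)%:E|)%E).
    by apply/funext => t; rewrite mulrC EFinM.
  by apply: integrableZl => //; exact: integrable_norm.
- apply: aeW => t n _ /=; rewrite lee_fin !normrM -[leRHS]mulr1 ler_pM ?mulr_ge0//.
  by rewrite ler_pM.
move=> _ _ fc; rewrite /Rintegral.
have -> // : (\int[P]_t (X t * g t * wave a c t)%:E = 0)%E.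
apply/esym; move/cvg_lim : fc => <- //.
rewrite (_ : (fun n => _) = cst 0%E); first by rewrite lim_cst.
apply/funext => n /=.
have [_ _ /(_ a c)] := g0 n; rewrite /Rintegral => h.
rewrite -[LHS]fineK; first by rewrite h.
exact: (integrable_fin_num measurableT (iXg a c (mg_ n) (gK n))).
Qed.

Lemma trig_null_poly (p : {poly R}) (g : T -> R) j a b : trig_null g ->
  trig_null (fun t => g t * p.[sin (a * Y j t + b)]).
Proof.
elim/poly_ind: p g => [|p c IH] g g0.
  (* The zero function, put into the form [k * g + h] to which [trig_null_lin] applies. *)
  rewrite (_ : (fun t => _) = (fun t => (-1) * g t + g t)); last first.
    by apply/funext => t; rewrite horner0; ring.
  exact: trig_null_lin.
rewrite (_ : (fun t => _) = (fun t => c * g t + (g t * sin (a * Y j t + b)) * p.[sin (a * Y j t + b)])).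
  by apply: trig_null_lin => //; apply: IH; exact: trig_null_sin.
by apply/funext => t; rewrite hornerMXaddC; ring.
Qed.

Lemma trig_null_sg (g : T -> R) j y : trig_null g ->
  trig_null (fun t => g t * Num.sg (Y j t + y)).
Proof.
move=> g0; have [mg [K gK] _] := g0.
have sg1 (x : R) : `|Num.sg x| <= 1 by rewrite normr_sg; case: (_ != _).
apply: (@trig_null_lim (fun n t => g t * Num.sg (sin ((Y j t + y) / n.+1%:R))) _ K).
- move=> n; apply: (@trig_null_lim (fun k t => g t * (sgn_poly k).[sin ((Y j t + y) / n.+1%:R)]) _ K).
  + move=> k; rewrite (_ : (fun t => _) = (fun t => g t * (sgn_poly k).[sin (n.+1%:R^-1 * Y j t + y / n.+1%:R)])).
      exact: trig_null_poly.
    by apply/funext => t; congr (_ * _.[sin _]); rewrite mulrDl; congr (_ + _); exact: mulrC.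
  + move=> k t; rewrite normrM -[leRHS]mulr1 ler_pM// normr_sgn_poly// sin_max//.
  + by move=> t; apply: cvgMr; apply: cvg_sgn_poly; exact: sin_max.
- by move=> n t; rewrite normrM -[leRHS]mulr1 ler_pM.
- by move=> t; apply: cvgMr; exact: cvg_sg_sin.
Qed.

Lemma trig_null_ray (g : T -> R) j y : trig_null g ->
  trig_null (fun t => g t * (y <= Y j t)%R%:R).
Proof.
move=> g0; have [mg [K gK] _] := g0.
have sg1 (x : R) : `|2^-1 * Num.sg x + 2^-1| <= 1.
  rewrite (le_trans (ler_normD _ _))// normrM ger0_norm// normr_sg; case: (_ != _) => /=; lra.
apply: (@trig_null_lim (fun n t => g t * (2^-1 * Num.sg (Y j t - y + n.+1%:R^-1) + 2^-1)) _ K).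
- move=> n; rewrite (_ : (fun t => _) = (fun t => 2^-1 * (g t * Num.sg (Y j t + (- y + n.+1%:R^-1))) +
     (2^-1 * g t + (- 1 * g t + g t)))).
    apply: trig_null_lin; first exact: trig_null_sg.
    by do 2 apply: trig_null_lin => //.
  by apply/funext => t; rewrite -[Y j t - y + _]addrA; ring.
- by move=> n t; rewrite normrM -[leRHS]mulr1 ler_pM.
- move=> t; apply: cvgMr; rewrite -subr_ge0; exact: cvg_sg_indic.
Qed.

(* Cramer-Wold: the sines of linear combinations determine the law. *)
Lemma Rintegral_rays_eq0 (y : J -> R) (s : seq J) :
  (forall a c, \int[P]_t (X t * sin (\sum_j a j * Y j t + c)) = 0) ->
  \int[P]_t (X t * \prod_(j <- s) (y j <= Y j t)%R%:R) = 0.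
Proof.
move=> X0.
have : trig_null (fun t => \prod_(j <- s) (y j <= Y j t)%R%:R).
  elim: s => [|j s IH].
    split=> [||a c].
    + by rewrite (_ : (fun _ => _) = cst 1)//; apply/funext => t; rewrite big_nil.
    + by exists 1 => t; rewrite big_nil normr1.
    + by under eq_Rintegral do rewrite big_nil mulr1; exact: X0.
  rewrite (_ : (fun t => _) = (fun t => \prod_(j <- s) (y j <= Y j t)%R%:R * (y j <= Y j t)%R%:R)).
    exact: trig_null_ray.
  by apply/funext => t; rewrite big_cons mulrC.
(* With zero frequencies and phase [pi / 2] the wave is the constant 1. *)
move=> [_ _ /(_ (fun=> 0) (pi / 2))] h.
rewrite -[RHS]h; apply: eq_Rintegral => t _.
by rewrite /wave [\sum_j _]big1 ?add0r ?sin_pihalf ?mulr1// => j _; rewrite mul0r.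
Qed.

End trig_test.

Section integ.
Context {R : realType} d (T : measurableType d) (P : {measure set T -> \bar R}).
Implicit Types f g : T -> R.

Lemma integ_measurable f : P.-integrable setT (EFin \o f) -> measurable_fun setT f.
Proof. by move/integrableP => [/measurable_EFinP]. Qed.

Lemma integZ k f : P.-integrable setT (EFin \o f) ->
  P.-integrable setT (EFin \o (fun t => k * f t)).
Proof.
move=> fi; rewrite (_ : _ \o _ = fun t => (k%:E * (EFin \o f) t)%E)//.
exact: integrableZl.
Qed.

Lemma integD f g : P.-integrable setT (EFin \o f) -> P.-integrable setT (EFin \o g) ->
  P.-integrable setT (EFin \o (fun t => f t + g t)).
Proof.
move=> fi gi; rewrite (_ : _ \o _ = fun t => ((EFin \o f) t + (EFin \o g) t)%E)//.
exact: integrableD.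
Qed.

Lemma integ_sum (I : Type) (s : seq I) (F : I -> T -> R) :
  (forall i, P.-integrable setT (EFin \o F i)) ->
  P.-integrable setT (EFin \o (fun t => \sum_(i <- s) F i t)).
Proof.
move=> iF; rewrite (_ : _ \o _ = fun t => \sum_(i <- s) (EFin \o F i) t)%E.
  by apply: integrable_sum => // i _; exact: iF.
by apply/funext => t; rewrite /= sumEFin.
Qed.

Lemma Rintegral_sum (I : Type) (s : seq I) (F : I -> T -> R) :
  (forall i, P.-integrable setT (EFin \o F i)) ->
  \int[P]_t (\sum_(i <- s) F i t) = \sum_(i <- s) \int[P]_t F i t.
Proof.
move=> iF; elim: s => [|i s IH].
  rewrite big_nil (_ : (fun t => _) = cst 0); first by rewrite Rintegral_cst// mul0r.
  by apply/funext => t; rewrite big_nil.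
rewrite big_cons -IH -RintegralD//; last exact: integ_sum.
by apply: eq_Rintegral => t _; rewrite big_cons.
Qed.

Lemma integ_le f g : measurable_fun setT f -> (forall t, `|f t| <= g t) ->
  P.-integrable setT (EFin \o g) -> P.-integrable setT (EFin \o f).
Proof.
move=> mf fg gi; apply: (le_integrable _ _ _ gi) => //; first exact/measurable_EFinP.
by move=> t _; rewrite /= lee_fin (le_trans (fg t))// ler_norm.
Qed.

End integ.

(** * Moments and tails of one Gaussian variable *)

Lemma is_derive_mgf {R : realType} (m s u : R) :
  is_derive u (1 : R) (fun v => expR (v * m + (v * s) ^+ 2 / 2)) ((m + u * s ^+ 2) * expR (u * m + (u * s) ^+ 2 / 2)).
Proof. by apply: is_derive_eq; rewrite /GRing.scale/=; field. Qed.

Section gaussian_rv.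
Context {R : realType} d (T : measurableType d) (P : probability T R).
Variables (X : T -> R) (m s : R).
Hypothesis (mX : measurable_fun setT X).
Hypothesis lawX : forall A, measurable A -> P (X @^-1` A) = gaussian_law m s A.

Let Xm := isMeasurableFun.Build _ _ _ _ X mX.
Let XX : {mfun T >-> R} := HB.pack X Xm.
Let XM' := isMeasurableFun.Build _ _ T (measurableTypeR R) X mX.
Let XM : {mfun T >-> measurableTypeR R} := HB.pack (X : T -> measurableTypeR R) XM'.

Lemma law_ge0_integral (f : R -> R) : measurable_fun setT f -> (forall x, 0 <= f x) ->
  (\int[P]_t (f (X t))%:E = if (s == 0)%R then (f m)%:E else \int[normal_prob m s]_x (f x)%:E)%E.
Proof.
move=> mf f0.
have mf' : measurable_fun [set: R] (EFin \o f) by exact/measurable_EFinP.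
have f0' x : (0 <= (EFin \o f) x)%E by rewrite lee_fin.
have <- := @ge0_integral_distribution _ _ _ _ _ P XM _ mf' f0'.
case: ifPn => s0.
  rewrite (eq_measure_integral (\d_(m : measurableTypeR R))); first by rewrite integral_dirac// diracT mul1e.
  by move=> A mA _; transitivity (P (X @^-1` A)) => //; rewrite lawX// /gaussian_law s0.
have e A : measurable A -> A `<=` setT -> distribution P XM A = normal_prob m s A.
  move=> mA _.
  by transitivity (P (X @^-1` A)) => //; rewrite lawX// /gaussian_law (negbTE s0).
by rewrite (eq_measure_integral _ e).
Qed.

Lemma law_integral (f : R -> R) : measurable_fun setT f ->
  P.-integrable setT (EFin \o (fun t => f (X t))) ->
  \int[P]_t (f (X t)) = if s == 0 then f m else \int[normal_prob m s]_x (f x).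
Proof.
move=> mf fi.
have mf' : measurable_fun [set: R] (EFin \o f) by exact/measurable_EFinP.
have := @integral_distribution _ _ _ _ _ P XM _ mf' fi; rewrite /Rintegral => <-.
case: ifPn => s0.
  rewrite (eq_measure_integral (\d_(m : measurableTypeR R))); first by rewrite integral_dirac// diracT mul1e.
  by move=> A mA _; transitivity (P (X @^-1` A)) => //; rewrite lawX// /gaussian_law s0.
have e A : measurable A -> A `<=` setT -> distribution P XM A = normal_prob m s A.
  move=> mA _.
  by transitivity (P (X @^-1` A)) => //; rewrite lawX// /gaussian_law (negbTE s0).
by rewrite (eq_measure_integral _ e).
Qed.

Lemma law_mgf t : (\int[P]_w (expR (t * X w))%:E = (expR (t * m + (t * s) ^+ 2 / 2))%:E)%E.
Proof.
have mexp : measurable_fun setT (fun x : R => expR (t * x)).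
  by apply: measurableT_comp => //; exact: measurable_funM.
rewrite (law_ge0_integral mexp); last by move=> x; exact: expR_ge0.
case: ifPn => [/eqP ->|s0]; last exact: normal_prob_mgf.
by rewrite mulr0 expr0n/= mul0r addr0.
Qed.

Lemma law_expR t : P.-integrable setT (EFin \o (fun w => expR (t * X w))).
Proof.
apply/integrableP; split.
  by apply/measurable_EFinP; apply: measurableT_comp => //; exact: measurable_funM.
under eq_integral do rewrite /= ger0_norm ?expR_ge0//.
by rewrite law_mgf ltry.
Qed.

(** Since [|x| <= expR |x|], the majorant is at most the exponential of [(k%:R + c) * |X|], hence at
    most a sum of two exponential moments. *)
Lemma law_poly_expR (f : T -> R) k c : measurable_fun setT f ->
  (forall w, `|f w| <= `|X w| ^+ k * expR (c * `|X w|)) ->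
  P.-integrable setT (EFin \o f).
Proof.
move=> mf fle.
have h w : `|f w| <= expR ((k%:R + c) * X w) + expR (- (k%:R + c) * X w).
  apply: (le_trans (fle w)).
  apply: (@le_trans _ _ (expR ((k%:R + c) * `|X w|))).
    rewrite mulrDl expRD ler_pM2r ?expR_gt0// expRM_natl.
    rewrite lerXn2r ?nnegrE ?expR_ge0// (le_trans _ (expR_ge1Dx _))// lerDr//.
  case: (ger0P (X w)) => _; first by rewrite lerDl expR_ge0.
  by rewrite mulrN -mulNr lerDr expR_ge0.
by apply: (integ_le mf h); apply: integD; exact: law_expR.
Qed.

Lemma law_integrable : P.-integrable setT (EFin \o X).
Proof.
by apply: (@law_poly_expR _ 1 0) => // w; rewrite expr1 mul0r expR0 mulr1.
Qed.

Lemma law_integrable_sqr : P.-integrable setT (EFin \o (fun w => X w ^+ 2)).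
Proof.
apply: (@law_poly_expR _ 2 0); first exact: measurable_funX.
by move=> w; rewrite normrX mul0r expR0 mulr1.
Qed.

(** Derivative of the moment generating function. This and one more derivative identify [m] and [s],
    whose mere existence is asserted by [gaussian_vector]. *)
Let law_derive1 u : \int[P]_w (X w * expR (u * X w)) =
  (m + u * s ^+ 2) * expR (u * m + (u * s) ^+ 2 / 2).
Proof.
pose f u w := expR (u * X w); pose df u w := X w * expR (u * X w).
have fd v w : is_derive v (1 : R) (f ^~ w) (df v w).
  by apply: is_derive_eq; rewrite /GRing.scale/= /df; ring.
have iG : P.-integrable setT (EFin \o (fun w => `|X w| ^+ 1 * expR ((`|u| + 1) * `|X w|))).
  have m1 : measurable_fun setT (fun w => `|X w|) by exact: measurableT_comp.
  apply: (@law_poly_expR _ 1 (`|u| + 1)).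
    apply: measurable_funM; first exact: measurable_funX.
    by apply: measurableT_comp => //; exact: measurable_funM.
  by move=> w; rewrite ger0_norm// mulr_ge0 ?expR_ge0// exprn_ge0.
have fG v w : u - 1 < v < u + 1 -> `|df v w| <= `|X w| ^+ 1 * expR ((`|u| + 1) * `|X w|).
  move=> /andP[v1 v2]; rewrite /df normrM expr1 ler_wpM2l// (ger0_norm (expR_ge0 _)) ler_expR.
  rewrite (le_trans (ler_norm _))// normrM ler_wpM2r//.
  have := ler_norm u; have := ler_norm (- u); rewrite normrN => h1 h2.
  by rewrite ler_norml; apply/andP; split; lra.
have D1 := is_derive_under_integral law_expR fd iG fG.
have D2 : is_derive u (1 : R) (fun v => expR (v * m + (v * s) ^+ 2 / 2)) ((m + u * s ^+ 2) * expR (u * m + (u * s) ^+ 2 / 2)).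
  exact: is_derive_mgf.
move: D1; rewrite (_ : (fun x => _) = (fun v => expR (v * m + (v * s) ^+ 2 / 2))); last first.
  by apply/funext => v; rewrite /Rintegral law_mgf.
by move=> /(@derive_val _ _ _ _ _ _ _); have := @derive_val _ _ _ _ _ _ _ D2 => -> ->.
Qed.

Lemma law_mean : \int[P]_w X w = m.
Proof.
have := law_derive1 0; rewrite !mul0r expr0n/= mul0r !addr0 expR0 mulr1 => <-.
by apply: eq_Rintegral => w _; rewrite mul0r expR0 mulr1.
Qed.

Lemma law_moment2 : \int[P]_w (X w ^+ 2) = m ^+ 2 + s ^+ 2.
Proof.
pose f u w := X w * expR (u * X w); pose df u w := X w ^+ 2 * expR (u * X w).
have m1 : measurable_fun setT (fun w => `|X w|) by exact: measurableT_comp.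
have mf v : measurable_fun setT (f v).
  apply: measurable_funM => //.
  by apply: measurableT_comp => //; exact: measurable_funM.
have fi v : P.-integrable setT (EFin \o f v).
  apply: (@law_poly_expR _ 1 `|v|) => // w; rewrite /f normrM expr1 ler_wpM2l//.
  by rewrite (ger0_norm (expR_ge0 _)) ler_expR -normrM ler_norm.
have fd v w : is_derive v (1 : R) (f ^~ w) (df v w).
  by apply: is_derive_eq; rewrite /GRing.scale/= /df; ring.
have iG : P.-integrable setT (EFin \o (fun w => `|X w| ^+ 2 * expR (1 * `|X w|))).
  apply: (@law_poly_expR _ 2 1).
    apply: measurable_funM; first exact: measurable_funX.
    by apply: measurableT_comp => //; exact: measurable_funM.
  by move=> w; rewrite ger0_norm// mulr_ge0 ?expR_ge0// exprn_ge0.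
have fG v w : 0 - 1 < v < 0 + 1 -> `|df v w| <= `|X w| ^+ 2 * expR (1 * `|X w|).
  move=> /andP[v1 v2]; rewrite /df normrM normrX ler_wpM2l ?exprn_ge0//.
  rewrite (ger0_norm (expR_ge0 _)) ler_expR.
  rewrite (le_trans (ler_norm _))// normrM ler_wpM2r//.
  by rewrite ler_norml; apply/andP; split; lra.
have D1 := is_derive_under_integral fi fd iG fG.
have D2 : is_derive (0 : R) (1 : R) (fun v => (m + v * s ^+ 2) * expR (v * m + (v * s) ^+ 2 / 2))
    (s ^+ 2 * expR (0 * m + (0 * s) ^+ 2 / 2) + (m + 0 * s ^+ 2) ^+ 2 * expR (0 * m + (0 * s) ^+ 2 / 2)).
  by apply: is_derive_eq; rewrite /GRing.scale/=; field.
move: D1; rewrite (_ : (fun x => _) = (fun v => (m + v * s ^+ 2) * expR (v * m + (v * s) ^+ 2 / 2))); last first.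
  by apply/funext => v; exact: law_derive1.
move=> /(@derive_val _ _ _ _ _ _ _); have := @derive_val _ _ _ _ _ _ _ D2 => -> .
rewrite !mul0r expr0n/= mul0r !addr0 expR0 !mulr1 addrC => ->.
by apply: eq_Rintegral => w _; rewrite /df mul0r expR0 mulr1.
Qed.

Lemma law_cos t b : m = 0 -> \int[P]_w cos (t * X w + b) = cos b * expR (- (t * s) ^+ 2 / 2).
Proof.
move=> m0.
have mc : measurable_fun setT (fun x : R => cos (t * x + b)).
  apply: (measurableT_comp (f := cos)).
    by apply: continuous_measurable_fun; exact: continuous_cos.
  by apply: measurable_funD => //; exact: measurable_funM.
rewrite (law_integral mc); last first.
  apply: (@law_poly_expR _ 0 0); first exact: (measurableT_comp mc).
  by move=> w; rewrite expr0 mul0r expR0 mulr1 cos_max.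
case: ifPn => [/eqP ->|s0]; last by rewrite m0 normal_cos.
by rewrite m0 !mulr0 add0r expr0n/= oppr0 mul0r expR0 mulr1.
Qed.

Lemma law_chernoff t y : 0 < t ->
  (P [set w | (y <= X w)%R] <= (expR (t * m + (t * s) ^+ 2 / 2 - t * y))%:E)%E.
Proof.
move=> t0; have := @chernoff _ _ _ P XX t y t0.
have -> : 'M_P XX t = (expR (t * m + (t * s) ^+ 2 / 2))%:E.
  rewrite /mmt_gen_fun expectation.unlock.
  transitivity (\int[P]_w (expR (t * X w))%:E)%E; last exact: law_mgf.
  by apply: eq_integral => w _; rewrite /= mulrC.
by move=> /le_trans; apply; rewrite -EFinM -expRD.
Qed.

(** On the interval from [y] to [y + |s|] the density is at least its value at the right end, and
    the length [|s|] cancels the factor [1 / |s|] of the peak. *)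
Lemma law_tail_lower y : m = 0 -> s != 0 -> 0 <= y ->
  (((Num.sqrt (pi *+ 2))^-1 * expR (- (y + `|s|) ^+ 2 / (s ^+ 2 *+ 2)))%:E
    <= P [set w | (y <= X w)%R])%E.
Proof.
move=> m0 s0 y0.
have s1 : 0 < `|s| by rewrite normr_gt0.
have -> : [set w | (y <= X w)%R] = X @^-1` `[y, +oo[.
  by apply/seteqP; split => w /=; rewrite in_itv/= andbT.
rewrite lawX// /gaussian_law (negbTE s0) /normal_prob m0.
have mpdf : measurable_fun [set: R] (fun x => (normal_pdf 0 s x)%:E).
  by apply/measurable_EFinP; exact: measurable_normal_pdf.
have pdf0 (x : R) : (0 <= (normal_pdf 0 s x)%:E)%E by rewrite lee_fin normal_pdf_ge0.
pose b : R := y + `|s|.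
apply: (@le_trans _ _ (\int[lebesgue_measure]_(x in `[y, b]) (normal_pdf 0 s x)%:E)%E); last first.
  apply: ge0_subset_integral => //; first exact: measurable_funTS.
  by move=> x /=; rewrite !in_itv/= => /andP[-> _].
apply: (@le_trans _ _ (\int[lebesgue_measure]_(x in `[y, b]) (normal_pdf 0 s b)%:E)%E); last first.
  apply: ge0_le_integral => //.
  - exact: measurable_funTS.
  - move=> x /=; rewrite in_itv/= => /andP[x1 x2].
    rewrite lee_fin !normal_pdfE// ler_wpM2l ?normal_peak_ge0// /normal_fun ler_expR.
    rewrite !subr0 !mulNr lerN2 ler_pM2r ?invr_gt0 ?mulrn_wgt0 ?exprn_even_gt0//.
    by rewrite lerXn2r ?nnegrE ?(le_trans y0)// (le_trans x1).
have b0 : 0 <= b by rewrite (le_trans y0)// lerDl.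
rewrite integral_cst//= lebesgue_measure_itv/= lte_fin /b ltrDl s1 -EFinB -EFinM lee_fin.
rewrite addrAC subrr add0r normal_pdfE// /normal_peak /normal_fun subr0 -mulrA [X in _ <= _ * X]mulrC mulrA.
rewrite ler_wpM2r ?expR_ge0// -[leRHS]/(_ * _).
rewrite -mulrnAr sqrtrM ?sqr_ge0// sqrtr_sqr invfM mulrAC mulVf ?mul1r// gt_eqF//.
Qed.

End gaussian_rv.

(** * Gaussian vectors *)

Section gaussian_vector_theory.
Context {R : realType} d (T : measurableType d) (P : probability T R).
Variables (I : finType) (phi : I -> {RV P >-> R}).
Hypothesis gv : gaussian_vector phi.
Hypothesis phi0 : forall v, ('E_P[phi v] = 0)%E.
Implicit Types a b : I -> R.

Definition lin a (t : T) : R := \sum_i a i * phi i t.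

Definition second_moment u v : R := \int[P]_t (phi u t * phi v t).

(** The covariance of [lin a] and [lin b]; it lets the later arguments act on coefficient vectors
    instead of random variables. It is only semidefinite: the field vanishes on the boundary of the
    box. *)
Definition gram a b : R := \sum_u \sum_v a u * b v * second_moment u v.

Lemma measurable_lin a : measurable_fun setT (lin a).
Proof. by apply: measurable_sum => i; exact: measurable_funM. Qed.

Let lin_delta v : lin (fun u => (u == v)%:R) = phi v.
Proof.
apply/funext => t; rewrite /lin (bigD1 v)//= eqxx mul1r big1 ?addr0// => i /negbTE ->.
by rewrite mul0r.
Qed.

Let lin_law0 a : exists m s, forall A, measurable A -> P (lin a @^-1` A) = gaussian_law m s A.
Proof. exact: gv. Qed.

Lemma lin_integrable a : P.-integrable setT (EFin \o lin a).
Proof. by have [m [s H]] := lin_law0 a; apply: law_integrable (measurable_lin a) H. Qed.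

Lemma lin_integrable_sqr a : P.-integrable setT (EFin \o (fun t => lin a t ^+ 2)).
Proof. by have [m [s H]] := lin_law0 a; apply: law_integrable_sqr (measurable_lin a) H. Qed.

Lemma phi_integrable v : P.-integrable setT (EFin \o phi v).
Proof. by rewrite -(lin_delta v); exact: lin_integrable. Qed.

Lemma phi_integrable_mul u v : P.-integrable setT (EFin \o (fun t => phi u t * phi v t)).
Proof.
have i2 w : P.-integrable setT (EFin \o (fun t => phi w t ^+ 2)).
  by rewrite -(lin_delta w); exact: lin_integrable_sqr.
apply: (integ_le _ _ (integD (i2 u) (i2 v))); first exact: measurable_funM.
move=> t; rewrite normrM -(real_normK (num_real (phi u t))) -(real_normK (num_real (phi v t))).
have := sqr_ge0 (`|phi u t| - `|phi v t|).
by have : 0 <= `|phi u t| * `|phi v t| by []; lra.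
Qed.

Lemma phi_mean v : \int[P]_t phi v t = 0.
Proof. by have := phi0 v; rewrite expectation.unlock /Rintegral => ->. Qed.

Lemma covariance_phi u v : covariance P (phi u) (phi v) = (second_moment u v)%:E.
Proof.
rewrite /second_moment /Rintegral fineK; last first.
  exact: (integrable_fin_num measurableT (phi_integrable_mul u v)).
rewrite covariance.unlock !phi0 expectation.unlock; apply: eq_integral => t _ /=.
by rewrite !fctE /= !subr0.
Qed.

Lemma lin_mean a : \int[P]_t lin a t = 0.
Proof.
rewrite Rintegral_sum; last by move=> i; apply: integZ; exact: phi_integrable.
by rewrite big1// => i _; rewrite RintegralZl ?phi_mean ?mulr0//; exact: phi_integrable.
Qed.

Lemma lin_moment2 a : \int[P]_t (lin a t ^+ 2) = gram a a.
Proof.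
have i1 u v : P.-integrable setT (EFin \o (fun t => a u * a v * (phi u t * phi v t))).
  by apply: integZ; exact: phi_integrable_mul.
rewrite (_ : (fun t => _) = fun t => \sum_u \sum_v a u * a v * (phi u t * phi v t)).
  rewrite Rintegral_sum; last by move=> u; exact: integ_sum.
  apply: eq_bigr => u _; rewrite Rintegral_sum//; apply: eq_bigr => v _.
  by rewrite RintegralZl//; exact: phi_integrable_mul.
apply/funext => t; rewrite expr2 /lin mulr_suml; apply: eq_bigr => u _.
by rewrite mulr_sumr; apply: eq_bigr => v _; ring.
Qed.

Lemma lin_law a : exists2 s, s ^+ 2 = gram a a &
  forall A, measurable A -> P (lin a @^-1` A) = gaussian_law 0 s A.
Proof.
have [m [s H]] := lin_law0 a.
have m0 : m = 0 by rewrite -(law_mean (measurable_lin a) H) lin_mean.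
rewrite m0 in H; exists s => //.
by rewrite -lin_moment2 (law_moment2 (measurable_lin a) H) expr0n add0r.
Qed.

Lemma gram_ge0 a : 0 <= gram a a.
Proof. by have [s <- _] := lin_law a; exact: sqr_ge0. Qed.

Lemma gramC a b : gram a b = gram b a.
Proof.
rewrite /gram exchange_big/=; apply: eq_bigr => u _; apply: eq_bigr => v _.
rewrite [a v * _]mulrC; congr (_ * _).
by apply: eq_Rintegral => t _; rewrite mulrC.
Qed.

Lemma gramDl a a' b : gram (fun i => a i + a' i) b = gram a b + gram a' b.
Proof.
rewrite /gram -big_split/=; apply: eq_bigr => u _.
by rewrite -big_split/=; apply: eq_bigr => v _; ring.
Qed.

Lemma gramZl k a b : gram (fun i => k * a i) b = k * gram a b.
Proof.
rewrite /gram mulr_sumr; apply: eq_bigr => u _.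
by rewrite mulr_sumr; apply: eq_bigr => v _; ring.
Qed.

Lemma gramDr a b b' : gram a (fun i => b i + b' i) = gram a b + gram a b'.
Proof. by rewrite !(gramC a) gramDl. Qed.

Lemma gramZr k a b : gram a (fun i => k * b i) = k * gram a b.
Proof. by rewrite !(gramC a) gramZl. Qed.

Lemma gram_suml (K : Type) (s : seq K) (F : K -> I -> R) b :
  gram (fun i => \sum_(k <- s) F k i) b = \sum_(k <- s) gram (F k) b.
Proof.
elim: s => [|k s IH].
  rewrite big_nil /gram big1// => u _; rewrite big1// => v _.
  by rewrite big_nil !mul0r.
rewrite big_cons -IH -gramDl /gram; apply: eq_bigr => u _; apply: eq_bigr => v _.
by rewrite big_cons.
Qed.

Lemma gram_sumr (K : Type) (s : seq K) (F : K -> I -> R) a :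
  gram a (fun i => \sum_(k <- s) F k i) = \sum_(k <- s) gram a (F k).
Proof. by rewrite gramC gram_suml; apply: eq_bigr => k _; exact: gramC. Qed.

Lemma gram_cauchy a b : gram a b ^+ 2 <= gram a a * gram b b.
Proof.
have q x : 0 <= gram a a + 2 * x * gram a b + x ^+ 2 * gram b b.
  have := gram_ge0 (fun i => a i + x * b i).
  rewrite gramDl !gramDr !gramZl !gramZr (gramC b a).
  by rewrite (_ : _ + _ = gram a a + 2 * x * gram a b + x ^+ 2 * gram b b)//; ring.
have bb0 := gram_ge0 b; have aa0 := gram_ge0 a.
have [b0|b0] := eqVneq (gram b b) 0.
  suff -> : gram a b = 0 by rewrite expr0n/= mulr_ge0.
  apply/eqP; apply: contraT => ab0.
  have := q (- (gram a a + 1) / (2 * gram a b)).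
  rewrite b0 mulr0 addr0 (_ : 2 * _ * _ = - (gram a a + 1)); last by field.
  by lra.
have bp : 0 < gram b b by rewrite lt_def b0.
have := q (- gram a b / gram b b).
rewrite (_ : _ + _ = (gram a a * gram b b - gram a b ^+ 2) / gram b b); last by field.
by rewrite pmulr_lge0 ?invr_gt0// subr_ge0.
Qed.

Lemma lin_lin (K : Type) (s : seq K) (F : K -> I -> R) (c : K -> R) t :
  \sum_(k <- s) c k * lin (F k) t = lin (fun i => \sum_(k <- s) c k * F k i) t.
Proof.
rewrite /lin; under [RHS]eq_bigr do rewrite mulr_suml.
rewrite exchange_big/=; apply: eq_bigr => k _; rewrite mulr_sumr.
by apply: eq_bigr => i _; rewrite mulrA.
Qed.

Lemma linD a b t : lin (fun i => a i + b i) t = lin a t + lin b t.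
Proof. by rewrite /lin -big_split/=; apply: eq_bigr => i _; rewrite mulrDl. Qed.

Lemma linZ k a t : lin (fun i => k * a i) t = k * lin a t.
Proof. by rewrite /lin mulr_sumr; apply: eq_bigr => i _; rewrite mulrA. Qed.

Lemma lin_chernoff a t y : 0 < t ->
  (P [set w | (y <= lin a w)%R] <= (expR (t ^+ 2 * gram a a / 2 - t * y))%:E)%E.
Proof.
have [s <- H] := lin_law a => t0.
have := law_chernoff (measurable_lin a) H y t0.
by rewrite mulr0 add0r exprMn.
Qed.

Lemma lin_tail_lower a y : 0 < gram a a -> 0 <= y ->
  (((Num.sqrt (pi *+ 2))^-1 * expR (- (y + Num.sqrt (gram a a)) ^+ 2 / (2 * gram a a)))%:E
    <= P [set w | (y <= lin a w)%R])%E.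
Proof.
have [s <- H] := lin_law a => s0 y0.
have := law_tail_lower H (erefl _) _ y0.
by rewrite [2 * _]mulr_natl sqrtr_sqr; apply; move: s0; rewrite exprn_even_gt0.
Qed.

Lemma lin_cos a c : \int[P]_t cos (lin a t + c) = cos c * expR (- gram a a / 2).
Proof.
have [s <- H] := lin_law a.
have := law_cos (measurable_lin a) H 1 c (erefl _); rewrite mul1r => <-.
by apply: eq_Rintegral => t _; rewrite mul1r.
Qed.

Lemma lin_sin a c : \int[P]_t sin (lin a t + c) = sin c * expR (- gram a a / 2).
Proof.
have e (x : R) : sin x = cos (x - pi / 2) by rewrite cos_sinD subrK.
rewrite (e c) -lin_cos; apply: eq_Rintegral => t _.
by rewrite e addrA.
Qed.

Let integ_sin (f : T -> R) : measurable_fun setT f -> P.-integrable setT (EFin \o (fun t => sin (f t))).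
Proof.
move=> mf; apply: (@integ_le _ _ _ _ _ (cst 1)).
- apply: (measurableT_comp (f := sin)) => //.
  by apply: continuous_measurable_fun; exact: continuous_sin.
- by move=> t; exact: sin_max.
- by apply: (finite_measure_integrable_cst P 1).
Qed.

Let integ_cos (f : T -> R) : measurable_fun setT f -> P.-integrable setT (EFin \o (fun t => cos (f t))).
Proof.
move=> mf; rewrite (_ : (fun t => _) = (fun t => sin (f t + pi / 2))).
  by apply: integ_sin; exact: measurable_funD.
by apply/funext => t; rewrite cos_sinD.
Qed.

(* Differentiate E cos(u lin a + lin b + c) at u = 0. *)
Lemma lin_orth_sin a b c : gram a b = 0 -> \int[P]_t (lin a t * sin (lin b t + c)) = 0.
Proof.
move=> ab0.
have ml := measurable_lin.
pose f u t := cos (u * lin a t + lin b t + c).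
pose df u t := - lin a t * sin (u * lin a t + lin b t + c).
have mu u : measurable_fun setT (fun t => u * lin a t + lin b t + c).
  apply: measurable_funD => //; apply: measurable_funD => //.
  exact: measurable_funM.
have fi u : P.-integrable setT (EFin \o f u) by exact: integ_cos.
have fd u t : is_derive u (1 : R) (f ^~ t) (df u t).
  by apply: is_derive_eq; rewrite /GRing.scale/= /df; ring.
have iG : P.-integrable setT (EFin \o (fun t => `|lin a t|)).
  by apply: (integrable_norm (lin_integrable a)).
have fG u t : 0 - 1 < u < 0 + 1 -> `|df u t| <= `|lin a t|.
  by move=> _; rewrite normrM normrN ler_piMr// sin_max.
have := is_derive_under_integral fi fd iG fG.
have E u : \int[P]_t f u t = cos c * expR (- (u ^+ 2 * gram a a + gram b b) / 2).
  have := lin_cos (fun i => u * a i + b i) c.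
  rewrite gramDl !gramDr !gramZl !gramZr (gramC b a) ab0 !mulr0 add0r addr0 mulrA -expr2 => <-.
  by apply: eq_Rintegral => t _; rewrite linD linZ.
rewrite (_ : (fun u => _) = fun u => cos c * expR (- (u ^+ 2 * gram a a + gram b b) / 2)); last first.
  by apply/funext => u; exact: E.
move: (gram a a) (gram b b) => ga gb.
have D u : is_derive u (1 : R) (fun u => cos c * expR (- (u ^+ 2 * ga + gb) / 2))
   (cos c * expR (- (u ^+ 2 * ga + gb) / 2) * (- u * ga)).
  by apply: is_derive_eq; rewrite /GRing.scale/=; field.
move=> /(@derive_val _ _ _ _ _ _ _); have := @derive_val _ _ _ _ _ _ _ (D 0) => ->.
rewrite oppr0 mul0r mulr0 => h.
suff -> : \int[P]_t (lin a t * sin (lin b t + c)) = - \int[P]_t df 0 t by rewrite -h oppr0.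
rewrite -mulN1r -RintegralZl//; last first.
  apply: (integ_le _ _ iG); last by move=> t; rewrite fG// sub0r add0r ltrN10 ltr01.
  apply: measurable_funM => //; first exact: measurableT_comp.
  apply: (measurableT_comp (f := sin)) => //.
  by apply: continuous_measurable_fun; exact: continuous_sin.
by apply: eq_Rintegral => t _; rewrite /df mul0r add0r; ring.
Qed.

(** Intersections of rays form a pi-system generating the sigma-algebra of the [lin (b j)], so this
    is the orthogonality that characterises a conditional expectation. *)
Lemma lin_orth_rays (J : finType) a (b : J -> I -> R) (y : J -> R) (s : seq J) :
  (forall j, gram a (b j) = 0) ->
  \int[P]_t (lin a t * \prod_(j <- s) (y j <= lin (b j) t)%R%:R) = 0.
Proof.
move=> ab0; apply: Rintegral_rays_eq0; first exact: lin_integrable.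
  by move=> j; exact: measurable_lin.
move=> e c; rewrite -[RHS](@lin_orth_sin a (fun i => \sum_j e j * b j i) c).
  by apply: eq_Rintegral => t _; rewrite lin_lin.
rewrite gram_sumr big1// => j _; rewrite gramZr ab0 mulr0//.
Qed.

Let measurable_ray a y : measurable [set w | (y <= lin a w)%R].
Proof.
rewrite (_ : [set w | _] = lin a @^-1` `[y, +oo[).
  by rewrite -[X in measurable X]setTI; exact: measurable_lin.
by apply/seteqP; split => w /=; rewrite in_itv/= andbT.
Qed.

Lemma measurable_rays (J : Type) (b : J -> I -> R) (y : J -> R) (s : seq J) :
  measurable [set w | all (fun j => y j <= lin (b j) w) s].
Proof.
elim: s => [|j s IH].
  by rewrite (_ : [set w | _] = setT)//; apply/seteqP; split.
rewrite (_ : [set w | _] = [set w | (y j <= lin (b j) w)%R] `&` [set w | all (fun j => y j <= lin (b j) w) s]).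
  exact: measurableI.
by apply/seteqP; split => w /=; [move=> /andP|move=> ?; apply/andP].
Qed.

Let ray_prob a y : \int[P]_t (y <= lin a t)%R%:R = fine (P [set w | (y <= lin a w)%R]).
Proof.
have := integral_indic P measurableT (measurable_ray a y); rewrite setIT => <-.
rewrite /Rintegral; congr fine; apply: eq_integral => t _; rewrite indicE.
by congr ((nat_of_bool _)%:R)%:E; apply/idP/idP; rewrite inE.
Qed.

Lemma rays_prob (J : Type) (b : J -> I -> R) (y : J -> R) (s : seq J) :
  \int[P]_t \prod_(j <- s) (y j <= lin (b j) t)%R%:R =
  fine (P [set w | all (fun j => y j <= lin (b j) w) s]).
Proof.
have := integral_indic P measurableT (measurable_rays b y s); rewrite setIT => <-.
rewrite /Rintegral; congr fine; apply: eq_integral => t _; rewrite indicE; congr EFin.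
rewrite (_ : (t \in _) = all (fun j => y j <= lin (b j) t) s); last by apply/idP/idP; rewrite inE.
elim: s => [|j s IH]; first by rewrite big_nil.
by rewrite big_cons IH /=; case: (y j <= _) => /=; rewrite ?mul1r ?mul0r.
Qed.

(** Cramer-Wold for the single variable [lin a], tested on the centred variable
    [sin (lin b + c) - mean]. Since [gram a b = 0], the combinations [ep] and [em] have the same
    variance, which makes the integral vanish. *)
Let ray_sin a y b c : gram a b = 0 ->
  \int[P]_t ((y <= lin a t)%R%:R * sin (lin b t + c)) =
  \int[P]_t (y <= lin a t)%R%:R * \int[P]_t sin (lin b t + c).
Proof.
move=> ab0; have ml := measurable_lin.
set mean := (X in _ = _ * X).
have mb : measurable_fun setT (fun t => lin b t + c) by exact: measurable_funD.
have is1 := integ_sin mb.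
have ic1 (k : R) : P.-integrable setT (EFin \o cst k) by exact: (finite_measure_integrable_cst P k).
pose X t := sin (lin b t + c) + - mean.
have iX : P.-integrable setT (EFin \o X) by exact: (integD is1 (ic1 (- mean))).
have X0 : \int[P]_t (X t * \prod_(j <- [:: tt]) (y <= lin a t)%R%:R) = 0.
  apply: (@Rintegral_rays_eq0 _ _ _ _ unit X (fun=> lin a) iX _ (fun=> y)) => // e c'.
  pose ep i := e tt * a i + b i; pose em i := - e tt * a i + b i.
  have gep : gram ep ep = e tt ^+ 2 * gram a a + gram b b.
    rewrite /ep gramDl !gramDr !gramZl !gramZr (gramC b a) ab0; ring.
  have gem : gram em em = e tt ^+ 2 * gram a a + gram b b.
    rewrite /em gramDl !gramDr !gramZl !gramZr (gramC b a) ab0; ring.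
  rewrite (_ : (fun t => _) = fun t => 2^-1 * cos (lin em t + (c - c')) +
     (- 2^-1 * cos (lin ep t + (c + c')) + - mean * sin (lin (fun i => e tt * a i) t + c'))); last first.
    apply/funext => t; rewrite (bigD1 tt)//= [\sum_(i | _) _]big1 ?addr0; last by case.
    rewrite /X /em /ep !linD !linZ.
    rewrite (_ : - e tt * lin a t + lin b t + (c - c') = (lin b t + c) - (e tt * lin a t + c')); last by ring.
    rewrite (_ : e tt * lin a t + lin b t + (c + c') = (lin b t + c) + (e tt * lin a t + c')); last by ring.
    by move: (lin b t + c) (e tt * lin a t + c') => u v; rewrite cosB cosD; field.
  have mA x z : measurable_fun setT (fun t => lin x t + z) by exact: measurable_funD.
  rewrite RintegralD//; last 2 first.
  - by apply: integZ; exact: integ_cos.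
  - by apply: integD; apply: integZ; [exact: integ_cos|exact: integ_sin].
  rewrite RintegralD//; last 2 first.
  - by apply: integZ; exact: integ_cos.
  - by apply: integZ; exact: integ_sin.
  rewrite !RintegralZl//; [|exact: integ_sin|exact: integ_cos|exact: integ_cos].
  rewrite !lin_cos lin_sin gep gem /mean lin_sin gramZl gramZr.
  rewrite (_ : - (e tt ^+ 2 * gram a a + gram b b) / 2 = - gram b b / 2 + - (e tt * (e tt * gram a a)) / 2); last by field.
  by rewrite expRD cosB cosD; field.
have mr : measurable_fun setT (fun t => (y <= lin a t)%R%:R : R).
  rewrite (_ : (fun t => _) = \1_[set w | (y <= lin a w)%R]); first exact: measurable_indic.
  by apply/funext => t; rewrite indicE; congr ((nat_of_bool _)%:R); apply/idP/idP; rewrite inE.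
have ir : P.-integrable setT (EFin \o (fun t => (y <= lin a t)%R%:R)).
  by apply: (integ_le mr _ (ic1 1)) => t /=; case: (y <= _); rewrite ?normr1 ?normr0.
move: X0; rewrite (_ : (fun t => _) = fun t => (y <= lin a t)%R%:R * sin (lin b t + c) + - mean * (y <= lin a t)%R%:R); last first.
  by apply/funext => t; rewrite big_seq1 /X; ring.
rewrite RintegralD//; last 2 first.
- apply: (integ_le _ _ (ic1 1)).
    apply: measurable_funM => //; apply: (measurableT_comp (f := sin)) => //.
    by apply: continuous_measurable_fun; exact: continuous_sin.
  by move=> t /=; case: (y <= _); rewrite ?mul1r ?sin_max// mul0r normr0.
- exact: integZ.
by rewrite RintegralZl// mulNr mulrC => /eqP; rewrite subr_eq0 => /eqP.
Qed.

(** One ray is split off at a time. Its centred indicator is orthogonal to all sines of combinations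
    of the remaining variables by [ray_sin], hence to the product of their ray indicators. *)
Lemma lin_indep (J : finType) (a : J -> I -> R) (y : J -> R) (s : seq J) :
  uniq s -> {in s &, forall j k, j != k -> gram (a j) (a k) = 0} ->
  fine (P [set w | all (fun j => y j <= lin (a j) w) s]) =
  \prod_(j <- s) fine (P [set w | (y j <= lin (a j) w)%R]).
Proof.
rewrite -rays_prob; under [RHS]eq_bigr do rewrite -ray_prob.
elim: s => [|k s IH] /=.
  move=> _ _; rewrite big_nil (_ : (fun t => _) = cst 1).
    by rewrite Rintegral_cst// mul1r; exact: (congr1 fine (probability_setT P)).
  by apply/funext => t; rewrite big_nil.
move=> /andP[ks us] orth; rewrite big_cons -IH//; last first.
  by move=> i j si sj; apply: orth; rewrite inE ?si ?sj orbT.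
(* [Rintegral_rays_eq0] involves every index of [J], while orthogonality is known on [s] only; the
   other vectors are replaced by 0. *)
pose b j := if j \in s then a j else fun=> 0.
have ml := measurable_lin.
have ic1 (c : R) : P.-integrable setT (EFin \o cst c) by exact: (finite_measure_integrable_cst P c).
have mr x z : measurable_fun setT (fun t => (z <= lin x t)%R%:R : R).
  rewrite (_ : (fun t => _) = \1_[set w | (z <= lin x w)%R]); first exact: measurable_indic.
  by apply/funext => t; rewrite indicE; congr ((nat_of_bool _)%:R); apply/idP/idP; rewrite inE.
have ir x z : P.-integrable setT (EFin \o (fun t => (z <= lin x t)%R%:R)).
  by apply: (integ_le (mr x z) _ (ic1 1)) => t /=; case: (z <= _); rewrite ?normr1 ?normr0.
set p := \int[P]_t (y k <= _)%R%:R.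
pose X t := (y k <= lin (a k) t)%R%:R + - p.
have iX : P.-integrable setT (EFin \o X) by exact: (integD (ir _ _) (ic1 (- p))).
have X0 : \int[P]_t (X t * \prod_(j <- s) (y j <= lin (b j) t)%R%:R) = 0.
  apply: Rintegral_rays_eq0 => // e c.
  pose w i := \sum_j e j * b j i.
  have wE t : \sum_j e j * lin (b j) t = lin w t by rewrite lin_lin.
  have kw : gram (a k) w = 0.
    rewrite /w gram_sumr big1// => j _; rewrite gramZr /b; case: ifPn => js.
      by rewrite orth ?mulr0// ?inE ?eqxx ?js ?orbT//; apply: contraNneq ks => ->.
    by rewrite gramC /gram big1 ?mulr0// => u _; rewrite big1// => v _; rewrite !mul0r.
  have mw : measurable_fun setT (fun t => lin w t + c) by exact: measurable_funD.
  rewrite (_ : (fun t => _) = fun t => (y k <= lin (a k) t)%R%:R * sin (lin w t + c) + - p * sin (lin w t + c)); last first.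
    by apply/funext => t; rewrite wE /X; ring.
  rewrite RintegralD//; last 2 first.
  - apply: (integ_le _ _ (ic1 1)).
      apply: measurable_funM => //; apply: (measurableT_comp (f := sin)) => //.
      by apply: continuous_measurable_fun; exact: continuous_sin.
    by move=> t /=; case: (y _ <= _); rewrite ?mul1r ?sin_max// mul0r normr0.
  - by apply: integZ; exact: integ_sin.
  rewrite RintegralZl//; last exact: integ_sin.
  by rewrite ray_sin// -/p mulNr subrr.
have prodE t : \prod_(j <- s) (y j <= lin (b j) t)%R%:R = \prod_(j <- s) (y j <= lin (a j) t)%R%:R :> R.
  by rewrite !big_seq; apply: eq_bigr => j js; rewrite /b js.
have mprod : measurable_fun setT (fun t => \prod_(j <- s) (y j <= lin (a j) t)%R%:R : R).
  by apply: measurable_prod => j _.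
have prod01 t : `|\prod_(j <- s) (y j <= lin (a j) t)%R%:R : R| <= 1.
  rewrite normr_prod; elim: {+}s => [|j s' IHs]; first by rewrite big_nil.
  by rewrite big_cons; case: (y _ <= _); rewrite ?normr1 ?mul1r// normr0 mul0r.
have iprod := integ_le mprod prod01 (ic1 1).
move: X0; rewrite (_ : (fun t => _) = fun t => \prod_(j <- k :: s) (y j <= lin (a j) t)%R%:R
   + - p * \prod_(j <- s) (y j <= lin (a j) t)%R%:R); last first.
  by apply/funext => t; rewrite prodE big_cons /X; ring.
rewrite RintegralD//; last 2 first.
- apply: (integ_le _ _ (ic1 1)); first by apply: measurable_prod => j _.
  move=> t; rewrite big_cons normrM; case: (y _ <= _); rewrite ?normr1 ?mul1r ?normr0 ?mul0r//.
- exact: integZ.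
by rewrite RintegralZl// mulNr => /eqP; rewrite subr_eq0 => /eqP.
Qed.

End gaussian_vector_theory.

(** * Projections and conditional expectations *)

Section projection.
Context {R : realType} d (T : measurableType d) (P : probability T R).
Variables (I : finType) (phi : I -> {RV P >-> R}).
Hypothesis gv : gaussian_vector phi.
Hypothesis phi0 : forall v, ('E_P[phi v] = 0)%E.
Local Notation gram := (gram phi).
Local Notation lin := (lin phi).

Definition coord (v : I) : I -> R := fun u => (u == v)%:R.

Lemma lin_coord v t : lin (coord v) t = phi v t.
Proof.
rewrite /lin /coord (bigD1 v)//= eqxx mul1r big1 ?addr0// => i /negbTE ->.
by rewrite mul0r.
Qed.

Lemma gram_null a b : gram a a = 0 -> gram a b = 0.
Proof.
move=> a0; have := gram_cauchy gv phi0 a b; rewrite a0 mul0r => h.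
by apply/eqP; rewrite -sqrf_eq0 eq_le h sqr_ge0.
Qed.

Lemma gramBl a a' b : gram (fun i => a i - a' i) b = gram a b - gram a' b.
Proof.
rewrite -mulN1r -gramZl -gramDl; congr gram; apply/funext => i.
by rewrite mulN1r.
Qed.

Lemma gramBr a b b' : gram a (fun i => b i - b' i) = gram a b - gram a b'.
Proof. by rewrite !(gramC _ a) gramBl. Qed.

Lemma gram_coord a b : gram a b = \sum_w b w * gram a (coord w).
Proof.
rewrite -[RHS](_ : gram a (fun i => \sum_w b w * coord w i) = _); last first.
  by rewrite gram_sumr; apply: eq_bigr => w _; rewrite gramZr.
congr gram; apply/funext => i; rewrite (bigD1 i)//= /coord eqxx mulr1 big1 ?addr0//.
by move=> j ji; rewrite eq_sym (negbTE ji) mulr0.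
Qed.

(** Gram-Schmidt, one coordinate at a time: [r] is the part of [coord w] orthogonal to the
    coordinates already treated. *)
Let proj_seq (s : seq I) a : exists2 h, (forall i, i \notin s -> h i = 0) &
  forall w, w \in s -> gram (fun i => a i - h i) (coord w) = 0.
Proof.
elim: s a => [|w s IH] a; first by exists (fun=> 0).
have [h hs ho] := IH a; have [k ks ko] := IH (coord w).
pose r i := coord w i - k i.
have rs u : u \in s -> gram r (coord u) = 0 by exact: ko.
have gk x : (forall u, u \in s -> gram x (coord u) = 0) -> gram x k = 0.
  move=> x0; rewrite gram_coord big1// => u _.
  by case: (boolP (u \in s)) => us; [rewrite x0// mulr0|rewrite ks// mul0r].
(* A null direction is orthogonal to everything by Cauchy-Schwarz, so the projection [h] need not be
   changed. *)
have [r0|r0] := eqVneq (gram r r) 0.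
  exists h => [i|u]; first by rewrite inE negb_or => /andP[_]; exact: hs.
  rewrite inE => /predU1P[->|]; last exact: ho.
  have := gramBr (fun i => a i - h i) (coord w) k; rewrite gk// subr0 => <-.
  by rewrite gramC; exact: gram_null.
pose c := gram (fun i => a i - h i) r / gram r r.
exists (fun i => h i + c * r i) => [i|u].
  rewrite inE negb_or => /andP[iw] is_; rewrite hs// /r /coord (negbTE iw) ks//.
  by rewrite subr0 mulr0 addr0.
have e x : gram (fun i => a i - (h i + c * r i)) x = gram (fun i => a i - h i) x - c * gram r x.
  by rewrite -gramZl -gramBl; congr gram; apply/funext => i; ring.
rewrite e inE => /predU1P[->|us]; last by rewrite ho// rs// mulr0 subr0.
have e2 x : (forall u, u \in s -> gram x (coord u) = 0) -> gram x (coord w) = gram x r.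
  by move=> x0; rewrite gramBr gk// subr0.
by rewrite !e2// /c divfK// subrr.
Qed.

Lemma projection_exists (S : pred I) a : exists2 h, (forall i, ~~ S i -> h i = 0) &
  forall w, S w -> gram (fun i => a i - h i) (coord w) = 0.
Proof.
have [h hs ho] := proj_seq (enum S) a; exists h => [i|w] Si.
  by apply: hs; rewrite mem_enum.
by apply: ho; rewrite mem_enum.
Qed.

End projection.

(** * Conditional expectation of a Gaussian vector given some coordinates *)

Section conditional_expectation.
Context {R : realType} d (T : measurableType d) (P : probability T R).
Variables (I : finType) (phi : I -> {RV P >-> R}).
Hypothesis gv : gaussian_vector phi.
Hypothesis phi0 : forall v, ('E_P[phi v] = 0)%E.
Variable S : set I.
Local Notation gram := (gram phi).
Local Notation lin := (lin phi).

Let F : set (set T) := <<s \bigcup_(w in S) preimage_set_system setT (phi w) measurable >>.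

Let rays : set (set T) := [set A | exists s : seq (I * R),
  (forall p, p \in s -> S p.1) /\ A = [set t | all (fun p => (p.2 <= phi p.1 t)%R) s]].

Let rays_setI : setI_closed rays.
Proof.
move=> A B [s [sS ->]] [s' [sS' ->]]; exists (s ++ s'); split.
  by move=> p; rewrite mem_cat => /orP[/sS|/sS'].
by apply/seteqP; split => t /=; rewrite all_cat => /andP.
Qed.

Let TF := g_sigma_algebraType rays.

Let F_rays : F `<=` <<s rays >>.
Proof.
apply: smallest_sub; first exact: smallest_sigma_algebra.
move=> A [w Sw [B mB <-]].
suff mw : measurable_fun [set: TF] (phi w : TF -> R) by exact: (mw measurableT B mB).
apply: (@measurability _ _ _ _ _ _ (@RGenCInfty.G R)); first exact: RGenCInfty.measurableE.
move=> _ [_ [x ->] <-]; apply: sub_sigma_algebra.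
exists [:: (w, x)]; split; first by move=> p; rewrite inE => /eqP ->.
by apply/seteqP; split => t /=; rewrite in_itv/= !andbT ?setTI//; case.
Qed.

Let rays_measurable A : rays A -> measurable A.
Proof.
move=> [s [_ ->]].
rewrite (_ : [set t | _] = [set t | all (fun p => p.2 <= lin (coord p.1) t) s]).
  exact: measurable_rays.
by apply/seteqP; split => t /=; apply: sub_all => p; rewrite lin_coord.
Qed.

Let sigma_measurable A : <<s rays >> A -> measurable A.
Proof.
move: A; apply: smallest_sub; last exact: rays_measurable.
exact: sigma_algebra_measurable.
Qed.

(** Dynkin's theorem for the pi-system [rays], on which the claim is [lin_orth_rays]. *)
Lemma integral_outer_eq0 (a : I -> R) A :
  (forall w, S w -> gram a (coord w) = 0) -> F A -> \int[P]_(t in A) lin a t = 0.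
Proof.
move=> aS /F_rays rA.
have il := lin_integrable gv a.
have ilS B : measurable B -> P.-integrable B (EFin \o lin a).
  by move=> mB; apply: integrableS il.
move: A rA; apply: (@dynkin_induction _ TF rays (fun A => \int[P]_(t in A) lin a t = 0)) => //.
- exact: lin_mean.
- move=> _ [s [sS ->]]; rewrite Rintegral_mkcond.
  pose n := size s.
  (* The enumeration of [s] by [nth] needs a default index; if [I] is empty, every [lin a] is 0. *)
  have [s0 _|w0] := pickP (fun i : I => true).
    pose b (j : 'I_n) := coord (R := R) (nth (s0, 0) s j).1.
    pose y (j : 'I_n) := (nth (s0, 0) s j).2.
    rewrite -[RHS](@lin_orth_rays _ _ _ _ _ _ gv phi0 'I_n a b y (enum 'I_n)); last first.
      by move=> j; apply: aS; apply: sS; exact: mem_nth.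
    apply: eq_Rintegral => t _; rewrite patchE.
    have -> : \prod_(j <- enum 'I_n) (y j <= lin (b j) t)%R%:R =
        (all (fun p => (p.2 <= phi p.1 t)%R) s)%:R :> R.
      have -> : \prod_(j <- enum 'I_n) (y j <= lin (b j) t)%R%:R = \prod_(p <- s) (p.2 <= phi p.1 t)%R%:R :> R.
        rewrite big_enum/= (big_nth (s0, 0)) big_mkord; apply: eq_bigr => j _.
        by rewrite /y /b lin_coord.
      elim: {+}s => [|p s' IH]; first by rewrite big_nil.
      by rewrite big_cons IH /=; case: (_ <= _)%R => /=; rewrite ?mul1r ?mul0r.
    rewrite (_ : (t \in _) = all (fun p => (p.2 <= phi p.1 t)%R) s).
      by case: (all _ _); rewrite ?mulr1 ?mulr0.
    by apply/idP/idP; rewrite inE.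
  rewrite (_ : _ \_ _ = cst 0); first by rewrite Rintegral_cst// mul0r.
  by apply/funext => t; rewrite patchE; case: ifP => // _; rewrite /lin big_pred0.
- move=> A /sigma_measurable mA A0.
  have := @Rintegral_setU _ _ _ P A (~` A) (lin a) mA (measurableC mA).
  rewrite setUv => /(_ il) h.
  have := h _; rewrite lin_mean// A0 add0r => <- //.
  by rewrite disj_set2E setICr.
- move=> G mG tG G0.
  have mG' n : @measurable _ T (G n) by apply: sigma_measurable; exact: mG.
  rewrite /Rintegral integral_bigcup//; last by apply: ilS; exact: bigcup_measurable.
  rewrite eseries0// => i _ _.
  rewrite -[LHS]fineK; last exact: (integrable_fin_num (mG' i) (ilS _ (mG' i))).
  by have := G0 i; rewrite /Rintegral => ->.
Qed.

(** The difference [Z] of [Y] and [lin h] is measurable for the conditioning sigma-algebra and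
    integrates to 0 over each of its sets. The sets where [Z] is positive or negative are among
    them, so both are null. *)
Lemma cond_expectation_lin (a h : I -> R) (X Y : T -> R) :
  (forall i, ~ S i -> h i = 0) ->
  (forall w, S w -> gram (fun i => a i - h i) (coord w) = 0) ->
  (forall t, X t = lin a t) ->
  cond_expectation P F X Y -> P [set t | Y t != lin h t] = 0%E.
Proof.
move=> hS ho XE [mY iY YX].
have mYF : measurable_fun [set: TF] (Y : TF -> R).
  by move=> _ B mB; rewrite setTI; apply: F_rays; exact: mY.
have mphiF w : S w -> F `<=` <<s rays >> -> measurable_fun [set: TF] (phi w : TF -> R).
  move=> Sw FF _ B mB; apply: FF; apply: sub_sigma_algebra.
  by exists w => //; exists B.
have FE A : F A <-> <<s rays >> A.
  split; first exact: F_rays.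
  move: A; apply: smallest_sub; first exact: smallest_sigma_algebra.
  move=> _ [s [sS ->]]; elim: s sS => [|p s IH] sS.
    rewrite (_ : [set t | _] = setT); last by apply/seteqP; split.
    exact: (@measurableT _ (g_sigma_algebraType (\bigcup_(w in S) preimage_set_system setT (phi w) measurable))).
  rewrite (_ : [set t | _] = (setT `&` phi p.1 @^-1` `[p.2, +oo[) `&` [set t | all (fun p => (p.2 <= phi p.1 t)%R) s]); last first.
    apply/seteqP; split => t /=; rewrite in_itv/= andbT.
      by move=> /andP[].
    by move=> [[_ ->] ->].
  apply: (@measurableI _ (g_sigma_algebraType (\bigcup_(w in S) preimage_set_system setT (phi w) measurable))).
    apply: sub_sigma_algebra; exists p.1; first by apply: sS; rewrite mem_head.
    by exists `[p.2, +oo[%classic.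
  by apply: IH => q qs; apply: sS; rewrite inE qs orbT.
have mh : measurable_fun [set: TF] (lin h : TF -> R).
  rewrite /lin; apply: (@measurable_sum _ TF R) => i.
  have [Si|Si] := pselect (S i); first by apply: measurable_funM => //; exact: (mphiF _ Si F_rays).
  by rewrite hS//; under eq_fun do rewrite mul0r; exact: measurable_cst.
have mZ : measurable_fun [set: TF] (fun t : TF => Y t - lin h t) by exact: measurable_funB.
have ila := lin_integrable gv.
pose Z t := Y t - lin h t.
have iZ : P.-integrable setT (EFin \o Z).
  rewrite (_ : _ \o _ = fun t => ((EFin \o Y) t - (EFin \o lin h) t)%E)//.
  by apply: integrableB => //; exact: ila.
have ZF A : F A -> \int[P]_(t in A) Z t = 0.
  move=> FA; have mA : measurable A by apply: sigma_measurable; exact/FE.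
  rewrite RintegralB//; [|exact: integrableS iY|exact: integrableS (ila _)].
  rewrite /Rintegral YX// -/(Rintegral _ _ _).
  rewrite (eq_integral (fun t => (lin a t)%:E)); last by move=> t _; rewrite XE.
  rewrite -!/(Rintegral _ _ _) -RintegralB//; [|exact: integrableS (ila _)|exact: integrableS (ila _)].
  rewrite -[RHS](integral_outer_eq0 ho FA); apply: eq_Rintegral => t _.
  by rewrite /lin -sumrB; apply: eq_bigr => i _; rewrite mulrBl.
have main (sg : R) : sg != 0 -> P [set t | 0 < sg * Z t] = 0%E.
  move=> sg0; set A := [set t | _].
  have FA : F A.
    apply/FE; rewrite (_ : A = setT `&` (fun t => sg * (Y t - lin h t)) @^-1` `]0, +oo[).
      by apply: (measurable_funM (measurable_cst sg) mZ) => //; exact: measurable_itv.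
    by rewrite setTI; apply/seteqP; split => t; rewrite /A /= in_itv/= andbT.
  have mA : measurable A by apply: sigma_measurable; exact/FE.
  have iA : P.-integrable A (EFin \o (fun t => sg * Z t)).
    by apply: (integrableS measurableT) => //; exact: integZ.
  have E0 : (\int[P]_(t in A) `|(sg * Z t)%:E| = 0)%E.
    rewrite (eq_integral (fun t => (sg * Z t)%:E)); last first.
      by move=> t; rewrite inE /A /= => At; rewrite ger0_norm// ltW.
    rewrite -[LHS]fineK; last exact: (integrable_fin_num mA iA).
    have := RintegralZl sg mA (integrableS measurableT mA (@subsetT _ A) iZ).
    by rewrite ZF// mulr0 /Rintegral => ->.
  have mf : measurable_fun A (fun t => (sg * Z t)%:E) by exact: (measurable_int _ iA).
  have [N [mN N0 AN]] := (ae_eq_integral_abs P mA mf).1 E0.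
  apply/eqP; rewrite eq_le measure_ge0 andbT -N0 le_measure ?inE//.
  move=> t At; apply: AN => /= /(_ At) [] st0.
  by move: At; rewrite /A /= st0 ltxx.
apply/eqP; rewrite eq_le measure_ge0 andbT.
have m1 (sg : R) : measurable [set t | 0 < sg * Z t].
  rewrite (_ : [set t | _] = setT `&` (fun t => sg * Z t) @^-1` `]0, +oo[).
    by apply: (integ_measurable (integZ sg iZ)) => //; exact: measurable_itv.
  by rewrite setTI; apply/seteqP; split => t /=; rewrite in_itv/= andbT.
apply: (@le_trans _ _ (P ([set t | 0 < 1 * Z t] `|` [set t | 0 < -1 * Z t])%R)).
  apply: le_measure; rewrite ?inE.
  - rewrite (_ : [set t | _] = [set t | 0 < 1 * Z t] `|` [set t | 0 < -1 * Z t]).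
      exact: measurableU.
    apply/seteqP; split => t /=; rewrite mul1r mulN1r oppr_gt0 subr_gt0 subr_lt0 neq_lt orbC.
      by move=> /orP.
    by move=> [->//|->]; rewrite orbT.
  - exact: measurableU.
  - move=> t /=; rewrite mul1r mulN1r oppr_gt0 subr_gt0 subr_lt0 neq_lt orbC.
    by move=> /orP.
apply: (le_trans (measureU2 P (m1 1) (m1 (-1)))).
apply: (@le_trans _ _ (0 + 0)%E); last by rewrite adde0.
by apply: leeD; rewrite le_eqVlt; apply/orP; left; apply/eqP; apply: main; rewrite ?oppr_eq0 oner_eq0.
Qed.

End conditional_expectation.

(** * Killed random walk and Green function *)

Lemma point_inj N : injective (@point N).
Proof. by move=> [a b] [c e] [/val_inj -> /val_inj ->]. Qed.

Definition nbr (x : lattice) : seq lattice :=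
  [:: (x.1 + 1, x.2); (x.1 - 1, x.2); (x.1, x.2 + 1); (x.1, x.2 - 1)].

Lemma adjacentC (x y : lattice) : adjacent x y = adjacent y x.
Proof. by rewrite /adjacent -(opprB y.1) -(opprB y.2) !sqrrN. Qed.

Lemma adjacent_nbr (x y : lattice) : adjacent x y = (y \in nbr x).
Proof.
apply/idP/idP.
  rewrite /adjacent => /eqP h.
  have : (x.1 - y.1 = 0 /\ (x.2 - y.2 = 1 \/ x.2 - y.2 = -1)) \/
         (x.2 - y.2 = 0 /\ (x.1 - y.1 = 1 \/ x.1 - y.1 = -1)).
    move: h; move: (x.1 - y.1) (x.2 - y.2) => a b h.
    have a1 : `|a| <= 1 by nia.
    have b1 : `|b| <= 1 by nia.
    have : a = 0 \/ a = 1 \/ a = -1 by lia.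
    have : b = 0 \/ b = 1 \/ b = -1 by lia.
    by nia.
  move: x y {h} => [x1 x2] [y1 y2] /= h; rewrite /nbr !inE /= -!pair_eqE /=.
  lia.
move: x y => [x1 x2] [y1 y2]; rewrite /nbr !inE /= /adjacent -!pair_eqE /= => h.
apply/eqP; nia.
Qed.

Lemma nbr_uniq x : uniq (nbr x).
Proof. by case: x => a b; rewrite /nbr /= !inE -!pair_eqE /=; lia. Qed.

Lemma sum_nbr (R : realType) (x : lattice) (f : lattice -> R) :
  \sum_(y <- nbr x) f y = f (x.1 + 1, x.2) + f (x.1 - 1, x.2) + f (x.1, x.2 + 1) + f (x.1, x.2 - 1).
Proof. by rewrite /nbr !big_cons big_nil addr0 !addrA. Qed.

Definition interior (N : nat) (x : lattice) : bool :=
  (0 < x.1 < N%:Z) && (0 < x.2 < N%:Z).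

Lemma inner_box (N : nat) (x : lattice) : inner (box_set N) x <-> interior N x.
Proof.
case: x => a b; rewrite /inner /boundary /box_set /interior /=; split.
  move=> [[ha hb] hn]; apply: contrapT => /negP h; apply: hn; split => //=.
  have [c [hc1 hc2]] : exists c : lattice, adjacent (a, b) c /\ ~ (0 <= c.1 <= N%:Z /\ 0 <= c.2 <= N%:Z).
    have : a = 0 \/ a = N%:Z \/ b = 0 \/ b = N%:Z by lia.
    move=> [->|[->|[->|->]]].
    - by exists (-1, b); rewrite adjacent_nbr /nbr !inE -!pair_eqE /=; split; lia.
    - by exists (N%:Z + 1, b); rewrite adjacent_nbr /nbr !inE -!pair_eqE /=; split; lia.
    - by exists (a, -1); rewrite adjacent_nbr /nbr !inE -!pair_eqE /=; split; lia.
    - by exists (a, N%:Z + 1); rewrite adjacent_nbr /nbr !inE -!pair_eqE /=; split; lia.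
  by exists c.
move=> h; split; first by split; lia.
move=> [_ [z zB]]; rewrite adjacent_nbr !inE -!pair_eqE /=.
by move=> hz; apply: zB => /=; split; lia.
Qed.

Lemma interior_nbr N x y : interior N x -> y \in nbr x -> box_set N y.
Proof.
case: x => a b; rewrite /nbr !inE /interior /box_set /= => h.
by move=> /or4P[] /eqP -> /=; split; lia.
Qed.

Section walk.
Context {R : realType} d (T : measurableType d) (P : probability T R).
Variables (u : lattice) (W : nat -> T -> lattice) (N : nat).
Hypothesis hW : simple_random_walk P u W.
Hypothesis uN : interior N u.

Let mW k x : measurable (W k @^-1` [set x]). Proof. exact: hW.1. Qed.

Lemma countable_preimage (C : countType) (f : T -> C) (A : set C) :
  (forall c, measurable (f @^-1` [set c])) -> measurable (f @^-1` A).
Proof.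
move=> mf; rewrite (_ : f @^-1` A = \bigcup_n (if unpickle n is Some c then
    (if c \in A then f @^-1` [set c] else set0) else set0)).
  apply: bigcupT_measurable => n; case: unpickle => // c; case: ifP => _ //.
apply/seteqP; split => t /=.
  by move=> At; exists (pickle (f t)) => //=; rewrite pickleK mem_set.
by move=> [n _]; case: unpickle => // c; case: ifPn => //; rewrite inE => Ac /= ->.
Qed.

Lemma countable_null (C : countType) (F : C -> set T) :
  (forall c, measurable (F c)) -> (forall c, P (F c) = 0%E) ->
  P (\bigcup_c F c) = 0%E.
Proof.
move=> mF F0; rewrite (_ : \bigcup_c F c = \bigcup_n (if unpickle n is Some c then F c else set0)).
  apply/negligibleP; first by apply: bigcupT_measurable => n; case: unpickle.
  apply: negligible_bigcup => n; apply/negligibleP; case: unpickle => //=.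
apply/seteqP; split => t /=.
  by move=> [c _ Fc]; exists (pickle c) => //=; rewrite pickleK.
by move=> [n _]; case: unpickle => // c Fc; exists c.
Qed.

(** Staying in the interior, rather than not having hit the boundary as in [green], makes the event
    empty for exterior [x] and gives a recursion in [k]; [alive_prob] compares the two. *)
Definition killed k x : set T := [set t | (forall j, (j <= k)%N -> interior N (W j t)) /\ W k t = x].

Let path_event k (p : nat -> lattice) : set T := [set t | forall j, (j <= k)%N -> W j t = p j].

Let measurable_path k p : measurable (path_event k p).
Proof.
rewrite (_ : path_event k p = \bigcap_(j in `I_k.+1) W j @^-1` [set p j]).
  by apply: bigcap_measurableType => // j _.
by apply/seteqP; split => t /= h j; exact: h.
Qed.

Let path_prob k p : P (path_event k p) = ((p 0%N == u)%:R * \prod_(j < k) srw_kernel R (p j) (p j.+1))%:E.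
Proof. exact: hW.2. Qed.

Let measurable_interior k : measurable [set t | forall j, (j <= k)%N -> interior N (W j t)].
Proof.
rewrite (_ : [set t | _] = \bigcap_(j in `I_k.+1) W j @^-1` [set x | interior N x]).
  apply: bigcap_measurableType => // j _.
  exact: (@countable_preimage lattice).
by apply/seteqP; split => t /= h j; exact: h.
Qed.

Lemma measurable_killed k x : measurable (killed k x).
Proof.
rewrite (_ : killed k x = [set t | forall j, (j <= k)%N -> interior N (W j t)] `&` W k @^-1` [set x]).
  by apply: measurableI.
by apply/seteqP; split => t [].
Qed.

Let bpath k := {ffun 'I_k.+1 -> box N}.

Let tolat k (p : bpath k) (j : nat) : lattice := point (p (inord j)).

Let of_interior x : interior N x -> exists b : box N, point b = x.
Proof.
case: x => [[a|a] [b|b]]; rewrite /interior /= => h; try lia.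
have ha : (a < N.+1)%N by lia.
have hb : (b < N.+1)%N by lia.
by exists (Ordinal ha, Ordinal hb).
Qed.

(** Trajectories inside the box are coded by a finite type, so the event is a finite disjoint union
    of path events, whose probabilities are prescribed. *)
Let killed_sum k (A : set T) : measurable A ->
  (P ([set t | forall j, (j <= k)%N -> interior N (W j t)] `&` A) =
  \sum_(p : bpath k) if [forall j, interior N (point (p j))] then P (path_event k (tolat p) `&` A) else 0)%E.
Proof.
move=> mA; set E := [set t | _].
have mEA : measurable (E `&` A) by apply: measurableI => //; exact: measurable_interior.
have := integral_indic P measurableT mEA; rewrite setIT => <-.
rewrite (eq_integral (fun t => \sum_(p : bpath k) (if [forall j, interior N (point (p j))] then
    \1_(path_event k (tolat p) `&` A) t else 0)%:E)%E); last first.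
  move=> t _; rewrite sumEFin; congr EFin; rewrite indicE.
  have [[Et At]|h] := pselect ((E `&` A) t); last first.
    rewrite memNset// big1// => p _; case: ifPn => // /forallP pin.
    rewrite indicE memNset// => -[Wp At]; apply: h; split => // j jk.
    by rewrite Wp//; exact: pin.
  rewrite mem_set//.
  have [f fE] : exists f : 'I_k.+1 -> box N, forall j, point (f j) = W j t.
    have h (j : 'I_k.+1) : exists b : box N, point b = W j t.
      by apply: of_interior; apply: Et; rewrite -ltnS.
    by exists (fun j => sval (cid (h j))) => j; case: (cid (h j)).
  rewrite (bigD1 (finfun f))//= big1 ?addr0.
    case: ifPn => [_|/negP[]]; last first.
      by apply/forallP => j; rewrite ffunE fE; apply: Et; rewrite -ltnS.
    rewrite indicE mem_set//; split => // j jk.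
    by rewrite /tolat ffunE fE inordK.
  move=> p pf; case: ifP => // _; rewrite indicE memNset// => -[Wp _].
  case/eqP: pf; apply/ffunP => j; apply: point_inj.
  have jk : (j <= k)%N by rewrite -ltnS.
  by have := Wp j jk; rewrite /tolat inord_val ffunE fE => ->.
rewrite ge0_integral_sum//; last 2 first.
- move=> p; case: [forall j, interior N (point (p j))] => //.
  by apply/measurable_EFinP; apply: measurable_indic; exact: measurableI.
- by move=> p t _; rewrite lee_fin; case: ifP.
apply: eq_bigr => p _; case: [forall j, interior N (point (p j))]; last by rewrite integral0.
by rewrite integral_indic// ?setIT//; exact: measurableI.
Qed.

(** Decomposition at the last step. It moves the end point, so the resulting Poisson equation is in
    the second argument of the Green function. *)
Lemma killed_rec k x : interior N x ->
  (P (killed k.+1 x) = \sum_(y <- nbr x) (4^-1)%:E * P (killed k y))%E.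
Proof.
move=> xN.
rewrite (_ : killed k.+1 x = [set t | forall j, (j <= k)%N -> interior N (W j t)] `&` W k.+1 @^-1` [set x]); last first.
  apply/seteqP; split => t [h1 h2]; split => // j.
    by move=> jk; apply: h1; rewrite ltnW.
  by rewrite leq_eqVlt => /orP[/eqP -> |]; [rewrite h2|rewrite ltnS; exact: h1].
rewrite killed_sum//.
transitivity (\sum_(y <- nbr x) (\sum_(p : bpath k) if [forall j, interior N (point (p j))] then
   (4^-1)%:E * P (path_event k (tolat p) `&` W k @^-1` [set y]) else 0))%E; last first.
  apply: eq_bigr => y _.
  rewrite (_ : killed k y = [set t | forall j, (j <= k)%N -> interior N (W j t)] `&` W k @^-1` [set y]); last first.
    by apply/seteqP; split => t.
  rewrite killed_sum// ge0_sume_distrr//; last by move=> p _; case: ifP.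
  by apply: eq_bigr => p _; case: ifP => _; rewrite ?mule0.
rewrite exchange_big/=; apply: eq_bigr => p _; case: ifPn => pin; last by rewrite big1.
pose q j := if j == k.+1 then x else tolat p j.
have -> : path_event k (tolat p) `&` W k.+1 @^-1` [set x] = path_event k.+1 q.
  apply/seteqP; split => t /=.
    move=> [h1 h2] j; rewrite /q leq_eqVlt; case: eqP => [-> //|_ /=].
    by rewrite ltnS; exact: h1.
  move=> h; split => [j jk|]; last by rewrite h// /q eqxx.
  by rewrite h ?(leqW jk)// /q ltn_eqF.
have kE y : path_event k (tolat p) `&` W k @^-1` [set y] =
    if tolat p k == y then path_event k (tolat p) else set0.
  apply/seteqP; split => t /=.
    by move=> [h1 h2]; rewrite -h2 h1// eqxx.
  by case: eqP => // <- h; split => //; rewrite h.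
have q1 : q k.+1 = x by rewrite /q eqxx.
have qj j : (j <= k)%N -> q j = tolat p j by move=> jk; rewrite /q ltn_eqF.
rewrite path_prob big_ord_recr /= q1 !qj//.
rewrite (eq_bigr (fun j : 'I_k => srw_kernel R (tolat p j) (tolat p j.+1))); last first.
  by move=> j _; rewrite !qj// ltnW.
rewrite mulrA EFinM -path_prob /srw_kernel.
under [RHS]eq_bigr do rewrite kE.
rewrite adjacentC adjacent_nbr; case: ifPn => pn.
  rewrite (bigD1_seq (tolat p k)) ?nbr_uniq//= eqxx big1 ?adde0; first by rewrite muleC.
  by move=> y; rewrite eq_sym => /negbTE ->; rewrite measure0 mule0.
rewrite mule0 big_seq big1// => y yn; case: eqP => [e|_]; last by rewrite measure0 mule0.
by rewrite e yn in pn.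
Qed.

Lemma killed0 x : interior N x -> P (killed 0 x) = ((x == u)%:R)%:E.
Proof.
move=> xN; have -> : killed 0 x = path_event 0 (fun=> x).
  apply/seteqP; split => t /=; first by move=> [_ h] j; rewrite leqn0 => /eqP ->.
  by move=> h; split=> [j|]; [rewrite leqn0 => /eqP ->; rewrite h|exact: h].
by rewrite path_prob big_ord0 mulr1.
Qed.

Lemma killed_out k x : ~~ interior N x -> killed k x = set0.
Proof.
move=> xN; apply/seteqP; split => // t [h1 h2].
by move: xN; rewrite -h2 h1.
Qed.

(** The hypothesis prescribes probabilities of paths and not the trajectories themselves. Long jumps
    are only almost surely absent, as a countable union of null path events. *)
Let jump_null k : P [set t | ~~ adjacent (W k t) (W k.+1 t)] = 0%E.
Proof.
pose C := {ffun 'I_k.+2 -> lattice}.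
pose F (p : C) := if adjacent (p (inord k)) (p (inord k.+1)) then set0 else path_event k.+1 (fun j => p (inord j)).
rewrite (_ : [set t | _] = \bigcup_p F p).
  apply: (@countable_null C F) => p; rewrite /F; case: ifPn => // pn.
  rewrite path_prob (bigD1 ord_max)//= /srw_kernel (negbTE pn) mul0r mulr0//.
apply/seteqP; split => t /=; last first.
  by move=> [p _]; rewrite /F; case: ifPn => // pn h; rewrite !h.
move=> h; exists [ffun j : 'I_k.+2 => W j t] => //.
rewrite /F !ffunE !inordK// (negbTE h) => j jk /=.
by rewrite ffunE inordK.
Qed.

Let measurable_jump k : measurable [set t | ~~ adjacent (W k t) (W k.+1 t)].
Proof.
have mp : measurable ((fun t => (W k t, W k.+1 t)) @^-1` [set z : lattice * lattice | ~~ adjacent z.1 z.2]).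
  apply: (@countable_preimage (lattice * lattice)%type) => -[a b].
  rewrite (_ : _ @^-1` _ = W k @^-1` [set a] `&` W k.+1 @^-1` [set b]); first exact: measurableI.
  by apply/seteqP; split => t /= [-> ->].
exact: mp.
Qed.

Lemma start_null : P [set t | W 0%N t != u] = 0%E.
Proof.
have : P (path_event 0 (fun=> u)) = 1%E by rewrite path_prob big_ord0 mulr1 eqxx.
rewrite (_ : path_event 0 (fun=> u) = W 0%N @^-1` [set u]); last first.
  apply/seteqP; split => t /=; first by move=> h; exact: h.
  by move=> h j; rewrite leqn0 => /eqP ->.
move=> h; rewrite (_ : [set t | _] = ~` (W 0%N @^-1` [set u])).
  by rewrite probability_setC// h subee.
by apply/seteqP; split => t /=; [move/eqP|move=> ?; apply/eqP].
Qed.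

Let B : set lattice := box_set N.

Let alive k : set T := [set t | forall j, (j <= k)%N -> ~ boundary B (W j t)].

Let alive_hit k t : ((k%:R)%:E < hitting_time R (boundary B) (W ^~ t))%E <-> alive k t.
Proof.
rewrite /hitting_time /alive /=; split.
  move=> h j jk bj; move: h; apply/negP; rewrite -leNgt.
  apply: (@le_trans _ _ (j%:R)%:E); last by rewrite lee_fin ler_nat.
  by apply: ereal_inf_lbound; exists j.
move=> h; apply: (@lt_le_trans _ _ (k.+1%:R)%:E); first by rewrite lte_fin ltr_nat.
apply: le_ereal_inf_tmp => _ [j bj <-]; rewrite lee_fin ler_nat.
by rewrite ltnNge; apply/negP => jk; exact: (h j jk).
Qed.

Let measurable_alive k : measurable (alive k).
Proof.
rewrite (_ : alive k = \bigcap_(j in `I_k.+1) W j @^-1` [set x | ~ boundary B x]).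
  apply: bigcap_measurableType => // j _.
  exact: (@countable_preimage lattice).
by apply/seteqP; split => t /= h j; exact: h.
Qed.

(** Off the null event [bad] the walk starts at the interior point [u] and moves between neighbours,
    so it cannot leave the interior without visiting the boundary. *)
Lemma alive_prob k x : P (alive k `&` W k @^-1` [set x]) = P (killed k x).
Proof.
pose bad := [set t | W 0%N t != u] `|` \bigcup_j [set t | ~~ adjacent (W j t) (W j.+1 t)].
have mstart : measurable [set t | W 0%N t != u].
  rewrite (_ : [set t | _] = ~` (W 0%N @^-1` [set u])); first exact: measurableC.
  by apply/seteqP; split => t /=; [move/eqP|move=> ?; apply/eqP].
have mbad : measurable bad.
  by apply: measurableU => //; exact: bigcupT_measurable.
have bad0 : P bad = 0%E.
  apply: null_set_setU => //; [exact: bigcupT_measurable|exact: start_null|].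
  apply/negligibleP; first exact: bigcupT_measurable.
  by apply: negligible_bigcup => n; apply/negligibleP; [exact: measurable_jump|exact: jump_null].
have mA : measurable (alive k `&` W k @^-1` [set x]) by exact: measurableI.
have mK := measurable_killed k x.
apply/eqP; rewrite eq_le; apply/andP; split.
  apply: (@le_trans _ _ (P (killed k x `|` bad))).
    apply: le_measure; rewrite ?inE//; first exact: measurableU.
    move=> t [al Wx]; have [bt|nb] := pselect (bad t); [by right|left; split => //].
    elim=> [|j IH] jk.
      have -> // : W 0%N t = u.
      by apply/eqP; apply: contrapT => /negP h; apply: nb; left.
    have := IH (ltnW jk) => ij.
    have adj : adjacent (W j t) (W j.+1 t).
      by apply: contrapT => /negP h; apply: nb; right; exists j.
    apply/inner_box; split; last exact: al.
    by apply: interior_nbr ij _; rewrite -adjacent_nbr.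
  apply: (le_trans (measureU2 P mK mbad)).
  by rewrite -[leRHS]adde0; apply: leeD => //; rewrite -bad0.
apply: le_measure; rewrite ?inE// => t [h1 h2]; split => // j jk bj.
by have /inner_box [] := h1 j jk.
Qed.

Let green_alive (PW : lattice -> probability T R) x : PW u = P ->
  (green PW W B u x = (pi / 2)%:E * \sum_(0 <= k <oo) P (alive k `&` W k @^-1` [set x]))%E.
Proof.
move=> PWu; rewrite /green PWu; congr (_ * _)%E.
transitivity (\int[P]_t (\sum_(0 <= k <oo) (\1_(alive k `&` W k @^-1` [set x]) t)%:E))%E.
  apply: eq_integral => t _; rewrite eseries_mkcond; apply: eq_eseriesr => k _.
  case: ifPn => [/alive_hit al|/negP al]; rewrite !indicE.
    by congr ((nat_of_bool _)%:R)%:E; apply/idP/idP; rewrite !inE => // -[].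
  by rewrite memNset// => -[/alive_hit].
rewrite integral_nneseries//; last first.
- by move=> k; apply/measurable_EFinP; apply: measurable_indic; exact: measurableI.
apply: eq_eseriesr => k _; rewrite integral_indic//; last exact: measurableI.
by rewrite setIT.
Qed.

Lemma green_boundary (PW : lattice -> probability T R) x : PW u = P -> boundary B u ->
  green PW W B u x = 0%E.
Proof.
move=> PWu bu; rewrite green_alive// eseries0 ?mule0// => k _ _.
apply/eqP; rewrite eq_le measure_ge0 andbT -start_null; apply: le_measure; rewrite ?inE.
- exact: measurableI.
- rewrite (_ : [set t | _] = ~` (W 0%N @^-1` [set u])); first exact: measurableC.
  by apply/seteqP; split => t /=; [move/eqP|move=> ?; apply/eqP].
- by move=> t [al _] /=; apply/eqP => e; apply: (al 0%N); rewrite // e.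
Qed.

Lemma green_killed (PW : lattice -> probability T R) x : PW u = P ->
  (green PW W B u x = (pi / 2)%:E * \sum_(0 <= k <oo) P (killed k x))%E.
Proof.
by move=> PWu; rewrite green_alive//; congr (_ * _)%E; apply: eq_eseriesr => k _; exact: alive_prob.
Qed.

(** The term [k = 0] gives the point mass and the later ones the mean over neighbours. Everything is
    stated in the extended reals because finiteness is not yet known. *)
Lemma green_rec (PW : lattice -> probability T R) x : PW u = P -> interior N x ->
  (green PW W B u x = ((pi / 2) * (x == u)%:R)%:E + \sum_(y <- nbr x) (4^-1)%:E * green PW W B u y)%E.
Proof.
move=> PWu xN.
have pi2 : 0 <= pi / 2 :> R by rewrite divr_ge0// pi_ge0.
have s0 y : (0 <= \sum_(0 <= k <oo) P (killed k y))%E by exact: nneseries_ge0.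
under eq_bigr do rewrite green_killed//.
rewrite green_killed// nneseries_recl// killed0// ge0_muleDr ?lee_fin//; last first.
  exact: nneseries_ge0.
rewrite EFinM; congr (_ + _)%E.
have -> : (\sum_(1 <= k <oo) P (killed k x) = \sum_(0 <= k <oo) P (killed k.+1 x))%E.
  by rewrite -(nneseries_addn 1)//; apply: eq_eseriesr => k _; rewrite addn1.
have -> : (\sum_(0 <= k <oo) P (killed k.+1 x) = \sum_(y <- nbr x) (4^-1)%:E * \sum_(0 <= k <oo) P (killed k y))%E.
  under eq_eseriesr do rewrite killed_rec//.
  elim: (nbr x) => [|y s IH].
    by rewrite big_nil eseries0// => k _ _; rewrite big_nil.
  rewrite big_cons -IH -nneseriesZl// -nneseriesD//; last 2 first.
  - by move=> k _ _; rewrite mule_ge0.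
  - by move=> k _ _; rewrite sume_ge0// => z _; rewrite mule_ge0.
  by apply: eq_eseriesr => k _; rewrite big_cons.
rewrite ge0_sume_distrr//; last by move=> y _; rewrite mule_ge0.
by apply: eq_bigr => y _; rewrite muleCA.
Qed.

Lemma green_out (PW : lattice -> probability T R) x : PW u = P -> ~~ interior N x ->
  (green PW W B u x = 0)%E.
Proof.
move=> PWu xN; rewrite green_killed// eseries0 ?mule0// => k _ _.
by rewrite killed_out// measure0.
Qed.

End walk.

(** * Discrete potential theory *)

Lemma box_point N x : box_set N x -> exists b : box N, point b = x.
Proof.
case: x => [[a|a] [b|b]]; rewrite /box_set /= => -[h1 h2]; try lia.
have ha : (a < N.+1)%N by lia.
have hb : (b < N.+1)%N by lia.
by exists (Ordinal ha, Ordinal hb).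
Qed.

Lemma box_set_point N (b : box N) : box_set N (point b).
Proof. by case: b => -[a ha] [b hb]; rewrite /box_set /=; split; lia. Qed.

Lemma interior_box N x : interior N x -> box_set N x.
Proof. by case: x => a b; rewrite /interior /box_set /= => h; split; lia. Qed.

Lemma nbr_sym x y : (y \in nbr x) = (x \in nbr y).
Proof. by rewrite -!adjacent_nbr adjacentC. Qed.

Section maximum_principle.
Context {R : realType} (N : nat).
Implicit Types (f : lattice -> R) (A : pred lattice).

(* Among the maximisers of f take one with largest first coordinate. *)
Lemma maximum_principle A f (M : R) : (forall x, A x -> interior N x) ->
  (forall x, A x -> 4 * f x <= \sum_(y <- nbr x) f y) ->
  (forall x y, A x -> y \in nbr x -> ~~ A y -> f y <= M) ->
  forall x, A x -> f x <= M.
Proof.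
move=> AN sub out x Ax.
have [b bx] := box_point (interior_box (AN x Ax)).
have Ab0 : A (point b) by rewrite bx.
have [b1 A1 b1max] : exists2 b1 : box N, A (point b1) &
    forall c : box N, A (point c) -> f (point c) <= f (point b1).
  pose b1 := [arg max_(c > b | A (point c)) f (point c)]%O.
  by exists b1; rewrite /b1; case: Order.TotalTheory.arg_maxP.
pose Q (c : box N) := A (point c) && (f (point c) == f (point b1)).
have [b2 /andP[Ab /eqP b2m] b2max] : exists2 b2 : box N, Q b2 & forall c : box N, Q c -> (c.1 <= b2.1)%N.
  have Q1 : Q b1 by rewrite /Q A1 eqxx.
  pose b2 := [arg max_(c > b1 | Q c) (c.1 : nat)].
  by exists b2; rewrite /b2; case: arg_maxnP.
rewrite -bx (le_trans (b1max b _))// -b2m leNgt; apply/negP => Mb.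
have nb y : y \in nbr (point b2) -> f y <= f (point b2).
  move=> yn; have [Ay|/(out _ _ Ab yn) Ay] := boolP (A y); last by rewrite (le_trans Ay)// ltW.
  have [c cy] := box_point (interior_box (AN y Ay)); rewrite b2m -cy.
  by apply: b1max; rewrite cy.
pose z : lattice := ((point b2).1 + 1, (point b2).2).
have zn : z \in nbr (point b2) by rewrite inE eqxx.
have fz : f z = f (point b2).
  apply/eqP; rewrite eq_le nb//=.
  have := sub _ Ab; rewrite sum_nbr -/z.
  have := nb ((point b2).1 - 1, (point b2).2); rewrite !inE eqxx orbT => /(_ isT).
  have := nb ((point b2).1, (point b2).2 + 1); rewrite !inE eqxx !orbT => /(_ isT).
  have := nb ((point b2).1, (point b2).2 - 1); rewrite !inE eqxx !orbT => /(_ isT).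
  by lra.
have Az : A z by apply: contraTT Mb => /(out _ _ Ab zn); rewrite fz -leNgt.
have [c cz] := box_point (interior_box (AN z Az)).
have := b2max c; rewrite /Q cz fz b2m eqxx Az => /(_ isT).
have : (c.1 : nat)%:Z = (b2.1 : nat)%:Z + 1 := congr1 fst cz.
lia.
Qed.

End maximum_principle.

(** * Green functions of subdomains as covariances of residual fields *)

Section green_function.
Context {R : realType} dW (TW : measurableType dW).
Variables (PW : lattice -> probability TW R) (W : nat -> TW -> lattice).
Hypothesis hW : forall u, simple_random_walk (PW u) u W.
Context d (T : measurableType d) (P : probability T R).
Variables (N : nat) (phi : box N -> {RV P >-> R}).
Hypothesis hphi : GFF PW W phi.

Local Notation gram := (gram phi).
Let gv : gaussian_vector phi. Proof. by case: hphi. Qed.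
Let phi0 v : ('E_P[phi v] = 0)%E. Proof. by case: hphi. Qed.
Implicit Types (a b : box N -> R) (A : pred lattice) (v w : box N) (x y : lattice).

(** Extends the covariance by 0 to the whole lattice, so that sums over neighbours need no case
    distinction. *)
Let kernel w x : R := \sum_(b | point b == x) second_moment phi w b.

Let kernel_point w v : kernel w (point v) = second_moment phi w v.
Proof.
rewrite /kernel (big_pred1 v)// => u /=; exact: (inj_eq (@point_inj N)).
Qed.

Let second_momentE v w : (second_moment phi v w)%:E = green PW W (box_set N) (point v) (point w).
Proof. by have [_ _ <-] := hphi; rewrite covariance_phi. Qed.

Let kernel_boundary w x : ~~ interior N (point w) -> kernel w x = 0.
Proof.
move=> wN; rewrite /kernel big1// => b _; apply: EFin_inj; rewrite second_momentE.
rewrite (green_boundary (hW _))//; apply: contrapT => nb; move/negP: wN; apply.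
by apply/inner_box; split => //; exact: box_set_point.
Qed.

Let kernel_out w x : ~~ interior N x -> kernel w x = 0.
Proof.
move=> xN; have [wN|/kernel_boundary->//] := boolP (interior N (point w)).
rewrite /kernel big1// => b /eqP bx; apply: EFin_inj.
by rewrite second_momentE bx (green_out (hW _)).
Qed.

(** Finiteness of the Green function comes from here: by the hypothesis on the field it is a
    covariance of square integrable variables. *)
Let green_kernelE w x : interior N (point w) ->
  green PW W (box_set N) (point w) x = (kernel w x)%:E.
Proof.
move=> wN; have [xN|xN] := boolP (interior N x); last by rewrite (green_out (hW _))// kernel_out.
have [b <-] := box_point (interior_box xN).
by rewrite -second_momentE kernel_point.
Qed.

Let kernel_poisson w x : interior N x ->
  4 * kernel w x = 2 * pi * (point w == x)%:R + \sum_(y <- nbr x) kernel w y.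
Proof.
move=> xN; have [wN|wN] := boolP (interior N (point w)); last first.
  rewrite kernel_boundary// mulr0 big1; last by move=> y _; rewrite kernel_boundary.
  case: eqP => [wx|]; first by rewrite wx xN in wN.
  by rewrite mulr0 addr0.
have := green_rec (hW (point w)) wN erefl xN.
rewrite green_kernelE// (eq_bigr (fun y => (4^-1 * kernel w y)%:E)); last first.
  by move=> y _; rewrite green_kernelE.
rewrite sumEFin -EFinD -mulr_sumr eq_sym => -[->].
by field.
Qed.

(** A coefficient vector is read as a distribution of charges. By [gram_potential], being
    uncorrelated with the field at a point means that the potential vanishes there. *)
Definition potential a x : R := \sum_w a w * kernel w x.

Lemma gram_potential a v : gram a (coord v) = potential a (point v).
Proof.
rewrite /gram /potential; apply: eq_bigr => u _.
rewrite (bigD1 v)//= /coord eqxx mulr1 big1 ?addr0 ?kernel_point// => i /negbTE ->.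
by rewrite mulr0 mul0r.
Qed.

Lemma potential_out a x : ~~ interior N x -> potential a x = 0.
Proof. by move=> /negbTE xN; rewrite /potential big1// => w _; rewrite kernel_out ?xN// mulr0. Qed.

Lemma potential_poisson a w : interior N (point w) ->
  4 * potential a (point w) = 2 * pi * a w + \sum_(y <- nbr (point w)) potential a y.
Proof.
move=> wN; rewrite exchange_big /= /potential mulr_sumr.
rewrite (eq_bigr (fun u => a u * (2 * pi * (point u == point w)%:R) +
    a u * \sum_(y <- nbr (point w)) kernel u y)); last first.
  by move=> u _; rewrite mulrCA kernel_poisson// mulrDr.
rewrite big_split/=; congr (_ + _); last by apply: eq_bigr => v _; rewrite mulr_sumr.
rewrite (bigD1 w)//= eqxx big1 ?addr0; first by rewrite mulr1 mulrC.
by move=> v vw; rewrite (inj_eq (@point_inj N)) (negbTE vw) !mulr0.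
Qed.

(** Coefficients of the field at [v] minus its projection on the field outside [A]. They are picked
    by choice because charges on the boundary of the box, where the field is 0, are not determined;
    by [residualP] the default of [xget] never matters. *)
Definition residual A v : box N -> R := xget (coord v)
  [set r | (forall i, A (point i) -> r i = coord v i) /\
           (forall w, ~~ A (point w) -> gram r (coord w) = 0)].

Lemma residualP A v : (forall i, A (point i) -> residual A v i = coord v i) /\
  (forall w, ~~ A (point w) -> gram (residual A v) (coord w) = 0).
Proof.
rewrite /residual; case: xgetP => // h; exfalso.
have [k k0 ko] := projection_exists gv phi0 (fun w => ~~ A (point w)) (coord v).
apply: (h (fun i => coord v i - k i)); split => [i Ai|//].
by rewrite k0 ?subr0//= negbK.
Qed.

(** For [A] inside the box this is the Green function of the walk killed outside [A], as
    [green_in_out] and [green_in_poisson] show. *)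
Definition green_in A v x : R := potential (residual A v) x.

Lemma residual_in A v w : A (point w) -> residual A v w = (w == v)%:R.
Proof. exact: (residualP A v).1. Qed.

Lemma gram_residual_coord A v w : gram (residual A v) (coord w) = green_in A v (point w).
Proof. exact: gram_potential. Qed.

Section domain.
Variable A : pred lattice.
Hypothesis AN : forall x, A x -> interior N x.

Let AP x : A x -> exists w, point w = x.
Proof. by move=> /AN /interior_box /box_point. Qed.

Lemma green_in_out v x : ~~ A x -> green_in A v x = 0.
Proof.
move=> Ax; have [xN|xN] := boolP (interior N x); last exact: potential_out.
have [w wx] := box_point (interior_box xN).
by rewrite -wx /green_in -gram_potential (residualP A v).2// wx.
Qed.

Lemma green_in_poisson v x : A x ->
  4 * green_in A v x = 2 * pi * (x == point v)%:R + \sum_(y <- nbr x) green_in A v y.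
Proof.
move=> Ax; have [w wx] := AP Ax; rewrite -wx /green_in potential_poisson; last first.
  by apply: AN; rewrite wx.
by rewrite residual_in ?wx// -wx (inj_eq (@point_inj N)).
Qed.

Lemma green_in_ge0 v x : 0 <= green_in A v x.
Proof.
have [Ax|Ax] := boolP (A x); last by rewrite green_in_out.
rewrite -oppr_le0; apply: (@maximum_principle _ N A (fun x => - green_in A v x)) => //.
  move=> y Ay; rewrite mulrN green_in_poisson// sumrN opprD gerDr oppr_le0.
  by rewrite mulr_ge0// mulr_ge0// pi_ge0.
by move=> y z _ _ Az; rewrite green_in_out// oppr0.
Qed.

Lemma green_in_le v x : green_in A v x <= green_in A v (point v).
Proof.
have [Ax|Ax] := boolP (A x); last by rewrite green_in_out ?green_in_ge0.
have [->//|xv] := eqVneq x (point v).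
apply: (@maximum_principle _ N (fun y => A y && (y != point v)) (green_in A v)).
- by move=> y /andP[/AN].
- by move=> y /andP[Ay /negbTE yv]; rewrite green_in_poisson// yv mulr0 add0r.
- move=> y z _ _; rewrite negb_and negbK => /orP[Az|/eqP ->//].
  by rewrite green_in_out ?green_in_ge0.
- by rewrite Ax.
Qed.

(** Pair the charges of [residual A v] with the potential of [residual A' w]: the latter vanishes
    off [A'], and on [A'], a part of [A], the former are the unit charge at [v]. *)
Lemma gram_residual_sub (A' : pred lattice) v w : (forall x, A' x -> A x) ->
  gram (residual A v) (residual A' w) = green_in A' w (point v).
Proof.
move=> AA; rewrite gramC gram_coord (bigD1 v)//= gram_residual_coord big1 => [|u uv].
  have [Av|Av] := boolP (A' (point v)); first by rewrite residual_in ?AA// eqxx mul1r addr0.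
  rewrite /green_in -gram_potential (residualP A' w).2// mulr0 addr0//.
have [Au|Au] := boolP (A' (point u)); first by rewrite residual_in ?AA// (negbTE uv) mul0r.
by rewrite (residualP A' w).2// mulr0.
Qed.

End domain.

Lemma gram_residual A v w : (forall x, A x -> interior N x) ->
  gram (residual A v) (residual A w) = green_in A v (point w).
Proof. by move=> AN; rewrite gramC gram_residual_sub. Qed.

Lemma green_in_sym A v w : (forall x, A x -> interior N x) ->
  green_in A v (point w) = green_in A w (point v).
Proof. by move=> AN; rewrite -!gram_residual// gramC. Qed.

(* In [A1] the charge of [residual A2 w] is the discrete Laplacian of a potential vanishing there. *)
Lemma gram_residual_disjoint (A1 A2 : pred lattice) v w :
  (forall x, A1 x -> interior N x) -> (forall x, A2 x -> interior N x) ->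
  (forall x, A1 x -> ~~ A2 x) -> (forall x y, A1 x -> y \in nbr x -> ~~ A2 y) ->
  gram (residual A1 v) (residual A2 w) = 0.
Proof.
move=> A1N A2N dis nadj; rewrite gram_coord big1// => u _.
have [Au|Au] := boolP (A1 (point u)); last by rewrite (residualP A1 v).2// mulr0.
have := potential_poisson (residual A2 w) (A1N _ Au).
rewrite -/(green_in A2 w _) green_in_out ?dis// mulr0 big_seq big1 ?addr0; last first.
  by move=> y yn; rewrite -/(green_in A2 w _) green_in_out// (nadj _ _ Au yn).
move/eqP; rewrite eq_sym !mulf_eq0 pnatr_eq0/= gt_eqF ?pi_gt0//= => /eqP ->.
by rewrite mul0r.
Qed.

(** The two poles cancel, so the difference is harmonic in [A'] and is bounded by its values next to
    [A'], where the second Green function vanishes. *)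
Lemma green_in_diff_le (A A' : pred lattice) v (M : R) :
  (forall x, A x -> interior N x) -> (forall x, A' x -> A x) ->
  (forall x, x = point v \/ (exists2 y, A' y & x \in nbr y) -> ~~ A' x -> green_in A v x <= M) ->
  green_in A v (point v) - green_in A' v (point v) <= M.
Proof.
move=> AN AA h; have AN' x : A' x -> interior N x by move=> /AA /AN.
have [vA|vA] := boolP (A' (point v)); last first.
  by rewrite (green_in_out v vA) subr0; apply: h => //; left.
apply: (@maximum_principle _ N A' (fun x => green_in A v x - green_in A' v x)) => //.
  move=> x Ax; rewrite mulrBr !green_in_poisson//; last exact: AA.
  by rewrite sumrB opprD addrACA subrr add0r.
move=> x y Ax yn Ay; rewrite (green_in_out v Ay) subr0; apply: h => //.
by right; exists x.
Qed.

Lemma gram_residual_diff (A A' : pred lattice) v :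
  (forall x, A x -> interior N x) -> (forall x, A' x -> A x) ->
  gram (fun i => residual A v i - residual A' v i) (fun i => residual A v i - residual A' v i) =
  green_in A v (point v) - green_in A' v (point v).
Proof.
move=> AN AA; have AN' x : A' x -> interior N x by move=> /AA /AN.
rewrite gramBl !gramBr !(gramC _ (residual A' v)) !gram_residual//.
by rewrite gram_residual_sub//; ring.
Qed.

Section lipschitz.
Variable A : pred lattice.
Hypothesis AN : forall x, A x -> interior N x.

(** In the Poisson equation at [w] the other three neighbours contribute at most three times the
    diagonal value. *)
Let resistance w y : A (point w) -> y \in nbr (point w) ->
  green_in A w (point w) - green_in A w y <= 2 * pi.
Proof.
move=> Aw yn; have := green_in_poisson AN w Aw; rewrite eqxx mulr1 (bigD1_seq y yn (nbr_uniq _))/=.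
have : \sum_(z <- nbr (point w) | z != y) green_in A w z <= 3 * green_in A w (point w).
  apply: (@le_trans _ _ (\sum_(z <- nbr (point w) | z != y) green_in A w (point w))).
    by apply: ler_sum => z _; exact: green_in_le.
  rewrite big_const_seq iter_addr addr0 mulr_natl.
  suff -> : count (fun z => z != y) (nbr (point w)) = 3%N by [].
  have := count_predC (pred1 y) (nbr (point w)).
  by rewrite count_uniq_mem ?nbr_uniq// yn /= => -[].
by lra.
Qed.

Lemma green_in_cauchy v w : green_in A v (point w) ^+ 2 <= green_in A v (point v) * green_in A w (point w).
Proof. by rewrite -!gram_residual//; exact: gram_cauchy. Qed.

(** Cauchy-Schwarz in [gram]: the variance of the difference of the residuals at two adjacent points
    is at most [4 * pi] by [resistance]. If one point lies outside [A], the diagonal value at the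
    other is itself at most [2 * pi]. *)
Lemma green_in_adjacent v x y : y \in nbr x ->
  `|green_in A v x - green_in A v y| <= Num.sqrt (4 * pi * green_in A v (point v)).
Proof.
have pi0 := @pi_ge0 R.
have v0 : 0 <= green_in A v (point v) by exact: green_in_ge0.
wlog Ax : x y / A x => [hw|] yn.
  have [Ax|Ax] := boolP (A x); first exact: hw.
  have [Ay|Ay] := boolP (A y); first by rewrite distrC; apply: hw => //; rewrite nbr_sym.
  by rewrite (green_in_out v Ax) (green_in_out v Ay) subrr normr0 sqrtr_ge0.
have [w wx] := box_point (interior_box (AN Ax)); rewrite -wx in Ax yn *.
have h1 := resistance Ax yn.
rewrite -sqrtr_sqr ler_wsqrtr//.
have [Ay|Ay] := boolP (A y); last first.
  rewrite [green_in A v y]green_in_out// subr0 (le_trans (green_in_cauchy v w))//.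
  rewrite mulrC ler_wpM2r//; move: h1; rewrite [green_in A w y]green_in_out// subr0.
  by lra.
have [u uy] := box_point (interior_box (AN Ay)); rewrite -uy in Ay yn h1 *.
have h2 : green_in A u (point u) - green_in A u (point w) <= 2 * pi.
  by apply: resistance => //; rewrite nbr_sym.
rewrite -!gram_residual// -gramBr (le_trans (gram_cauchy gv phi0 _ _))// mulrC ler_wpM2r//.
  by rewrite gram_residual.
rewrite gramBl !gramBr !gram_residual// (green_in_sym u w)//.
by move: h1 h2; rewrite (green_in_sym u w)//; lra.
Qed.

Lemma green_in_lipschitz v x (i j : nat) (s1 s2 : bool) :
  `|green_in A v x - green_in A v (x.1 + (-1) ^+ s1 * i%:Z, x.2 + (-1) ^+ s2 * j%:Z)|
    <= (i + j)%:R * Num.sqrt (4 * pi * green_in A v (point v)).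
Proof.
elim: j => [|j IH]; last first.
  rewrite addnS mulrSr mulrDl mul1r.
  rewrite (le_trans (ler_distD (green_in A v (x.1 + (-1) ^+ s1 * i%:Z, x.2 + (-1) ^+ s2 * j%:Z)) _ _))//.
  apply: lerD => //; apply: green_in_adjacent.
  rewrite /nbr !inE -!pair_eqE /= intS; case: s2 {IH}; rewrite ?expr0 ?expr1; lia.
rewrite mulr0 addr0 addn0; elim: i => [|i IH].
  by rewrite mulr0 addr0 -surjective_pairing subrr normr0 mul0r.
rewrite mulrSr mulrDl mul1r.
rewrite (le_trans (ler_distD (green_in A v (x.1 + (-1) ^+ s1 * i%:Z, x.2)) _ _))//.
apply: lerD => //; apply: green_in_adjacent.
rewrite /nbr !inE -!pair_eqE /= intS; case: s1 {IH}; rewrite ?expr0 ?expr1; lia.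
Qed.

End lipschitz.

End green_function.

(** * Logarithmic bounds for Green functions *)

Section log_kernel.
Context {R : realType}.
Implicit Types (x y : lattice) (K : nat).

Let q x : R := 1 + x.1%:~R ^+ 2 + x.2%:~R ^+ 2.

(** An explicit stand-in for the potential kernel of the walk. The 1 under the logarithm makes it 0
    at the origin and subharmonic everywhere; the unit point charge becomes the nonnegative spread
    [log_charge]. *)
Definition log_kernel x : R := ln (q x) / 2.

Definition log_charge x : R := \sum_(y <- nbr x) log_kernel y - 4 * log_kernel x.

Let q_ge1 x : 1 <= q x.
Proof. by rewrite /q -addrA lerDl addr_ge0// sqr_ge0. Qed.

Let q_gt0 x : 0 < q x. Proof. exact: lt_le_trans (q_ge1 x). Qed.

Lemma log_kernel_ge0 x : 0 <= log_kernel x.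
Proof. by rewrite divr_ge0// ln_ge0// q_ge1. Qed.

Lemma log_kernel0 : log_kernel (0, 0) = 0.
Proof. by rewrite /log_kernel /q /= expr0n/= !addr0 ln1 mul0r. Qed.

Lemma log_kernel_le x (n : nat) : `|x.1| <= n%:Z -> `|x.2| <= n%:Z -> (0 < n)%N ->
  log_kernel x <= ln (2 * n%:R).
Proof.
move=> x1 x2 n0; rewrite /log_kernel ler_pdivrMr// (mulr_natr (ln _)) -lnXn ?mulr_gt0 ?ltr0n//.
have h (z : int) : `|z| <= n%:Z -> (z%:~R : R) ^+ 2 <= n%:R ^+ 2.
  move=> zn; rewrite -real_normK ?num_real// lerXn2r ?nnegrE// -intr_norm.
  by rewrite -[leRHS]/((n%:Z)%:~R) ler_int.
have n1 : 1 <= n%:R ^+ 2 :> R by rewrite exprn_ege1// ler1n.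
rewrite ler_ln ?posrE ?exprn_gt0 ?mulr_gt0 ?ltr0n// /q exprMn.
by have := h _ x1; have := h _ x2; nra.
Qed.

Lemma log_kernel_ge x (r : R) : 0 < r -> r <= `|x.1|%:~R \/ r <= `|x.2|%:~R -> ln r <= log_kernel x.
Proof.
move=> r0 h; rewrite /log_kernel ler_pdivlMr// mulr_natr -lnXn//.
rewrite ler_ln ?posrE ?exprn_gt0// /q.
have s1 := sqr_ge0 (x.1%:~R : R); have s2 := sqr_ge0 (x.2%:~R : R).
have sq (z : int) : r <= `|z|%:~R -> r ^+ 2 <= z%:~R ^+ 2.
  by move=> rz; rewrite -[leRHS]real_normK ?num_real// -intr_norm lerXn2r ?nnegrE ?ler0z//; lra.
by case: h => /sq; lra.
Qed.

(** In exponential form: the product of [q] over the four neighbours is at least the fourth power of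
    its central value, and the difference is an explicit sum of nonnegative terms. *)
Lemma log_charge_ge0 x : 0 <= log_charge x.
Proof.
rewrite /log_charge subr_ge0 sum_nbr /log_kernel -!mulrDl mulrA ler_pM2r ?invr_gt0//.
rewrite -!lnM ?posrE ?mulr_gt0// mulr_natl -lnXn// ler_ln ?posrE ?exprn_gt0 ?mulr_gt0//.
rewrite /q /= !(intrD, intrB) /=; move: (x.1%:~R : R) (x.2%:~R : R) => a b.
have a0 := sqr_ge0 a; have b0 := sqr_ge0 b.
pose s := 1 + a ^+ 2 + b ^+ 2.
have s0 : 1 <= s by rewrite /s; lra.
rewrite -/s -subr_ge0.
have -> : (1 + (a + 1) ^+ 2 + b ^+ 2) * (1 + (a - 1) ^+ 2 + b ^+ 2) *
  (1 + a ^+ 2 + (b + 1) ^+ 2) * (1 + a ^+ 2 + (b - 1) ^+ 2) - s ^+ 4 =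
  2 * s ^+ 2 + 8 * s + 5 + 16 * (a ^+ 2 * b ^+ 2) by rewrite /s; ring.
have := mulr_ge0 a0 b0; have := sqr_ge0 s; lra.
Qed.

(** Total charge in the square of radius [K] around the origin; it tends to [2 * pi]. *)
Definition flux K : R := \sum_(i < K.*2.+1) \sum_(j < K.*2.+1) log_charge (i%:Z - K%:Z, j%:Z - K%:Z).

Let second_difference (g : int -> R) (a : int) n :
  \sum_(i < n) (g (i%:Z + a + 1) + g (i%:Z + a - 1) - 2 * g (i%:Z + a)) =
  g (n%:Z + a) - g (n%:Z + a - 1) - g a + g (a - 1).
Proof.
elim: n => [|n IH]; first by rewrite big_ord0 add0r; ring.
rewrite big_ord_recr /= IH.
rewrite (_ : n.+1%:Z + a = n%:Z + a + 1); last by rewrite intS; ring.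
by rewrite addrK; ring.
Qed.

(** Discrete divergence theorem: second differences telescope in each direction, and by symmetry the
    four sides of the square contribute equally. *)
Let fluxE K : flux K = 4 * \sum_(j < K.*2.+1)
  (log_kernel (K%:Z + 1, j%:Z - K%:Z) - log_kernel (K%:Z, j%:Z - K%:Z)).
Proof.
have lN (a b : int) : log_kernel (- a, b) = log_kernel (a, b).
  by rewrite /log_kernel /q /= intrN sqrrN.
have lC (a b : int) : log_kernel (a, b) = log_kernel (b, a).
  by rewrite /log_kernel /q /= addrAC.
pose D (j : int) := log_kernel (K%:Z + 1, j) - log_kernel (K%:Z, j).
have sd (j : int) : \sum_(i < K.*2.+1) (log_kernel (i%:Z - K%:Z + 1, j) +
    log_kernel (i%:Z - K%:Z - 1, j) - 2 * log_kernel (i%:Z - K%:Z, j)) = 2 * D j.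
  rewrite (second_difference (fun i => log_kernel (i, j))) /D.
  rewrite (_ : K.*2.+1%:Z - K%:Z = K%:Z + 1) ?addrK; last by lia.
  by rewrite lN (_ : - K%:Z - 1 = - (K%:Z + 1)) ?lN; [ring|lia].
rewrite /flux.
transitivity (\sum_(i < K.*2.+1) \sum_(j < K.*2.+1)
  ((log_kernel (i%:Z - K%:Z + 1, j%:Z - K%:Z) + log_kernel (i%:Z - K%:Z - 1, j%:Z - K%:Z)
    - 2 * log_kernel (i%:Z - K%:Z, j%:Z - K%:Z)) +
  (log_kernel (j%:Z - K%:Z + 1, i%:Z - K%:Z) + log_kernel (j%:Z - K%:Z - 1, i%:Z - K%:Z)
    - 2 * log_kernel (j%:Z - K%:Z, i%:Z - K%:Z)))).
  apply: eq_bigr => i _; apply: eq_bigr => j _; rewrite /log_charge sum_nbr /=.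
  move: (i%:Z - K%:Z) (j%:Z - K%:Z) => a b.
  by rewrite (lC a (b + 1)) (lC a (b - 1)) (lC b a); ring.
rewrite (eq_bigr (fun i : 'I_K.*2.+1 => \sum_(j < K.*2.+1)
  (log_kernel (i%:Z - K%:Z + 1, j%:Z - K%:Z) + log_kernel (i%:Z - K%:Z - 1, j%:Z - K%:Z)
    - 2 * log_kernel (i%:Z - K%:Z, j%:Z - K%:Z)) + 2 * D (i%:Z - K%:Z))); last first.
  by move=> i _; rewrite big_split/=; congr (_ + _); exact: sd.
rewrite big_split/= exchange_big/= (eq_bigr (fun j : 'I_K.*2.+1 => 2 * D (j%:Z - K%:Z))); last first.
  by move=> j _; exact: sd.
by rewrite -!mulr_sumr /D; ring.
Qed.

Let even_sum (g : int -> R) K : (forall z, g (- z) = g z) ->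
  \sum_(j < K.*2.+1) g (j%:Z - K%:Z) = g 0 + 2 * \sum_(j < K) g (j.+1%:Z).
Proof.
move=> ge; elim: K => [|K IH].
  by rewrite !big_ord_recl !big_ord0 subr0 mulr0.
rewrite doubleS big_ord_recr big_ord_recl /= [in RHS]big_ord_recr /=.
rewrite (eq_bigr (fun j : 'I_K.*2.+1 => g (j%:Z - K%:Z))); last first.
  by move=> j _; congr g; rewrite /bump /=; lia.
rewrite IH sub0r ge (_ : K.*2.+2%:Z - K.+1%:Z = K.+1%:Z); last by lia.
by ring.
Qed.

Let atan_mvt (a b : R) : 0 <= a -> a <= b ->
  (b - a) / (1 + b ^+ 2) <= atan b - atan a <= (b - a) / (1 + a ^+ 2).
Proof.
move=> a0 ab.
have [c cab ->] := @MVT_segment R atan (fun z : R => (1 + z ^+ 2)^-1) a b ab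
  (fun z _ => is_derive1_atan z) (@continuous_subspaceT _ _ _ _ (@continuous_atan R)).
move: cab; rewrite in_itv/= => /andP[ac cb]; have c0 := le_trans a0 ac.
have p (z : R) : 0 < 1 + z ^+ 2 by rewrite ltr_wpDr// sqr_ge0.
rewrite [_ * (b - a)]mulrC !ler_wpM2l ?subr_ge0// lef_pV2 ?posrE// lerD2l lerXn2r ?nnegrE//.
by rewrite (le_trans c0).
Qed.

(** Right and left Riemann sums of the derivative of [atan] on [0, 1]. *)
Let atan_sum (n : nat) : (0 < n)%N ->
  \sum_(j < n) (n%:R / (n%:R ^+ 2 + (j.+1)%:R ^+ 2) : R) <= pi / 4 <=
  \sum_(j < n) (n%:R / (n%:R ^+ 2 + j%:R ^+ 2) : R).
Proof.
move=> n0; have n0' : 0 < n%:R :> R by rewrite ltr0n.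
have -> : pi / 4 = \sum_(j < n) (atan (j.+1%:R / n%:R) - atan (j%:R / n%:R)) :> R.
  rewrite -(big_mkord xpredT (fun j => atan (j.+1%:R / n%:R) - atan (j%:R / n%:R))).
  by rewrite telescope_sumr// mul0r atan0 subr0 divff ?gt_eqF// atan1.
have h (j : nat) : n%:R / (n%:R ^+ 2 + (j.+1)%:R ^+ 2) <=
    (atan (j.+1%:R / n%:R) - atan (j%:R / n%:R) : R) <= (n%:R / (n%:R ^+ 2 + j%:R ^+ 2) : R).
  have j0 : 0 <= j%:R :> R by [].
  have := @atan_mvt (j%:R / n%:R) (j.+1%:R / n%:R).
  rewrite divr_ge0// ler_pM2r ?invr_gt0// ler_nat => /(_ isT (leqnSn _)).
  have -> : j.+1%:R / n%:R - j%:R / n%:R = n%:R^-1 :> R.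
    by rewrite -mulrBl -natr1 addrAC subrr add0r mul1r.
  have e (k : nat) : n%:R^-1 / (1 + (k%:R / n%:R) ^+ 2) = n%:R / (n%:R ^+ 2 + k%:R ^+ 2) :> R.
    have k0 := sqr_ge0 (k%:R : R).
    have kn : 0 < n%:R ^+ 2 + k%:R ^+ 2 :> R by rewrite ltr_pwDl// exprn_gt0.
    by field; rewrite !gt_eqF// addrC.
  by rewrite !e.
by apply/andP; split; apply: ler_sum => j _; case/andP: (h j).
Qed.

(** Across a side the kernel increases by about [K / (K ^ 2 + j ^ 2)] at height [j], so each of the
    four sides carries about [pi / 2] by [atan_sum]. *)
Lemma flux_bounds K : (0 < K)%N ->
  (2 - K.+1%:R^-1) * (pi - 2 / K.+1%:R) / (1 + K.+1%:R ^- 2) <= flux K <=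
  (2 + K%:R^-1) * (pi + 2 / K%:R).
Proof.
move=> K0; have K0' : 0 < K%:R :> R by rewrite ltr0n.
have dE (j : int) : log_kernel (K%:Z + 1, j) - log_kernel (K%:Z, j) =
    ln (1 + (2 * K%:R + 1) / (1 + K%:R ^+ 2 + j%:~R ^+ 2)) / 2.
  have p : 0 < 1 + K%:R ^+ 2 + j%:~R ^+ 2 :> R := q_gt0 (K%:Z, j).
  rewrite /log_kernel -mulrBl -ln_div ?posrE// /q /= intrD /=; congr (ln _ / 2).
  by field; rewrite gt_eqF.
rewrite fluxE.
pose g (j : int) : R := log_kernel (K%:Z + 1, j) - log_kernel (K%:Z, j).
rewrite (eq_bigr (fun j : 'I_K.*2.+1 => g (j%:Z - K%:Z)))// even_sum; last first.
  by move=> z; rewrite /g !dE intrN sqrrN.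
have up (j : int) : g j <= (2 * K%:R + 1) / (2 * K%:R) * (K%:R / (K%:R ^+ 2 + j%:~R ^+ 2)).
  rewrite /g dE; have j0 := sqr_ge0 (j%:~R : R).
  have p : 0 < K%:R ^+ 2 + j%:~R ^+ 2 :> R by rewrite ltr_pwDl// exprn_gt0.
  have -> : (2 * K%:R + 1) / (2 * K%:R) * (K%:R / (K%:R ^+ 2 + j%:~R ^+ 2)) =
     (2 * K%:R + 1) / (K%:R ^+ 2 + j%:~R ^+ 2) / 2 :> R.
    by field; rewrite !gt_eqF.
  rewrite ler_pM2r ?invr_gt0// (le_trans (le_ln1Dx _))//.
    by apply: (lt_le_trans (ltrN10 _)); apply: divr_ge0; [lra|exact: ltW (q_gt0 (K%:Z, j))].
  by apply: ler_wpM2l; [lra|rewrite lef_pV2 ?posrE//; lra].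
have [n nd] : exists n : R, n = K.+1%:R by exists K.+1%:R.
have q2 : 0 < n ^+ 2 + 1 by rewrite ltr_wpDl ?sqr_ge0.
rewrite -nd; have nE : n = K%:R + 1 by rewrite nd -natr1.
have n1 : 1 < n by rewrite nE ltrDr.
have lo (j : int) : (2 * n - 1) / (2 * n) / (1 + n ^- 2) * (n / (n ^+ 2 + j%:~R ^+ 2)) <= g j.
  rewrite /g dE; have j0 := sqr_ge0 (j%:~R : R).
  have p : 0 < n ^+ 2 + j%:~R ^+ 2 :> R by rewrite ltr_pwDl// exprn_gt0// (lt_trans _ n1).
  set b := 1 + K%:R ^+ 2 + j%:~R ^+ 2; have b0 : 0 < b := q_gt0 (K%:Z, j).
  have bn : b + (2 * K%:R + 1) = 1 + n ^+ 2 + j%:~R ^+ 2 by rewrite /b nE; ring.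
  have n0 : 0 < n by lra.
  have bn0 : 0 < b + (2 * K%:R + 1) by rewrite bn; lra.
  have -> : (2 * n - 1) / (2 * n) / (1 + n ^- 2) * (n / (n ^+ 2 + j%:~R ^+ 2)) =
     (2 * K%:R + 1) / ((1 + n ^- 2) * (n ^+ 2 + j%:~R ^+ 2)) / 2.
    have -> : 2 * n - 1 = 2 * K%:R + 1 by rewrite nE; ring.
    field; rewrite !gt_eqF ?exprn_gt0//.
  rewrite ler_pM2r ?invr_gt0//.
  (* A lower bound for the logarithm from the upper one: [ln (1 + a / b) = - ln (1 - a / (a + b)) >=
     a / (a + b)]. *)
  have -> : 1 + (2 * K%:R + 1) / b = (1 - (2 * K%:R + 1) / (b + (2 * K%:R + 1)))^-1.
    by field; rewrite !gt_eqF//; lra.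
  rewrite lnV ?posrE; last first.
    by rewrite subr_gt0 ltr_pdivrMr// mul1r ltrDr.
  rewrite lerNr (le_trans (le_ln1Dx _))//.
    by rewrite ltrN2 ltr_pdivrMr// mul1r ltrDr.
  rewrite lerN2; apply: ler_wpM2l; first by lra.
  rewrite lef_pV2 ?posrE//; last by rewrite mulr_gt0// addr_gt0// invr_gt0 exprn_gt0.
  have : 0 <= n ^- 2 * j%:~R ^+ 2 by rewrite mulr_ge0// invr_ge0 exprn_ge0 ?ltW.
  by rewrite bn mulrDl mul1r mulrDr mulVf ?gt_eqF ?exprn_gt0//; lra.
apply/andP; split.
  have /andP[_] := atan_sum (ltn0Sn K); rewrite big_ord_recl /= -nd expr0n addr0.
  rewrite (eq_bigr (fun i : 'I_K => n / (n ^+ 2 + (i.+1%:Z)%:~R ^+ 2)))//.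
  set s := \sum_(i < K) _ => hs.
  have gs : (2 * n - 1) / (2 * n) / (1 + n ^- 2) * s <= \sum_(j < K) g j.+1%:Z.
    by rewrite /s mulr_sumr; apply: ler_sum => j _; exact: lo.
  have := lo 0; rewrite expr0n addr0 => g0.
  have n0 : 0 < n by lra.
  set c := (2 * n - 1) / (2 * n) / (1 + n ^- 2) in gs g0.
  have c0 : 0 <= c.
    apply: divr_ge0; first by apply: divr_ge0; lra.
    by rewrite addr_ge0// invr_ge0 exprn_ge0// ltW.
  have -> : (2 - n^-1) * (pi - 2 / n) / (1 + n ^- 2) = 2 * c * (pi - 2 / n).
    rewrite /c; field; rewrite !gt_eqF ?addr_gt0 ?exprn_gt0//.
  have e : n / n ^+ 2 = n^-1 by field; rewrite gt_eqF.
  rewrite e in hs g0.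
  have : c * (pi / 4) <= c * (n^-1 + s) by rewrite ler_wpM2l.
  lra.
have /andP[+ _] := atan_sum K0.
rewrite (eq_bigr (fun i : 'I_K => K%:R / (K%:R ^+ 2 + (i.+1%:Z)%:~R ^+ 2)))//.
set s := \sum_(i < K) _ => hs.
set c := (2 * K%:R + 1) / (2 * K%:R) in up.
have gs : \sum_(j < K) g j.+1%:Z <= c * s.
  by rewrite /s mulr_sumr; apply: ler_sum => j _; exact: up.
have := up 0; rewrite expr0n addr0 => g0.
have c0 : 0 <= c by rewrite /c divr_ge0 ?addr_ge0 ?mulr_ge0 ?ltW.
have -> : (2 + K%:R^-1) * (pi + 2 / K%:R) = 2 * c * (pi + 2 / K%:R).
  by rewrite /c; field; rewrite gt_eqF.
have e : K%:R / K%:R ^+ 2 = K%:R^-1 :> R by field; rewrite gt_eqF.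
rewrite e in g0.
have : c * s <= c * (pi / 4) by rewrite ler_wpM2l.
lra.
Qed.

Lemma flux_approx (e : R) : 0 < e -> exists K, 2 * pi * (1 - e) <= flux K.
Proof.
(* With [u = 1 / (K + 1)], the constant 16 is a crude choice for which [(2 - u) * (pi - 2 * u) >= 2
   * pi * (1 - 16 * u) * (1 + u ^ 2)] when [u <= 1 / 2]. *)
move=> e0; exists (Num.truncn (16 / e)).+1.
have /andP[+ _] := @flux_bounds (Num.truncn (16 / e)).+1 isT; apply: le_trans.
set n : R := (Num.truncn (16 / e)).+2%:R.
have hn : 16 / e < n.
  apply: (lt_le_trans (truncnS_gt _)); by rewrite /n ler_nat leqnSn.
have n0 : 0 < n by rewrite (lt_trans _ hn)// divr_gt0.
have n2 : 2 <= n by rewrite /n ler_nat.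
have ne : 16 / n <= e by rewrite ler_pdivrMr// mulrC -ler_pdivrMr// ltW.
have pi2 := @pi_ge2 R.
have pi4 : pi <= 4 :> R by have := pihalf_lt2 R; lra.
rewrite ler_pdivlMr; last by rewrite addr_gt0// invr_gt0 exprn_gt0.
set u := n^-1 in ne *; have u0 : 0 < u by rewrite invr_gt0.
have u1 : u <= 2^-1 by rewrite /u lef_pV2 ?posrE.
have -> : n ^- 2 = u ^+ 2 by rewrite exprVn.
have [e1|e1] := leP 1 e.
  rewrite (@le_trans _ _ 0)//.
    rewrite pmulr_lle0 ?ltr_wpDr ?sqr_ge0// pmulr_rle0; [lra|].
    by rewrite mulr_gt0//; lra.
  by rewrite mulr_ge0//; lra.
apply: (@le_trans _ _ (2 * pi * (1 - 16 * u) * (1 + u ^+ 2))).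
  rewrite ler_wpM2r ?addr_ge0 ?sqr_ge0// ler_wpM2l; [by []|by rewrite mulr_ge0//; lra|lra].
have h1 : 0 <= pi * u by rewrite mulr_ge0//; lra.
have h2 : pi * u ^+ 2 <= pi * u * 2^-1 by rewrite expr2 mulrA ler_wpM2l.
have h3 : 0 <= pi * u ^+ 2 * u by rewrite !mulr_ge0// ?sqr_ge0//; lra.
have h4 : 2 * u <= pi * u by rewrite ler_wpM2r//; lra.
have h5 : 0 <= u ^+ 2 by exact: sqr_ge0.
have -> : 2 * pi * (1 - 16 * u) * (1 + u ^+ 2) = 2 * pi - 32 * (pi * u) + 2 * (pi * u ^+ 2) - 32 * (pi * u ^+ 2 * u) by ring.
have -> : (2 - u) * (pi - 2 * u) = 2 * pi - 4 * u - pi * u + 2 * u ^+ 2 by ring.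
lra.
Qed.

End log_kernel.

Definition lattice_sub (x y : lattice) : lattice := (x.1 - y.1, x.2 - y.2).

Lemma sum_nbr_sub (R : realType) (f : lattice -> R) x y :
  \sum_(z <- nbr x) f (lattice_sub z y) = \sum_(z <- nbr (lattice_sub x y)) f z.
Proof.
rewrite !sum_nbr /lattice_sub /=.
by congr (f _ + f _ + f _ + f _); congr (_, _); ring.
Qed.

Lemma sum_box_le (R : realType) N (f : lattice -> R) (v : box N) : (forall x, 0 <= f x) ->
  \sum_(w : box N) f (lattice_sub (point w) (point v)) <=
  \sum_(i < N.*2.+1) \sum_(j < N.*2.+1) f (i%:Z - N%:Z, j%:Z - N%:Z).
Proof.
move=> f0.
have h (g : int -> R) (c : 'I_N.+1) : (forall z, 0 <= g z) ->
    \sum_(a < N.+1) g (a%:Z - c%:Z) <= \sum_(i < N.*2.+1) g (i%:Z - N%:Z).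
  move=> g0; have cN : (c <= N)%N by rewrite -ltnS.
  rewrite -(big_mkord xpredT (fun i => g (i%:Z - N%:Z))).
  rewrite (@big_cat_nat _ _ _ (N - c))//=; last by lia.
  rewrite ler_wpDl ?sumr_ge0//.
  rewrite (@big_cat_nat _ _ _ (N.+1 + (N - c)) (N - c))//=; [|lia|lia].
  rewrite ler_wpDr ?sumr_ge0// -{1}(add0n (N - c)%N) big_addn addnK big_mkord.
  apply: ler_sum => a _; rewrite le_eqVlt; apply/orP; left; apply/eqP; congr g; lia.
rewrite -(pair_bigA _ (fun a b : 'I_N.+1 => f (a%:Z - v.1%:Z, b%:Z - v.2%:Z)))/=.
apply: (@le_trans _ _ (\sum_(a < N.+1) \sum_(j < N.*2.+1) f (a%:Z - v.1%:Z, j%:Z - N%:Z))).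
  by apply: ler_sum => a _; apply: (h (fun z => f (a%:Z - v.1%:Z, z))).
rewrite exchange_big [leRHS]exchange_big /=; apply: ler_sum => j _.
exact: (h (fun z => f (z, j%:Z - N%:Z))).
Qed.

(** Absorbs the Lipschitz error of a smeared charge, of order the square root of a Green value [g],
    into a small multiple of [g] and a constant. *)
Lemma sqrt_young (R : realType) (a e q g : R) : 0 < e -> 0 < q -> 0 <= g ->
  2 * a * Num.sqrt (4 * q * g) <= e * g + 4 * q * a ^+ 2 / e.
Proof.
move=> e0 q0 g0; set s := Num.sqrt _.
have ss : s ^+ 2 = 4 * q * g by rewrite sqr_sqrtr// !mulr_ge0// ltW.
have -> : g = s ^+ 2 / (4 * q) by rewrite ss; field; rewrite gt_eqF.
rewrite -subr_ge0.
have -> : e * (s ^+ 2 / (4 * q)) + 4 * q * a ^+ 2 / e - 2 * a * s =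
   (e * s - 4 * q * a) ^+ 2 / (4 * q * e).
  by field; rewrite !gt_eqF.
by rewrite divr_ge0 ?sqr_ge0// !mulr_ge0// ltW.
Qed.

(** * Comparison of Green functions with the logarithmic kernel *)

Section green_bounds.
Context {R : realType} dW (TW : measurableType dW).
Variables (PW : lattice -> probability TW R) (W : nat -> TW -> lattice).
Hypothesis hW : forall u, simple_random_walk (PW u) u W.
Context d (T : measurableType d) (P : probability T R).
Variables (N : nat) (phi : box N -> {RV P >-> R}).
Hypothesis hphi : GFF PW W phi.

Variable A : pred lattice.
Hypothesis AN : forall x, A x -> interior N x.
Local Notation G := (green_in phi A).
Implicit Types (v w c : box N) (x y : lattice).

Let out v x : ~~ A x -> G v x = 0.
Proof. exact: (green_in_out hW hphi). Qed.

Let ge0 v x : 0 <= G v x.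
Proof. exact: (green_in_ge0 hW hphi AN). Qed.

Let sym v w : G v (point w) = G w (point v).
Proof. exact: (green_in_sym hphi). Qed.

Let AP x : A x -> exists w, point w = x.
Proof. by move=> /AN /interior_box /box_point. Qed.

Let log_poisson (c : R) v x :
  4 * (c - log_kernel (lattice_sub x (point v))) =
  log_charge (lattice_sub x (point v)) + \sum_(y <- nbr x) (c - log_kernel (lattice_sub y (point v))).
Proof.
have -> : \sum_(y <- nbr x) (c - log_kernel (lattice_sub y (point v))) =
    4 * c - \sum_(y <- nbr (lattice_sub x (point v))) log_kernel y.
  by rewrite sumrB -(@sum_nbr_sub R); congr (_ - _); rewrite sum_nbr; ring.
by rewrite /log_charge; ring.
Qed.

(** [2 * pi * F] and the sum of the [k w * G w] solve the same Poisson equation in [A], and off [A]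
    the first is at most 0 while the second vanishes. At [v] the second is at most [flux N * G v v],
    since by symmetry the diagonal value dominates each [G w v]. *)
Lemma green_in_lower v (r : R) : 0 < r ->
  (forall x, `|x.1 - (point v).1|%:~R < r -> `|x.2 - (point v).2|%:~R < r -> A x) ->
  2 * pi * ln r <= flux N * G v (point v).
Proof.
move=> r0 rA.
pose k w := log_charge (lattice_sub (point w) (point v)) : R.
pose F x := ln r - log_kernel (lattice_sub x (point v)) : R.
pose f x := 2 * pi * F x - \sum_w k w * G w x.
have vv : lattice_sub (point v) (point v) = (0, 0) by rewrite /lattice_sub !subrr.
have Av : A (point v) by apply: rA; rewrite subrr normr0.
have : f (point v) <= 0.
  apply: (@maximum_principle R N A f) => //.
    move=> x Ax; have [w0 wx] := AP Ax.
    have -> : \sum_(y <- nbr x) f y = 2 * pi * \sum_(y <- nbr x) F y -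
        \sum_w k w * \sum_(y <- nbr x) G w y.
      rewrite /f sumrB -mulr_sumr; congr (_ - _).
      by rewrite exchange_big/=; apply: eq_bigr => w _; rewrite mulr_sumr.
    rewrite /f mulrBr mulrCA log_poisson mulr_sumr.
    have -> : \sum_w 4 * (k w * G w x) = 2 * pi * k w0 + \sum_w k w * \sum_(y <- nbr x) G w y.
      rewrite (eq_bigr (fun w => k w * (2 * pi * (x == point w)%:R) + k w * \sum_(y <- nbr x) G w y)).
        rewrite big_split/=; congr (_ + _); rewrite (bigD1 w0)//= -wx eqxx mulr1 big1 ?addr0 1?mulrC//.
        by move=> w ww; rewrite (inj_eq (@point_inj N)) eq_sym (negbTE ww) !mulr0.
      by move=> w _; rewrite mulrCA (green_in_poisson hW hphi AN)// mulrDr.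
    rewrite /k wx -/(F _) mulrDr opprD addrACA subrr add0r /F.
    by [].
  move=> x y _ _ Ay; rewrite /f big1 ?subr0 => [|w _]; last by rewrite out ?mulr0.
  rewrite pmulr_rle0 ?mulr_gt0 ?pi_gt0// subr_le0; apply: log_kernel_ge => //=.
  have [h1|h1] := ltP `|y.1 - (point v).1|%:~R r; last by left.
  have [h2|h2] := ltP `|y.2 - (point v).2|%:~R r; last by right.
  by move: Ay; rewrite rA.
rewrite /f /F vv log_kernel0 subr0 subr_le0 => /le_trans; apply.
apply: (@le_trans _ _ (\sum_w k w * G v (point v))).
  apply: ler_sum => w _; rewrite sym ler_wpM2l ?log_charge_ge0//.
  exact: (green_in_le hW hphi AN).
by rewrite -mulr_suml ler_wpM2r//; apply: sum_box_le => x; exact: log_charge_ge0.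
Qed.

Section upper.
Variables (v : box N) (rho : nat).
Hypothesis Arho : forall x, A x -> `|x.1 - (point v).1| <= rho%:Z /\ `|x.2 - (point v).2| <= rho%:Z.

Let F x : R := ln (2 * rho.+1%:R) - log_kernel (lattice_sub x (point v)).

Let F_ge0 x y : A x -> y \in nbr x -> 0 <= F y.
Proof.
move=> /Arho/=[h1 h2]; rewrite /nbr !inE => yn; rewrite /F subr_ge0 log_kernel_le//=.
  by case/or4P: yn => /eqP -> /=; lia.
by case/or4P: yn => /eqP -> /=; lia.
Qed.

(** Only the charges of radius [K] around [v] are kept; the omitted ones are nonnegative, which
    gives an upper bound for the potential [w] of the smeared charge. Moving each kept charge back
    to [v] costs the Lipschitz term. *)
Lemma green_in_smeared K c : A (point c) ->
  flux K * (G v (point c) - 2 * K%:R * Num.sqrt (4 * pi * G c (point c))) <= 2 * pi * F (point c).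
Proof.
move=> Ac.
pose k (p : 'I_K.*2.+1 * 'I_K.*2.+1) : R := log_charge (p.1%:Z - K%:Z, p.2%:Z - K%:Z).
pose z (p : 'I_K.*2.+1 * 'I_K.*2.+1) : lattice :=
  ((point v).1 + (p.1%:Z - K%:Z), (point v).2 + (p.2%:Z - K%:Z)).
(* Some of the smeared sources may lie outside the box; [H] is 0 for them. *)
pose H y x := \sum_(b | point b == y) G b x.
have HP y x : A x -> 4 * H y x = 2 * pi * (x == y)%:R + \sum_(t <- nbr x) H y t.
  move=> Ax; rewrite /H [in RHS]exchange_big mulr_sumr /=.
  rewrite (eq_bigr (fun b => 2 * pi * (x == point b)%:R + \sum_(t <- nbr x) G b t)); last first.
    by move=> b _; rewrite (green_in_poisson hW hphi AN).
  rewrite big_split/=; congr (_ + _); rewrite -mulr_sumr; congr (_ * _).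
  have [w wx] := AP Ax.
  have [<-|xy] := eqVneq x y; last by rewrite big1// => b /eqP ->; rewrite (negbTE xy).
  rewrite (big_pred1 w) ?wx ?eqxx// => b /=; by rewrite -wx (inj_eq (@point_inj N)).
pose w x := \sum_p k p * H (z p) x.
have wF : w (point c) - 2 * pi * F (point c) <= 0.
  apply: (@maximum_principle R N A (fun x => w x - 2 * pi * F x)) => //.
    move=> x Ax; rewrite sumrB mulrBr (mulrCA 4) log_poisson -mulr_sumr mulrDr opprD addrA.
    rewrite lerD2r lerBlDr /w mulr_sumr [in leRHS]exchange_big/=.
    rewrite (eq_bigr (fun p => 2 * pi * (k p * (x == z p)%:R) + \sum_(y <- nbr x) k p * H (z p) y)); last first.
      by move=> p _; rewrite mulrCA HP// mulrDr mulr_sumr; congr (_ + _); ring.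
    rewrite big_split/= addrC lerD2l -mulr_sumr ler_pM2l ?mulr_gt0 ?pi_gt0//.
    have [p xp|np] := pickP (fun p => x == z p); last first.
      by rewrite big1 ?log_charge_ge0// => p _; rewrite np mulr0.
    rewrite (bigD1 p)//= xp mulr1 big1 ?addr0 => [|p' pp].
      rewrite /k (eqP xp) /lattice_sub /z /=.
      by rewrite !(addrC (_ + _) (- _)) !addKr.
    case: eqP => [|_]; last by rewrite mulr0.
    rewrite (eqP xp) /z => -[] h1 h2.
    have e1 : p.1 = p'.1 by apply: val_inj => /=; lia.
    have e2 : p.2 = p'.2 by apply: val_inj => /=; lia.
    by move: pp; rewrite (surjective_pairing p) (surjective_pairing p') e1 e2 eqxx.
  move=> x y Ax yn Ay; rewrite /w big1 ?sub0r => [|p _]; last first.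
    by rewrite /H big1 ?mulr0// => b _; rewrite out.
  by rewrite oppr_le0 mulr_ge0 ?(F_ge0 Ax yn)// mulr_ge0// pi_ge0.
rewrite -subr_le0 (le_trans _ wF)// lerB// /w.
have -> : flux K = \sum_p k p by rewrite /flux pair_bigA.
rewrite mulr_suml; apply: ler_sum => p _; rewrite ler_wpM2l ?log_charge_ge0//.
have -> : H (z p) (point c) = G c (z p).
  rewrite /H; have [/existsP[b /eqP bz]|/existsPn nb] := boolP [exists b : box N, point b == z p].
    rewrite -bz (big_pred1 b) => [|b' /=]; [exact: sym|exact: (inj_eq (@point_inj N))].
  rewrite big_pred0 => [|b]; last exact/negbTE/nb.
  by rewrite out//; apply/negP => /AP[b bz]; have := nb b; rewrite bz eqxx.
rewrite sym lerBlDl -lerBlDr.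
have sgn (i : 'I_K.*2.+1) : exists (s : bool) (j : nat), (j <= K)%N /\ i%:Z - K%:Z = (-1) ^+ s * j%:Z.
  have iK : (i <= K.*2)%N by rewrite -ltnS.
  have [h|h] := leqP K i; [exists false, (i - K)%N|exists true, (K - i)%N];
  by rewrite ?expr0 ?expr1; lia.
have [s1 [j1 [j1K e1]]] := sgn p.1; have [s2 [j2 [j2K e2]]] := sgn p.2.
have := green_in_lipschitz hW hphi AN c (point v) j1 j2 s1 s2.
rewrite -e1 -e2 -/(z p) => h.
apply: (le_trans (le_trans (ler_norm _) h)).
by rewrite ler_wpM2r ?sqrtr_ge0// -natrM ler_nat; lia.
Qed.

End upper.

(** The Lipschitz error involves the diagonal value at the target point [c]. That value is bounded
    first ([diag]), by the same inequality with the pole at the target itself, where the error can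
    be absorbed. *)
Lemma green_in_upper v (rho : nat) K (e : R) : 0 < e -> e <= 2^-1 ->
  2 * pi * (1 - e) <= flux K -> (rho <= N)%N -> (0 < N)%N ->
  (forall x, A x -> `|x.1 - (point v).1| <= rho%:Z /\ `|x.2 - (point v).2| <= rho%:Z) ->
  forall x, A x -> G v x <= ln (2 * rho.+1%:R) - log_kernel (lattice_sub x (point v)) +
    6 * e * ln (6 * N%:R) + 8 * pi * K%:R ^+ 2 / e.
Proof.
move=> e0 e1 fK rN N0 Arho x Ax.
have n1 : (2 * rho.+1 <= 6 * N)%N by clear -rN N0; lia.
have n2 : (2 * rho.*2.+1 <= 6 * N)%N by clear -rN N0; lia.
have [c cx] := AP Ax; rewrite -cx in Ax *.
have pi0 := @pi_gt0 R.
have smear (g : R) (g0 : 0 <= g) := @sqrt_young _ K%:R e _ g e0 pi0 g0.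
set C := 4 * pi * K%:R ^+ 2 / e in smear.
have C0 : 0 <= C.
  by apply: divr_ge0; [rewrite mulr_ge0 ?sqr_ge0// mulr_ge0// ltW|exact: ltW].
have unsmear (F' z : R) : 0 <= F' -> flux K * z <= 2 * pi * F' -> (1 - e) * z <= F'.
  move=> F0 h; have [z0|z0] := leP z 0.
    by rewrite (le_trans _ F0)// mulr_ge0_le0//; lra.
  have : 2 * pi * (1 - e) * z <= flux K * z by rewrite ler_wpM2r// ltW.
  move=> /le_trans/(_ h); rewrite -!mulrA.
  by rewrite !ler_pM2l.
have diag w (r : nat) : A (point w) ->
    (forall x, A x -> `|x.1 - (point w).1| <= r%:Z /\ `|x.2 - (point w).2| <= r%:Z) ->
    G w (point w) <= 4 * ln (2 * r.+1%:R) + 2 * C.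
  move=> Aw Ar; have := green_in_smeared Ar K Aw.
  have -> : lattice_sub (point w) (point w) = (0, 0) by rewrite /lattice_sub !subrr.
  have l0 : 0 <= ln (2 * r.+1%:R) :> R.
    by rewrite ln_ge0// -natrM ler1n.
  rewrite log_kernel0 subr0 => /(unsmear _ _ l0).
  have := smear _ (ge0 w (point w)); set g := G w (point w).
  set t := 2 * K%:R * _ => tg.
  have g0 : 0 <= g by exact: ge0.
  move: tg l0 g0; move: (ln _) t => l t; move: g => g tg l0 g0 h.
  have zl : g - t <= 2 * l.
    have [z0|z0] := leP (g - t) 0; first by rewrite (le_trans z0)// mulr_ge0.
    have : 2^-1 * (g - t) <= (1 - e) * (g - t) by rewrite ler_wpM2r//; lra.
    lra.
  have : 2^-1 * g <= (1 - e) * g by rewrite ler_wpM2r//; lra.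
  lra.
have [cv1 cv2] := Arho _ Ax.
(* [A] lies within [rho] of [v], hence within twice [rho] of [c]. *)
have cc : G c (point c) <= 4 * ln (2 * rho.*2.+1%:R) + 2 * C.
  by apply: diag => // y /Arho [h1 h2]; lia.
have := green_in_smeared Arho K Ax.
set lR := ln (2 * rho.+1%:R); set l := log_kernel _.
have l0 : 0 <= l by exact: log_kernel_ge0.
have F0 : 0 <= lR - l.
  by rewrite subr_ge0 /l /lR log_kernel_le//=; move: cv1 cv2 => /= *; lia.
move=> /(unsmear _ _ F0).
have := smear _ (ge0 c (point c)).
set t := 2 * K%:R * _ => tg hz.
have r1 : lR <= ln (6 * N%:R).
  by rewrite /lR ler_ln ?posrE ?mulr_gt0 ?ltr0n// -!natrM ler_nat.
have r2 : ln (2 * rho.*2.+1%:R) <= ln (6 * N%:R) :> R.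
  by rewrite ler_ln ?posrE ?mulr_gt0 ?ltr0n// -!natrM ler_nat.
have hz2 : G v (point c) - t <= (lR - l) + 2 * e * (lR - l).
  have [z0|z0] := leP (G v (point c) - t) 0.
    by rewrite (le_trans z0)// addr_ge0// mulr_ge0// mulr_ge0// ltW.
  have := F0; move: hz z0; move: (lR - l) (G v (point c) - t) => f z hz z0 f0.
  have : (1 + 2 * e) * ((1 - e) * z) <= (1 + 2 * e) * f by rewrite ler_wpM2l//; lra.
  have : 0 <= e * (1 - 2 * e) * z by rewrite !mulr_ge0//; lra.
  lra.
have -> : 8 * pi * K%:R ^+ 2 / e = 2 * C by rewrite /C !mulrA; congr (_ * _ * _ / _); ring.
have h1 : e * G c (point c) <= 2^-1 * (2 * C) + e * (4 * ln (6 * N%:R)).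
  rewrite (le_trans (ler_wpM2l (ltW e0) cc))// mulrDr addrC lerD//.
    by rewrite ler_wpM2r// mulr_ge0.
  by rewrite ler_wpM2l ?(ltW e0)// ler_wpM2l.
have h2 : e * (lR - l) <= e * ln (6 * N%:R) by rewrite ler_wpM2l ?(ltW e0)//; lra.
lra.
Qed.

End green_bounds.

(** * Oscillation of the Green function *)

Section frame.
Variables (swap neg : bool) (a b : int).

(** Coordinates adapted to a side of the box or to an axis of reflection: [frame_s] is the signed
    distance to that line and [frame_t] runs along it. The flags cover all four directions at
    once. *)
Definition frame_s (x : lattice) : int := (-1) ^+ neg * ((if swap then x.2 else x.1) - a).
Definition frame_t (x : lattice) : int := (if swap then x.1 else x.2) - b.

Definition reflection (x : lattice) : lattice :=
  if swap then (x.1, 2 * a - x.2) else (2 * a - x.1, x.2).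

Lemma reflectionK x : reflection (reflection x) = x.
Proof. by case: x => x1 x2; rewrite /reflection; case: swap => /=; congr (_, _); ring. Qed.

Lemma frame_s_reflection x : frame_s (reflection x) = - frame_s x.
Proof. by rewrite /frame_s /reflection; case: swap => /=; ring. Qed.

Lemma frame_t_reflection x : frame_t (reflection x) = frame_t x.
Proof. by rewrite /frame_t /reflection; case: swap. Qed.

Lemma frame_nbr x y : y \in nbr x ->
  (frame_t y = frame_t x /\ (frame_s y = frame_s x + 1 \/ frame_s y = frame_s x - 1)) \/
  (frame_s y = frame_s x /\ (frame_t y = frame_t x + 1 \/ frame_t y = frame_t x - 1)).
Proof.
rewrite /nbr !inE /frame_s /frame_t.
by case/or4P => /eqP ->; case: swap => /=; case: neg; rewrite ?expr0 ?expr1 /=; lia.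
Qed.

Lemma sum_nbr_reflection (R : realType) (f : lattice -> R) x :
  \sum_(y <- nbr x) f (reflection y) = \sum_(y <- nbr (reflection x)) f y.
Proof.
rewrite !sum_nbr /reflection; case: swap => /=.
  have -> : 2 * a - (x.2 + 1) = 2 * a - x.2 - 1 by ring.
  have -> : 2 * a - (x.2 - 1) = 2 * a - x.2 + 1 by ring.
  by ring.
have -> : 2 * a - (x.1 + 1) = 2 * a - x.1 - 1 by ring.
have -> : 2 * a - (x.1 - 1) = 2 * a - x.1 + 1 by ring.
by ring.
Qed.

Variables (R : realType) (rho : nat).

(** Discrete harmonic since [s ^ 2] and [t ^ 2] have equal Laplacians. For [0 <= s <= rho] it is
    nonnegative, and it is at least [rho ^ 2] where [s = rho] or [|t| >= rho]; on the axis [t = 0]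
    it is only of order [rho * s]. *)
Definition barrier x : R :=
  2 * rho%:R * (frame_s x)%:~R - (frame_s x)%:~R ^+ 2 + (frame_t x)%:~R ^+ 2.

Lemma barrier_harmonic x : \sum_(y <- nbr x) barrier y = 4 * barrier x.
Proof.
rewrite sum_nbr /barrier /frame_s /frame_t.
case: swap; case: neg; rewrite /= ?expr0 ?expr1 ?mul1r ?mulN1r !(intrN, intrD, intrB) /=;
move: (x.1%:~R : R) (x.2%:~R : R) (a%:~R : R) (b%:~R : R) => x1 x2 ra rb; ring.
Qed.

Lemma barrier_bound N (A : pred lattice) (g : lattice -> R) (M : R) : (0 < rho)%N -> 0 <= M ->
  (forall x, A x -> interior N x) ->
  (forall x, A x -> 4 * g x = \sum_(y <- nbr x) g y) ->
  (forall x y, A x -> y \in nbr x -> ~~ A y -> 0 <= frame_s y <= rho%:Z /\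
    (g y <= 0 \/ (g y <= M /\ (frame_s y = rho%:Z \/ rho%:Z <= `|frame_t y|)))) ->
  forall x, A x -> rho%:R ^+ 2 * g x <= M * barrier x.
Proof.
move=> r0 M0 AN gh bd x Ax; rewrite -subr_le0.
apply: (@maximum_principle R N A (fun x => rho%:R ^+ 2 * g x - M * barrier x)) Ax => //.
  move=> {}x Ax; rewrite sumrB -!mulr_sumr barrier_harmonic -gh//.
  by rewrite le_eqVlt; apply/orP; left; apply/eqP; ring.
move=> {}x y Ax yn Ay; rewrite subr_le0; have [/andP[s0 s1] h] := bd _ _ Ax yn Ay.
have s0' : 0 <= (frame_s y)%:~R :> R by rewrite ler0z.
have s1' : (frame_s y)%:~R <= rho%:R :> R by rewrite -[leRHS]/((rho%:Z)%:~R) ler_int.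
have t2 := sqr_ge0 ((frame_t y)%:~R : R).
have b0 : 0 <= barrier y.
  rewrite /barrier addr_ge0// (_ : _ - _ = (frame_s y)%:~R * (2 * rho%:R - (frame_s y)%:~R)); last by ring.
  by rewrite mulr_ge0//; lra.
case: h => [g0|[gM h]].
  by rewrite (@le_trans _ _ 0) ?mulr_ge0// mulr_ge0_le0// sqr_ge0.
rewrite (@le_trans _ _ (rho%:R ^+ 2 * M))//; first by rewrite ler_wpM2l// sqr_ge0.
rewrite mulrC ler_wpM2l//; case: h => [sr|tr].
  by rewrite /barrier sr -[(rho%:Z)%:~R]/(rho%:R : R); lra.
have : (rho%:R : R) ^+ 2 <= (frame_t y)%:~R ^+ 2.
  rewrite -[leRHS]real_normK ?num_real// -intr_norm lerXn2r ?nnegrE ?ler0z//.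
  by rewrite -[leLHS]/((rho%:Z)%:~R) ler_int.
rewrite /barrier; have : 0 <= (frame_s y)%:~R * (2 * rho%:R - (frame_s y)%:~R) :> R by rewrite mulr_ge0//; lra.
by lra.
Qed.

End frame.

Section oscillation.
Context {R : realType} (N : nat).
Implicit Types (D A : pred lattice) (x y : lattice).

Variables (D : pred lattice) (g : lattice -> R) (M : R).
Hypothesis DN : forall x, D x -> interior N x.
Hypothesis gD : forall x, D x -> 4 * g x = \sum_(y <- nbr x) g y.
Hypothesis g0 : forall x, ~~ interior N x -> g x = 0.
Hypothesis gM : forall x, `|g x| <= M.

Let M0 : 0 <= M. Proof. exact: le_trans (gM (0, 0)). Qed.

Let one_side swap neg a b (rho : nat) (f : lattice -> R) x :
  (forall y, D y -> 4 * f y = \sum_(z <- nbr y) f z) ->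
  (forall y, ~~ interior N y -> f y = 0) -> (forall y, f y <= M) ->
  0 < frame_s swap neg a x < rho%:Z -> frame_t swap b x = 0 -> interior N x ->
  (forall y, interior N y -> 0 < frame_s swap neg a y) ->
  (forall y, interior N y -> frame_s swap neg a y < rho%:Z -> `|frame_t swap b y| < rho%:Z -> D y) ->
  rho%:R * f x <= 2 * M * (frame_s swap neg a x)%:~R.
Proof.
move=> fD f0 fM sx tx xN sN inD.
pose A y := [&& interior N y, frame_s swap neg a y < rho%:Z & `|frame_t swap b y| < rho%:Z].
have r0 : (0 < rho)%N by case/andP: sx; lia.
have Ax : A x by rewrite /A xN tx normr0; case/andP: sx => _ ->; rewrite ltz_nat.
have := @barrier_bound swap neg a b R rho N A f M r0 M0 _ _ _ x Ax.
rewrite /barrier tx expr0n addr0 => h.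
have {h} : rho%:R ^+ 2 * f x <= M * (2 * rho%:R * (frame_s swap neg a x)%:~R - (frame_s swap neg a x)%:~R ^+ 2).
  apply: h.
  - by move=> y /and3P[].
  - by move=> y /and3P[yN ys yt]; apply: fD; apply: inD.
  - move=> y z /and3P[yN ys yt] zn Az.
    have y0 := sN _ yN; have fn := frame_nbr swap neg a b zn.
    split; first by move: fn y0 ys; lia.
    have [zN|zN] := boolP (interior N z); last by left; rewrite f0.
    right; split => //.
    by move: Az; rewrite /A zN /= => Az; move: fn y0 ys yt Az; lia.
have r0' : 0 < rho%:R :> R by rewrite ltr0n.
have s2 := sqr_ge0 ((frame_s swap neg a x)%:~R : R).
move=> h; rewrite -(ler_pM2l r0').
have : 0 <= M * (frame_s swap neg a x)%:~R ^+ 2 by rewrite mulr_ge0.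
lra.
Qed.

(* Near a side of the box, [g] is small by comparison with the barrier of that side. *)
Lemma boundary_decay (rho c : nat) x : (c < rho)%N ->
  (forall y, interior N y -> `|y.1 - x.1| < rho%:Z -> `|y.2 - x.2| < rho%:Z -> D y) ->
  x.1 <= c%:Z \/ N%:Z - x.1 <= c%:Z \/ x.2 <= c%:Z \/ N%:Z - x.2 <= c%:Z ->
  rho%:R * `|g x| <= 2 * M * c%:R.
Proof.
move=> cr inD xc.
have [xN|xN] := boolP (interior N x); last by rewrite g0// normr0 mulr0 mulr_ge0// mulr_ge0.
suff h (f : lattice -> R) : (forall y, D y -> 4 * f y = \sum_(z <- nbr y) f z) ->
    (forall y, ~~ interior N y -> f y = 0) -> (forall y, f y <= M) ->
    rho%:R * f x <= 2 * M * c%:R.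
  have [gx|gx] := leP 0 (g x).
    rewrite ger0_norm//; apply: h => // y; exact: le_trans (ler_norm _) (gM y).
  rewrite ltr0_norm//; apply: (h (fun y => - g y)) => [y Dy|y yN|y].
  - by rewrite mulrN gD// sumrN.
  - by rewrite g0// oppr0.
  - by rewrite (le_trans (ler_norm _))// normrN.
move=> fD f0 fM.
have fin (s : int) : s <= c%:Z -> rho%:R * f x <= 2 * M * s%:~R -> rho%:R * f x <= 2 * M * c%:R.
  move=> sc /le_trans; apply; rewrite ler_wpM2l ?mulr_ge0//.
  by rewrite -[leRHS]/((c%:Z)%:~R) ler_int.
case: x => x1 x2 in inD xc xN fin *; move: xc xN; rewrite /interior /= => xc xN.
have inD' (y : lattice) : interior N y -> `|y.1 - x1| < rho%:Z -> `|y.2 - x2| < rho%:Z -> D y.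
  exact: inD.
case: xc => [|[|[|]]] xc.
- apply: (fin (frame_s false false 0 (x1, x2))); first by rewrite /frame_s /= expr0; lia.
  apply: (@one_side false false 0 x2) => //=; rewrite /frame_s /frame_t /= ?expr0; try lia.
  + by move=> [y1 y2]; rewrite /interior /=; lia.
  + by move=> [y1 y2] yN /= ys yt; apply: inD' => //=; move: yN; rewrite /interior /=; lia.
- apply: (fin (frame_s false true N (x1, x2))); first by rewrite /frame_s /= expr1; lia.
  apply: (@one_side false true N x2) => //=; rewrite /frame_s /frame_t /= ?expr1; try lia.
  + by move=> [y1 y2]; rewrite /interior /=; lia.
  + by move=> [y1 y2] yN /= ys yt; apply: inD' => //=; move: yN; rewrite /interior /=; lia.
- apply: (fin (frame_s true false 0 (x1, x2))); first by rewrite /frame_s /= expr0; lia.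
  apply: (@one_side true false 0 x1) => //=; rewrite /frame_s /frame_t /= ?expr0; try lia.
  + by move=> [y1 y2]; rewrite /interior /=; lia.
  + by move=> [y1 y2] yN /= ys yt; apply: inD' => //=; move: yN; rewrite /interior /=; lia.
- apply: (fin (frame_s true true N (x1, x2))); first by rewrite /frame_s /= expr1; lia.
  apply: (@one_side true true N x1) => //=; rewrite /frame_s /frame_t /= ?expr1; try lia.
  + by move=> [y1 y2]; rewrite /interior /=; lia.
  + by move=> [y1 y2] yN /= ys yt; apply: inD' => //=; move: yN; rewrite /interior /=; lia.
Qed.

(* g minus its reflection vanishes on the axis, hence is dominated by the barrier. *)
Lemma reflection_bound swap a b (rho : nat) x : 0 < frame_s swap false a x < rho%:Z ->
  frame_t swap b x = 0 ->
  (forall y, `|frame_s swap false a y| < rho%:Z -> `|frame_t swap b y| < rho%:Z -> D y) ->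
  rho%:R * `|g x - g (reflection swap a x)| <= 4 * M * (frame_s swap false a x)%:~R.
Proof.
move=> sx tx inD.
pose A y := (0 < frame_s swap false a y < rho%:Z) && (`|frame_t swap b y| < rho%:Z).
have r0 : (0 < rho)%N by case/andP: sx; lia.
have Ax : A x by rewrite /A sx tx normr0 ltz_nat.
have r0' : 0 < rho%:R :> R by rewrite ltr0n.
have AD y : A y -> D y /\ D (reflection swap a y).
  move=> /andP[/andP[h1 h2] h3]; split; apply: inD; rewrite ?frame_s_reflection ?frame_t_reflection//; lia.
suff h (f : lattice -> R) : (forall y, D y -> 4 * f y = \sum_(z <- nbr y) f z) ->
    (forall y, `|f y| <= M) ->
    rho%:R * (f x - f (reflection swap a x)) <= 4 * M * (frame_s swap false a x)%:~R.
  have [gx|gx] := leP 0 (g x - g (reflection swap a x)); first by rewrite ger0_norm//; exact: h.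
  rewrite ltr0_norm// opprB addrC -[g (reflection _ _ _)]opprK.
  apply: (h (fun y => - g y)) => y.
    by move=> Dy; rewrite mulrN gD// sumrN.
  by rewrite normrN.
move=> fD fM.
have := @barrier_bound swap false a b R rho N A (fun y => f y - f (reflection swap a y)) (2 * M) r0 _ _ _ _ x Ax.
rewrite /barrier tx expr0n addr0 => h.
have s2 := sqr_ge0 ((frame_s swap false a x)%:~R : R).
have {h} : rho%:R ^+ 2 * (f x - f (reflection swap a x)) <=
   2 * M * (2 * rho%:R * (frame_s swap false a x)%:~R - (frame_s swap false a x)%:~R ^+ 2).
  apply: h.
  - by rewrite mulr_ge0.
  - by move=> y /AD[/DN].
  - by move=> y /AD[Dy Dry]; rewrite mulrBr !fD// sumrB sum_nbr_reflection.
  - move=> y z /andP[ys yt] zn Az; have fn := frame_nbr swap false a b zn.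
    split; first by move: fn ys; lia.
    have [z0|z0] := eqVneq (frame_s swap false a z) 0.
      left; suff -> : reflection swap a z = z by rewrite subrr.
      move: z0; rewrite /frame_s /reflection expr0 mul1r; case: z {zn Az fn} => z1 z2 /=.
      by clear; case: swap => /= h; congr (_, _); lia.
    right; split; last by move: Az; rewrite /A => Az; move: fn ys yt Az z0; lia.
    have := fM z; have := fM (reflection swap a z); rewrite !ler_norml => /andP[h1 _] /andP[_ h2].
    by lra.
move=> h; rewrite -(ler_pM2l r0').
have : 0 <= M * (frame_s swap false a x)%:~R ^+ 2 by rewrite mulr_ge0.
lra.
Qed.

(** Reflections in two perpendicular axes carry one point to the other; an axis through a lattice
    point produces an even displacement, whence the factors 2. The intermediate scale [rho] decides:
    within [3 * rho] of a side both values are small by [boundary_decay], elsewhere the reflections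
    stay inside the box. *)
Lemma oscillation (rho q r : nat) v (i j : int) : (0 < rho)%N -> (q < rho)%N -> (8 * rho <= r)%N ->
  `|i| <= q%:Z -> `|j| <= q%:Z ->
  (forall y, interior N y -> `|y.1 - v.1| < r%:Z -> `|y.2 - v.2| < r%:Z -> D y) ->
  `|g (v.1 + 2 * i, v.2 + 2 * j) - g v| <= M * (24 * rho%:R / r%:R + 8 * q%:R / rho%:R).
Proof.
move=> r0 qr rr iq jq inD; case: v => v1 v2 in inD *; rewrite /= in inD *.
have rho0 : 0 < rho%:R :> R by rewrite ltr0n.
have rr0 : 0 < r%:R :> R by rewrite ltr0n; lia.
have q0 : 0 <= M * (8 * q%:R / rho%:R) by rewrite mulr_ge0// divr_ge0// ltW.
have q1 : 0 <= M * (24 * rho%:R / r%:R) by rewrite mulr_ge0// divr_ge0// ltW.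
have [near|far] := boolP [|| v1 <= (3 * rho)%:Z, N%:Z - v1 <= (3 * rho)%:Z, v2 <= (3 * rho)%:Z |
    N%:Z - v2 <= (3 * rho)%:Z].
  rewrite mulrDr ler_wpDr//.
  have r'E : ((r - 2 * q)%:R : R) >= r%:R * (3 / 4).
    rewrite natrB; last by lia.
    have : 8 * q%:R <= r%:R :> R by rewrite -natrM ler_nat; lia.
    by rewrite natrM; lra.
  have pr (z : R) (c : R) : 0 <= z -> (r - 2 * q)%:R * z <= 2 * M * (c * rho%:R) ->
      z <= 8 / 3 * c * (M * rho%:R / r%:R).
    move=> z0 h; rewrite !mulrA ler_pdivlMr// -(ler_pM2l (_ : 0 < 3 / 4 :> R)); last by lra.
    have : r%:R * (3 / 4) * z <= (r - 2 * q)%:R * z by rewrite ler_wpM2r.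
    lra.
  have h1 : (r - 2 * q)%:R * `|g (v1, v2)| <= 2 * M * (3 * rho%:R).
    rewrite -natrM; apply: boundary_decay => /=; first by lia.
      by move=> y yN h1 h2; apply: inD => //; lia.
    by case/or4P: near => ?; lia.
  have h2 : (r - 2 * q)%:R * `|g (v1 + 2 * i, v2 + 2 * j)| <= 2 * M * (5 * rho%:R).
    rewrite -natrM; apply: boundary_decay => /=; first by lia.
      by move=> y yN h2 h3; apply: inD => //; lia.
    by case/or4P: near => ?; lia.
  have {}h1 := pr _ _ (normr_ge0 _) h1; have {}h2 := pr _ _ (normr_ge0 _) h2.
  apply: (le_trans (ler_normB _ _)).
  have : 0 <= M * rho%:R / r%:R by rewrite !mulr_ge0// invr_ge0.
  have -> : M * (24 * rho%:R / r%:R) = 24 * (M * rho%:R / r%:R) by ring.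
  move: h1 h2; move: (_ / r%:R) `|g (v1, v2)| `|g (v1 + _, _)| => w z1 z2; lra.
rewrite mulrDr ler_wpDl//.
have q2 : 0 <= M * (4 * q%:R / rho%:R) by rewrite mulr_ge0// divr_ge0// ltW.
have qq : M * (4 * q%:R / rho%:R) + M * (4 * q%:R / rho%:R) = M * (8 * q%:R / rho%:R).
  by rewrite -mulrDr -mulrDl -mulrDl; congr (_ * (_ * _ / _)); ring.
have step swap a b x : (forall y, `|frame_s swap false a y| < rho%:Z -> `|frame_t swap b y| < rho%:Z -> D y) ->
    `|frame_s swap false a x| <= q%:Z -> frame_t swap b x = 0 ->
    `|g x - g (reflection swap a x)| <= M * (4 * q%:R / rho%:R).
  move=> inD'; suff pos z : 0 < frame_s swap false a z <= q%:Z -> frame_t swap b z = 0 ->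
      `|g z - g (reflection swap a z)| <= M * (4 * q%:R / rho%:R).
    move=> sq tx; have [sx|sx|sx] := ltgtP (frame_s swap false a x) 0.
    - rewrite distrC -[in X in _ - X](reflectionK swap a x); apply: pos.
        by rewrite frame_s_reflection; lia.
      by rewrite frame_t_reflection.
    - by apply: pos => //; lia.
    - suff -> : reflection swap a x = x by rewrite subrr normr0.
      move: sx; rewrite /frame_s /reflection expr0 mul1r; case: x {sq tx} => x1 x2 /=.
      by case: swap {inD' pos} => /= h; congr (_, _); lia.
  move=> /andP[s0 sq] tz; rewrite !mulrA ler_pdivlMr// mulrC.
  rewrite (le_trans (@reflection_bound swap a b rho z _ tz inD'))//; first by lia.
  have : (frame_s swap false a z)%:~R <= q%:R :> R by rewrite -[leRHS]/((q%:Z)%:~R) ler_int.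
  by move=> h; rewrite (mulrC M) ler_wpM2l// mulr_ge0.
have v1N : (3 * rho)%:Z < v1 /\ (3 * rho)%:Z < N%:Z - v1 by move: far; lia.
have v2N : (3 * rho)%:Z < v2 /\ (3 * rho)%:Z < N%:Z - v2 by move: far; lia.
apply: (le_trans (ler_distD (g (v1, v2 + 2 * j)) _ _)).
rewrite -qq; apply: lerD.
  have := @step false (v1 + i) (v2 + 2 * j) (v1 + 2 * i, v2 + 2 * j).
  rewrite /reflection /frame_s /frame_t /= expr0.
  have -> : 2 * (v1 + i) - (v1 + 2 * i) = v1 by ring.
  apply; [|lia|lia].
  move=> [y1 y2] /= h1 h2; apply: inD => /=; rewrite /interior /=; lia.
have := @step true (v2 + j) v1 (v1, v2 + 2 * j).
rewrite /reflection /frame_s /frame_t /= expr0.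
have -> : 2 * (v2 + j) - (v2 + 2 * j) = v2 by ring.
apply; [|lia|lia].
move=> [y1 y2] /= h1 h2; apply: inD => /=; rewrite /interior /=; lia.
Qed.

End oscillation.

(** * Conditioning levels *)

Section asymptotics.
Context {R : realType}.

Lemma ln_nat_large (C : R) : exists N0, forall N, (N0 <= N)%N -> (1 <= N)%N /\ C <= ln N%:R.
Proof.
exists (Num.truncn (expR C)).+1 => N hN; have N0 : (1 <= N)%N by lia.
split => //; rewrite -ler_expR lnK ?posrE ?ltr0n// (le_trans (ltW (truncnS_gt _)))//.
by rewrite ler_nat.
Qed.

Lemma powR_nat (N : nat) (a : R) : (1 <= N)%N -> N%:R `^ a = expR (a * ln N%:R).
Proof. by move=> N1; rewrite /powR gt_eqF ?ltr0n. Qed.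

Lemma powR_nat_small (a eta : R) : 0 < a -> 0 < eta ->
  exists N0, forall N, (N0 <= N)%N -> N%:R `^ (- a) <= eta.
Proof.
move=> a0 eta0; have [N0 h] := ln_nat_large (- ln eta / a).
exists N0 => N /h[N1]; rewrite ler_pdivrMr// => hN; rewrite powR_nat// -[leRHS]lnK ?posrE//.
by rewrite ler_expR; lra.
Qed.

Lemma powR_nat_ge1 (N : nat) (a : R) : (1 <= N)%N -> 0 <= a -> 1 <= N%:R `^ a.
Proof.
move=> N1 a0; rewrite powR_nat// -[leLHS]expR0 ler_expR; apply: mulr_ge0 => //.
by apply: ln_ge0; rewrite ler1n.
Qed.

End asymptotics.

Lemma int_triangle (a b c : int) : `|a - b| <= `|a - c| + `|b - c|.
Proof. lia. Qed.

Lemma absz_lt_le (z : int) (n : nat) : (`|z| < n.+1)%N -> `|z| <= n%:Z.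
Proof. lia. Qed.

Section levels.
Context {R : realType}.
Implicit Types (lam : R) (u v x : lattice) (N : nat).

(** Boolean form of [inner (neighborhood N lam v)]. The added 1 discards the boundary; at [lam = 1]
    it makes the set empty since then the half-width is 1/2, while [lam = 0] means the whole box and
    is a separate case. *)
Definition level N lam v : pred lattice := fun x => interior N x && ((lam == 0) ||
  ((`|x.1 - v.1|%:~R + 1 <= N%:R `^ (1 - lam) / 2) && (`|x.2 - v.2|%:~R + 1 <= N%:R `^ (1 - lam) / 2))).

Lemma level_interior N lam v x : level N lam v x -> interior N x.
Proof. by case/andP. Qed.

Lemma level_sub N lam lam' v x : (1 <= N)%N -> 0 <= lam -> lam <= lam' ->
  level N lam' v x -> level N lam v x.
Proof.
move=> N1 l0 ll /andP[xN h]; rewrite /level xN /=.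
have [//|ln0] := eqVneq lam 0.
have le : N%:R `^ (1 - lam') / 2 <= N%:R `^ (1 - lam) / 2 :> R.
  by rewrite ler_pM2r ?invr_gt0// ler_powR ?ler1n// lerB.
move: h; rewrite gt_eqF ?(lt_le_trans _ ll) ?lt_def ?ln0//= => /andP[h1 h2].
by rewrite (le_trans h1)// (le_trans h2).
Qed.

Lemma inner_neighborhood N lam v x : 0 <= lam <= 1 ->
  inner (neighborhood N lam v) x <-> level N lam v x.
Proof.
move=> /andP[l0 l1]; rewrite /neighborhood /level.
have [->|ln0] := eqVneq lam 0; first by rewrite andbT; exact: inner_box.
have [->|ln1] := eqVneq lam 1.
  split.
    move=> [/= -> []]; split => //; exists (v.1 + 1, v.2).
      by move=> /(congr1 fst) /=; lia.
    by rewrite adjacent_nbr inE eqxx.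
  rewrite subrr powRr0 => /andP[_ /andP[h _]].
  have : 0 <= `|x.1 - v.1|%:~R :> R by rewrite ler0z.
  lra.
set r : R := N%:R `^ (1 - lam) / 2.
have rE : 2^-1 * N%:R `^ (1 - lam) = r by rewrite mulrC.
rewrite rE; set B := (X in inner X).
have near (a b : int) : (a%:~R \in `[b%:~R - r, b%:~R + r]) = (`|a - b|%:~R <= r :> R).
  by rewrite in_itv/= intr_norm intrB ler_norml; apply/idP/idP; lra.
have abs1 (a b c : int) : c = a + 1 \/ c = a - 1 -> `|a - b|%:~R + 1 <= r -> `|c - b|%:~R <= r.
  move=> h; apply: le_trans; rewrite -[1]/(1%:~R) -intrD ler_int; lia.
split.
  move=> [Bx nb]; have inB y : y \in nbr x -> B y.
    move=> yn; apply: contrapT => By; apply: nb; split => //; exists y => //.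
    by rewrite adjacent_nbr.
  have xN : interior N x.
    apply/inner_box; split; first by case: Bx.
    by move=> [_ [z zN xz]]; apply: zN; move: xz; rewrite adjacent_nbr => /inB[].
  rewrite xN /=.
  have big (a b : int) : (a + 1)%:~R \in `[b%:~R - r, b%:~R + r] ->
      (a - 1)%:~R \in `[b%:~R - r, b%:~R + r] -> `|a - b|%:~R + 1 <= r.
    rewrite !near => h1 h2; have [ab|ab] := leP b a.
      by apply: le_trans h1; rewrite -[1]/(1%:~R) -intrD ler_int; lia.
    by apply: le_trans h2; rewrite -[1]/(1%:~R) -intrD ler_int; lia.
  have m (z : lattice) : z \in nbr x -> z.1%:~R \in `[v.1%:~R - r, v.1%:~R + r] /\
             z.2%:~R \in `[v.2%:~R - r, v.2%:~R + r] by move/inB => [].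
  have n1 : (x.1 + 1, x.2) \in nbr x by rewrite inE eqxx.
  have n2 : (x.1 - 1, x.2) \in nbr x by rewrite !inE eqxx orbT.
  have n3 : (x.1, x.2 + 1) \in nbr x by rewrite !inE eqxx !orbT.
  have n4 : (x.1, x.2 - 1) \in nbr x by rewrite !inE eqxx !orbT.
  have [h1 _] := m _ n1; have [h2 _] := m _ n2; have [_ h3] := m _ n3; have [_ h4] := m _ n4.
  by rewrite !big.
move=> /andP[xN /andP[h1 h2]].
have h1' : `|x.1 - v.1|%:~R <= r by lra.
have h2' : `|x.2 - v.2|%:~R <= r by lra.
have Bx : B x by split; [split; rewrite near|exact: interior_box].
split => // -[_ [z zB]]; rewrite adjacent_nbr => zn; apply: zB; split; last exact: interior_nbr zn.
move: zn; rewrite /= !near /nbr !inE.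
by case/or4P => /eqP -> /=; split => //; [apply: abs1 h1|apply: abs1 h1|apply: abs1 h2|apply: abs1 h2]; lia.
Qed.

Lemma level_radius N lam v : (1 <= N)%N -> 0 <= lam <= 1 -> box_set N v ->
  exists rho : nat, [/\ (rho <= N)%N, ln (2 * rho.+1%:R) <= (1 - lam) * ln N%:R + ln 4 &
    forall x, level N lam v x -> `|x.1 - v.1| <= rho%:Z /\ `|x.2 - v.2| <= rho%:Z].
Proof.
move=> N1 /andP[l0 l1] vN; have N0 : 0 < N%:R :> R by rewrite ltr0n.
have y1 : 1 <= N%:R `^ (1 - lam) :> R by rewrite powR_nat_ge1// subr_ge0.
have y0 := lt_le_trans ltr01 y1.
have lnE : (1 - lam) * ln N%:R + ln 4 = ln (4 * N%:R `^ (1 - lam)).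
  by rewrite lnM ?posrE// ln_powR addrC.
rewrite lnE; have [l00|ln0] := eqVneq lam 0.
  exists N; split => //.
    rewrite l00 subr0 powRr1 ?ler0n// ler_ln ?posrE ?mulr_gt0 ?ltr0n//.
    by rewrite -!natrM ler_nat; lia.
  by move=> x /level_interior/interior_box; move: vN; rewrite /box_set /=; lia.
have t0 : 0 <= N%:R `^ (1 - lam) / 2 :> R by rewrite divr_ge0// ltW.
exists (Num.truncn (N%:R `^ (1 - lam) / 2 : R)); set rho := Num.truncn _.
have rle : rho%:R <= N%:R `^ (1 - lam) / 2 :> R by rewrite truncn_le.
split.
- rewrite -(ler_nat R) (le_trans rle)// ler_pdivrMr//.
  have : N%:R `^ (1 - lam) <= N%:R `^ 1 :> R by rewrite ler_powR ?ler1n//; lra.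
  by rewrite powRr1 ?ler0n//; lra.
- rewrite ler_ln ?posrE ?mulr_gt0 ?ltr0n// -natr1; lra.
- move=> x /andP[_]; rewrite (negbTE ln0) /= => /andP[h1 h2].
  have lez (z : int) : `|z|%:~R + 1 <= N%:R `^ (1 - lam) / 2 :> R -> `|z| <= rho%:Z.
    move=> h; have : (`|z|%N)%:R < rho.+1%:R :> R.
      apply: (le_lt_trans _ (truncnS_gt _)); move: h; rewrite -[`|z|%:~R]/((`|z|%N%:Z)%:~R) => h.
      by have -> : (`|z|%N)%:R = (`|z|%N%:Z)%:~R :> R by []; rewrite abszE; lra.
    by rewrite ltr_nat; exact: absz_lt_le.
  by split; apply: lez.
Qed.

Lemma log_kernel_off_level N lam u v x : (1 <= N)%N -> 0 <= lam <= 1 ->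
  interior N x -> ~~ level N lam u x ->
  `|u.1 - v.1|%:~R <= N%:R `^ (1 - lam) / 8 :> R -> `|u.2 - v.2|%:~R <= N%:R `^ (1 - lam) / 8 :> R ->
  (1 - lam) * ln N%:R - ln 8 <= log_kernel (lattice_sub x v).
Proof.
move=> N1 /andP[l0 l1] xN xl u1 u2.
have y1 : 1 <= N%:R `^ (1 - lam) :> R by rewrite powR_nat_ge1// subr_ge0.
have y0 := lt_le_trans ltr01 y1.
rewrite (_ : _ - _ = ln (N%:R `^ (1 - lam) / 8)); last first.
  by rewrite ln_div ?posrE// ln_powR.
have [y8|y8] := leP (N%:R `^ (1 - lam)) (8 : R).
  rewrite (le_trans _ (log_kernel_ge0 _))// ln_le0// ler_pdivrMr//; lra.
apply: log_kernel_ge; first by rewrite divr_gt0.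
have tri (a b c : int) : N%:R `^ (1 - lam) / 2 < `|a - b|%:~R + 1 :> R ->
    `|b - c|%:~R <= N%:R `^ (1 - lam) / 8 :> R -> N%:R `^ (1 - lam) / 8 <= `|a - c|%:~R :> R.
  move=> h1 h2; have : `|a - b|%:~R <= `|a - c|%:~R + `|b - c|%:~R :> R.
    by rewrite -intrD ler_int; exact: int_triangle.
  lra.
move: xl; rewrite /level xN /= negb_or negb_and -!ltNge => /andP[_ /orP[h|h]].
  by left; apply: tri u1.
by right; apply: tri u2.
Qed.

End levels.

Lemma int_shift (R : realType) (a b z : int) (r : nat) : `|a - b| < r%:Z ->
  `|a - (b + 2 * z)|%:~R + 1 <= r%:R + `|2 * z|%:~R :> R.
Proof.
move=> h; have : `|a - (b + 2 * z)| + 1 <= r%:Z + `|2 * z| by lia.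
by rewrite -(ler_int R) !intrD.
Qed.

Lemma sqr_le (R : realType) (a b : R) : 0 <= a -> a <= b -> a ^+ 2 <= b ^+ 2.
Proof. by move=> a0 ab; rewrite lerXn2r ?nnegrE// (le_trans a0). Qed.

Lemma min_exists (R : realType) (a b : R) : 0 < a -> 0 < b ->
  exists c : R, [/\ 0 < c, c <= a & c <= b].
Proof.
by move=> a0 b0; exists (Num.min a b); rewrite lt_min a0 b0 !ge_min !lexx orbT.
Qed.

(** * Variances of the conditioned fields *)

Section level_variances.
Context {R : realType} dW (TW : measurableType dW).
Variables (PW : lattice -> probability TW R) (W : nat -> TW -> lattice).
Hypothesis hW : forall u, simple_random_walk (PW u) u W.
Variables (d : nat -> measure_display) (T : forall N, measurableType (d N))
  (P : forall N, probability (T N) R)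
  (phi : forall N, box N -> {RV (P N) >-> R}).
Hypothesis hphi : forall N, (1 <= N)%N -> GFF PW W (@phi N).
Implicit Types (lam delta : R).

Local Notation G N := (green_in (@phi N)).

Lemma green_level_upper delta : 0 < delta -> exists N0, forall N, (N0 <= N)%N ->
  forall (v : box N) lam (A : pred lattice), 0 <= lam <= 1 ->
  (forall x, A x -> level N lam (point v) x) -> forall x, A x ->
  G N A v x <= (1 - lam + delta) * ln N%:R - log_kernel (lattice_sub x (point v)).
Proof.
(* Then [6 * e * ln N] takes half of [delta], and for large [N] the constants fit in the other
   half. *)
move=> d0; pose e : R := Num.min 2^-1 (delta / 12).
have e0 : 0 < e by rewrite lt_min invr_gt0// divr_gt0//= ltr0n.
have e1 : e <= 2^-1 by rewrite ge_min lexx.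
have e2 : e <= delta / 12 by rewrite ge_min lexx orbT.
have [K fK] := flux_approx e0.
have [N0 hN0] := ln_nat_large (2 / delta * (ln 4 + 6 * e * ln 6 + 8 * pi * K%:R ^+ 2 / e)).
exists N0 => N /hN0 [N1 hl] v lam A lam01 Al x Ax.
have [rho [rN lr Arho]] := level_radius N1 lam01 (box_set_point v).
have AN y : A y -> interior N y by move=> /Al /level_interior.
have := green_in_upper hW (hphi N1) AN e0 e1 fK rN N1 (fun y Ay => Arho y (Al y Ay)) Ax.
move=> /le_trans; apply.
have lN : 0 <= ln N%:R :> R by rewrite ln_ge0// ler1n.
rewrite [ln (6 * _)]lnM ?posrE ?ltr0n//.
set C := 8 * pi * _ / e in hl *.
have h1 : ln 4 + 6 * e * ln 6 + C <= delta / 2 * ln N%:R.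
  rewrite -(ler_pM2l (_ : 0 < 2 / delta)) ?divr_gt0// (le_trans hl)//.
  by rewrite mulrA (_ : 2 / delta * (delta / 2) = 1) ?mul1r//; field; rewrite gt_eqF.
have h2 : 6 * e * ln N%:R <= delta / 2 * ln N%:R by rewrite ler_wpM2r//; lra.
lra.
Qed.

(** A general inner domain is allowed so as to cover both a smaller neighbourhood of [v] and, with
    [lam' = lam], the intersection of neighbourhoods of two nearby points, where the loss is only
    [delta * ln N]. *)
Lemma level_variance_le delta : 0 < delta -> exists N0, forall N, (N0 <= N)%N ->
  forall (v : box N) lam lam' (A : pred lattice), 0 <= lam -> lam <= lam' -> lam' <= 1 ->
  (forall x, A x -> level N lam (point v) x) ->
  (forall x, level N lam (point v) x -> ~~ A x -> exists u : lattice,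
    [/\ `|u.1 - (point v).1|%:~R <= N%:R `^ (1 - lam') / 8 :> R,
        `|u.2 - (point v).2|%:~R <= N%:R `^ (1 - lam') / 8 :> R &
        ~~ level N lam' u x]) ->
  G N (level N lam (point v)) v (point v) - G N A v (point v) <= (lam' - lam + delta) * ln N%:R.
Proof.
move=> d0; have d2 : 0 < delta / 2 by rewrite divr_gt0.
have [N0 hN0] := green_level_upper d2; have [N1 hN1] := ln_nat_large (2 / delta * ln 8).
exists (maxn N0 N1) => N; rewrite geq_max => /andP[/hN0 up /hN1[Npos hl]].
move=> v lam lam' A l0 ll l1 Al hA.
have lN : 0 <= ln N%:R :> R by rewrite ln_ge0// ler1n.
have lN' : (1 - lam') * ln N%:R >= 0 by rewrite mulr_ge0// subr_ge0.
apply: (green_in_diff_le hW (hphi Npos)) => //; first exact: level_interior.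
move=> x _ Ax; have [lx|lx] := boolP (level N lam (point v) x); last first.
  rewrite (green_in_out hW (hphi Npos))// mulr_ge0// addr_ge0 ?(ltW d0)//; lra.
have l01 : 0 <= lam <= 1 by rewrite l0 (le_trans ll).
have l01' : 0 <= lam' <= 1 by rewrite (le_trans l0).
have [u [u1 u2 xu]] := hA x lx Ax.
have := up v lam (level N lam (point v)) l01 (fun y h => h) x lx.
move=> /le_trans; apply.
have := log_kernel_off_level Npos l01' (level_interior lx) xu u1 u2.
have : ln 8 <= delta / 2 * ln N%:R.
  rewrite -(ler_pM2l (_ : 0 < 2 / delta)) ?divr_gt0// (le_trans hl)//.
  by rewrite mulrA (_ : 2 / delta * (delta / 2) = 1) ?mul1r//; field; rewrite gt_eqF.
lra.
Qed.

Lemma level_variance_step delta : 0 < delta -> exists N0, forall N, (N0 <= N)%N ->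
  forall (v : box N) lam lam', 0 <= lam -> lam <= lam' -> lam' <= 1 ->
  G N (level N lam (point v)) v (point v) - G N (level N lam' (point v)) v (point v) <=
    (lam' - lam + delta) * ln N%:R.
Proof.
move=> d0; have [N0 h] := level_variance_le d0; exists (maxn 1 N0) => N.
rewrite geq_max => /andP[N1 /h {}h] v lam lam' l0 ll l1; apply: h => //.
  by move=> x; exact: level_sub.
by move=> x _ xl; exists (point v); rewrite !subrr normr0 divr_ge0 ?powR_ge0.
Qed.

(** The middle half of the box in each coordinate: squares of half-width [N / 4] around such points
    do not leave the box. *)
Definition bulk N (v : box N) : bool :=
  (N <= 4 * v.1 <= 3 * N)%N && (N <= 4 * v.2 <= 3 * N)%N.

Lemma green_level_lower delta : 0 < delta -> exists N0, forall N, (N0 <= N)%N ->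
  forall (v : box N) lam, bulk v -> 0 <= lam <= 1 ->
  (1 - lam - delta) * ln N%:R <= G N (level N lam (point v)) v (point v).
Proof.
move=> d0; have [N0 hN0] := ln_nat_large ((ln 4 + 3) / delta).
exists N0 => N /hN0 [N1 hl] v lam vb /andP[l0 l1].
have lN : 0 <= ln N%:R :> R by rewrite ln_ge0// ler1n.
have N0' : 0 < N%:R :> R by rewrite ltr0n.
have hd : ln 4 + 3 <= delta * ln N%:R by move: hl; rewrite ler_pdivrMr// mulrC.
have y1 : 1 <= N%:R `^ (1 - lam) :> R by rewrite powR_nat_ge1// subr_ge0.
have y0 := lt_le_trans ltr01 y1.
have yN : N%:R `^ (1 - lam) <= N%:R :> R.
  by rewrite -[leRHS]powRr1 ?ler0n// ler_powR ?ler1n//; lra.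
set g := G N _ v _; have g0 : 0 <= g.
  by apply: (green_in_ge0 hW (hphi N1)); exact: level_interior.
set r : R := N%:R `^ (1 - lam) / 4; have r0 : 0 < r by rewrite divr_gt0.
have lnr : ln r = (1 - lam) * ln N%:R - ln 4 by rewrite ln_div ?posrE// ln_powR.
suff : ln r - 3 <= g by lra.
have [r1|r1] := leP r 1.
  by rewrite (le_trans _ g0)// subr_le0 (@le_trans _ _ 0)// ln_le0.
have rA x : `|x.1 - (point v).1|%:~R < r -> `|x.2 - (point v).2|%:~R < r -> level N lam (point v) x.
  move=> h1 h2; rewrite /level; apply/andP; split; last first.
    apply/orP; right; apply/andP; split; rewrite (le_trans (_ : _ <= r + r))//.
    - by rewrite lerD// ltW.
    - by rewrite /r; lra.
    - by rewrite lerD// ltW.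
    - by rewrite /r; lra.
  have four (z : int) : `|z|%:~R < r -> 4 * `|z| < N%:Z.
    move=> h; rewrite -(ltr_int R) intrM -[(N%:Z)%:~R]/(N%:R : R).
    by apply: lt_le_trans yN; move: h; rewrite /r ltr_pdivlMr// mulrC.
  have := four _ h1; have := four _ h2; move: vb; rewrite /bulk /interior /= => vb f1 f2.
  by clear -vb f1 f2 N1; case: x v vb f1 f2 => x1 x2 [v1 v2] /=; lia.
have := green_in_lower hW (hphi N1) (@level_interior R N lam (point v)) r0 rA.
rewrite -/g => h.
have /andP[_ fu] := @flux_bounds R N N1.
have p2 := @pi_ge2 R; have p4 := @pihalf_lt2 R.
set i := N%:R^-1 in fu; have i0 : 0 < i by rewrite invr_gt0.
have i1 : i <= 1 by rewrite invf_le1// ler1n.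
have {h} h : 2 * pi * ln r <= 2 * pi * (1 + 3 * i) * g.
  apply: (le_trans h); apply: ler_wpM2r => //; apply: (le_trans fu).
  rewrite -/i.
  have h1 : i * i <= i * 1 by rewrite ler_wpM2l// ltW.
  have h2 : 2 * i <= pi * i by rewrite ler_wpM2r// ltW.
  have h3 : pi * i <= 4 * i by rewrite ler_wpM2r ?(ltW i0)//; lra.
  have -> : (2 + i) * (pi + 2 * i) = 2 * pi + 4 * i + pi * i + 2 * (i * i) by ring.
  have -> : 2 * pi * (1 + 3 * i) = 2 * pi + 6 * (pi * i) by ring.
  lra.
have {}h : ln r <= (1 + 3 * i) * g.
  by move: h; rewrite -!mulrA ler_pM2l// ler_pM2l ?pi_gt0.
(* The excess factor [1 + 3 / N] of the flux costs at most 3 if [g <= N]; a larger [g] is above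
   [ln r] anyway. *)
have [gN|gN] := leP g N%:R.
  have : i * g <= 1 by rewrite mulrC ler_pdivrMr// mul1r.
  by move: h; rewrite mulrDl mul1r; lra.
have : ln r < r by exact: ln_sublinear.
have : r <= N%:R by rewrite /r; lra.
lra.
Qed.

Lemma level_variance_ge delta : 0 < delta -> exists N0, forall N, (N0 <= N)%N ->
  forall (v : box N) lam lam', bulk v -> 0 <= lam -> lam <= lam' -> lam' <= 1 ->
  (lam' - lam - delta) * ln N%:R <=
  G N (level N lam (point v)) v (point v) - G N (level N lam' (point v)) v (point v).
Proof.
move=> d0; have d2 : 0 < delta / 2 by rewrite divr_gt0.
have [N0 hN0] := green_level_upper d2; have [N1 hN1] := green_level_lower d2.
exists (maxn 1 (maxn N0 N1)) => N; rewrite !geq_max => /and3P[Npos /hN0 up /hN1 lo].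
move=> v lam lam' vb l0 ll l1.
have lN : 0 <= ln N%:R :> R by rewrite ln_ge0// ler1n.
have lN' : (1 - lam') * ln N%:R >= 0 by rewrite mulr_ge0// subr_ge0.
have l01 : 0 <= lam <= 1 by rewrite l0 (le_trans ll).
have l01' : 0 <= lam' <= 1 by rewrite (le_trans l0).
have h1 := lo v lam vb l01.
have : G N (level N lam' (point v)) v (point v) <= (1 - lam' + delta / 2) * ln N%:R.
  have [vl|vl] := boolP (level N lam' (point v) (point v)); last first.
    by rewrite (green_in_out hW (hphi Npos))// mulr_ge0// addr_ge0 ?subr_ge0// ltW.
  have := up v lam' (level N lam' (point v)) l01' (fun y h => h) (point v) vl.
  by rewrite /lattice_sub !subrr log_kernel0 subr0.
lra.
Qed.

(* Coefficients of the paper's [phi_v(lam)]. *)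
Definition level_mean N lam (v : box N) : box N -> R :=
  fun i => coord v i - residual (@phi N) (level N lam (point v)) v i.

Let mean_diff N (D : pred lattice) (u v w : box N) : R :=
  (coord u w - residual (@phi N) D u w) - (coord v w - residual (@phi N) D v w).

(** A self-improving estimate. The difference [dd] of the two projections has no charge in [D], so
    its potential [g] is harmonic there, and its variance [S] equals [g] at [u] minus [g] at [v].
    Cauchy-Schwarz bounds [g] by the square root of [S * (2 * ln N)], and [oscillation] then bounds
    [S] by a multiple of its own square root. *)
Let mean_oscillation N (D : pred lattice) (u v : box N) (i j : int) (rho q r : nat) :
  (1 <= N)%N -> (forall x, D x -> interior N x) ->
  (forall b : box N, gram (@phi N) (residual (@phi N) (interior N) b) (residual (@phi N) (interior N) b) <= 2 * ln N%:R) ->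
  (0 < rho)%N -> (q < rho)%N -> (8 * rho <= r)%N -> `|i| <= q%:Z -> `|j| <= q%:Z ->
  point u = ((point v).1 + 2 * i, (point v).2 + 2 * j) ->
  (forall y, interior N y -> `|y.1 - (point v).1| < r%:Z -> `|y.2 - (point v).2| < r%:Z -> D y) ->
  gram (@phi N) (mean_diff D u v) (mean_diff D u v) <= (24 * rho%:R / r%:R + 8 * q%:R / rho%:R) ^+ 2 * (2 * ln N%:R).
Proof.
move=> N1 DN I2 rho0 qr rr iq jq uv inD; set dd := mean_diff D u v.
have [gv phi0 _] := hphi N1.
pose g := potential (@phi N) dd.
have dd0 w : D (point w) -> dd w = 0.
  by move=> Dw; rewrite /dd /mean_diff !(residual_in (hphi N1))// /coord !subrr.
have gE w : gram (@phi N) dd (coord w) = g (point w) by exact: gram_potential.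
have S0 : 0 <= gram (@phi N) dd dd by exact: gram_ge0.
have lN : 0 <= ln N%:R :> R by rewrite ln_ge0// ler1n.
have dr z : gram (@phi N) dd (residual (@phi N) D z) = 0.
  rewrite gramC gram_coord big1// => w _.
  have [Dw|Dw] := boolP (D (point w)); first by rewrite dd0// mul0r.
  by rewrite (residualP (hphi N1) D z).2// mulr0.
have SE : gram (@phi N) dd dd = g (point u) - g (point v).
  rewrite -!gE -gramBr -[RHS](_ : gram (@phi N) dd (fun w => dd w + (residual (@phi N) D u w - residual (@phi N) D v w)) = _).
    by rewrite [RHS]gramDr [X in _ = _ + X]gramBr !dr subrr addr0.
  by congr gram; apply/funext => w; rewrite /dd /mean_diff; ring.
set S := gram _ dd dd in S0 SE *.
pose M := Num.sqrt (S * (2 * ln N%:R)).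
have M2 : M ^+ 2 = S * (2 * ln N%:R) by rewrite sqr_sqrtr// mulr_ge0// mulr_ge0.
have gM x : `|g x| <= M.
  have [xN|xN] := boolP (interior N x); last first.
    by rewrite /g (potential_out hW (hphi N1))// normr0 sqrtr_ge0.
  have [b bx] := box_point (interior_box xN).
  rewrite -bx -gE.
  have -> : gram (@phi N) dd (coord b) = gram (@phi N) dd (residual (@phi N) (interior N) b).
    apply/eqP; rewrite -subr_eq0 -gramBr gram_coord big1// => w _.
    have [wN|wN] := boolP (interior N (point w)).
      by rewrite (residual_in (hphi N1))// /coord subrr mul0r.
    by rewrite gram_potential (potential_out hW (hphi N1))// mulr0.
  rewrite -sqrtr_sqr ler_wsqrtr// (le_trans (gram_cauchy gv phi0 _ _))// ler_wpM2l//.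
have gD x : D x -> 4 * g x = \sum_(y <- nbr x) g y.
  move=> Dx; have [b bx] := box_point (interior_box (DN _ Dx)).
  rewrite -bx /g (potential_poisson hW (hphi N1)) ?dd0 ?bx ?mulr0 ?add0r//; exact: DN.
have := @oscillation R N D g M DN gD (fun x xN => potential_out hW (hphi N1) dd xN) gM
  rho q r (point v) i j rho0 qr rr iq jq inD.
rewrite -uv -SE ger0_norm// => h.
set c := _ + _ in h *.
have [->|Sn0] := eqVneq S 0; first by rewrite mulr_ge0 ?sqr_ge0// mulr_ge0.
have Sp : 0 < S by rewrite lt_def Sn0.
have c0 : 0 <= c by rewrite addr_ge0// divr_ge0// mulr_ge0.
rewrite -(ler_pM2l Sp) -expr2.
have -> : S * (c ^+ 2 * (2 * ln N%:R)) = (M * c) ^+ 2 by rewrite exprMn M2; ring.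
by rewrite lerXn2r ?nnegrE// mulr_ge0// sqrtr_ge0.
Qed.

Let gram_sum3 N (a b c : box N -> R) : (1 <= N)%N ->
  gram (@phi N) (fun w => a w + (b w + c w)) (fun w => a w + (b w + c w)) <=
  3 * (gram (@phi N) a a + gram (@phi N) b b + gram (@phi N) c c).
Proof.
move=> N1; have [gv phi0 _] := hphi N1.
have h1 := gram_ge0 gv phi0 (fun w => a w - b w).
have h2 := gram_ge0 gv phi0 (fun w => a w - c w).
have h3 := gram_ge0 gv phi0 (fun w => b w - c w).
rewrite !gramBl !gramBr in h1 h2 h3; rewrite !gramDl !gramDr.
rewrite (gramC _ b a) in h1 *; rewrite (gramC _ c a) in h2 *; rewrite (gramC _ c b) in h3 *.
lra.
Qed.

(** The difference splits into a change of domain for [u], the passage from [u] to [v] in the common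
    domain [D], and a change of domain for [v]. Each has variance at most [delta / 9 * ln N], and
    [gram_sum3] costs another factor 3. *)
Lemma level_mean_close lam eps delta : 0 < lam < 1 -> 0 < eps -> 0 < delta ->
  exists N0, forall N, (N0 <= N)%N -> forall (u v : box N) (i j : int),
  point u = ((point v).1 + 2 * i, (point v).2 + 2 * j) ->
  `|i|%:~R <= N%:R `^ (1 - lam - eps) :> R -> `|j|%:~R <= N%:R `^ (1 - lam - eps) :> R ->
  gram (@phi N) (fun w => level_mean lam u w - level_mean lam v w)
       (fun w => level_mean lam u w - level_mean lam v w) <= delta * ln N%:R.
Proof.
move=> /andP[l0 l1] e0 d0.
have d9 : 0 < delta / 9 by rewrite divr_gt0.
have [N0 hN0] := level_variance_le d9; have [N1 hN1] := green_level_upper (@ltr01 R).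
(* The bound 1/68 keeps the truncated scales ordered as [q < rho] and [8 * rho <= r]; [400 * eta]
   will bound the oscillation factor, which is at most [24 * 16 * eta + 8 * eta]. *)
have [eta [eta0 eta1 eta2]] : exists eta : R, [/\ 0 < eta, eta <= 68^-1 & eta <= delta / 9 / (2 * 400 * 400)].
  by apply: min_exists; lra.
have e2 : 0 < eps / 2 by rewrite divr_gt0.
have [N2 hN2] := powR_nat_small e2 eta0.
have l1' : 0 < 1 - lam by rewrite subr_gt0.
have [N3 hN3] := powR_nat_small l1' eta0.
exists (maxn 1 (maxn N0 (maxn N1 (maxn N2 N3)))) => N; rewrite !geq_max.
move=> /and5P[Npos /hN0 vle /hN1 up /hN2 se /hN3 sl] u v i j uv hi hj.
have [gv phi0 _] := hphi Npos.
have lN : 0 <= ln N%:R :> R by rewrite ln_ge0// ler1n.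
have l01 : 0 <= lam <= 1 by rewrite !ltW.
set s := N%:R `^ (- (eps / 2)) in se.
have s0 : 0 < s by rewrite powR_gt0// ltr0n.
pose Y : R := N%:R `^ (1 - lam); have Y0 : 0 < Y by rewrite powR_gt0// ltr0n.
have Yeta : 1 <= eta * Y.
  by move: sl; rewrite powRN -/Y -ler_pdivrMr// mul1r.
have Ys2 : N%:R `^ (1 - lam - eps) = Y * s ^+ 2 :> R.
  by rewrite /Y /s !powR_nat// -expRM_natl -expRD; congr expR; rewrite -mulr_natl; field.
rewrite Ys2 in hi hj.
(* Three scales in nearly geometric progression, so that both ratios [q / rho] and [rho / r] are of
   order [s = N ^ (- eps / 2)]. *)
pose q := Num.truncn (Y * s ^+ 2); pose rho := (Num.truncn (Y * s)).+1; pose r := Num.truncn (Y / 4).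
have sY : 0 <= Y * s by apply: mulr_ge0; exact: ltW.
have s2Y : 0 <= Y * s ^+ 2 by rewrite mulr_ge0 ?sqr_ge0// ltW.
have ss : s ^+ 2 <= eta * s by rewrite expr2 ler_wpM2r// ltW.
have Yss : Y * s ^+ 2 <= eta * (Y * s) by rewrite [leRHS]mulrCA; apply: ler_wpM2l => //; exact: ltW.
have Yse : Y * s <= eta * Y by rewrite mulrC ler_wpM2r// ltW.
have eY : 68 * (eta * Y) <= Y by rewrite mulrA ler_piMl ?(ltW Y0)//; lra.
have eYs : 68 * (eta * (Y * s)) <= Y * s by rewrite mulrA ler_piMl//; lra.
have qle : q%:R <= Y * s ^+ 2 by rewrite truncn_le.
have rhog : Y * s < rho%:R by exact: truncnS_gt.
have rhole : rho%:R <= Y * s + 1 by rewrite /rho -natr1 lerD2r truncn_le.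
have rle : r%:R <= Y / 4 by rewrite truncn_le// divr_ge0// ltW.
have rg : Y / 4 - 1 < r%:R by rewrite ltrBlDr natr1; exact: truncnS_gt.
have qrho : (q < rho)%N by rewrite -(ltr_nat R); lra.
have rhor : (8 * rho <= r)%N by rewrite -(ler_nat R) natrM; lra.
have toint (z : int) : `|z|%:~R <= Y * s ^+ 2 -> `|z| <= q%:Z.
  move=> h; apply: absz_lt_le; rewrite -(ltr_nat R); apply: (le_lt_trans _ (truncnS_gt _)).
  by apply: le_trans h; rewrite -[leLHS]/((`|z|%N%:Z)%:~R) abszE.
have iq := toint _ hi; have jq := toint _ hj.
have u1E : (point u).1 - (point v).1 = 2 * i by rewrite uv /=; ring.
have u2E : (point u).2 - (point v).2 = 2 * j by rewrite uv /=; ring.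
have dbl (z : int) : `|z|%:~R <= Y * s ^+ 2 -> `|2 * z|%:~R <= Y / 8.
  by rewrite normrM (ger0_norm (ler0n _ 2)) intrM => h; lra.
pose D x := level N lam (point v) x && level N lam (point u) x.
have DN x : D x -> interior N x by move=> /andP[/level_interior].
have inD y : interior N y -> `|y.1 - (point v).1| < r%:Z -> `|y.2 - (point v).2| < r%:Z -> D y.
  move=> yN h1 h2; rewrite /D /level yN (gt_eqF l0) -/Y !andTb !orFb.
  have near (b : int) (a : int) (z : int) : `|a - b| < r%:Z -> `|z|%:~R <= Y * s ^+ 2 ->
      `|a - (b + 2 * z)|%:~R + 1 <= Y / 2.
    by move=> /(int_shift R z) ab /dbl zs; lra.
  have nv (b : int) (a : int) : `|a - b| < r%:Z -> `|a - b|%:~R + 1 <= Y / 2.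
    by move=> h; rewrite -{1}[b]addr0 -(mulr0 2) near// normr0.
  have un1 : (point u).1 = (point v).1 + 2 * i by rewrite uv.
  have un2 : (point u).2 = (point v).2 + 2 * j by rewrite uv.
  by rewrite un1 un2 (nv _ _ h1) (nv _ _ h2) (near _ _ _ h1 hi) (near _ _ _ h2 hj).
have I2 (b : box N) : gram (@phi N) (residual (@phi N) (interior N) b) (residual (@phi N) (interior N) b) <= 2 * ln N%:R.
  rewrite (gram_residual (hphi Npos))//.
  have [bN|bN] := boolP (interior N (point b)); last first.
    by rewrite (green_in_out hW (hphi Npos))// mulr_ge0.
  have l001 : 0 <= (0 : R) <= 1 by rewrite lexx ler01.
  have := up b 0 (interior N) l001 _ (point b) bN.
  rewrite /lattice_sub !subrr log_kernel0 !subr0 => h; apply: le_trans (h _) _.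
    by move=> x xN; rewrite /level xN eqxx.
  by rewrite ler_wpM2r//; lra.
have h2 := mean_oscillation Npos DN I2 (ltn0Sn _) qrho rhor iq jq uv inD.
have rp : 0 < r%:R :> R by lra.
have rhop : 0 < rho%:R :> R by lra.
have c0 : 0 <= 24 * rho%:R / r%:R + 8 * q%:R / rho%:R :> R.
  by rewrite addr_ge0// divr_ge0// mulr_ge0.
have c1 : 24 * rho%:R / r%:R + 8 * q%:R / rho%:R <= 400 * eta.
  have a1 : rho%:R / r%:R <= 16 * eta by rewrite ler_pdivrMr//; nra.
  have a2 : q%:R / rho%:R <= eta by rewrite ler_pdivrMr//; nra.
  by rewrite -!mulrA; lra.
have c2 : (24 * rho%:R / r%:R + 8 * q%:R / rho%:R) ^+ 2 * (2 * ln N%:R) <= delta / 9 * ln N%:R.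
  have : (24 * rho%:R / r%:R + 8 * q%:R / rho%:R) ^+ 2 <= (400 * eta) ^+ 2.
    exact: sqr_le.
  move=> h; rewrite mulrA ler_wpM2r//.
  have : eta * eta <= delta / 9 / (2 * 400 * 400) by rewrite -[leRHS]mul1r ler_pM ?(ltW eta0)//; lra.
  by move: h; rewrite exprMn expr2; lra.
have DA x : D x -> level N lam (point v) x by case/andP.
have DU x : D x -> level N lam (point u) x by case/andP.
have hv := vle v lam lam D (ltW l0) (lexx _) (ltW l1) DA.
have hu := vle u lam lam D (ltW l0) (lexx _) (ltW l1) DU.
rewrite subrr add0r -/Y in hv hu.
have b1 : `|(point u).1 - (point v).1|%:~R <= Y / 8 by rewrite u1E; exact: dbl.
have b2 : `|(point u).2 - (point v).2|%:~R <= Y / 8 by rewrite u2E; exact: dbl.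
have {}hv : G N (level N lam (point v)) v (point v) - G N D v (point v) <= delta / 9 * ln N%:R.
  by apply: hv => x lx; rewrite /D lx /= => ux; exists (point u).
have {}hu : G N (level N lam (point u)) u (point u) - G N D u (point u) <= delta / 9 * ln N%:R.
  apply: hu => x lx; rewrite /D lx andbT => vx; exists (point v).
  by split => //; rewrite distrC.
rewrite -(gram_residual_diff (hphi Npos)) in hv; [|exact: level_interior|exact: DA].
rewrite -(gram_residual_diff (hphi Npos)) in hu; [|exact: level_interior|exact: DU].
have gopp a b : gram (@phi N) (fun w => a w - b w) (fun w => a w - b w) =
    gram (@phi N) (fun w => b w - a w) (fun w => b w - a w).
  by rewrite !gramBl !gramBr; ring.
rewrite gopp in hu.
have -> : (fun w => level_mean lam u w - level_mean lam v w) = (fun w =>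
    (residual (@phi N) D u w - residual (@phi N) (level N lam (point u)) u w) +
    (mean_diff D u v w + (residual (@phi N) (level N lam (point v)) v w - residual (@phi N) D v w))).
  by apply/funext => w; rewrite /level_mean /mean_diff; ring.
apply: (le_trans (gram_sum3 _ _ _ Npos)).
by move: hu hv (le_trans h2 c2); lra.
Qed.

End level_variances.

(** * Increments of the field *)

Lemma common_threshold (K : nat) (Q : nat -> nat -> Prop) :
  (forall k, (k < K)%N -> exists N0, forall N, (N0 <= N)%N -> Q k N) ->
  exists N0, forall N, (N0 <= N)%N -> forall k, (k < K)%N -> Q k N.
Proof.
elim: K => [|K IH] h; first by exists 0%N.
have [N1 h1] := IH (fun k kK => h k (ltnW kK)).
have [N2 h2] := h K (ltnSn K).
exists (maxn N1 N2) => N; rewrite geq_max => /andP[/h1 {}h1 /h2 {}h2] k.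
by rewrite ltnS leq_eqVlt => /predU1P[->//|]; exact: h1.
Qed.

Lemma int_quadrangle (R : realType) (p q x y : int) : `|x - y| <= 1 ->
  `|p - q|%:~R <= `|x - p|%:~R + 1 + `|y - q|%:~R :> R.
Proof. by move=> xy; rewrite -[1]/(1%:~R) -!intrD ler_int; lia. Qed.

Section gram_sums.
Context {R : realType} d (T : measurableType d) (P : probability T R).
Variables (I : finType) (phi : I -> {RV P >-> R}).
Hypothesis gv : gaussian_vector phi.
Hypothesis phi0 : forall v, ('E_P[phi v] = 0)%E.

Lemma gram_mean_le (a b : I -> R) : gram phi a b <= (gram phi a a + gram phi b b) / 2.
Proof.
have := gram_ge0 gv phi0 (fun w => a w - b w); rewrite gramBl !gramBr (gramC _ b a).
lra.
Qed.

Lemma gram_sub_le (a b : I -> R) : gram phi (fun w => a w - b w) (fun w => a w - b w) <=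
  2 * (gram phi a a + gram phi b b).
Proof.
have := gram_ge0 gv phi0 (fun w => a w + b w).
by rewrite gramBl !gramBr gramDl !gramDr (gramC _ b a); lra.
Qed.

Lemma gram_sum_le K (z : nat -> I -> R) :
  gram phi (fun w => \sum_(k < K) z k w) (fun w => \sum_(k < K) z k w) <=
  K%:R * \sum_(k < K) gram phi (z k) (z k).
Proof.
rewrite gram_suml; under eq_bigr do rewrite gram_sumr.
apply: (@le_trans _ _ (\sum_(j < K) \sum_(k < K) (gram phi (z j) (z j) + gram phi (z k) (z k)) / 2)).
  by apply: ler_sum => j _; apply: ler_sum => k _; exact: gram_mean_le.
under eq_bigr do rewrite -mulr_suml big_split/= sumr_const card_ord.
rewrite -mulr_suml big_split/= sumr_const card_ord sumrMnl.
set S := \sum_(i < K) gram phi (z i) (z i).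
have -> : S *+ K = K%:R * S by rewrite mulr_natl.
lra.
Qed.

Lemma gram_add_le (a b : I -> R) (e : R) : 0 < e ->
  gram phi (fun w => a w + b w) (fun w => a w + b w) <=
  (1 + e) * gram phi a a + (1 + e^-1) * gram phi b b.
Proof.
move=> e0.
have := gram_ge0 gv phi0 (fun w => e * a w - b w); rewrite gramBl !gramBr !gramZl !gramZr.
rewrite gramDl !gramDr (gramC _ b a); move: (gram phi a a) (gram phi a b) (gram phi b b) => x y z h.
have : 0 <= e^-1 * (e * (e * x) - e * y - (e * y - z)) by rewrite mulr_ge0// invr_ge0 ltW.
have -> : e^-1 * (e * (e * x) - e * y - (e * y - z)) = e * x - y - y + e^-1 * z.
  by field; rewrite gt_eqF.
lra.
Qed.

End gram_sums.

Section increments.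
Context {R : realType} dW (TW : measurableType dW).
Variables (PW : lattice -> probability TW R) (W : nat -> TW -> lattice).
Hypothesis hW : forall u, simple_random_walk (PW u) u W.
Variables (d : nat -> measure_display) (T : forall N, measurableType (d N))
  (P : forall N, probability (T N) R)
  (phi : forall N, box N -> {RV (P N) >-> R}).
Hypothesis hphi : forall N, (1 <= N)%N -> GFF PW W (@phi N).
Variables (K : nat) (mu : nat -> R).
Hypothesis mu0 : mu 0%N = 0.
Hypothesis muK : mu K = 1.
Hypothesis mu_lt : forall k, (k < K)%N -> mu k < mu k.+1.
Implicit Types (a : nat -> R).

Local Notation D k := (mu k.+1 - mu k).

Lemma mu_le j k : (j <= k <= K)%N -> mu j <= mu k.
Proof.
move=> /andP[jk kK]; elim: k jk kK => [|k IH]; first by rewrite leqn0 => /eqP ->.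
rewrite leq_eqVlt => /predU1P[->//|jk] kK; rewrite (le_trans (IH jk (ltnW kK)))// ltW//.
exact: mu_lt.
Qed.

Lemma mu_ge0 k : (k <= K)%N -> 0 <= mu k.
Proof. by move=> kK; rewrite -mu0 mu_le. Qed.

Lemma mu_le1 k : (k <= K)%N -> mu k <= 1.
Proof. by move=> kK; rewrite -muK mu_le// kK leqnn. Qed.

Lemma mu_lt1 k : (k < K)%N -> mu k < 1.
Proof. by move=> kK; rewrite (lt_le_trans (mu_lt kK))// mu_le1. Qed.

Lemma mu_gt0 k : (0 < k <= K)%N -> 0 < mu k.
Proof.
case: k => // k /andP[_ kK]; rewrite (le_lt_trans _ (mu_lt kK))// mu_ge0//; exact: ltnW.
Qed.

(** Coefficients of the increment of the conditional mean from level [mu k] to level [mu k.+1]; the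
    sign is reversed because a residual is the field minus its mean. *)
Definition increment N k (v w : box N) : R :=
  residual (@phi N) (level N (mu k) (point v)) v w -
  residual (@phi N) (level N (mu k.+1) (point v)) v w.

Definition comb N a (v w : box N) : R := \sum_(k < K) a k * increment k v w.

Lemma level_sub_mu N j k v x : (1 <= N)%N -> (j <= k <= K)%N ->
  level N (mu k) v x -> level N (mu j) v x.
Proof.
move=> N1 jk; apply: level_sub => //; last exact: mu_le.
by apply: mu_ge0; case/andP: jk; exact: leq_trans.
Qed.

Lemma gram_increment N k (v : box N) : (1 <= N)%N -> (k < K)%N ->
  gram (@phi N) (increment k v) (increment k v) =
  green_in (@phi N) (level N (mu k) (point v)) v (point v) -
  green_in (@phi N) (level N (mu k.+1) (point v)) v (point v).
Proof.
move=> N1 kK; apply: (gram_residual_diff (hphi N1)); first exact: level_interior.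
by move=> x; apply: level_sub_mu => //; rewrite leqnSn.
Qed.

(* The four residuals involved pair to a quantity depending only on the domain around [w]. *)
Lemma gram_increment_nested N j k (v w : box N) : (1 <= N)%N -> (j < K)%N -> (k < K)%N ->
  (forall x, level N (mu k) (point w) x -> level N (mu j.+1) (point v) x) ->
  gram (@phi N) (increment j v) (increment k w) = 0.
Proof.
move=> N1 jK kK kj; have I m u x : level N (mu m) u x -> interior N x by exact: level_interior.
have kj' x : level N (mu k) (point w) x -> level N (mu j) (point v) x.
  by move=> /kj; apply: level_sub_mu; rewrite // leqnSn.
have kk x : level N (mu k.+1) (point w) x -> level N (mu k) (point w) x.
  by apply: level_sub_mu; rewrite // leqnSn.
rewrite gramBl !gramBr !(gram_residual_sub (hphi N1))//; first by ring.
- by move=> x /kk /kj.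
- by move=> x /kk /kj'.
Qed.

Lemma gram_increment_orth N j k (v : box N) : (1 <= N)%N -> (j < K)%N -> (k < K)%N -> j != k ->
  gram (@phi N) (increment j v) (increment k v) = 0.
Proof.
move=> N1; wlog jk : j k / (j < k)%N => [hw|] jK kK jk'.
  have := jk'; rewrite neq_ltn => /orP[jk|kj]; first exact: hw.
  by rewrite gramC; apply: hw; rewrite // eq_sym.
by apply: gram_increment_nested => // x; apply: level_sub_mu; rewrite // jk ltnW.
Qed.

(** Neighbourhoods of half-width below half the distance neither meet nor touch, so all four pairs
    of residuals are orthogonal. The condition [0 < s] excludes level 0, whose neighbourhood is the
    whole box. *)
Lemma gram_increment_disjoint N s j k (v w : box N) : (1 <= N)%N -> (0 < s)%N ->
  (s <= j < K)%N -> (s <= k < K)%N ->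
  N%:R `^ (1 - mu s) < `|(point v).1 - (point w).1|%:~R :> R \/
  N%:R `^ (1 - mu s) < `|(point v).2 - (point w).2|%:~R :> R ->
  gram (@phi N) (increment j v) (increment k w) = 0.
Proof.
move=> N1 s0 /andP[sj jK] /andP[sk kK] far.
have I m u x : level N (mu m) u x -> interior N x by exact: level_interior.
have mus : mu s != 0 by rewrite gt_eqF// mu_gt0// s0 (leq_trans sj)// ltnW.
have nadj x y : level N (mu s) (point v) x -> y = x \/ y \in nbr x -> ~~ level N (mu s) (point w) y.
  move=> /andP[_ lx] xy; apply/negP => /andP[_ ly]; move: lx ly far.
  rewrite (negbTE mus) !orFb; set r := N%:R `^ _.
  move=> /andP[lx1 lx2] /andP[ly1 ly2].
  have [xy1 xy2] : `|x.1 - y.1| <= 1 /\ `|x.2 - y.2| <= 1.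
    case: xy => [->|]; first by rewrite !subrr normr0.
    by rewrite /nbr !inE => /or4P[] /eqP -> /=; lia.
  have := int_quadrangle R (point v).1 (point w).1 xy1.
  have := int_quadrangle R (point v).2 (point w).2 xy2.
  by move=> h2 h1 far; suff : r < r by [rewrite ltxx]; case: far => far; lra.
have dis m n : (s <= m <= K)%N -> (s <= n <= K)%N ->
    gram (@phi N) (residual (@phi N) (level N (mu m) (point v)) v)
      (residual (@phi N) (level N (mu n) (point w)) w) = 0.
  move=> sm sn; apply: (gram_residual_disjoint hW (hphi N1)); try exact: I.
    move=> x lx; apply/negP => ly; move/negP: (nadj x x (level_sub_mu N1 sm lx) (or_introl erefl)).
    by apply; exact: level_sub_mu ly.
  move=> x y lx xy; apply/negP => ly; move/negP: (nadj x y (level_sub_mu N1 sm lx) (or_intror xy)).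
  by apply; exact: level_sub_mu ly.
have sj1 : (s <= j <= K)%N by rewrite sj ltnW.
have sj2 : (s <= j.+1 <= K)%N by rewrite jK leqW.
have sk1 : (s <= k <= K)%N by rewrite sk ltnW.
have sk2 : (s <= k.+1 <= K)%N by rewrite kK leqW.
rewrite gramBl !gramBr (dis _ _ sj1 sk1) (dis _ _ sj1 sk2) (dis _ _ sj2 sk1) (dis _ _ sj2 sk2).
by rewrite !subrr.
Qed.

Lemma gram_comb N a (v : box N) : (1 <= N)%N -> gram (@phi N) (comb a v) (comb a v) =
  \sum_(k < K) a k ^+ 2 * gram (@phi N) (increment k v) (increment k v).
Proof.
move=> N1; rewrite /comb gram_suml; apply: eq_bigr => j _.
rewrite gram_sumr (bigD1 j)//= big1 ?addr0 => [|k kj]; first by rewrite gramZl gramZr; ring.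
by rewrite gramZl gramZr gram_increment_orth ?mulr0// eq_sym.
Qed.

Lemma lin_comb N a (v : box N) t :
  lin (@phi N) (comb a v) t = \sum_(k < K) a k * lin (@phi N) (increment k v) t.
Proof.
rewrite /lin /comb; under eq_bigr do rewrite mulr_suml.
by rewrite exchange_big; apply: eq_bigr => k _; rewrite mulr_sumr; apply: eq_bigr => i _; rewrite mulrA.
Qed.

Lemma increment_variance_le delta : 0 < delta -> exists N0, forall N, (N0 <= N)%N ->
  forall (v : box N) k, (k < K)%N ->
  gram (@phi N) (increment k v) (increment k v) <= (D k + delta) * ln N%:R.
Proof.
move=> d0; have [N0 h] := level_variance_step hW hphi d0; exists (maxn 1 N0) => N.
rewrite geq_max => /andP[N1 /h {}h] v k kK; rewrite gram_increment//; apply: h.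
- exact: mu_ge0 (ltnW kK).
- exact: ltW (mu_lt kK).
- exact: mu_le1.
Qed.

Lemma increment_variance_ge delta : 0 < delta -> exists N0, forall N, (N0 <= N)%N ->
  forall (v : box N) k, bulk v -> (k < K)%N ->
  (D k - delta) * ln N%:R <= gram (@phi N) (increment k v) (increment k v).
Proof.
move=> d0; have [N0 h] := level_variance_ge hW hphi d0; exists (maxn 1 N0) => N.
rewrite geq_max => /andP[N1 /h {}h] v k vb kK; rewrite gram_increment//; apply: h => //.
- exact: mu_ge0 (ltnW kK).
- exact: ltW (mu_lt kK).
- exact: mu_le1.
Qed.

Lemma comb_variance_le a delta : 0 < delta -> exists N0, forall N, (N0 <= N)%N ->
  forall (v : box N), gram (@phi N) (comb a v) (comb a v) <=
  (\sum_(k < K) a k ^+ 2 * D k + delta) * ln N%:R.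
Proof.
move=> d0; set s := \sum_(k < K) a k ^+ 2 + 1.
have s0 : 0 < s by rewrite ltr_wpDl// sumr_ge0// => k _; exact: sqr_ge0.
have [N0 h] := increment_variance_le (divr_gt0 d0 s0); exists (maxn 1 N0) => N.
rewrite geq_max => /andP[N1 /h {}h] v; rewrite gram_comb//.
have lN : 0 <= ln N%:R :> R by rewrite ln_ge0// ler1n.
apply: (@le_trans _ _ (\sum_(k < K) a k ^+ 2 * ((D k + delta / s) * ln N%:R))).
  by apply: ler_sum => k _; rewrite ler_wpM2l ?sqr_ge0// h.
under eq_bigr do rewrite mulrA mulrDr.
rewrite -mulr_suml big_split/= ler_wpM2r// lerD2l -mulr_suml mulrCA -[leRHS]mulr1.
by apply: ler_wpM2l; [exact: ltW|rewrite ler_pdivrMr// mul1r /s lerDl].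
Qed.

Let gram_level_mean0 N (u v : box N) : (1 <= N)%N ->
  gram (@phi N) (fun w => level_mean phi (mu 0) u w - level_mean phi (mu 0) v w)
       (fun w => level_mean phi (mu 0) u w - level_mean phi (mu 0) v w) = 0.
Proof.
move=> N1; rewrite gram_coord big1// => w _.
have [wN|wN] := boolP (interior N (point w)).
  have lw z : level N (mu 0) z (point w) by rewrite /level wN mu0 eqxx.
  by rewrite /level_mean !(residual_in (hphi N1))// /coord !subrr mul0r.
by rewrite gram_potential (potential_out hW (hphi N1))// mulr0.
Qed.

(** As [a] vanishes from [k0] on, only conditional means up to level [mu k0] occur, and these vary
    slowly at distances below [N ^ (1 - mu k0)] by [level_mean_close]. *)
Lemma comb_close a k0 eps delta : (k0 < K)%N -> (forall k, (k0 <= k)%N -> a k = 0) ->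
  0 < eps -> 0 < delta ->
  exists N0, forall N, (N0 <= N)%N -> forall (u v : box N) (i j : int),
  point u = ((point v).1 + 2 * i, (point v).2 + 2 * j) ->
  `|i|%:~R <= N%:R `^ (1 - mu k0 - eps) :> R -> `|j|%:~R <= N%:R `^ (1 - mu k0 - eps) :> R ->
  gram (@phi N) (fun w => comb a u w - comb a v w) (fun w => comb a u w - comb a v w)
  <= delta * ln N%:R.
Proof.
move=> k0K ak0 e0 d0; pose s : R := K%:R * \sum_(k < K) a k ^+ 2 * 4 + 1.
have s0 : 0 < s by rewrite ltr_wpDl// mulr_ge0// sumr_ge0// => k _; rewrite mulr_ge0// sqr_ge0.
pose x N (u v : box N) k w := level_mean phi (mu k) u w - level_mean phi (mu k) v w.
have [N0 h] : exists N0, forall N, (N0 <= N)%N -> forall k, (k < k0.+1)%N -> (1 <= N)%N /\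
    forall (u v : box N) (i j : int),
  point u = ((point v).1 + 2 * i, (point v).2 + 2 * j) ->
  `|i|%:~R <= N%:R `^ (1 - mu k0 - eps) :> R -> `|j|%:~R <= N%:R `^ (1 - mu k0 - eps) :> R ->
  gram (@phi N) (x N u v k) (x N u v k) <= delta / s * ln N%:R.
  apply: common_threshold => -[|k] kk0.
    exists 1%N => N N1; split => // u v i j _ _ _; rewrite gram_level_mean0//.
    by apply: mulr_ge0; [rewrite divr_ge0// ltW|rewrite ln_ge0// ler1n].
  have kK : (k.+1 < K)%N := leq_ltn_trans (kk0 : (k.+1 <= k0)%N) k0K.
  have mk : 0 < mu k.+1 < 1 by rewrite mu_gt0 ?mu_lt1//= ltnW.
  have [N0 h] := level_mean_close hW hphi mk e0 (divr_gt0 d0 s0).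
  exists (maxn 1 N0) => N; rewrite geq_max => /andP[N1 /h {}h]; split => // u v i j uv hi hj.
  have le : N%:R `^ (1 - mu k0 - eps) <= N%:R `^ (1 - mu k.+1 - eps) :> R.
    by rewrite ler_powR ?ler1n// lerD2r lerD2l lerN2 mu_le//; apply/andP; split; [|exact: ltnW].
  by apply: (h u v i j uv); [exact: le_trans hi le|exact: le_trans hj le].
exists N0 => N /h {}h u v i j uv hi hj.
have [N1 _] := h 0%N isT; have [gv phi0 _] := hphi N1.
have lN : 0 <= ln N%:R :> R by rewrite ln_ge0// ler1n.
pose z k w := a k * (x N u v k.+1 w - x N u v k w).
have -> : (fun w => comb a u w - comb a v w) = fun w => \sum_(k < K) z k w.
  apply/funext => w; rewrite /comb -sumrB; apply: eq_bigr => k _.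
  by rewrite /z /x /level_mean /increment; ring.
apply: (le_trans (gram_sum_le gv phi0 K z)).
have zk k : (k < K)%N -> gram (@phi N) (z k) (z k) <= a k ^+ 2 * 4 * (delta / s * ln N%:R).
  move=> kK; have [kk|kk] := leqP k0 k.
    rewrite /z gramZl gramZr ak0// !mul0r mulr_ge0//.
    by apply: mulr_ge0 => //; rewrite divr_ge0// ltW.
  have [_ h1] := h k (ltnW kk); have [_ h2] := h k.+1 kk.
  have {}h1 := h1 _ _ _ _ uv hi hj; have {}h2 := h2 _ _ _ _ uv hi hj.
  rewrite /z gramZl gramZr mulrA -expr2 -mulrA ler_wpM2l ?sqr_ge0//.
  apply: (le_trans (gram_sub_le gv phi0 _ _)); move: h1 h2.
  by move: (gram _ _ _) (gram _ _ _) (delta / s * _) => p q r; lra.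
apply: (@le_trans _ _ (K%:R * \sum_(k < K) (a k ^+ 2 * 4 * (delta / s * ln N%:R)))).
  by rewrite ler_wpM2l//; apply: ler_sum => k _; exact: zk.
rewrite -mulr_suml !mulrA ler_wpM2r// ler_pdivrMr// mulrC ler_wpM2l ?(ltW d0)// /s lerDl//.
Qed.

End increments.

(** * Upper bound *)

Lemma measurable_ge (R : realType) d (T : measurableType d) (f : T -> R) (y : R) :
  measurable_fun setT f -> measurable [set t | y <= f t].
Proof.
move=> mf; rewrite (_ : [set t | _] = setT `&` f @^-1` `[y, +oo[); first exact: mf.
by rewrite setTI; apply/seteqP; split => t /=; rewrite in_itv/= andbT.
Qed.

Section counting.
Context {R : realType} d (T : measurableType d) (P : probability T R) (I : finType).
Variable E : I -> T -> bool.
Hypothesis mE : forall i, measurable [set t | E i t].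

Lemma measurable_finset (A : set {set I}) : measurable [set t | A [set i | E i t]%SET].
Proof.
apply: (@countable_preimage _ T {set I} (fun t => [set i | E i t]%SET) A) => B.
rewrite (_ : _ @^-1` _ = \bigcap_(i in setT) (if i \in B then [set t | E i t] else ~` [set t | E i t])).
  apply: fin_bigcap_measurable => // i _; case: ifP => // _; exact: measurableC.
apply/seteqP; split => t /=.
  by move=> <- i _ /=; rewrite inE; case: ifP => // /negbT/negP.
move=> h; apply/setP => i; rewrite inE; have := h i Logic.I.
by case: ifP => [_ /= ->//|_ /= /negP/negbTE].
Qed.

Lemma count_markov (y p : R) : 0 < y -> (forall i, (P [set t | E i t] <= p%:E)%E) ->
  (P [set t | (y <= #|[set i | E i t]%SET|%:R)%R] <= (#|I|%:R * p / y)%:E)%E.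
Proof.
move=> y0 Ep; pose f t : R := \sum_i (E i t)%:R.
have fE t : #|[set i | E i t]%SET|%:R = f t.
  rewrite /f -sum1_card natr_sum big_mkcond/=; apply: eq_bigr => i _.
  by rewrite inE; case: ifP.
have mi i : measurable_fun setT (fun t => (E i t)%:R : R).
  rewrite (_ : (fun t => _) = \1_[set t | E i t]); first exact: measurable_indic.
  by apply/funext => t; rewrite indicE; congr ((nat_of_bool _)%:R); apply/idP/idP; rewrite inE.
have mf : measurable_fun setT f by exact: measurable_sum.
set S := [set t | _].
have mS : measurable S by exact: (measurable_finset (fun B => y <= #|B|%:R)).
have h : (y%:E * P S <= \sum_i P [set t | E i t])%E.
  have -> : (\sum_i P [set t | E i t] = \int[P]_t (\sum_i ((E i t)%:R)%:E))%E.
    rewrite ge0_integral_sum//; last by move=> i; apply/measurable_EFinP; exact: mi.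
    apply: eq_bigr => i _; rewrite -[E i in LHS]/(E i).
    rewrite -(setIT [set t | E i t]) -(integral_indic P measurableT (mE i)).
    apply: eq_integral => t _; rewrite indicE; congr ((nat_of_bool _)%:R)%:E.
    by apply/idP/idP; rewrite inE.
  have -> : (y%:E * P S = \int[P]_t (y * \1_S t)%:E)%E.
    under eq_integral do rewrite EFinM.
    rewrite ge0_integralZl ?lee_fin ?(ltW y0)//; last first.
      by apply/measurable_EFinP; exact: measurable_indic.
    by rewrite integral_indic// setIT.
  apply: ge0_le_integral => //.
  - by move=> t _; rewrite lee_fin mulr_ge0// ltW.
  - by apply/measurable_EFinP; apply: measurable_funM => //; exact: measurable_indic.
  - by under eq_fun do rewrite sumEFin; apply/measurable_EFinP; exact: mf.
  - move=> t _; rewrite sumEFin lee_fin -/(f t) indicE.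
    have [St|St] := boolP (t \in S); last by rewrite mulr0 sumr_ge0.
    by move: St; rewrite inE mulr1 /S /= fE.
have y0' : (0 < y%:E)%E by rewrite lte_fin.
rewrite -(lee_pmul2l (_ : y%:E \is a fin_num) y0')// (le_trans h)// -EFinM.
have -> : y * (#|I|%:R * p / y) = \sum_(i : I) p.
  by rewrite sumr_const -mulr_natl; field; rewrite gt_eqF.
by rewrite -sumEFin; apply: lee_sum => i _.
Qed.

Lemma union_bound (p : R) : (forall i, (P [set t | E i t] <= p%:E)%E) ->
  (P [set t | exists i, E i t] <= (#|I|%:R * p)%:E)%E.
Proof.
move=> Ep; have := count_markov (@ltr01 R) Ep; rewrite divr1; apply: le_trans.
apply: le_measure; rewrite ?inE.
- rewrite (_ : [set t | _] = [set t | [set i | E i t]%SET != finset.set0]).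
    exact: (measurable_finset (fun B => B != finset.set0)).
  apply/seteqP; split => t /=.
    by move=> [i Ei]; apply/set0Pn; exists i; rewrite inE.
  by move=> /set0Pn[i]; rewrite inE => Ei; exists i.
- exact: (measurable_finset (fun B => 1 <= #|B|%:R)).
- by move=> t /= [i Ei]; rewrite ler1n card_gt0; apply/set0Pn; exists i; rewrite inE.
Qed.

End counting.

Section representatives.
Variables (N q : nat).
Hypothesis q0 : (0 < q)%N.

(** Representatives keep the parity of the coordinate, since [level_mean_close] compares points that
    differ by even vectors. *)
Definition rep_coord (p : 'I_(N %/ q).+1 * bool) : 'I_N.+1 := inord (2 * (q * p.1) + p.2).

Let rep_coordP (x : 'I_N.+1) : exists p (i : nat),
  (i < q)%N /\ (x : nat) = (rep_coord p + 2 * i)%N.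
Proof.
have xN : (x <= N)%N by rewrite -ltnS.
have lt : (x./2 %/ q < (N %/ q).+1)%N.
  by rewrite ltnS leq_div2r// (leq_trans _ xN)//; lia.
have e := divn_eq x./2 q; have r := ltn_pmod x./2 q0.
exists (Ordinal lt, odd x), (x./2 %% q)%N; split => //.
rewrite /rep_coord inordK /=; last first.
  by rewrite ltnS (leq_trans _ xN)//; have := odd_double_half x; nia.
by have := odd_double_half x; nia.
Qed.

Definition rep (p : ('I_(N %/ q).+1 * bool) * ('I_(N %/ q).+1 * bool)) : box N :=
  (rep_coord p.1, rep_coord p.2).

Lemma repP (v : box N) : exists p (i j : nat), [/\ (i < q)%N, (j < q)%N &
  point v = ((point (rep p)).1 + 2 * i%:Z, (point (rep p)).2 + 2 * j%:Z)].
Proof.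
case: v => x y; have [p [i [iq xE]]] := rep_coordP x; have [p' [j [jq yE]]] := rep_coordP y.
exists (p, p'), i, j; split => //; rewrite /point /=; congr (_, _); lia.
Qed.

End representatives.

Lemma exp_small (R : realType) (a C eta : R) : 0 < a -> 0 < eta ->
  exists N0, forall N, (N0 <= N)%N -> expR (C - a * ln N%:R) <= eta.
Proof.
move=> a0 e0; have [N0 h] := ln_nat_large ((C - ln eta) / a).
exists N0 => N /h[_]; rewrite ler_pdivrMr// => hN.
by rewrite -[leRHS]lnK ?posrE// ler_expR; lra.
Qed.

Lemma card_box_le (R : realType) N : (1 <= N)%N ->
  #|{: box N}|%:R <= expR (ln 4 + 2 * ln N%:R) :> R.
Proof.
move=> N1; have N0 : 0 < N%:R :> R by rewrite ltr0n.
have -> : ln 4 + 2 * ln N%:R = ln (4 * (N%:R * N%:R)) :> R.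
  by rewrite !lnM ?posrE ?mulr_gt0//; ring.
rewrite lnK ?posrE ?mulr_gt0// card_prod !card_ord -!natrM ler_nat.
nia.
Qed.

(** * Subtraction of coarse fields and Chernoff's inequality *)

Section upper_bound.
Context {R : realType} dW (TW : measurableType dW).
Variables (PW : lattice -> probability TW R) (W : nat -> TW -> lattice).
Hypothesis hW : forall u, simple_random_walk (PW u) u W.
Variables (d : nat -> measure_display) (T : forall N, measurableType (d N))
  (P : forall N, probability (T N) R)
  (phi : forall N, box N -> {RV (P N) >-> R}).
Hypothesis hphi : forall N, (1 <= N)%N -> GFF PW W (@phi N).
Variables (K : nat) (mu : nat -> R).
Hypothesis mu0 : mu 0%N = 0.
Hypothesis muK : mu K = 1.
Hypothesis mu_lt : forall k, (k < K)%N -> mu k < mu k.+1.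
Variables (sg b : nat -> R) (kp : nat) (c : R).
Hypothesis b0 : forall k, (k < K)%N -> 0 < b k.
Hypothesis b_le : forall k, (k.+1 < K)%N -> b k.+1 <= b k.
Hypothesis kpK : (kp < K)%N.
Hypothesis c0 : 0 <= c.
Hypothesis c1 : (0 < kp)%N -> 1 <= c * b kp.-1.

Local Notation D k := (mu k.+1 - mu k).
Local Notation comb := (comb phi K mu).

Hypothesis slope : forall k, (k <= kp)%N -> \sum_(j < k) (sg j / b j) ^+ 2 * D j <= mu k.
Hypothesis slope_eq : \sum_(j < kp) (sg j / b j) ^+ 2 * D j = mu kp.
Hypothesis level_eq : \sum_(j < kp) b j * D j = \sum_(j < kp) sg j ^+ 2 / b j * D j.

Let A := \sum_(j < kp) sg j ^+ 2 / b j * D j.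
Let B := \sum_(kp <= j < K) sg j ^+ 2 * D j.
Let V := mu kp + c ^+ 2 * B.

(** The weights [nu] are the decrements of [w], nonnegative since [b] is nonincreasing and
    [c * b kp.-1 >= 1]. The coarse field [i] has coefficients [sg j / b j] up to [i]; by [slope] its
    variance is about [mu i.+1 * ln N] at most. *)
Let w j := if (j < kp)%N then c * b j else 1.
Let nu i := w i - w i.+1.
Let trunc i j := if (j <= i)%N then sg j / b j else 0.

Let nu_ge0 i : (i < kp)%N -> 0 <= nu i.
Proof.
move=> ik; rewrite /nu /w ik; case: ifPn => [ik'|].
  by rewrite -mulrBr mulr_ge0// subr_ge0 b_le// (leq_trans ik')// ltnW.
rewrite -leqNgt => ki; have ke : kp = i.+1 by apply/eqP; rewrite eqn_leq ki ik.
by rewrite subr_ge0; move: c1; rewrite ke => /(_ isT).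
Qed.

Let sum_nu j : (j < kp)%N -> \sum_(i < kp) nu i * (if (j <= i)%N then 1 else 0) = c * b j - 1.
Proof.
move=> jk; rewrite -(big_mkord xpredT (fun i => nu i * (if (j <= i)%N then 1 else 0))).
rewrite (@big_cat_nat _ _ _ j)//=; last exact: ltnW.
rewrite big_nat big1 ?add0r => [|i /andP[_ ij]]; last by rewrite leqNgt ij mulr0.
rewrite big_nat (eq_bigr nu) => [|i /andP[ji _]]; last by rewrite ji mulr1.
rewrite -big_nat (eq_bigr (fun i => - (w i.+1 - w i))) => [|i _]; last by rewrite opprB.
rewrite sumrN telescope_sumr; last exact: ltnW.
by rewrite /w jk ltnn opprB.
Qed.

(** Abel summation; [level_eq] turns the sum of [b j * D j] into [A]. This is the total height
    removed with the coarse fields. *)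
Let sum_nu_mu : \sum_(i < kp) nu i * mu i.+1 = c * A - mu kp.
Proof.
have abel n : \sum_(i < n) nu i * mu i.+1 = \sum_(j < n) w j * D j - w n * mu n.
  elim: n => [|n IH]; first by rewrite !big_ord0 mu0 mulr0 subr0.
  by rewrite !big_ord_recr /= IH /nu; ring.
rewrite abel /w ltnn mul1r; congr (_ - _); rewrite /A -level_eq mulr_sumr.
by apply: eq_bigr => j _; rewrite ltn_ord mulrA.
Qed.

(** What remains of [c * sg] after subtracting the weighted coarse fields. Its variance is [V], by
    [slope_eq]. *)
Let coeff j := if (j < kp)%N then sg j / b j else c * sg j.

Let coeffE j : (j < K)%N -> c * sg j - \sum_(i < kp) nu i * trunc i j = coeff j.
Proof.
move=> jK; rewrite /coeff /trunc; case: ifPn => [jk|].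
  rewrite (eq_bigr (fun i : 'I_kp => nu i * (if (j <= i)%N then 1 else 0) * (sg j / b j))).
    by rewrite -mulr_suml sum_nu//; field; rewrite gt_eqF// b0.
  by move=> i _; rewrite -mulrA; congr (_ * _); case: ifP => _; rewrite ?mul1r ?mul0r.
rewrite -leqNgt => kj; rewrite big1 ?subr0// => i _.
by rewrite leqNgt (leq_trans (ltn_ord i) kj) mulr0.
Qed.

Let coeff_var : \sum_(j < K) coeff j ^+ 2 * D j = V.
Proof.
rewrite -(big_mkord xpredT (fun j => coeff j ^+ 2 * D j)) (@big_cat_nat _ _ _ kp)//=; last exact: ltnW.
rewrite /V -slope_eq -(big_mkord xpredT (fun j => (sg j / b j) ^+ 2 * D j)); congr (_ + _).
  by rewrite !big_nat; apply: eq_bigr => j /andP[_ jk]; rewrite /coeff jk.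
rewrite /B mulr_sumr !big_nat; apply: eq_bigr => j /andP[kj _].
by rewrite /coeff ltnNge kj /=; ring.
Qed.

Variables (e : R) (e0 : 0 < e).
Let nub := \sum_(i < kp) nu i + 1.
Let nub0 : 0 < nub.
Proof. by rewrite ltr_wpDl// sumr_ge0// => i _; exact: nu_ge0. Qed.
(** Chosen so that the total slack [eps] times the sum of the [nu i] is at most [e / 8]. *)
Let eps := e / (8 * nub).
Let eps0 : 0 < eps. Proof. by rewrite divr_gt0// mulr_gt0. Qed.

(** Coarse field [i] is nearly constant on blocks of this size, of which there are about
    [N ^ (2 * (mu i.+1 + eps))]. *)
Let step N i : nat := (Num.truncn (N%:R `^ (1 - mu i.+1 - eps) : R)).+1.

Let reps N i := ('I_(N %/ step N i).+1 * bool * ('I_(N %/ step N i).+1 * bool))%type.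

Let card_reps N i : (1 <= N)%N -> (i < K)%N ->
  (#|{: reps N i}|%:R : R) <= 16 * expR (2 * (mu i.+1 + eps) * ln N%:R).
Proof.
move=> N1 iK; rewrite !card_prod !card_ord card_bool.
set m := (N %/ step N i).+1; set y := expR ((mu i.+1 + eps) * ln N%:R).
have N0 : 0 < N%:R :> R by rewrite ltr0n.
have lN : 0 <= ln N%:R :> R by rewrite ln_ge0// ler1n.
have my : m%:R <= 2 * y.
  have y1 : 1 <= y.
    by rewrite -[leLHS]expR0 ler_expR mulr_ge0// addr_ge0 ?(ltW eps0)// (mu_ge0 mu0 mu_lt).
  have : (N %/ step N i)%:R <= y.
    have st : N%:R `^ (1 - mu i.+1 - eps) <= (step N i)%:R :> R by exact/ltW/truncnS_gt.
    have st0 : 0 < N%:R `^ (1 - mu i.+1 - eps) :> R by rewrite powR_gt0.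
    have : (N %/ step N i)%:R * N%:R `^ (1 - mu i.+1 - eps) <= N%:R.
      rewrite (le_trans (ler_wpM2l _ st))// -natrM ler_nat; exact: leq_trunc_div.
    rewrite -ler_pdivlMr// => /le_trans; apply; rewrite powR_nat// -expRN.
    rewrite -{1}[N%:R](@lnK R) ?posrE// -expRD ler_expR.
    by rewrite le_eqVlt; apply/orP; left; apply/eqP; ring.
  by rewrite /m -natr1; lra.
have y0 : 0 <= y by exact: expR_ge0.
have -> : expR (2 * (mu i.+1 + eps) * ln N%:R) = y * y by rewrite -expRD; congr expR; ring.
rewrite !natrM.
have : (m%:R : R) * 2 <= 4 * y by lra.
move=> h; have : (m%:R * 2) * (m%:R * 2) <= (4 * y) * (4 * y) :> R by rewrite ler_pM// mulr_ge0.
lra.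
Qed.

Let trunc_sum i : (i < kp)%N -> \sum_(j < K) trunc i j ^+ 2 * D j <= mu i.+1.
Proof.
move=> ik; apply: le_trans (slope ik).
rewrite -(big_mkord xpredT (fun j => trunc i j ^+ 2 * D j)) (@big_cat_nat _ _ _ i.+1)//=; last first.
  by rewrite (leq_trans ik)// ltnW.
rewrite [X in _ + X]big_nat [X in _ + X]big1 ?addr0 => [|j /andP[ij _]]; last first.
  by rewrite /trunc leqNgt ij expr0n mul0r.
rewrite big_nat -(big_mkord xpredT (fun j => (sg j / b j) ^+ 2 * D j)) [leRHS]big_nat.
by apply: ler_sum => j /andP[_ ji]; rewrite /trunc -ltnS ji.
Qed.

Let bad N i (p : reps N i) (t : T N) : bool :=
  (mu i.+1 + eps) * (2 * ln N%:R) <= lin (@phi N) (comb (trunc i) (rep p)) t.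

(** Chernoff with parameter 2 gives about [N ^ (- 2 * mu i.+1 - 7 / 2 * eps)] for one
    representative, against [16 * N ^ (2 * mu i.+1 + 2 * eps)] of them. *)
Let bad_small i (eta : R) : (i < kp)%N -> 0 < eta -> exists N0, forall N, (N0 <= N)%N ->
  (P N [set t | exists p, @bad N i p t] <= eta%:E)%E.
Proof.
move=> ik eta0; have e4 : 0 < eps / 4 by rewrite divr_gt0.
have [N0 h0] := comb_variance_le hW hphi mu0 muK mu_lt (trunc i) e4.
have [N1 h1] := @exp_small R eps (ln 16) eta eps0 eta0.
exists (maxn 1 (maxn N0 N1)) => N; rewrite !geq_max => /and3P[Npos /h0 {}h0 /h1 {}h1].
have [gv phi0 _] := hphi Npos.
have lN : 0 <= ln N%:R :> R by rewrite ln_ge0// ler1n.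
pose p := expR (- 2 * mu i.+1 * ln N%:R - 4 * eps * ln N%:R + eps / 2 * ln N%:R).
apply: (@le_trans _ _ (#|{: reps N i}|%:R * p)%:E).
  apply: union_bound => [r|r]; first exact: measurable_ge (measurable_lin _ _).
  apply: (le_trans (lin_chernoff gv phi0 _ _ (ltr0n R 2))).
  rewrite lee_fin ler_expR.
  have := h0 (rep r); have : \sum_(j < K) trunc i j ^+ 2 * D j * ln N%:R <= mu i.+1 * ln N%:R.
    by rewrite -mulr_suml ler_wpM2r// trunc_sum.
  by rewrite -mulr_suml; move: (gram _ _ _) (\sum_(j < K) _) => g s; lra.
rewrite lee_fin; apply: le_trans h1.
have iK : (i < K)%N by rewrite (leq_trans ik)// ltnW.
rewrite (le_trans (ler_wpM2r (expR_ge0 _) (card_reps Npos iK)))//.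
rewrite [leRHS]expRD lnK ?posrE// -[leLHS]mulrA ler_pM2l// -expRD ler_expR.
have : 0 <= eps * ln N%:R by rewrite mulr_ge0// ltW.
lra.
Qed.

Let repr N i (v : box N) : reps N i := sval (cid (@repP N (step N i) isT v)).

(** The coarse fields are taken at representatives instead of at [v], so that a union bound over
    blocks controls them; [tiltE] isolates the error, which [comb_close] makes small. *)
Let tilt N (v z : box N) : R :=
  c * comb sg v z + \sum_(i < kp) (- nu i) * comb (trunc i) (rep (repr i v)) z.

Let tiltE N (v : box N) : tilt v = fun z =>
  comb coeff v z + \sum_(i < kp) nu i * (comb (trunc i) v z - comb (trunc i) (rep (repr i v)) z).
Proof.
apply/funext => z; rewrite /tilt.
have -> : comb coeff v z = c * comb sg v z - \sum_(i < kp) nu i * comb (trunc i) v z.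
  rewrite /comb; under [X in _ - X]eq_bigr do rewrite mulr_sumr.
  rewrite exchange_big/= mulr_sumr -sumrB; apply: eq_bigr => j _.
  rewrite -coeffE// mulrBl mulrA; congr (_ - _); rewrite mulr_suml.
  by apply: eq_bigr => i _; rewrite mulrA.
rewrite -addrA; congr (_ + _); rewrite -sumrN -big_split/=.
by apply: eq_bigr => i _; ring.
Qed.

Let V_ge0 : 0 <= V.
Proof.
rewrite -coeff_var sumr_ge0// => j _; rewrite mulr_ge0 ?sqr_ge0// subr_ge0 ltW//.
exact: mu_lt.
Qed.

Let tilt_variance : exists N0, forall N, (N0 <= N)%N -> forall v : box N,
  gram (@phi N) (tilt v) (tilt v) <= (V + e / 4) * ln N%:R.
Proof.
have e16 : 0 < e / 16 by rewrite divr_gt0.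
have [N0 h0] := comb_variance_le hW hphi mu0 muK mu_lt coeff e16.
(* The factor [1 + th] raises [V + e / 16] to at most [V + e / 8], which leaves [e / 8] for the
   error term. *)
pose th := e / 16 / (V + e); have Ve : 0 < V + e by rewrite ltr_wpDl.
have th0 : 0 < th by rewrite divr_gt0.
pose s := (1 + th^-1) * (kp%:R * \sum_(i < kp) nu i ^+ 2 + 1).
have ti0 : 0 < th^-1 by rewrite invr_gt0.
have sn0 : 0 <= \sum_(i < kp) nu i ^+ 2 by rewrite sumr_ge0// => i _; exact: sqr_ge0.
have s0 : 0 < s.
  by rewrite mulr_gt0// ?ltr_wpDl// ?mulr_ge0// addr_gt0.
have d0 : 0 < e / 8 / s by rewrite divr_gt0// divr_gt0.
have [N1 h1] : exists N0, forall N, (N0 <= N)%N -> forall i, (i < kp)%N ->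
  forall (u v : box N) (k j : int), point u = ((point v).1 + 2 * k, (point v).2 + 2 * j) ->
  `|k|%:~R <= N%:R `^ (1 - mu i.+1 - eps) :> R -> `|j|%:~R <= N%:R `^ (1 - mu i.+1 - eps) :> R ->
  gram (@phi N) (fun w => comb (trunc i) u w - comb (trunc i) v w)
     (fun w => comb (trunc i) u w - comb (trunc i) v w) <= e / 8 / s * ln N%:R.
  apply: common_threshold => i ik.
  apply: (comb_close hW hphi mu0 muK mu_lt) => //; first exact: leq_ltn_trans kpK.
  by move=> k ki; rewrite /trunc leqNgt ki.
exists (maxn 1 (maxn N0 N1)) => N; rewrite !geq_max => /and3P[Npos /h0 {}h0 /h1 {}h1] v.
have [gv phi0 _] := hphi Npos.
have lN : 0 <= ln N%:R :> R by rewrite ln_ge0// ler1n.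
rewrite tiltE (le_trans (gram_add_le gv phi0 _ _ th0))//.
set z := fun (i : nat) (w : box N) => nu i * (comb (trunc i) v w - comb (trunc i) (rep (repr i v)) w).
have gz : gram (@phi N) (fun w => \sum_(i < kp) z i w) (fun w => \sum_(i < kp) z i w) <=
    kp%:R * ((\sum_(i < kp) nu i ^+ 2) * (e / 8 / s * ln N%:R)).
  apply: (le_trans (gram_sum_le gv phi0 kp z)); rewrite ler_wpM2l//.
  rewrite mulr_suml; apply: ler_sum => i _.
  rewrite /z gramZl gramZr mulrA -expr2 ler_wpM2l ?sqr_ge0//.
  rewrite /repr; case: (cid _) => p /= [a [j [ai ji vE]]].
  have lt (n : nat) : (n < step N i)%N -> `|n%:Z|%:~R <= N%:R `^ (1 - mu i.+1 - eps) :> R.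
    have -> : `|n%:Z| = n%:Z by [].
    by move=> ns; rewrite -[(n%:Z)%:~R]/(n%:R : R) -truncn_ge_nat ?powR_ge0.
  by apply: (h1 i _ v (rep p) a j) => //; exact: lt.
have gc := h0 v; rewrite coeff_var in gc.
have t1 : (1 + th) * gram (@phi N) (comb coeff v) (comb coeff v) <= (V + e / 8) * ln N%:R.
  rewrite (le_trans (ler_wpM2l _ gc)) ?addr_ge0 ?(ltW th0)// mulrA ler_wpM2r//.
  have : th * (V + e / 16) <= e / 16.
    rewrite /th -mulrA mulrC ler_piMl ?(ltW e16)// mulrC ler_pdivrMr// mul1r; lra.
  lra.
have t2 : (1 + th^-1) * gram (@phi N) (fun w => \sum_(i < kp) z i w) (fun w => \sum_(i < kp) z i w) <=
    e / 8 * ln N%:R.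
  have h : 0 <= 1 + th^-1 by rewrite addr_ge0// ltW.
  rewrite (le_trans (ler_wpM2l h gz))// !mulrA ler_wpM2r//.
  have Xs : (1 + th^-1) * kp%:R * (\sum_(i < kp) nu i ^+ 2) <= s.
    by rewrite /s -mulrA [leRHS]mulrDr mulr1 lerDl.
  rewrite ler_pdivrMr// -[leLHS]mulrA [leRHS]mulrC ler_wpM2r// divr_ge0// ltW//.
lra.
Qed.

(** When no coarse field is bad, a high point has tilted value at least [(V - e / 8) * (2 * ln N)].
    Chernoff with parameter 2 bounds this by [N ^ (- 2 * V + e)], and Markov's inequality over fewer
    than [4 * N ^ 2] points (up to equality) leaves the margin [N ^ (- e)]. *)
Lemma upper_tail (eta : R) : 0 < eta -> exists N0, forall N, (N0 <= N)%N ->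
  (P N [set t | (expR ((2 - 2 * V + 2 * e) * ln N%:R) <=
     #|[set v | ((A + c * B) * (2 * ln N%:R) <= lin (@phi N) (comb sg v) t)%R]%SET|%:R)%R]
   <= eta%:E)%E.
Proof.
move=> eta0; have et2 : 0 < eta / 2 by rewrite divr_gt0.
have etk : 0 < eta / 2 / kp.+1%:R by rewrite divr_gt0.
have [N0 h0] := tilt_variance.
have [N1 h1] : exists N0, forall N, (N0 <= N)%N -> forall i, (i < kp)%N ->
   (P N [set t | exists p, @bad N i p t] <= (eta / 2 / kp.+1%:R)%:E)%E.
  by apply: common_threshold => i ik; exact: bad_small.
have [N2 h2] := @exp_small R e (ln 4) (eta / 2) e0 et2.
exists (maxn 1 (maxn N0 (maxn N1 N2))) => N; rewrite !geq_max.
move=> /and4P[Npos /h0 {}h0 /h1 {}h1 /h2 {}h2].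
have [gv phi0 _] := hphi Npos.
have lN : 0 <= ln N%:R :> R by rewrite ln_ge0// ler1n.
pose E (v : box N) t := (V - e / 8) * (2 * ln N%:R) <= lin (@phi N) (tilt v) t.
pose Bd (i : 'I_kp) t := `[< exists p, @bad N i p t >].
have mB i : measurable [set t | Bd i t].
  rewrite (_ : [set t | _] = [set t | [set p | @bad N i p t]%SET != finset.set0]).
    apply: (measurable_finset (E := @bad N i) _ (fun B => B != finset.set0)) => p.
    exact: measurable_ge (measurable_lin _ _).
  apply/seteqP; split => t /=.
    by move=> /asboolP[p bp]; apply/set0Pn; exists p; rewrite inE.
  by move=> /set0Pn[p]; rewrite inE => bp; apply/asboolP; exists p.
have mE v : measurable [set t | E v t] by exact: measurable_ge (measurable_lin _ _).
set y := expR _.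
have mS : measurable [set t | (y <= #|[set v | E v t]%SET|%:R)%R].
  exact: (measurable_finset mE (fun B => y <= #|B|%:R)).
have mBs : measurable [set t | exists i, Bd i t].
  rewrite (_ : [set t | _] = \bigcup_(i in setT) [set t | Bd i t]).
    by apply: fin_bigcup_measurable.
  by apply/seteqP; split => t /=; [move=> [i ?]; exists i|move=> [i _ ?]; exists i].
apply: (@le_trans _ _ (P N ([set t | exists i, Bd i t] `|` [set t | (y <= #|[set v | E v t]%SET|%:R)%R]))).
  apply: le_measure; rewrite ?inE.
  - apply: (measurable_finset (E := fun v t => _ <= lin (@phi N) (comb sg v) t) _ (fun B => y <= #|B|%:R)).
    by move=> v; exact: measurable_ge (measurable_lin _ _).
  - exact: measurableU.
  - move=> t /= yt; have [[i Bi]|nB] := pselect (exists i, Bd i t); [by left; exists i|right].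
    apply: (le_trans yt); rewrite ler_nat subset_leq_card//.
    apply/fintype.subsetP => v; rewrite !inE /E /tilt => hv.
    rewrite linD linZ -(lin_lin (@phi N) (index_enum 'I_kp) (fun i => comb (trunc i) (rep (repr i v)))).
    have le1 : c * ((A + c * B) * (2 * ln N%:R)) <= c * lin (@phi N) (comb sg v) t by rewrite ler_wpM2l.
    have le2 : - \sum_(i < kp) nu i * ((mu i.+1 + eps) * (2 * ln N%:R)) <=
        \sum_(i < kp) - nu i * lin (@phi N) (comb (trunc i) (rep (repr i v))) t.
      rewrite -sumrN; apply: ler_sum => i _; rewrite mulNr lerN2 ler_wpM2l ?nu_ge0//.
      rewrite leNgt; apply/negP => h; apply: nB; exists i; apply/asboolP.
      by exists (repr i v); exact: ltW.
    apply: le_trans (lerD le1 le2).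
    have -> : \sum_(i < kp) nu i * ((mu i.+1 + eps) * (2 * ln N%:R)) =
        (c * A - mu kp + eps * \sum_(i < kp) nu i) * (2 * ln N%:R).
      rewrite -sum_nu_mu mulr_sumr -big_split/= mulr_suml; apply: eq_bigr => i _.
      by ring.
    have en : eps * \sum_(i < kp) nu i <= e / 8.
      rewrite /eps -mulrA mulrC -mulrA ler_pdivlMr//.
      rewrite (_ : _ * 8 = e * ((\sum_(i < kp) nu i) / nub)); last by field; rewrite gt_eqF.
      rewrite ler_piMr ?(ltW e0)// ler_pdivrMr// mul1r /nub lerDl//.
    have -> : c * ((A + c * B) * (2 * ln N%:R)) - (c * A - mu kp + eps * \sum_(i < kp) nu i) * (2 * ln N%:R) =
        (V - eps * \sum_(i < kp) nu i) * (2 * ln N%:R) by rewrite /V; ring.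
    by rewrite ler_wpM2r ?mulr_ge0// lerD2l lerN2.
apply: (le_trans (measureU2 (P N) mBs mS)).
have -> : eta = eta / 2 + eta / 2 by lra.
rewrite EFinD; apply: leeD.
  apply: (le_trans (union_bound mB (p := eta / 2 / kp.+1%:R) _)).
    move=> i; rewrite (_ : [set t | Bd i t] = [set t | exists p, @bad N i p t]); first exact: h1.
    by apply/seteqP; split => t /asboolP.
  rewrite lee_fin card_ord mulrC mulrAC ler_pdivrMr// ler_wpM2l ?(ltW et2)//.
  by rewrite ler_nat.
have y0 : 0 < y by exact: expR_gt0.
pose p := expR ((- 2 * V + e) * ln N%:R).
apply: (le_trans (count_markov mE y0 (p := p) _)).
  move=> v; apply: (le_trans (lin_chernoff gv phi0 _ _ (ltr0n R 2))).
  rewrite lee_fin ler_expR; have := h0 v; move: (gram _ _ _) => g; lra.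
rewrite lee_fin; apply: le_trans h2.
have cb := card_box_le R Npos.
apply: (@le_trans _ _ (expR (ln 4 + 2 * ln N%:R) * p / y)).
  apply: ler_wpM2r; first by rewrite invr_ge0 ltW.
  by apply: ler_wpM2r => //; exact: expR_ge0.
rewrite /p /y -expRN -!expRD ler_expR.
lra.
Qed.

End upper_bound.

(** * Lower bound *)

Section second_moment_method.
Context {R : realType} d (T : measurableType d) (P : probability T R) (I : finType).
Variable E : I -> T -> bool.
Hypothesis mE : forall i, measurable [set t | E i t].

Let f t := [set i | E i t]%SET.
Let atom (B : {set I}) := [set t | f t = B].
Let pr (B : {set I}) : R := fine (P (atom B)).

Let matom B : measurable (atom B).
Proof. exact: (measurable_finset mE (fun C => C = B)). Qed.

Let prE B : P (atom B) = (pr B)%:E.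
Proof. by rewrite fineK// fin_num_measure. Qed.

(** The random set of successes has finitely many values, so the moments below become finite sums
    over its atoms. *)
Lemma finset_prob (A : pred {set I}) :
  P [set t | A (f t)] = (\sum_(B | A B) pr B)%:E.
Proof.
have mA : measurable [set t | A (f t)] by exact: (measurable_finset mE (fun B => A B)).
have := integral_indic P measurableT mA; rewrite setIT => <-.
rewrite -sumEFin [RHS]big_mkcond/=.
rewrite (eq_integral (fun t => \sum_B (if A B then \1_(atom B) t else 0)%:E)%E); last first.
  move=> t _; rewrite sumEFin indicE -big_mkcond/=; congr EFin.
  have ind B : \1_(atom B) t = (f t == B)%:R :> R.
    by rewrite indicE; congr ((nat_of_bool _)%:R); apply/idP/eqP; rewrite inE.
  under eq_bigr do rewrite ind.
  have [At|At] := boolP (A (f t)).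
    rewrite mem_set// (bigD1 (f t))//= eqxx big1 ?addr0// => B /andP[_].
    by rewrite eq_sym => /negbTE ->.
  rewrite memNset ?big1//; last exact/negP.
  by move=> B AB; case: eqP => // e; rewrite e AB in At.
rewrite ge0_integral_sum//; last 2 first.
- by move=> B; case: (A B) => //; apply/measurable_EFinP; exact: measurable_indic.
- by move=> B t _; case: (A B).
apply: eq_bigr => B _; case: (A B); last by rewrite integral0.
by have := integral_indic P measurableT (matom B); rewrite setIT => ->; exact: prE.
Qed.

Let pr_ge0 B : 0 <= pr B.
Proof. by rewrite fine_ge0. Qed.

Let sum_pr : \sum_B pr B = 1.
Proof.
apply: EFin_inj; rewrite -(finset_prob xpredT).
by rewrite (_ : [set t | _] = setT) ?probability_setT//; apply/seteqP; split.
Qed.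

Variables (S : {set I}) (p : I -> R) (q pmin : R).
Hypothesis S0 : (0 < #|S|)%N.
Hypothesis pE : forall i, i \in S -> fine (P [set t | E i t]) = p i.
Hypothesis pmin0 : 0 < pmin.
Hypothesis pminP : forall i, i \in S -> pmin <= p i.
Hypothesis pairs : \sum_(i in S) \sum_(j in S)
  fine (P [set t | E i t && E j t]) / (p i * p j) <= (1 + q) * #|S|%:R ^+ 2.

Let p0 i : i \in S -> 0 < p i.
Proof. by move=> /pminP; exact: lt_le_trans. Qed.

(** Chebyshev for the count weighted by [1 / p i]: its mean is exactly [#|S|] although the [p i]
    differ, and it is at most the number of successes divided by [pmin]. *)
Lemma second_moment_bound :
  (P [set t | (#|[set i | E i t]%SET|%:R < #|S|%:R / 2 * pmin)%R] <= (4 * q)%:E)%E.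
Proof.
pose n : R := #|S|%:R; have n0 : 0 < n by rewrite ltr0n.
pose Z (B : {set I}) : R := \sum_(i in S) (i \in B)%:R / p i.
have Ei i : fine (P [set t | E i t]) = \sum_B pr B * (i \in B)%:R.
  rewrite (_ : [set t | E i t] = [set t | i \in f t]).
    rewrite (finset_prob (fun B => i \in B))/= big_mkcond/=; apply: eq_bigr => B _.
    by case: ifP => _; rewrite ?mulr1 ?mulr0.
  by apply/seteqP; split => t /=; rewrite inE.
have Eij i j : fine (P [set t | E i t && E j t]) = \sum_B pr B * ((i \in B)%:R * (j \in B)%:R).
  rewrite (_ : [set t | E i t && E j t] = [set t | (i \in f t) && (j \in f t)]).
    rewrite (finset_prob (fun B => (i \in B) && (j \in B)))/= big_mkcond/=; apply: eq_bigr => B _.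
    by case: (i \in B); case: (j \in B); rewrite ?mulr1 ?mulr0 ?mul0r.
  by apply/seteqP; split => t /=; rewrite !inE.
have mZ : \sum_B pr B * Z B = n.
  rewrite /Z; under eq_bigr do rewrite mulr_sumr.
  rewrite exchange_big/= /n -sum1_card natr_sum; apply: eq_bigr => i iS.
  transitivity ((\sum_B pr B * (i \in B)%:R) / p i).
    by rewrite mulr_suml; apply: eq_bigr => B _; rewrite mulrA.
  by rewrite -Ei pE// divff// lt0r_neq0// p0.
have mZ2 : \sum_B pr B * Z B ^+ 2 <= (1 + q) * n ^+ 2.
  apply: le_trans pairs; rewrite le_eqVlt; apply/orP; left; apply/eqP.
  under [RHS]eq_bigr do under eq_bigr do rewrite Eij mulr_suml.
  under [RHS]eq_bigr do rewrite exchange_big.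
  rewrite [RHS]exchange_big/=; apply: eq_bigr => B _.
  rewrite /Z expr2 mulr_suml mulr_sumr; apply: eq_bigr => i _.
  rewrite !mulr_sumr; apply: eq_bigr => j _.
  by rewrite invfM; ring.
have var : \sum_B pr B * (Z B - n) ^+ 2 <= q * n ^+ 2.
  have -> : \sum_B pr B * (Z B - n) ^+ 2 =
      \sum_B pr B * Z B ^+ 2 - 2 * n * (\sum_B pr B * Z B) + n ^+ 2 * \sum_B pr B.
    rewrite mulr_sumr mulr_sumr -sumrN -!big_split/=.
    by apply: eq_bigr => B _; ring.
  by rewrite mZ sum_pr; lra.
rewrite (_ : [set t | _] = [set t | (#|f t|%:R < n / 2 * pmin)%R])//.
rewrite (finset_prob (fun B => #|B|%:R < n / 2 * pmin)) lee_fin.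
rewrite -(ler_pM2r (_ : 0 < n ^+ 2)) ?exprn_gt0//.
apply: (@le_trans _ _ (4 * \sum_B pr B * (Z B - n) ^+ 2)); last by rewrite -!mulrA ler_pM2l//.
rewrite big_mkcond mulr_suml mulr_sumr; apply: ler_sum => B _.
case: ifPn => [hB|_]; last first.
  by rewrite mul0r; apply: mulr_ge0 => //; apply: mulr_ge0 => //; exact: sqr_ge0.
rewrite [leRHS]mulrCA; apply: ler_wpM2l => //.
have ZB : Z B <= n / 2.
  apply: (@le_trans _ _ (\sum_(i in S) (i \in B)%:R / pmin)).
    apply: ler_sum => i iS; rewrite ler_wpM2l// lef_pV2 ?posrE ?p0//; exact: pminP.
  rewrite -mulr_suml ler_pdivrMr// (le_trans _ (ltW hB))// -natr_sum ler_nat.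
  apply: (@leq_trans (\sum_(i : I) (i \in B))%N).
    by rewrite big_mkcond; apply: leq_sum => i _; case: (i \in S).
  by rewrite -sum1_card [leqRHS]big_mkcond; apply: leq_sum => i _; case: (i \in B).
have : 0 <= (n - Z B) - n / 2 by lra.
have nz : 0 <= n - Z B by lra.
move=> h; have : 0 <= ((n - Z B) - n / 2) * ((n - Z B) + n / 2) by rewrite mulr_ge0//; lra.
lra.
Qed.

End second_moment_method.

Section lattice_counts.
Context {R : realType} (N : nat).

Let card_near1 (a : 'I_N.+1) (rho : nat) :
  (#|[set x : 'I_N.+1 | (`|(x : nat)%:Z - (a : nat)%:Z| <= rho%:Z)%R]%SET| <= (2 * rho).+1)%N.
Proof.
pose g (x : 'I_N.+1) : 'I_(2 * rho).+1 := inord (x + rho - a).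
rewrite -(card_ord (2 * rho).+1); set X := [set x | _]%SET.
rewrite -(@card_in_imset _ _ g X); first exact: max_card.
move=> x y; rewrite !inE => hx hy /(congr1 val); rewrite /g /= !inordK; [|lia|lia].
by move=> h; apply: val_inj => /=; lia.
Qed.

Lemma card_near (a : box N) (r : R) : 0 <= r ->
  #|[set x : box N | (`|(point x).1 - (point a).1|%:~R <= r) &&
                     (`|(point x).2 - (point a).2|%:~R <= r)]%SET|%:R <= (2 * r + 1) ^+ 2 :> R.
Proof.
move=> r0; pose rho := Num.truncn r.
have rle : rho%:R <= r by rewrite truncn_le.
pose X i := [set x : 'I_N.+1 | `|(x : nat)%:Z - (i : nat)%:Z| <= rho%:Z]%SET.
have sub : [set x : box N | (`|(point x).1 - (point a).1|%:~R <= r) &&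
     (`|(point x).2 - (point a).2|%:~R <= r)]%SET \subset finset.setX (X a.1) (X a.2).
  apply/fintype.subsetP => x; rewrite !inE => /andP[h1 h2].
  have toint (z : int) : `|z|%:~R <= r -> `|z| <= rho%:Z.
    move=> h; apply: absz_lt_le; rewrite -(ltr_nat R); apply: (le_lt_trans _ (truncnS_gt _)).
    by apply: le_trans h; rewrite -[leLHS]/((`|z|%N%:Z)%:~R) abszE.
  by rewrite !toint.
apply: (@le_trans _ _ ((2 * rho).+1 * (2 * rho).+1)%:R).
  rewrite ler_nat (leq_trans (subset_leq_card sub))// cardsX.
  by apply: leq_mul; exact: card_near1.
rewrite natrM -expr2; apply: sqr_le => //.
by rewrite -natr1 natrM lerD2r ler_pM2l.
Qed.

Lemma card_bulk : (8 <= N)%N -> N%:R ^+ 2 / 64 <= #|[set v : box N | bulk v]%SET|%:R :> R.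
Proof.
(* With [m] a quarter of [N], the square of coordinates from [m + 1] to [2 * m] lies in the bulk,
   and [N <= 8 * m]. *)
move=> N8; have [m [m1 m2]] : exists m, (4 * m <= N)%N /\ (N < 4 * m + 4)%N.
  by exists (N %/ 4)%N; lia.
pose g (x : 'I_m * 'I_m) : box N := (inord (m + x.1.+1), inord (m + x.2.+1)).
have val1 (i : 'I_m) : (inord (m + i.+1) : 'I_N.+1) = (m + i.+1)%N :> nat.
  by rewrite inordK//; have := ltn_ord i; lia.
have gi : injective g.
  move=> [x1 x2] [y1 y2] [] /(congr1 val) /=; rewrite !val1 => h1 /(congr1 val) /=; rewrite !val1 => h2.
  by congr (_, _); apply: val_inj => /=; lia.
have sub : [set g x | x in [set: 'I_m * 'I_m]%SET]%SET \subset [set v : box N | bulk v]%SET.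
  apply/fintype.subsetP => _ /imsetP[[x1 x2] _ ->]; rewrite inE /bulk /g /= !val1.
  by have := ltn_ord x1; have := ltn_ord x2; lia.
have := subset_leq_card sub; rewrite card_imset// cardsT card_prod !card_ord => h.
have m8 : N%:R <= 8 * m%:R :> R by rewrite -natrM ler_nat; lia.
apply: (@le_trans _ _ (m * m)%:R); last by rewrite ler_nat.
rewrite natrM ler_pdivrMr//.
have : N%:R ^+ 2 <= (8 * m%:R) ^+ 2 :> R by exact: sqr_le.
by rewrite exprMn expr2; lra.
Qed.

End lattice_counts.

(** * Second moment of the number of tall points *)

Section lower_bound.
Context {R : realType} dW (TW : measurableType dW).
Variables (PW : lattice -> probability TW R) (W : nat -> TW -> lattice).
Hypothesis hW : forall u, simple_random_walk (PW u) u W.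
Variables (d : nat -> measure_display) (T : forall N, measurableType (d N))
  (P : forall N, probability (T N) R)
  (phi : forall N, box N -> {RV (P N) >-> R}).
Hypothesis hphi : forall N, (1 <= N)%N -> GFF PW W (@phi N).
Variables (K : nat) (mu : nat -> R).
Hypothesis mu0 : mu 0%N = 0.
Hypothesis muK : mu K = 1.
Hypothesis mu_lt : forall k, (k < K)%N -> mu k < mu k.+1.
Variables (y : nat -> R).
Hypothesis y0 : forall k, (k < K)%N -> 0 <= y k.

Local Notation D k := (mu k.+1 - mu k).
Local Notation increment := (increment phi mu).
(** Increment [k] exceeds [y k * (2 * ln N)] with probability about [N ^ (- 2 * cost k)], up to
    arbitrarily small powers of [N]. *)
Let cost k := y k ^+ 2 / D k.

Let D0 k : (k < K)%N -> 0 < D k.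
Proof. by move=> kK; rewrite subr_gt0 mu_lt. Qed.

Let cost0 k : (k < K)%N -> 0 <= cost k.
Proof. by move=> kK; rewrite divr_ge0 ?sqr_ge0// ltW// D0. Qed.

Let q N k (v : box N) : R := fine (P N [set t | (y k * (2 * ln N%:R) <= lin (@phi N) (increment k v) t)%R]).

Let increment_tail1 k delta : (k < K)%N -> 0 < delta -> exists N0, forall N, (N0 <= N)%N ->
  forall v : box N, bulk v -> expR (- (2 * cost k + delta) * ln N%:R) <= q k v.
Proof.
move=> kK d0; have Dk := D0 kK; have ck := cost0 kK.
have c6 : 0 < 6 * cost k + 1 by rewrite ltr_wpDl// mulr_ge0.
(* The parameter [a] separates the shift by one standard deviation in [lin_tail_lower] from the main
   term and also bounds the variance defect; as [a <= 1], the total factor [(1 + a) ^ 2] costs at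
   most [6 * a * cost k]. *)
have [a [a0 a1 a2]] : exists a : R, [/\ 0 < a, a <= 1 & a <= delta / 2 / (6 * cost k + 1)].
  by apply: min_exists => //; rewrite divr_gt0// divr_gt0.
have d1 : 0 < D k * (a / (1 + a)) by rewrite mulr_gt0// divr_gt0// addr_gt0.
have [N0 h0] := increment_variance_ge hW hphi mu0 muK mu_lt d1.
pose C := (1 + a^-1) / 2 + ln (Num.sqrt (pi *+ 2)).
have [N1 h1] := ln_nat_large (Num.max 1 (2 / delta * C)).
exists (maxn 1 (maxn N0 N1)) => N; rewrite !geq_max => /and3P[Npos /h0 {}h0 /h1 [_]].
rewrite ge_max => /andP[l1 lC] v vb; have [gv phi0 _] := hphi Npos.
set l := ln N%:R in l1 lC *; have l0 : 0 < l by lra.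
have := h0 v k vb kK; set g := gram _ _ _ => hg.
have D1 : D k - D k * (a / (1 + a)) = D k / (1 + a) by field; rewrite gt_eqF// addr_gt0.
rewrite D1 in hg.
have Da : 0 < D k / (1 + a) * l by rewrite mulr_gt0// divr_gt0// addr_gt0.
have g0 : 0 < g := lt_le_trans Da hg.
have yk : 0 <= y k * (2 * l) by rewrite !mulr_ge0 ?y0// ltW.
have := lin_tail_lower gv phi0 g0 yk.
rewrite -/(q k v) => tl.
have {tl} : (Num.sqrt (pi *+ 2))^-1 * expR (- (y k * (2 * l) + Num.sqrt g) ^+ 2 / (2 * g)) <= q k v.
  by rewrite -lee_fin /q fineK// fin_num_measure//; exact: measurable_ge (measurable_lin _ _).
apply: le_trans.
have sp : 0 < Num.sqrt (pi *+ 2) :> R by rewrite sqrtr_gt0 mulrn_wgt0// pi_gt0.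
rewrite -[(Num.sqrt (pi *+ 2))^-1]lnK ?posrE ?invr_gt0// lnV ?posrE// -expRD ler_expR.
set z := y k * (2 * l) in yk *; set s := Num.sqrt g.
have s2 : s ^+ 2 = g by rewrite sqr_sqrtr// ltW.
have h2 : (z + s) ^+ 2 / (2 * g) <= (1 + a) * (z ^+ 2 / (2 * g)) + (1 + a^-1) / 2.
  rewrite -subr_ge0.
  have -> : (1 + a) * (z ^+ 2 / (2 * g)) + (1 + a^-1) / 2 - (z + s) ^+ 2 / (2 * g) =
      (a * z - s) ^+ 2 / (a * (2 * g)).
    rewrite -s2; field; rewrite !gt_eqF// sqrtr_gt0//.
  by rewrite divr_ge0 ?sqr_ge0// mulr_ge0 ?(ltW a0)// mulr_ge0// ltW.
have h3 : z ^+ 2 / (2 * g) <= 2 * cost k * (1 + a) * l.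
  rewrite ler_pdivrMr ?mulr_gt0//.
  have -> : z ^+ 2 = 2 * cost k * (1 + a) * l * (2 * (D k / (1 + a) * l)).
    by rewrite /z /cost; field; rewrite !gt_eqF// addr_gt0.
  rewrite ler_wpM2l//; last by rewrite ler_pM2l.
  apply: mulr_ge0; last exact: ltW.
  by apply: mulr_ge0; [rewrite mulr_ge0|rewrite addr_ge0// ltW].
have h4 : (1 + a) * (2 * cost k * (1 + a) * l) <= (2 * cost k + delta / 2) * l.
  rewrite mulrA ler_pM2r//.
  have : a * (6 * cost k + 1) <= delta / 2 by rewrite -ler_pdivlMr.
  have : a * a * cost k <= a * cost k.
    by apply: ler_wpM2r => //; rewrite -[leRHS]mulr1; apply: ler_wpM2l => //; exact: ltW.
  lra.
have h5 : C <= delta / 2 * l.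
  rewrite -(ler_pM2l (_ : 0 < 2 / delta)) ?divr_gt0// (le_trans lC)//.
  by rewrite mulrA (_ : 2 / delta * (delta / 2) = 1) ?mul1r//; field; rewrite gt_eqF.
have h6 : (1 + a) * (z ^+ 2 / (2 * g)) <= (1 + a) * (2 * cost k * (1 + a) * l).
  by rewrite ler_wpM2l// addr_ge0// ltW.
rewrite !mulNr; move: h2 h4 h5 h6; rewrite /C.
move: (_ / (2 * g)) (_ * (_ / (2 * g))) => u1 u2; lra.
Qed.

Let increment_tail delta : 0 < delta -> exists N0, forall N, (N0 <= N)%N ->
  forall k, (k < K)%N -> forall v : box N, bulk v -> expR (- (2 * cost k + delta) * ln N%:R) <= q k v.
Proof. by move=> d0; apply: common_threshold => k kK; exact: increment_tail1. Qed.

(** Increment 0 is excluded: it is correlated even for points at distance of order [N], and imposing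
    it would multiply the ratio for most pairs by a power of [N]. *)
Let evs : seq 'I_K := [seq k : 'I_K <- enum 'I_K | (0 < k)%N].

Definition tall N (v : box N) (t : T N) : bool :=
  all (fun k : 'I_K => y k * (2 * ln N%:R) <= lin (@phi N) (increment k v) t) evs.

Lemma measurable_tall N (v : box N) : measurable [set t | tall v t].
Proof. exact: measurable_rays. Qed.

Let tall_prob N (v : box N) : (1 <= N)%N ->
  fine (P N [set t | tall v t]) = \prod_(k < K | (0 < k)%N) q k v.
Proof.
move=> N1; have [gv phi0 _] := hphi N1.
have orth : {in evs &, forall j k : 'I_K, j != k -> gram (@phi N) (increment j v) (increment k v) = 0}.
  by move=> j k _ _ jk; exact: (gram_increment_orth hphi mu0 mu_lt).
have uq : uniq evs by exact: filter_uniq (enum_uniq _).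
rewrite (lin_indep gv phi0 (fun k : 'I_K => y k * (2 * ln N%:R)) uq orth).
by rewrite big_filter big_enum_cond.
Qed.

Let close N s (v w : box N) : bool :=
  (`|(point w).1 - (point v).1|%:~R <= N%:R `^ (1 - mu s)) &&
  (`|(point w).2 - (point v).2|%:~R <= N%:R `^ (1 - mu s)).

(** The finest level at which the points are still close; two points of the box are always close at
    level 0, the generic case. *)
Let sep N (v w : box N) : 'I_K.+1 := [arg max_(s > ord0 | close s v w) (s : nat)].

Let sepP N (v w : box N) : (1 <= N)%N -> close (sep v w) v w /\
  forall s, (sep v w < s <= K)%N -> ~~ close s v w.
Proof.
move=> N1; rewrite /sep; case: arg_maxnP => [|s cs smax].
  have bd (a b : 'I_N.+1) : `|(a : nat)%:Z - (b : nat)%:Z|%:~R <= N%:R `^ (1 - mu 0) :> R.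
    have := ltn_ord a; have := ltn_ord b; rewrite mu0 subr0 powRr1 ?ler0n// => h1 h2.
    by rewrite -[leRHS]/((N%:Z)%:~R) ler_int; lia.
  by rewrite /close !bd.
split => // s' /andP[ss sK]; apply/negP => cs'.
have sK' : (s' < K.+1)%N by [].
by have := smax (Ordinal sK') cs'; rewrite /= leqNgt ss.
Qed.

(** Constraints kept in the joint event: those of [w] finer than the separation level [s], and all
    those of [v] except at [s.-1] and [s], where the domains around [v] and [w] may overlap without
    being nested. Flag [true] stands for [w]. *)
Let sel s (x : 'I_K * bool) : bool :=
  if x.2 then (s < x.1)%N else [&& (0 < x.1)%N, x.1 != s :> nat & x.1.+1 != s].

Let qx N (v w : box N) (x : 'I_K * bool) : R := q x.1 (if x.2 then w else v).

Let pair_orth : exists N0, forall N, (N0 <= N)%N -> forall (v w : box N) (x x' : 'I_K * bool),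
  sel (sep v w) x -> sel (sep v w) x' -> x != x' ->
  gram (@phi N) (increment x.1 (if x.2 then w else v)) (increment x'.1 (if x'.2 then w else v)) = 0.
Proof.
(* A factor 3 between consecutive scales lets a level [s] square around [w], displaced from [v] by
   up to its side, fit into the level [s.-1] square around [v]. *)
have [N0 h0] : exists N0, forall N, (N0 <= N)%N -> forall s, (s < K)%N -> N%:R `^ (- D s) <= 3^-1 :> R.
  by apply: common_threshold => s sK; apply: powR_nat_small; [exact: D0|rewrite invr_gt0].
exists (maxn 1 N0) => N; rewrite geq_max => /andP[N1 /h0 {}h0] v w.
have N0' : 0 < N%:R :> R by rewrite ltr0n.
have [cs ns] := sepP v w N1; set s := sep v w in cs ns *.
have mixed (j k : 'I_K) : sel s (j, false) -> sel s (k, true) ->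
    gram (@phi N) (increment j v) (increment k w) = 0.
  rewrite /sel /= => /and3P[j0 js js1] sk.
  have [sj|js2] := ltnP s j.
    apply: (gram_increment_disjoint hW hphi mu0 mu_lt (s := s.+1)) => //.
    - by rewrite sj ltn_ord.
    - by rewrite sk ltn_ord.
    - have := ns s.+1; rewrite ltnSn (leq_trans sj)//; last exact: ltnW.
      move=> /(_ isT); rewrite /close negb_and -!ltNge.
      by move=> /orP[h|h]; [left|right]; rewrite distrC.
  have js3 : (j.+2 <= s)%N by move: js2 js js1; rewrite -/s; lia.
  have sK : (s <= K)%N by rewrite -ltnS ltn_ord.
  have s0 : (0 < s)%N by rewrite (leq_trans _ js3).
  apply: (gram_increment_nested hphi mu0 mu_lt) => // x.
  have pos m : (0 < m <= K)%N -> mu m == 0 = false by move=> h; rewrite gt_eqF// (mu_gt0 mu0 mu_lt).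
  rewrite /level => /andP[-> /=].
  rewrite !pos ?ltn_ord// ?(leq_ltn_trans _ sk) ?(ltnW (ltn_ord k))// !orFb.
  have step : 3 * N%:R `^ (1 - mu s) <= N%:R `^ (1 - mu j.+1) :> R.
    have := h0 s.-1; rewrite (leq_trans _ sK) ?prednK// => /(_ isT) h.
    have hl : N%:R `^ (1 - mu s) = N%:R `^ (1 - mu s.-1) * N%:R `^ (- (mu s - mu s.-1)) :> R.
      by rewrite !powR_nat// -expRD; congr expR; ring.
    have hm : N%:R `^ (1 - mu s.-1) <= N%:R `^ (1 - mu j.+1) :> R.
      rewrite ler_powR ?ler1n// lerD2l lerN2 (mu_le mu_lt)//.
      by rewrite -ltnS prednK// js3 (leq_trans _ sK)// leq_pred.
    apply: le_trans hm; rewrite hl mulrCA ler_piMr ?powR_ge0//.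
    by rewrite -ler_pdivlMl// mulr1.
  have le : N%:R `^ (1 - mu k) <= N%:R `^ (1 - mu s) :> R.
    by rewrite ler_powR ?ler1n// lerD2l lerN2 (mu_le mu_lt)// ltnW ?(ltnW (ltn_ord k)).
  have tri (a b c : int) : `|a - c|%:~R <= `|a - b|%:~R + `|b - c|%:~R :> R.
    by rewrite -intrD ler_int (ler_distD b).
  case/andP: cs => cs1 cs2 /andP[h1 h2].
  have t1 := tri x.1 (point w).1 (point v).1; have t2 := tri x.2 (point w).2 (point v).2.
  by apply/andP; split; lra.
move=> [j [|]] [k [|]] /= sj sk jk.
- apply: (gram_increment_orth hphi mu0 mu_lt) => //.
  by apply: contraNneq jk => /val_inj ->.
- by rewrite gramC; exact: mixed.
- exact: mixed.
- apply: (gram_increment_orth hphi mu0 mu_lt) => //.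
  by apply: contraNneq jk => /val_inj ->.
Qed.

Let pair_prob : exists N0, forall N, (N0 <= N)%N -> forall v w : box N,
  fine (P N [set t | tall v t && tall w t]) <= \prod_(x | sel (sep v w) x) qx v w x.
Proof.
have [N0 h0] := pair_orth; exists (maxn 1 N0) => N.
rewrite geq_max => /andP[N1 /h0 {}h0] v w; have [gv phi0 _] := hphi N1.
pose js := [seq x <- enum {: 'I_K * bool} | sel (sep v w) x].
pose a (x : 'I_K * bool) := increment x.1 (if x.2 then w else v).
pose yx (x : 'I_K * bool) := y x.1 * (2 * ln N%:R).
have -> : \prod_(x | sel (sep v w) x) qx v w x =
    \prod_(x <- js) fine (P N [set t | (yx x <= lin (@phi N) (a x) t)%R]).
  by rewrite big_filter big_enum_cond.
have orth : {in js &, forall x x', x != x' -> gram (@phi N) (a x) (a x') = 0}.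
  by move=> x x'; rewrite !mem_filter => /andP[sx _] /andP[sx' _]; exact: h0.
have uq : uniq js by exact: filter_uniq (enum_uniq _).
rewrite -(lin_indep gv phi0 yx uq orth).
have m2 : measurable [set t | all (fun x => yx x <= lin (@phi N) (a x) t) js] by exact: measurable_rays.
have m1 : measurable [set t | tall v t && tall w t].
  rewrite (_ : [set t | _] = [set t | tall v t] `&` [set t | tall w t]).
    by apply: measurableI; exact: measurable_tall.
  by apply/seteqP; split => t /=; [move/andP|move=> [-> ->]].
rewrite fine_le ?fin_num_measure//; apply: le_measure; rewrite ?inE// => t /= /andP[/allP tv /allP tw].
apply/allP => -[k b]; rewrite mem_filter => /andP[sx _].
have k0 : (0 < k)%N.
  by move: sx; rewrite /sel /=; case: b => [|/and3P[]//]; exact: leq_ltn_trans.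
have ke : k \in evs by rewrite mem_filter k0 mem_enum.
by rewrite /yx /a /=; case: b sx => _; [exact: tw|exact: tv].
Qed.

Variables (r2 h : R).
Hypothesis K1 : (1 <= K)%N.
Hypothesis h0 : 0 <= h.
Hypothesis r21 : r2 <= 1.
Hypothesis slope : forall s, (s <= K)%N -> \sum_(k < s | (0 < k)%N) cost k <= r2 * mu s.
Hypothesis mesh : forall k, (0 < k < K)%N -> cost k <= h.
Hypothesis gap : 3 * h < mu 1 * (1 - r2).

(** The constraints dropped by [sel]; they determine the loss in [pair_ratio]. Nothing is lost when
    [s = 0]. *)
Let rest s (x : 'I_K * bool) : bool := (0 < x.1)%N && ~~ sel s x.

Let rest0 x : rest 0 x = false.
Proof. by case: x => k [|]; rewrite /rest /sel /=; case: (nat_of_ord k) => [|j]. Qed.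

Let sum_single m : \sum_(k < K) (if (k : nat) == m then h else 0) <= h.
Proof.
have [mK|mK] := ltnP m K; last first.
  by rewrite big1// => k _; rewrite ltn_eqF// (leq_trans (ltn_ord k)).
by rewrite (bigD1 (Ordinal mK))//= eqxx big1 ?addr0// => k km; rewrite -val_eqE /= in km; rewrite (negbTE km).
Qed.

(** The three terms [h] come from index [s] for [w] and indices [s] and [s.-1] for [v]; what remains
    is [w] below [s], bounded by [slope]. *)
Let rest_cost s : (s <= K)%N -> \sum_(x | rest s x) cost x.1 <= 3 * h + r2 * mu s.
Proof.
move=> sK; rewrite big_mkcond/=.
pose f (k : 'I_K) := if (0 < k < s)%N then cost k else 0.
pose g m (k : 'I_K) := if (k : nat) == m then h else 0.
have g0 m k : 0 <= g m k by rewrite /g; case: ifP.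
have f0 k : 0 <= f k by rewrite /f; case: ifP => // _; exact: cost0.
apply: (@le_trans _ _ (\sum_(x : 'I_K * bool) (if x.2 then f x.1 + g s x.1 else g s x.1 + g s.-1 x.1))).
  apply: ler_sum => -[k b] _; rewrite /rest /sel /=; case: ifPn => [/andP[k0 hk]|_]; last first.
    by case: b; rewrite addr_ge0.
  have ch : cost k <= h by apply: mesh; rewrite k0 ltn_ord.
  case: b hk => hk.
    have [ks|ks] := ltnP k s; first by rewrite {1}/f k0 ks lerDl.
    have -> : g s k = h by rewrite /g; case: eqP => // ne; move: hk ks ne; lia.
    by rewrite ler_wpDl.
  move: hk; rewrite k0 /= negb_and !negbK => /orP[/eqP ke|/eqP ke].
    have -> : g s k = h by rewrite /g ke eqxx.
    by rewrite ler_wpDr.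
  have -> : g s.-1 k = h by rewrite /g -ke /= eqxx.
  by rewrite ler_wpDl.
rewrite -(pair_bigA _ (fun k b => if b then f k + g s k else g s k + g s.-1 k))/=.
under eq_bigr do rewrite big_bool.
rewrite !big_split/=.
have fs : \sum_(k < K) f k <= r2 * mu s.
  apply: le_trans (slope sK); rewrite (big_ord_widen_cond K (fun k => (0 < k)%N) cost sK).
  by rewrite [leRHS]big_mkcond.
have := sum_single s; have := sum_single s.-1; rewrite -/(g s) -/(g s.-1).
rewrite -!/(\sum_(k < K) _).
move: fs; rewrite /g; move: (\sum_(k < K) f k) (\sum_(k < K) (if _ == s then _ else _)) (\sum_(k < K) (if _ == s.-1 then _ else _)) => a b c.
lra.
Qed.

Let p N (v : box N) : R := \prod_(k < K | (0 < k)%N) q k v.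

Let prodJ N (v w : box N) : p v * p w = \prod_(x : 'I_K * bool | (0 < x.1)%N) qx v w x.
Proof.
transitivity (\prod_(k < K | (0 < k)%N) \prod_(b : bool) qx v w (k, b)).
  rewrite /p -big_split; apply: eq_bigr => k _.
  by rewrite big_bool /qx /= mulrC.
by rewrite pair_big; apply: eq_big => [[k b]|[k b] _] //=; rewrite andbT.
Qed.

Let sel_pos s x : sel s x -> (0 < x.1)%N.
Proof.
by case: x => k [|]; rewrite /sel /=; [exact: leq_ltn_trans|case/and3P].
Qed.

Let pair_ratio delta : 0 < delta -> exists N0, forall N, (N0 <= N)%N -> forall v w : box N,
  bulk v -> bulk w ->
  fine (P N [set t | tall v t && tall w t]) / (p v * p w) <=
  expR ((2 * \sum_(x | rest (sep v w) x) cost x.1 + (\sum_(x | rest (sep v w) x) delta)) * ln N%:R).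
Proof.
move=> d0; have [N0 t0] := increment_tail d0; have [N1 t1] := pair_prob.
exists (maxn N0 N1) => N; rewrite geq_max => /andP[/t0 {}t0 /t1 {}t1] v w vb wb.
set s := (sep v w : nat).
have qpos x : 0 < qx v w x.
  apply: (lt_le_trans (expR_gt0 _) (t0 x.1 (ltn_ord _) _ _)).
  by case: x.2.
have pp : 0 < p v * p w by rewrite prodJ prodr_gt0.
rewrite ler_pdivrMr// (le_trans (t1 v w))// prodJ [X in _ <= _ * X](bigID (sel s))/=.
have -> : \prod_(x : 'I_K * bool | (0 < x.1)%N && sel s x) qx v w x = \prod_(x | sel s x) qx v w x.
  by apply: eq_bigl => x; case: (boolP (sel s x)) => [/sel_pos->|_]; rewrite ?andbF.
rewrite mulrCA -[leLHS]mulr1 ler_pM2l ?prodr_gt0//.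
have one : 1 = expR ((2 * \sum_(x | rest s x) cost x.1 + (\sum_(x | rest s x) delta)) * ln N%:R) *
    \prod_(x | rest s x) expR (- (2 * cost x.1 + delta) * ln N%:R).
  rewrite -expR_sum -expRD -[LHS]expR0; congr expR.
  rewrite -mulr_suml -mulrDl sumrN big_split/= mulr_sumr subrr mul0r//.
rewrite {1}one; apply: ler_wpM2l; first exact: expR_ge0.
apply: ler_prod => x _; rewrite expR_ge0 /= t0 ?ltn_ord//.
by case: x.2.
Qed.

Variables (sg : nat -> R) (gamma tau : R).
Hypothesis sg_ge0 : forall k, (k < K)%N -> 0 <= sg k.
Hypothesis tau0 : 0 < tau.
Hypothesis first : 4 * sg 0 ^+ 2 * mu 1 <= tau ^+ 2.
Hypothesis gain : gamma + tau <= \sum_(k < K | (0 < k)%N) sg k * y k.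

(** Pairs separating at level [s] are a fraction of about [N ^ (- 2 * mu s)] of all pairs, with
    ratio at most about [N ^ (2 * (3 * h + r2 * mu s))]. The net exponent is at most [- 2 * g], the
    worst case being [s = 1]; half of it absorbs the errors [delta]. *)
Let g := mu 1 * (1 - r2) - 3 * h.
Let g0 : 0 < g. Proof. by rewrite subr_gt0. Qed.

Let mu1 : 0 < mu 1. Proof. by rewrite (mu_gt0 mu0 mu_lt). Qed.

Let card_close N s (v : box N) : (1 <= N)%N -> (s <= K)%N ->
  #|[set w | close s v w]%SET|%:R <= 9 * expR ((2 - 2 * mu s) * ln N%:R) :> R.
Proof.
move=> N1 sK; have N0 : 0 < N%:R :> R by rewrite ltr0n.
have r1 : 1 <= N%:R `^ (1 - mu s) :> R by rewrite powR_nat_ge1// subr_ge0 (mu_le1 muK mu_lt).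
apply: (le_trans (card_near v (powR_ge0 _ _))).
have -> : expR ((2 - 2 * mu s) * ln N%:R) = (N%:R `^ (1 - mu s)) ^+ 2.
  by rewrite powR_nat// expr2 -expRD; congr expR; ring.
have : (2 * N%:R `^ (1 - mu s) + 1) ^+ 2 <= (3 * N%:R `^ (1 - mu s)) ^+ 2 :> R.
  by apply: sqr_le; move: r1; set r := N%:R `^ _; lra.
by rewrite exprMn; lra.
Qed.

(** The constant [24 * 24] is 9 times 64: the first from [card_close], the second from [card_bulk],
    which compares [N ^ 2] with the number of bulk points. *)
Let pair_sum : exists N0, forall N, (N0 <= N)%N ->
  \sum_(v in [set v : box N | bulk v]%SET) \sum_(w in [set v : box N | bulk v]%SET)
    fine (P N [set t | tall v t && tall w t]) / (p v * p w) <=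
  (1 + 24 * 24 * K%:R * expR (- g * ln N%:R)) * #|[set v : box N | bulk v]%SET|%:R ^+ 2.
Proof.
have K0 : 0 < K%:R :> R by rewrite ltr0n.
pose delta := g / (2 * K%:R).
have d0 : 0 < delta by rewrite divr_gt0// mulr_gt0.
have [N0 t0] := pair_ratio d0.
exists (maxn 8 N0) => N; rewrite geq_max => /andP[N8 /t0 {}t0].
have N1 : (1 <= N)%N by exact: leq_trans N8.
have lN : 0 <= ln N%:R :> R by rewrite ln_ge0// ler1n.
set S := [set v : box N | bulk v]%SET; set n : R := #|S|%:R.
pose X s := expR ((2 * (3 * h + r2 * mu s) + g) * ln N%:R).
have ratio v w : v \in S -> w \in S ->
    fine (P N [set t | tall v t && tall w t]) / (p v * p w) <=
    1 + \sum_(s < K) (if close s.+1 v w then X s.+1 else 0).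
  rewrite !inE => vb wb; apply: (le_trans (t0 v w vb wb)).
  have rest_delta s : \sum_(x | rest s x) delta <= g.
    rewrite big_mkcond; apply: (@le_trans _ _ (\sum_(x : 'I_K * bool) delta)).
      by apply: ler_sum => x _; case: ifP => // _; exact: ltW.
    rewrite sumr_const card_prod card_ord card_bool -[leLHS]mulr_natr natrM /delta.
    by rewrite mulrC (mulrC K%:R) mulrCA divff ?mulr1// lt0r_neq0// mulr_gt0.
  have [cs _] := sepP v w N1; have : (sep v w <= K)%N by rewrite -ltnS ltn_ord.
  case: (nat_of_ord (sep v w)) cs => [|s] cs sK.
    rewrite (big_pred0 _ _ _ _ rest0) [X in _ + X](big_pred0 _ _ _ _ rest0).
    rewrite mulr0 addr0 mul0r expR0 lerDl sumr_ge0// => s _.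
    by case: ifP => // _; exact: expR_ge0.
  rewrite ler_wpDl// (bigD1 (Ordinal sK))//= cs ler_wpDr//.
    by rewrite sumr_ge0// => i _; case: ifP => // _; exact: expR_ge0.
  by rewrite ler_expR ler_wpM2r// lerD ?rest_delta// ler_pM2l// rest_cost.
have row v : v \in S -> \sum_(w in S) fine (P N [set t | tall v t && tall w t]) / (p v * p w) <=
    n + 9 * K%:R * expR ((2 - g) * ln N%:R).
  move=> vS; apply: (@le_trans _ _ (\sum_(w in S) (1 + \sum_(s < K) (if close s.+1 v w then X s.+1 else 0)))).
    by apply: ler_sum => w wS; exact: ratio.
  rewrite big_split/= sumr_const -/n lerD2l exchange_big/=.
  apply: (@le_trans _ _ (\sum_(s < K) 9 * expR ((2 - g) * ln N%:R))); last first.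
    by rewrite sumr_const card_ord -[leLHS]mulr_natr mulrAC.
  apply: ler_sum => s _.
  apply: (@le_trans _ _ (\sum_(w | close s.+1 v w) X s.+1)).
    rewrite big_mkcond [leRHS]big_mkcond; apply: ler_sum => w _.
    by case: (w \in S); case: ifP => // _; exact: expR_ge0.
  have -> : \sum_(w | close s.+1 v w) X s.+1 = #|[set w | close s.+1 v w]%SET|%:R * X s.+1.
    by rewrite sumr_const mulr_natl; congr (_ *+ _); apply: eq_card => w; rewrite !inE.
  apply: (le_trans (ler_wpM2r (expR_ge0 _) (card_close v N1 (ltn_ord s)))).
  rewrite -mulrA ler_pM2l// -expRD ler_expR -mulrDl ler_wpM2r//.
  have m1 : mu 1 <= mu s.+1 by rewrite (mu_le mu_lt)// ltn_ord.
  have : mu 1 * (1 - r2) <= mu s.+1 * (1 - r2) by rewrite ler_wpM2r// subr_ge0.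
  by rewrite /g; lra.
apply: (@le_trans _ _ (\sum_(v in S) (n + 9 * K%:R * expR ((2 - g) * ln N%:R)))).
  by apply: ler_sum => v; exact: row.
rewrite sumr_const -/n -[leLHS]mulr_natr -/n.
have -> : (1 + 24 * 24 * K%:R * expR (- g * ln N%:R)) * n ^+ 2 =
    (n + 9 * K%:R * (expR (- g * ln N%:R) * (64 * n))) * n by ring.
apply: ler_wpM2r => //; rewrite lerD2l; apply: ler_wpM2l; first by rewrite mulr_ge0// ltW.
have -> : expR ((2 - g) * ln N%:R) = expR (- g * ln N%:R) * N%:R ^+ 2.
  have Ne : expR (ln N%:R) = N%:R :> R by rewrite lnK// posrE ltr0n.
  by rewrite -[in RHS]Ne expRK expr2 -!expRD; congr expR; ring.
apply: ler_wpM2l; first exact: expR_ge0.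
by rewrite mulrC -ler_pdivrMr// card_bulk.
Qed.

(** Increment 0 has variance at most [2 * mu 1 * ln N], so [first] and Chernoff with parameter
    [2 / tau] give [N ^ (- 3)] for one point, against about [N ^ 2] points. *)
Let first_small (eta : R) : 0 < eta -> exists N0, forall N, (N0 <= N)%N ->
  (P N [set t | exists v : box N, (tau * (2 * ln N%:R) <= lin (@phi N) (fun w => - sg 0 * increment 0 v w) t)%R]
   <= eta%:E)%E.
Proof.
move=> eta0.
have [N0 t0] := increment_variance_le hW hphi mu0 muK mu_lt mu1.
have [N1 t1] := @exp_small R 1 (ln 4) eta ltr01 eta0.
exists (maxn 1 (maxn N0 N1)) => N; rewrite !geq_max => /and3P[Npos /t0 {}t0 /t1 {}t1].
have [gv phi0 _] := hphi Npos.
have lN : 0 <= ln N%:R :> R by rewrite ln_ge0// ler1n.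
apply: (@le_trans _ _ (#|{: box N}|%:R * expR (- 3 * ln N%:R))%:E); last first.
  rewrite lee_fin; apply: le_trans t1.
  apply: (le_trans (ler_wpM2r (expR_ge0 _) (card_box_le R Npos))).
  by rewrite -expRD ler_expR; lra.
apply: union_bound => [v|v]; first exact: measurable_ge (measurable_lin _ _).
have t2 : 0 < 2 / tau by rewrite divr_gt0.
apply: (le_trans (lin_chernoff gv phi0 _ _ t2)); rewrite lee_fin ler_expR.
rewrite gramZl gramZr.
have := t0 v 0%N K1; rewrite mu0 subr0; set G := gram _ _ _ => hG.
have -> : (2 / tau) ^+ 2 * (- sg 0 * (- sg 0 * G)) / 2 - 2 / tau * (tau * (2 * ln N%:R)) =
   2 / tau ^+ 2 * sg 0 ^+ 2 * G - 4 * ln N%:R by field; rewrite gt_eqF.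
have s2 : 0 <= 2 / tau ^+ 2 * sg 0 ^+ 2.
  by apply: mulr_ge0; [rewrite divr_ge0// sqr_ge0|exact: sqr_ge0].
have : 2 / tau ^+ 2 * sg 0 ^+ 2 * G <= 1 * ln N%:R.
  apply: (le_trans (ler_wpM2l s2 hG)); rewrite mulrA ler_wpM2r//.
  have -> : 2 / tau ^+ 2 * sg 0 ^+ 2 * (mu 1 + mu 1) = 4 * sg 0 ^+ 2 * mu 1 / tau ^+ 2.
    by field; rewrite gt_eqF.
  by rewrite ler_pdivrMr ?exprn_gt0// mul1r.
lra.
Qed.

(** At a tall point increments 1 and later give at least [gamma + tau] by [gain], and increment 0
    takes away at most [tau]. The factor 1/128, from half of at least [N ^ 2 / 64] points, is
    absorbed by [N ^ (- e / 2)]. *)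
Lemma lower_tail (e eta : R) : 0 < e -> 0 < eta -> exists N0, forall N, (N0 <= N)%N ->
  (P N [set t | (#|[set v | (gamma * (2 * ln N%:R) <= lin (@phi N) (comb phi K mu sg v) t)%R]%SET|%:R <
     expR ((2 - 2 * \sum_(k < K | (0 < k)%N) cost k - e) * ln N%:R))%R] <= eta%:E)%E.
Proof.
move=> e0 eta0; have K0 : 0 < K%:R :> R by rewrite ltr0n.
have et2 : 0 < eta / 2 by rewrite divr_gt0.
have e2 : 0 < e / 2 by rewrite divr_gt0.
pose delta := e / 2 / K%:R; have d0 : 0 < delta by rewrite divr_gt0.
have et3 : 0 < eta / 2 / (4 * (24 * 24 * K%:R)) by rewrite divr_gt0// !mulr_gt0.
have c128 : 0 < 128^-1 :> R by rewrite invr_gt0.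
have [N0 t0] := pair_sum; have [N1 t1] := first_small et2; have [N2 t2] := increment_tail d0.
have [N3 t3] := @exp_small R g 0 _ g0 et3; have [N4 t4] := @exp_small R (e / 2) 0 _ e2 c128.
exists (maxn 8 (maxn N0 (maxn N1 (maxn N2 (maxn N3 N4))))) => N.
rewrite !geq_max => /and5P[N8 /t0 {}t0 /t1 {}t1 /t2 {}t2 /andP[/t3 {}t3 /t4 {}t4]].
have Npos : (1 <= N)%N by exact: leq_trans N8.
have lN : 0 <= ln N%:R :> R by rewrite ln_ge0// ler1n.
set S := [set v : box N | bulk v]%SET in t0.
have cS : N%:R ^+ 2 / 64 <= #|S|%:R :> R by exact: card_bulk.
have NN : 0 < N%:R ^+ 2 :> R by rewrite exprn_gt0// ltr0n.
have S0 : (0 < #|S|)%N by rewrite -(ltr_nat R); apply: lt_le_trans cS; rewrite divr_gt0.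
pose c := \sum_(k < K | (0 < k)%N) cost k.
pose pm := expR (- (2 * c + e / 2) * ln N%:R).
have pmp v : v \in S -> pm <= p v.
  rewrite inE => vb.
  apply: (@le_trans _ _ (\prod_(k < K | (0 < k)%N) expR (- (2 * cost k + delta) * ln N%:R))).
    rewrite -expR_sum ler_expR -mulr_suml ler_wpM2r// sumrN lerN2 big_split/= -mulr_sumr lerD2l.
    rewrite big_mkcond; apply: (@le_trans _ _ (\sum_(k < K) delta)).
      by apply: ler_sum => k _; case: ifP => // _; exact: ltW.
    by rewrite sumr_const card_ord -[leLHS]mulr_natr /delta divfK// lt0r_neq0.
  by apply: ler_prod => k _; rewrite expR_ge0 t2.
have := @second_moment_bound _ _ _ (P N) (box N) (@tall N) (@measurable_tall N) S (@p N) _ pm S0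
  (fun v _ => tall_prob v Npos) (expR_gt0 _) pmp t0.
set bad := [set t | _] => hbad.
set y' := expR _; set E0 := [set t | exists v, _] in t1.
have m0 : measurable E0.
  rewrite (_ : E0 = \bigcup_(v in setT) [set t | tau * (2 * ln N%:R) <= lin (@phi N) (fun w => - sg 0 * increment 0 v w) t]).
    by apply: fin_bigcup_measurable => // v _; exact: measurable_ge (measurable_lin _ _).
  by apply/seteqP; split => t /=; [move=> [i ?]; exists i|move=> [i _ ?]; exists i].
have mb : measurable bad.
  exact: (measurable_finset (@measurable_tall N) (fun B => #|B|%:R < #|S|%:R / 2 * pm)).
apply: (@le_trans _ _ (P N (E0 `|` bad))).
  apply: le_measure; rewrite ?inE.
  - apply: (measurable_finset _ (fun B => #|B|%:R < y')) => v.
    exact: measurable_ge (measurable_lin _ _).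
  - exact: measurableU.
  move=> t /= small; have [|nE] := pselect (E0 t); [by left|right].
  rewrite /bad /=; apply: (@le_lt_trans _ _ (#|[set v | gamma * (2 * ln N%:R) <= lin (@phi N) (comb phi K mu sg v) t]%SET|%:R)).
    rewrite ler_nat subset_leq_card//; apply/fintype.subsetP => v; rewrite !inE => /allP tv.
    rewrite lin_comb.
    have Y0 : - tau * (2 * ln N%:R) <= sg 0 * lin (@phi N) (increment 0 v) t.
      rewrite leNgt; apply/negP => hv; apply: nE; exists v; rewrite linZ; lra.
    have Y k : (k < K)%N -> (0 < k)%N -> sg k * y k * (2 * ln N%:R) <= sg k * lin (@phi N) (increment k v) t.
      move=> kK k0; rewrite -mulrA ler_wpM2l ?sg_ge0//.
      by apply: (tv (Ordinal kK)); rewrite mem_filter k0 mem_enum.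
    rewrite (bigID (fun k : 'I_K => (0 < k)%N))/=.
    have -> : \sum_(k < K | ~~ (0 < k)%N) sg k * lin (@phi N) (increment k v) t =
        sg 0 * lin (@phi N) (increment 0 v) t.
      by rewrite (big_pred1 (Ordinal K1))// => k; rewrite -leqNgt leqn0.
    have : (\sum_(k < K | (0 < k)%N) sg k * y k) * (2 * ln N%:R) <=
        \sum_(k < K | (0 < k)%N) sg k * lin (@phi N) (increment k v) t.
      by rewrite mulr_suml; apply: ler_sum => k k0; exact: Y.
    have : (gamma + tau) * (2 * ln N%:R) <= (\sum_(k < K | (0 < k)%N) sg k * y k) * (2 * ln N%:R).
      by apply: ler_wpM2r => //; rewrite mulr_ge0.
    lra.
  apply: (lt_le_trans small).
  have -> : y' = expR (0 - e / 2 * ln N%:R) * N%:R ^+ 2 * pm.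
    have {2}-> : N%:R = expR (ln N%:R) :> R by rewrite lnK// posrE ltr0n.
    by rewrite expr2 -!expRD /y' -/c; congr expR; field.
  apply: ler_wpM2r; first exact: expR_ge0.
  have := ler_wpM2r (ltW NN) t4; lra.
apply: (le_trans (measureU2 _ _ _)) => //.
rewrite (splitr eta) EFinD leeD//; apply: (le_trans hbad); rewrite lee_fin.
move: t3; rewrite sub0r -mulNr ler_pdivlMr ?mulr_gt0//; lra.
Qed.

End lower_bound.

(** * Grids and the concave hull *)

Section grids.
Context {R : realType}.
Implicit Types (mu u : nat -> R) (f : R -> R).

Lemma step_locate mu i k x : (i <= k)%N -> mu i < x <= mu k ->
  exists j, (i <= j < k)%N /\ mu j < x <= mu j.+1.
Proof.
move=> ik /andP[ix]; elim: k ik => [|k IH] ik xk.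
  by move: ik ix; rewrite leqn0 => /eqP ->; rewrite ltNge xk.
have [xk'|kx] := leP x (mu k); last first.
  exists k; rewrite kx xk ltnSn andbT; split => //.
  by move: ik; rewrite leq_eqVlt => /predU1P[e|//]; move: ix; rewrite e ltNge xk.
move: ik; rewrite leq_eqVlt => /predU1P[e|ik]; first by move: ix; rewrite e ltNge xk.
by have [j [/andP[ij jk] h]] := IH ik xk'; exists j; rewrite ij ltnS (ltnW jk).
Qed.

Definition stepwise K mu f : Prop :=
  forall j x, (j < K)%N -> mu j < x <= mu j.+1 -> f x = f (mu j.+1).

Section integral.
Variables (K : nat) (mu : nat -> R).
Hypothesis mu_lt : forall k, (k < K)%N -> mu k < mu k.+1.

Lemma J_stepwise f i k : (i <= k <= K)%N -> stepwise K mu f ->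
  J f (mu i) (mu k) = \sum_(i <= j < k) f (mu j.+1) * (mu j.+1 - mu j).
Proof.
move=> /andP[ik kK] sf.
pose g x := \sum_(i <= j < k) f (mu j.+1) * \1_(`]mu j, mu j.+1]) x.
have fg x : mu i < x <= mu k -> f x = g x.
  move=> hx; have [j [/andP[ij jk] hj]] := step_locate ik hx.
  have jK := leq_trans jk kK.
  rewrite /g (bigD1_seq j) ?mem_index_iota ?ij ?iota_uniq//= indicE mem_set ?mulr1.
    rewrite big_seq_cond big1 ?addr0; first exact: sf.
    move=> n; rewrite mem_index_iota => /andP[/andP[_ nk] nj].
    rewrite indicE memNset ?mulr0//= in_itv/= => hn.
    have [/andP[l1 l2] /andP[l3 l4]] := (hn, hj).
    have nK := leq_trans nk kK.
    have [h|h] : (n < j \/ j < n)%N by move: nj; rewrite neq_ltn => /orP.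
      have : mu n.+1 <= mu j by rewrite (mu_le mu_lt)// h ltnW.
      by rewrite leNgt (lt_le_trans l3 l2).
    have : mu j.+1 <= mu n by rewrite (mu_le mu_lt)// h ltnW.
    by rewrite leNgt (lt_le_trans l1 l4).
  by rewrite /= in_itv.
have mg : measurable_fun setT g.
  apply: measurable_sum => j; apply: measurable_funM => //; exact: measurable_indic.
rewrite /J /Rintegral -(integral_itv_obnd_cbnd (r := mu i)); last first.
  apply/measurable_EFinP; apply: (@eq_measurable_fun _ _ _ _ _ g).
    by move=> x; rewrite inE /= in_itv => /= hx; rewrite fg.
  exact: measurable_funS mg.
transitivity (fine (\int[lebesgue_measure]_(x in `]mu i, mu k])
    \sum_(i <= j < k) ((f (mu j.+1))%:E * (\1_(`]mu j, mu j.+1]) x)%:E))%E).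
  congr fine; apply: eq_integral => x; rewrite inE /= in_itv => /= hx.
  by rewrite fg// /g -sumEFin.
have mI : measurable (`]mu i, mu k] : set R) by [].
have ii j : (lebesgue_measure : measure _ R).-integrable `]mu i, mu k]
    (fun x => (\1_(`]mu j, mu j.+1]) x)%:E).
  apply/integrableP; split; first exact/measurable_EFinP/measurable_indic.
  under eq_integral do rewrite gee0_abs ?lee_fin//.
  rewrite integral_indic// (le_lt_trans (measureIr _ _ _))//= lebesgue_measure_itv/=.
  by case: ifP; rewrite ?ltry.
rewrite integral_sum//; last by move=> j; exact: integrableZl.
rewrite big_seq (eq_bigr (fun j => (f (mu j.+1) * (mu j.+1 - mu j))%:E)); last first.
  move=> j; rewrite mem_index_iota => /andP[ij jk].
  have jK := leq_trans jk kK.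
  rewrite integralZl// integral_indic// (_ : _ `&` _ = [set` `]mu j, mu j.+1]]); last first.
    apply/setIidPl => x /=; rewrite !in_itv/= => /andP[h1 h2].
    rewrite (le_lt_trans (mu_le mu_lt _) h1) ?ij ?(ltnW jK)//.
    by rewrite (le_trans h2)// (mu_le mu_lt)// jk.
  have e : lebesgue_measure ([set` `]mu j, mu j.+1]] : set R) = (mu j.+1 - mu j)%:E.
    by rewrite lebesgue_measure_itv/= lte_fin mu_lt.
  by rewrite EFinM; congr (_ * _)%E.
by rewrite -big_seq sumEFin.
Qed.

End integral.

Lemma stepwise_refine n u K mu f : (forall k, (k < K)%N -> mu k < mu k.+1) ->
  u 0%N = mu 0%N -> u n = mu K ->
  (forall i, (i <= n)%N -> exists2 k, (k <= K)%N & mu k = u i) ->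
  stepwise n u f -> stepwise K mu f.
Proof.
move=> mu_lt u0 un ref sf j x jK /andP[jx xj].
have hx : u 0%N < x <= u n.
  rewrite u0 un (le_lt_trans _ jx) ?(mu_le mu_lt)//; last exact: ltnW.
  by rewrite (le_trans xj)// (mu_le mu_lt)// jK leqnn.
have [i [/andP[_ ni] /andP[ix xi]]] := step_locate (leq0n n) hx.
have [a aK ea] := ref _ (ltnW ni); have [b bK eb] := ref _ ni.
have aj : (a <= j)%N.
  rewrite leqNgt; apply/negP => ja.
  have : mu j.+1 <= mu a by rewrite (mu_le mu_lt)// ja.
  by rewrite leNgt ea (lt_le_trans ix).
have jb : (j < b)%N.
  rewrite ltnNge; apply/negP => bj.
  have : mu b <= mu j by rewrite (mu_le mu_lt)// bj ltnW.
  by rewrite leNgt eb (lt_le_trans jx).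
have h1 : mu a <= mu j by rewrite (mu_le mu_lt)// aj ltnW.
have h2 : mu j.+1 <= mu b by rewrite (mu_le mu_lt)// jb.
rewrite ea in h1; rewrite eb in h2.
rewrite (sf i x ni) ?ix// (sf i (mu j.+1) ni)// h2 andbT (le_lt_trans h1)//.
exact: mu_lt.
Qed.

Lemma grid_exists (s : seq R) : all (fun x => 0 <= x <= 1) s ->
  exists K mu, [/\ mu 0%N = 0, mu K = 1, forall k, (k < K)%N -> mu k < mu k.+1,
    forall x, x \in s -> exists2 k, (k <= K)%N & mu k = x &
    forall k, (k <= K)%N -> mu k \in [:: 0, 1 & s]].
Proof.
move=> /allP s01; pose v := sort <=%R (undup [:: 0, 1 & s]).
have mv x : (x \in v) = (x \in [:: 0, 1 & s]) by rewrite mem_sort mem_undup.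
have v01 x : x \in v -> 0 <= x <= 1.
  by rewrite mv !inE => /or3P[/eqP->|/eqP->|/s01//]; rewrite ?lexx ler01.
have sv : sorted <%R v by rewrite sort_lt_sorted undup_uniq.
have vs : (0 < size v)%N.
  have : 0 \in v by rewrite mv inE eqxx.
  by case: v {mv v01 sv}.
have nthv x : x \in v -> exists2 k, (k <= (size v).-1)%N & nth 1 v k = x.
  by move=> xv; exists (index x v); rewrite ?nth_index// -ltnS prednK// index_mem.
have lt i j : (i < j < size v)%N -> nth 1 v i < nth 1 v j.
  move=> /andP[ij js]; apply: (sorted_ltn_nth lt_trans 1 sv) => //.
  by rewrite inE (ltn_trans ij).
have le i j : (i <= j < size v)%N -> nth 1 v i <= nth 1 v j.
  move=> /andP[]; rewrite leq_eqVlt => /predU1P[->//|ij] js.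
  by apply: ltW; apply: lt; rewrite ij.
have last : ((size v).-1 < size v)%N by rewrite prednK.
exists (size v).-1, (nth 1 v); split.
- have /nthv[k ks e] : 0 \in v by rewrite mv inE eqxx.
  apply/eqP; rewrite eq_le; apply/andP; split.
    by rewrite -[leRHS]e le// (leq_ltn_trans ks).
  by have /v01/andP[] := mem_nth 1 vs.
- have /nthv[k ks e] : 1 \in v by rewrite mv !inE eqxx orbT.
  apply/eqP; rewrite eq_le; apply/andP; split.
    by have /v01/andP[] := mem_nth 1 last.
  by rewrite -[leLHS]e le// ks.
- move=> k kK; by apply: lt; rewrite ltnSn -(prednK vs) ltnS.
- by move=> x xs; apply: nthv; rewrite mv !inE xs !orbT.
- move=> k kK; by rewrite -mv mem_nth// -(prednK vs) ltnS.
Qed.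

End grids.

Section grid_profiles.
Context {R : realType}.
Implicit Types (mu : nat -> R) (f g : R -> R) (base : seq R).

Definition grid K mu : Prop :=
  [/\ mu 0%N = 0, mu K = 1 & forall k, (k < K)%N -> mu k < mu k.+1].

Definition refines base K mu : Prop :=
  forall x, x \in base -> exists2 k, (k <= K)%N & mu k = x.

(** Quantifying over all grids through [base] lets the grid be chosen late, once the points and the
    mesh needed are known. *)
Definition steps base f : Prop :=
  forall K mu, grid K mu -> refines base K mu -> stepwise K mu f.

Lemma grid_lt K mu j k : grid K mu -> (j <= K)%N -> (k <= K)%N -> (mu j < mu k) = (j < k)%N.
Proof.
move=> [_ _ mu_lt] jK kK; apply/idP/idP => [|jk]; last first.
  apply: (lt_le_trans (mu_lt _ (leq_trans jk kK))); rewrite (mu_le mu_lt)// jk.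
  exact: kK.
by apply: contraTltn => kj; rewrite -leNgt (mu_le mu_lt)// kj.
Qed.

Lemma grid_le K mu j k : grid K mu -> (j <= K)%N -> (k <= K)%N -> (mu j <= mu k) = (j <= k)%N.
Proof. by move=> gm jK kK; rewrite leNgt (grid_lt gm)// -leqNgt. Qed.

Lemma J_grid base f K mu i k : grid K mu -> refines base K mu -> steps base f -> (i <= k <= K)%N ->
  J f (mu i) (mu k) = \sum_(i <= j < k) f (mu j.+1) * (mu j.+1 - mu j).
Proof. by move=> gm rm sf ik; case: (gm) => _ _ mu_lt; apply: (J_stepwise mu_lt ik); exact: sf. Qed.

Lemma refine_points base (s : seq R) : all (fun x => 0 <= x <= 1) base ->
  all (fun x => 0 <= x <= 1) s -> exists K mu, [/\ grid K mu, refines base K mu, refines s K mu &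
    forall k, (k <= K)%N -> mu k \in [:: 0, 1 & s ++ base]].
Proof.
move=> b01 s01; have [|K [mu [m0 m1 mlt pts inv]]] := @grid_exists R (s ++ base).
  by rewrite all_cat s01.
exists K, mu; split=> // x xb; apply: pts; rewrite mem_cat xb ?orbT//.
Qed.

Lemma J_increment base f s p : all (fun x => 0 <= x <= 1) base -> steps base f ->
  0 <= s -> s <= p -> p <= 1 -> forall lo hi, (forall x, s < x <= p -> lo <= f x <= hi) ->
  lo * (p - s) <= J f 0 p - J f 0 s <= hi * (p - s).
Proof.
move=> b01 sf s0 sp p1 lo hi flh.
have [|K [mu [gm rb rs _]]] := @refine_points base [:: s; p] b01.
  by rewrite /= s0 p1 (le_trans sp)// (le_trans s0).
have [i iK es] := rs s (mem_head _ _).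
have [k kK ep] : exists2 k, (k <= K)%N & mu k = p by apply: rs; rewrite !inE eqxx orbT.
have ik : (i <= k)%N by rewrite -(grid_le gm)// es ep.
have [m0 _ mlt] := gm.
have -> : J f 0 p - J f 0 s = \sum_(i <= j < k) f (mu j.+1) * (mu j.+1 - mu j).
  have J0 n : (n <= K)%N -> J f 0 (mu n) = \sum_(0 <= j < n) f (mu j.+1) * (mu j.+1 - mu j).
    by move=> nK; rewrite -{1}m0 (J_grid gm rb sf).
  rewrite -es -ep !J0//.
  by rewrite (@big_cat_nat _ _ _ i 0 k)//= addrAC subrr add0r.
have tel C : C * (p - s) = \sum_(i <= j < k) C * (mu j.+1 - mu j).
  by rewrite -mulr_sumr telescope_sumr// es ep.
have bd j : (i <= j < k)%N -> 0 <= mu j.+1 - mu j /\ lo <= f (mu j.+1) <= hi.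
  move=> /andP[ij jk]; have jK := leq_trans jk kK.
  rewrite subr_ge0 (ltW (mlt _ jK)); split => //; apply: flh.
  by rewrite -es -ep (grid_lt gm)// (grid_le gm)// ltnS ij jk.
rewrite !tel; apply/andP; split; rewrite big_nat [leRHS]big_nat; apply: ler_sum => j /bd[d0 /andP[h1 h2]];
  exact: ler_wpM2r.
Qed.

End grid_profiles.

(** * The hull touches the profile at its corners *)

Section concave_hull.
Context {R : realType}.
Variables (sig sbar hatJ : R -> R) (base : seq R) (S : R).
Hypothesis b01 : all (fun x => 0 <= x <= 1) base.
Hypothesis steps_sig : steps base (fun r => sig r ^+ 2).
Hypothesis steps_sbar : steps base (fun r => sbar r ^+ 2).
Hypothesis sigS : forall x, 0 < x <= 1 -> 0 <= sig x ^+ 2 <= S.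
Hypothesis sbar0 : {in `[0, 1], forall s, 0 < sbar s}.
Hypothesis sbar_ni : {in `[0, 1] &, {homo sbar : x y /~ x <= y}}.
Hypothesis hull : least_concave_majorant (J (fun r => sig r ^+ 2) 0) hatJ.
Hypothesis hatJE : {in `]0, 1], forall s, hatJ s = J (fun r => sbar r ^+ 2) 0 s}.

Let J1 := J (fun r => sig r ^+ 2) 0.
Let J2 := J (fun r => sbar r ^+ 2) 0.

Let J00 (f : R -> R) : J f 0 0 = 0.
Proof. by rewrite /J set_itv1 Rintegral_set1. Qed.

Lemma profile_le s : 0 <= s <= 1 -> J1 s <= J2 s.
Proof.
move=> /andP[s0 s1]; move: s0; rewrite le_eqVlt => /predU1P[<-|s0].
  by rewrite /J1 /J2 !J00.
rewrite /J2 -hatJE ?in_itv/= ?s0//; have [_ h _] := hull.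
by apply: h; rewrite in_itv/= ltW.
Qed.

(* Otherwise the corner of the hull at [p] could be cut off by a line. *)
Lemma hull_corner p b : 0 < p < 1 -> 0 <= b -> b < sbar p -> (forall x, p < x <= 1 -> sbar x <= b) ->
  J1 p = J2 p.
Proof.
move=> /andP[p0 p1] b0 bp sb; apply/eqP; rewrite eq_le profile_le ?(ltW p0) ?(ltW p1)//= leNgt.
apply/negP => lt; set a := sbar p in bp.
pose de := J2 p - J1 p; have de0 : 0 < de by rewrite subr_gt0.
have a0 : 0 < a by exact: le_lt_trans bp.
have ab : 0 < a ^+ 2 - b ^+ 2.
  by rewrite subr_sqr mulr_gt0 ?subr_gt0// ltr_wpDr.
(* The line [l] has the mean of the two slopes and passes [et] below the corner. It is under [J2]
   only for [|s - p|] up to [2 * et / (a ^ 2 - b ^ 2)], where [J1] is below its value at [p] plus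
   [S * |s - p|]; [w] is the factor making [l] stay above [J1] there. *)
pose e := (a ^+ 2 + b ^+ 2) / 2; pose w := 1 + (e + S) * (2 / (a ^+ 2 - b ^+ 2)).
have S0 : 0 <= S by have /sigS/andP[h1 h2] : 0 < p <= 1 by [rewrite p0 ltW]; exact: le_trans h2.
have e0 : 0 <= e by rewrite divr_ge0// addr_ge0// sqr_ge0.
have w0 : 0 < w by rewrite ltr_pwDl// mulr_ge0 ?addr_ge0// divr_ge0// ltW.
pose et := de / w; have et0 : 0 < et by rewrite divr_gt0.
pose l (x : R) := J2 p - et + e * (x - p).
have left s : 0 <= s <= p -> a ^+ 2 * (p - s) <= J2 p - J2 s.
  move=> /andP[s0 sp].
  have := J_increment b01 steps_sbar s0 sp (ltW p1) (lo := a ^+ 2) (hi := sbar 0 ^+ 2).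
  case/(_ _)/andP => // x /andP[sx xp].
  have x01 : x \in `[0, 1] by rewrite in_itv/= (le_trans s0 (ltW sx)) (le_trans xp (ltW p1)).
  have h1 : a <= sbar x by apply: sbar_ni => //; rewrite in_itv/= (ltW p0) (ltW p1).
  have h2 : sbar x <= sbar 0.
    by apply: sbar_ni => //; [rewrite in_itv/= lexx ler01|have := x01; rewrite in_itv/= => /andP[]].
  by rewrite !ler_sqr ?nnegrE ?h1 ?h2// ltW// ?sbar0// in_itv/= lexx ler01.
have right s : p <= s <= 1 -> J2 s - J2 p <= b ^+ 2 * (s - p).
  move=> /andP[ps s1].
  have := J_increment b01 steps_sbar (ltW p0) ps s1 (lo := 0) (hi := b ^+ 2).
  case/(_ _)/andP => // x /andP[px xs].
  have x1 := le_trans xs s1; rewrite sqr_ge0/=.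
  have x01 : x \in `[0, 1] by rewrite in_itv/= (le_trans (ltW p0) (ltW px)).
  by rewrite ler_sqr ?nnegrE ?sb ?px//; exact/ltW/sbar0.
have J1lip s : 0 <= s <= 1 -> J1 s <= J1 p + S * `|s - p|.
  move=> /andP[s0 s1].
  have bd x y z : 0 <= x -> z <= 1 -> x < y <= z -> 0 <= sig y ^+ 2 <= S.
    by move=> x0 z1 /andP[xy yz]; apply: sigS; rewrite (le_lt_trans x0 xy) (le_trans yz).
  have [sp|ps] := leP s p.
    have /andP[h _] := J_increment b01 steps_sig s0 sp (ltW p1) (fun y => bd s y p s0 (ltW p1)).
    rewrite mul0r subr_ge0 in h; rewrite (le_trans h)// lerDl mulr_ge0//.
  have /andP[_] := J_increment b01 steps_sig (ltW p0) (ltW ps) s1 (fun y => bd p y s (ltW p0) s1).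
  by rewrite ger0_norm ?subr_ge0 ?(ltW ps)// -/J1; lra.
have J1l s : 0 <= s <= 1 -> J1 s <= l s.
  move=> s01; have [|lt'] := leP (J2 s) (l s); first exact: le_trans (profile_le s01).
  have near : `|s - p| <= 2 / (a ^+ 2 - b ^+ 2) * et.
    rewrite mulrAC ler_pdivlMr//.
    case/andP: (s01) => s0 s1; have [sp|ps] := leP s p.
      have := left s; rewrite s0 sp => /(_ isT).
      rewrite ler0_norm ?subr_le0// opprB; move: lt'; rewrite /l /e; lra.
    have := right s; rewrite (ltW ps) s1 => /(_ isT).
    by rewrite ger0_norm ?subr_ge0 ?(ltW ps)//; move: lt'; rewrite /l /e; lra.
  apply: (le_trans (J1lip s s01)).
  have dE : J1 p = J2 p - et * w by rewrite /et divfK ?lt0r_neq0// /de; ring.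
  rewrite dE /l /w.
  have n1 : - e * `|s - p| <= e * (s - p).
    rewrite mulNr -mulrN; apply: ler_wpM2l => //; rewrite lerNl -normrN; exact: ler_norm.
  have := ler_wpM2l (addr_ge0 e0 S0) near; lra.
have [cc mj least] := hull.
(* A concave majorant of [J1] strictly below the hull at [p], against minimality. *)
pose h x := Num.min (hatJ x) (l x).
have ch : concave01 h.
  move=> t x y xI yI; have := cc t x y xI yI.
  set z := conv t x y => cz.
  have {}cz : - hatJ z <= t%:num * (- hatJ x) + (1 - t%:num) * (- hatJ y) by exact: cz.
  suff : t%:num * h x + (1 - t%:num) * h y <= h z.
    move=> hz; suff : - h z <= t%:num * (- h x) + (1 - t%:num) * (- h y) by [].
    by rewrite !mulrN -opprD lerN2.
  have zE : z = t%:num * x + (1 - t%:num) * y by [].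
  have t0 : 0 <= t%:num :> R by [].
  have t1 : 0 <= 1 - t%:num :> R by rewrite subr_ge0.
  have mn u : h u <= hatJ u /\ h u <= l u by split; rewrite /h ge_min lexx ?orbT.
  have [hx1 hx2] := mn x; have [hy1 hy2] := mn y.
  rewrite {3}/h le_min; apply/andP; split.
    have := ler_wpM2l t0 hx1; have := ler_wpM2l t1 hy1; lra.
  have -> : l z = t%:num * l x + (1 - t%:num) * l y by rewrite zE /l; ring.
  by apply: lerD; apply: ler_wpM2l.
have Jh : {in `[0, 1], forall s, J1 s <= h s}.
  by move=> s sI; rewrite /h le_min mj//= J1l//; move: sI; rewrite in_itv.
have := least h ch Jh p; rewrite in_itv/= (ltW p0) (ltW p1) => /(_ isT).
rewrite /h le_min => /andP[_]; rewrite hatJE ?in_itv/= ?p0 ?(ltW p1)// /l -/J2.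
lra.
Qed.

End concave_hull.

Section hull_on_grid.
Context {R : realType}.
Variables (sig sbar : R -> R) (base : seq R) (S : R).
Hypothesis b01 : all (fun x => 0 <= x <= 1) base.
Hypothesis steps_sig : steps base sig.
Hypothesis steps_sbar : steps base sbar.
Hypothesis sig0 : forall x, 0 < x <= 1 -> 0 < sig x.
Hypothesis sigS : forall x, 0 < x <= 1 -> sig x <= S.
Hypothesis eff : effective_profile sig sbar.
Variables (m : nat) (lam : nat -> R).
Hypothesis hlam : jump_subdivision sbar m lam.
Variables (l : nat) (hl : (1 <= l <= m)%N).
Variables (K : nat) (mu : nat -> R).
Hypothesis gm : grid K mu.
Hypothesis rb : refines base K mu.
Variables (kp kl : nat).
Hypothesis kpK : (kp <= K)%N.
Hypothesis klK : (kl <= K)%N.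
Hypothesis kpE : mu kp = lam l.-1.
Hypothesis klE : mu kl = lam l.

Local Notation D k := (mu k.+1 - mu k).
Local Notation b k := (sbar (mu k.+1)).
Local Notation sg k := (sig (mu k.+1)).

Let m0 : mu 0%N = 0. Proof. by case: gm. Qed.
Let mK : mu K = 1. Proof. by case: gm. Qed.
Let mlt k : (k < K)%N -> mu k < mu k.+1. Proof. by case: gm => _ _; apply. Qed.

Let mu01 k : (k <= K)%N -> mu k \in `[0, 1].
Proof. by move=> kK; rewrite in_itv/= -{1}m0 -mK !(grid_le gm). Qed.

Let mu01' k : (k < K)%N -> 0 < mu k.+1 <= 1.
Proof. by move=> kK; rewrite -{1}m0 -mK (grid_lt gm) ?(grid_le gm). Qed.

Lemma grid_step_gt0 k : (k < K)%N -> 0 < D k.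
Proof. by move=> kK; rewrite subr_gt0 mlt. Qed.

Lemma grid_sbar_gt0 k : (k < K)%N -> 0 < b k.
Proof. by move=> kK; case: eff => h _ _ _ _; apply/h/mu01. Qed.

Lemma grid_sig_gt0 k : (k < K)%N -> 0 < sg k.
Proof. by move=> kK; apply/sig0/mu01'. Qed.

Let b_mono j k : (j <= k < K)%N -> b k <= b j.
Proof.
move=> /andP[jk kK]; case: eff => _ h _ _ _; apply: h; rewrite ?mu01 ?(leq_ltn_trans jk)//.
by rewrite (grid_le gm)// (leq_ltn_trans jk).
Qed.

Lemma grid_sbar_le k : (k.+1 < K)%N -> b k.+1 <= b k.
Proof. by move=> kK; apply: b_mono; rewrite leqnSn. Qed.

(** The height of the hull above the profile at [mu k], by [gapE]. *)
Let gap k : R := \sum_(j < k) (b j ^+ 2 - sg j ^+ 2) * D j.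

Let steps_comp (F : R -> R) f : steps base f -> steps base (fun x => F (f x)).
Proof. by move=> sf K' mu' g r j x jK hx; rewrite (sf K' mu' g r j x jK hx). Qed.

Let J_mu f i k : steps base f -> (i <= k <= K)%N ->
  J f (mu i) (mu k) = \sum_(i <= j < k) f (mu j.+1) * D j.
Proof. by move=> sf ik; exact: (J_grid gm rb sf). Qed.

Let gapE k : (k <= K)%N -> gap k = J (fun r => sbar r ^+ 2) 0 (mu k) - J (fun r => sig r ^+ 2) 0 (mu k).
Proof.
move=> kK; rewrite -[in RHS]m0 !J_mu ?kK//; try exact: (steps_comp (fun x => x ^+ 2)).
rewrite -sumrB /gap -(big_mkord xpredT (fun j => (b j ^+ 2 - sg j ^+ 2) * D j)).
by apply: eq_bigr => j _; rewrite mulrBl.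
Qed.

Let sqS x : 0 < x <= 1 -> 0 <= sig x ^+ 2 <= S ^+ 2.
Proof.
move=> hx; rewrite sqr_ge0/= ler_sqr ?nnegrE ?sigS ?(ltW (sig0 hx))//.
exact: le_trans (ltW (sig0 hx)) (sigS hx).
Qed.

Let gap_ge0 k : (k <= K)%N -> 0 <= gap k.
Proof.
move=> kK; rewrite gapE// subr_ge0; case: eff => _ _ _ _ [hatJ hJ hE].
apply: (profile_le hJ hE); by have := mu01 kK; rewrite in_itv.
Qed.

Let gap_jump k : (0 < k < K)%N -> b k < b k.-1 -> gap k = 0.
Proof.
move=> /andP[k0 kK] lt; case: eff => hpos hni _ _ [hatJ hJ hE].
rewrite gapE ?(ltW kK)//; last exact: ltnW.
apply/eqP; rewrite subr_eq0 eq_sym; apply/eqP.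
have bE : b k.-1 = sbar (mu k) by rewrite prednK.
apply: (hull_corner b01 (steps_comp (fun x => x ^+ 2) steps_sig)
  (steps_comp (fun x => x ^+ 2) steps_sbar) sqS hpos hni hJ hE (b := b k)).
- have [/andP[h _] kK'] := (mu01' (leq_ltn_trans (leq_pred k) kK), kK).
  by rewrite prednK// in h; rewrite h -mK (grid_lt gm)// ltnW.
- exact/ltW/grid_sbar_gt0.
- by rewrite -bE.
- move=> x /andP[kx x1]; have [xk|xk] := leP x (mu k.+1).
    by rewrite (steps_sbar gm rb kK) ?kx.
  have x0 : 0 <= x by rewrite (le_trans _ (ltW kx))//; have := mu01 (ltnW kK); rewrite in_itv => /andP[].
  by apply: hni; rewrite ?mu01// ?(ltW xk)// in_itv/= x0.
Qed.

(** In the summation by parts every term with [F (b j)] different from [F (b j.-1)] sits at a jump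
    of [b], where the gap vanishes. [F] is the inverse square for the slopes and the inverse for the
    levels. *)
Let abel (F : R -> R) k : (0 < k <= K)%N ->
  \sum_(j < k) (b j ^+ 2 - sg j ^+ 2) * D j * F (b j) = gap k * F (b k.-1).
Proof.
case: k => // k /andP[_]; elim: k => [|k IH] kK; first by rewrite /gap !big_ord1.
rewrite big_ord_recr IH ?(ltnW kK)// /gap [in RHS]big_ord_recr/= -/(gap k.+1).
have := b_mono (j := k) (k := k.+1); rewrite leqnSn => /(_ kK); rewrite le_eqVlt => /predU1P[e|lt].
  by rewrite /= -e -mulrDl.
by rewrite (gap_jump (k := k.+1))// !(mul0r, add0r).
Qed.

Let sum_gap (F : R -> R) k : \sum_(j < k) (b j ^+ 2 - sg j ^+ 2) * D j * F (b j) =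
  \sum_(j < k) b j ^+ 2 * F (b j) * D j - \sum_(j < k) sg j ^+ 2 * F (b j) * D j.
Proof. by rewrite -sumrB; apply: eq_bigr => j _; ring. Qed.

Let sumD k : \sum_(j < k) D j = mu k.
Proof.
by rewrite -(big_mkord xpredT (fun j => D j)) telescope_sumr// m0 subr0.
Qed.

Let slopeE k : (0 < k <= K)%N -> \sum_(j < k) (sg j / b j) ^+ 2 * D j = mu k - gap k / b k.-1 ^+ 2.
Proof.
move=> k0K; have /esym := abel (fun x => (x ^+ 2)^-1) k0K.
rewrite (sum_gap (fun x => (x ^+ 2)^-1)) => ->.
rewrite -{1}sumD; rewrite opprB addrC -addrA -sumrN -big_split/= [X in _ = _ + X]big1 ?addr0.
  by apply: eq_bigr => j _; rewrite exprMn exprVn.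
move=> j _; have bj : b j != 0.
  by rewrite lt0r_neq0// grid_sbar_gt0// (leq_trans (ltn_ord j))//; case/andP: k0K.
by rewrite mulfV ?mul1r ?addNr// expf_neq0.
Qed.

Lemma grid_slope k : (k <= K)%N -> \sum_(j < k) (sg j / b j) ^+ 2 * D j <= mu k.
Proof.
case: k => [|k] kK; first by rewrite big_ord0 m0.
rewrite slopeE// lerBlDr lerDl; apply: divr_ge0; last exact: sqr_ge0.
exact: gap_ge0.
Qed.

Let lam_jump p : (exists2 j, (0 < j < m)%N & lam j = p) <-> 0 < p < 1 /\ ~ {for p, continuous sbar}.
Proof.
case: hlam => _ _ _ e; have -> : (exists2 j, (0 < j < m)%N & lam j = p) = [set lam l | l in [set l | (0 < l < m)%N]] p.
  by [].
by rewrite e.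
Qed.

Lemma grid_continuous k : (0 < k < K)%N -> b k = b k.-1 <-> {for mu k, continuous sbar}.
Proof.
move=> /andP[k0 kK]; have rk x : mu k < x <= mu k.+1 -> sbar x = b k by move=> hx; exact: (steps_sbar gm rb kK).
have k1K : (k.-1 < K)%N by rewrite (leq_ltn_trans (leq_pred k)).
have lk x : mu k.-1 < x <= mu k -> sbar x = sbar (mu k).
  by move=> hx; rewrite (steps_sbar gm rb k1K) ?prednK.
have lt1 := mlt kK; have := mlt k1K; rewrite [in X in X -> _]prednK// => lt0.
have -> : b k.-1 = sbar (mu k) by rewrite prednK.
split => [e|cs].
  apply: (near_cst_continuous (sbar (mu k))); near=> x.
  have [xk|kx] := leP x (mu k).
    by rewrite lk// xk andbT; near: x; exact: lt_nbhsr.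
  rewrite rk ?e// kx/=; apply: ltW; near: x; exact: lt_nbhsl.
have h1 : sbar x @[x --> (mu k)^'+] --> sbar (mu k) by exact: cvg_at_right_filter.
have h2 : sbar x @[x --> (mu k)^'+] --> b k.
  apply: cvg_near_cst; near=> x; rewrite rk//; apply/andP; split.
    by near: x; exact: nbhs_right_gt.
  by apply: ltW; near: x; exact: nbhs_right_lt.
exact: cvg_unique h2 h1.
Unshelve. all: by end_near. Qed.

Let gl : grid m lam. Proof. by case: hlam. Qed.

Let lm : (l <= m)%N. Proof. by case/andP: hl. Qed.
Let l1m : (l.-1 <= m)%N. Proof. by rewrite (leq_trans (leq_pred l)). Qed.

Lemma grid_level_lt : (kp < kl)%N.
Proof. by rewrite -(grid_lt gm)// kpE klE (grid_lt gl)// ltn_predL; case/andP: hl. Qed.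

Let kpK' : (kp < K)%N := leq_trans grid_level_lt klK.

Let gap_kp : gap kp = 0.
Proof.
have [->|k0] := posnP kp; first by rewrite /gap big_ord0.
apply: gap_jump; first by rewrite k0 kpK'.
rewrite lt_neqAle b_mono ?leq_pred ?kpK'// andbT; apply/eqP => e.
have /lam_jump[_] : exists2 j, (0 < j < m)%N & lam j = mu kp.
  exists l.-1 => //; apply/andP; split; last by rewrite (leq_trans _ lm)// ltn_predL; case/andP: hl.
  by rewrite -(grid_lt gl)// -kpE; have [-> _ _] := gl; rewrite -m0 (grid_lt gm).
by apply; apply/grid_continuous; rewrite // k0 kpK'.
Qed.

Lemma grid_slope_eq : \sum_(j < kp) (sg j / b j) ^+ 2 * D j = mu kp.
Proof.
have [->|k0] := posnP kp; first by rewrite big_ord0 m0.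
by rewrite slopeE ?k0// gap_kp mul0r subr0.
Qed.

Lemma grid_level_eq : \sum_(j < kp) b j * D j = \sum_(j < kp) sg j ^+ 2 / b j * D j.
Proof.
have [->|k0] := posnP kp; first by rewrite !big_ord0.
have := abel (fun x => x^-1) (k := kp); rewrite k0 => /(_ kpK); rewrite (sum_gap (fun x => x^-1)).
rewrite gap_kp mul0r => /subr0_eq <-; apply: eq_bigr => j _.
rewrite expr2 mulfK// lt0r_neq0// grid_sbar_gt0//; exact: leq_trans (ltn_ord j) kpK.
Qed.

(** A change of value between grid points would be a jump of [sbar] strictly between two consecutive
    points of [lam]. *)
Lemma grid_piece k : (kp <= k < kl)%N -> b k = sbar (lam l).
Proof.
move=> /andP[kk kkl]; have kl0 : (0 < kl)%N by exact: leq_ltn_trans kkl.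
have [i ki] : exists i, (k + i = kl.-1)%N by exists (kl.-1 - k)%N; lia.
elim: i k kk kkl ki => [|i IH] k kk kkl ki.
  by rewrite -klE; congr (sbar (mu _)); lia.
rewrite -(IH k.+1); [|lia|lia|lia].
have kK : (0 < k.+1 < K)%N by rewrite (leq_trans _ klK)//; lia.
apply/esym/(grid_continuous kK); apply: contrapT => nc.
have [|j /andP[j0 jm] ej] := (lam_jump (mu k.+1)).2.
  by split => //; rewrite -{1}m0 -mK !(grid_lt gm)//; case/andP: kK => // *; exact: ltnW.
have h1 : (l.-1 < j)%N.
  by rewrite -(grid_lt gl) ?(ltnW jm)// ej -kpE (grid_lt gm)// ltnW//; case/andP: kK.
have h2 : (j < l)%N.
  rewrite -(grid_lt gl) ?(ltnW jm)// ej -klE (grid_lt gm)//; last by rewrite ltnW//; case/andP: kK.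
  lia.
by move: h1 h2; lia.
Qed.

Let steps_ratio : steps base (fun x => sig x ^+ 2 / sbar x).
Proof.
by move=> K' mu' g r j x jK hx; rewrite (steps_sig g r jK hx) (steps_sbar g r jK hx).
Qed.

Lemma J_ratio_grid : J (fun s => sig s ^+ 2 / sbar s) 0 (lam l.-1) = \sum_(j < kp) sg j ^+ 2 / b j * D j.
Proof.
by rewrite -{1}m0 -kpE J_mu// (big_mkord xpredT (fun j => sg j ^+ 2 / b j * D j)).
Qed.

Lemma J_sqr_grid : J (fun s => sig s ^+ 2) (lam l.-1) 1 = \sum_(kp <= j < K) sg j ^+ 2 * D j.
Proof. by rewrite -mK -kpE J_mu ?kpK ?leqnn//; exact: (steps_comp (fun x => x ^+ 2)). Qed.

Lemma J_sqr_gt0 : 0 < J (fun s => sig s ^+ 2) (lam l.-1) 1.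
Proof.
rewrite J_sqr_grid (big_ltn kpK').
apply: ltr_wpDr; last by rewrite mulr_gt0 ?exprn_gt0 ?grid_sig_gt0 ?grid_step_gt0.
rewrite big_nat sumr_ge0// => j /andP[_ jK].
by rewrite mulr_ge0 ?sqr_ge0// ltW// grid_step_gt0.
Qed.

Let level_sum k : (k <= K)%N -> J (fun s => sig s ^+ 2 / sbar (Num.min s (mu k))) 0 1 =
  \sum_(j < k) sg j ^+ 2 / b j * D j + (\sum_(k <= j < K) sg j ^+ 2 * D j) / sbar (mu k).
Proof.
move=> kK; have minl j : (j < k)%N -> Num.min (mu j.+1) (mu k) = mu j.+1.
  by move=> jk; apply/min_idPl; rewrite (grid_le gm)//; exact: leq_trans kK.
have minr j x : (k <= j)%N -> (j < K)%N -> mu j < x -> Num.min x (mu k) = mu k.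
  by move=> kj jK jx; apply/min_idPr; apply: le_trans (ltW jx); rewrite (grid_le gm)// ltnW.
rewrite -{1}m0 -mK (J_stepwise mlt) ?leqnn//; last first.
  move=> j x jK hx; rewrite (steps_sig gm rb jK hx); congr (_ / _).
  have [jk|kj] := ltnP j k.
    have xk : x <= mu k.
      by case/andP: hx => _ /le_trans; apply; rewrite (grid_le gm).
    by rewrite minl// (min_idPl xk) (steps_sbar gm rb jK hx).
  by case/andP: hx => jx _; rewrite !(minr j)// mlt.
rewrite (@big_cat_nat _ _ _ k 0 K)//=; congr (_ + _).
  rewrite big_mkord; apply: eq_bigr => j _; by rewrite minl.
rewrite mulr_suml big_nat [RHS]big_nat; apply: eq_bigr => j /andP[kj jK].
by rewrite (minr j) ?mlt// mulrAC.
Qed.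

Variable gamma : R.
Hypothesis hgamma : critical_level sig sbar lam l.-1 <= gamma < critical_level sig sbar lam l.

Let A := J (fun s => sig s ^+ 2 / sbar s) 0 (lam l.-1).
Let B := J (fun s => sig s ^+ 2) (lam l.-1) 1.

Let lower_level : (0 < kp)%N -> critical_level sig sbar lam l.-1 = A + B / b kp.-1.
Proof.
move=> k0; rewrite /critical_level.
have l0 : l.-1 != 0%N.
  by rewrite -lt0n -(grid_lt gl)// -kpE; have [-> _ _] := gl; rewrite -m0 (grid_lt gm).
rewrite (negbTE l0) -kpE level_sum// /A /B J_ratio_grid J_sqr_grid.
by rewrite prednK.
Qed.

Let upper_level : critical_level sig sbar lam l = A + B / sbar (lam l).
Proof.
rewrite /critical_level gtn_eqF; last by case/andP: hl.
rewrite -klE level_sum// /A /B J_ratio_grid J_sqr_grid klE.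
rewrite -(big_mkord xpredT (fun j => sg j ^+ 2 / b j * D j)) -(big_mkord xpredT (fun j => sg j ^+ 2 / b j * D j)).
have kpkl := ltnW grid_level_lt.
rewrite (@big_cat_nat _ _ _ kp 0 kl)//= -addrA; congr (_ + _).
rewrite (@big_cat_nat _ _ _ kl kp K)//= mulrDl; congr (_ + _).
rewrite mulr_suml big_nat [RHS]big_nat; apply: eq_bigr => j hj.
by rewrite grid_piece// mulrAC.
Qed.

Let B0 : 0 < B. Proof. exact: J_sqr_gt0. Qed.

(** The critical levels are [A + B / s], with [s] the value of [sbar] just before and just after
    [lam l.-1]; this places [c] between the inverses of these two values. *)
Let c := (gamma - A) / B.

Lemma grid_tilt_level : 0 <= gamma /\ gamma = A + c * B.
Proof.
split; last by rewrite /c divfK ?lt0r_neq0// addrC subrK.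
case/andP: hgamma => h _; apply: le_trans h; have [k0|k0] := posnP kp; last first.
  rewrite lower_level// /A J_ratio_grid addr_ge0//; last first.
    by rewrite divr_ge0// ltW// grid_sbar_gt0// (leq_ltn_trans (leq_pred _)).
  rewrite sumr_ge0// => j _; have jK := leq_trans (ltn_ord j) kpK.
  by rewrite mulr_ge0 ?(ltW (grid_step_gt0 jK))// divr_ge0 ?sqr_ge0// ltW// grid_sbar_gt0.
rewrite /critical_level; have -> : (l.-1 == 0)%N; last by [].
rewrite -leqn0 -(grid_le gl)// -kpE k0 m0; have [-> _ _] := gl; exact: lexx.
Qed.

Lemma grid_tilt_lower : (0 < kp)%N -> 1 <= c * b kp.-1.
Proof.
move=> k0; case/andP: hgamma => h _; rewrite lower_level// in h.
have b0 : 0 < b kp.-1 by rewrite grid_sbar_gt0// (leq_ltn_trans (leq_pred _)).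
rewrite -ler_pdivrMr// mul1r /c ler_pdivlMr// lerBrDl; move: h; rewrite mulrC.
by [].
Qed.

Lemma grid_tilt_ge0 : 0 <= c.
Proof.
have [k0|k0] := posnP kp; last first.
  have b0 : 0 < b kp.-1 by rewrite grid_sbar_gt0// (leq_ltn_trans (leq_pred _)).
  rewrite -(pmulr_lge0 _ b0); apply: le_trans (grid_tilt_lower k0); exact: ler01.
rewrite divr_ge0 ?(ltW B0)// /A J_ratio_grid k0 big_ord0 subr0.
by case: grid_tilt_level.
Qed.

Lemma grid_tilt_upper : c < (sbar (lam l))^-1.
Proof.
case/andP: hgamma => _; rewrite upper_level => h.
by rewrite /c ltr_pdivrMr// ltrBlDl mulrC.
Qed.

End hull_on_grid.

(** * High points of the field *)

Lemma positive_lower_bound (R : realType) (s : seq R) :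
  exists2 kappa, 0 < kappa & forall x, x \in s -> 0 < x -> kappa <= x.
Proof.
elim: s => [|y s [k k0 ks]]; first by exists 1.
have [y0|y0] := ltP 0 y; last first.
  exists k => // x; rewrite inE => /predU1P[->|/ks//]; by rewrite ltNge y0.
have [a [a0 ak ay]] := min_exists k0 y0.
exists a => // x; rewrite inE => /predU1P[->//|xs] x0; exact: le_trans ak (ks x xs x0).
Qed.

Section fine_grids.
Context {R : realType}.

(** The first step keeps the prescribed length [kappa] while the others shrink with [n]: the
    condition [gap] of the second moment compares the mesh with [kappa]. No positive base point lies
    below [kappa], so the first step is not cut. *)
Lemma fine_grid (base : seq R) (kappa : R) (n : nat) :
  all (fun x => 0 <= x <= 1) base -> 0 < kappa -> kappa < 1 ->
  (forall x, x \in base -> 0 < x -> kappa <= x) -> (0 < n)%N ->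
  exists K mu, [/\ grid K mu, refines base K mu, (0 < K)%N, mu 1%N = kappa &
    forall k, (0 < k < K)%N -> mu k.+1 - mu k <= n%:R^-1].
Proof.
move=> b01 k0 k1 kb n0; have nR : 0 < n%:R :> R by rewrite ltr0n.
(* The iota reaches [n.+1], so that each grid point before 1 has a successor in the mesh within
   [1 / n]. *)
pose mesh := [seq Num.min 1 (kappa + i%:R / n%:R) | i <- iota 0 n.+2].
have meshP x : x \in mesh -> kappa <= x <= 1.
  move=> /mapP[i _ ->]; rewrite ge_min lexx le_min (ltW k1)/= lerDl divr_ge0//.
have [|K [mu [gm rb rm inv]]] := refine_points b01 (s := mesh).
  apply/allP => x /meshP/andP[h1 ->]; rewrite (le_trans (ltW k0) h1)//.
have [m0 m1 mlt] := gm.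
have K0 : (0 < K)%N.
  by case: (K) m1 => // e; move: (@ltr01 R); rewrite -e m0 ltxx.
have ge k : (0 < k <= K)%N -> kappa <= mu k.
  move=> /andP[kp kK]; have mk : 0 < mu k by rewrite -m0 (grid_lt gm).
  have := inv k kK; rewrite 2!in_cons mem_cat => /or3P[/eqP e|/eqP->|].
  - by move: mk; rewrite e ltxx.
  - exact: ltW.
  - by move=> /orP[/meshP/andP[]//|/kb]; apply.
exists K, mu; split => //.
  apply/le_anti; rewrite ge ?K0// andbT.
  have [j jK ej] : exists2 j, (j <= K)%N & mu j = kappa.
    apply: rm; apply/mapP; exists 0%N; rewrite ?mem_iota//.
    by rewrite mul0r addr0; apply/esym/min_idPr/ltW.
  by rewrite -ej (grid_le gm)// -(grid_lt gm)// m0 ej.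
move=> k /andP[kp kK].
pose i := Num.truncn ((mu k - kappa) * n%:R).
have mk : 0 <= mu k - kappa by rewrite subr_ge0 ge// kp ltnW.
have i1 : i%:R <= (mu k - kappa) * n%:R by rewrite truncn_le// mulr_ge0// ltW.
have i2 : (mu k - kappa) * n%:R < i.+1%:R by exact: truncnS_gt.
have lt1 : mu k < 1 by rewrite -m1 (grid_lt gm)// ltnW.
have iN : (i <= n)%N.
  rewrite -(ler_nat R) (le_trans i1)// -[leRHS]mul1r ler_pM2r//; lra.
have [j jK ej] : exists2 j, (j <= K)%N & mu j = Num.min 1 (kappa + i.+1%:R / n%:R).
  by apply: rm; apply/mapP; exists i.+1; rewrite // mem_iota/= add0n ltnS.
have kj : (k < j)%N.
  rewrite -(grid_lt gm) ?(ltnW kK)// ej lt_min lt1/= -ltrBlDl.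
  by rewrite ltr_pdivlMr.
have : mu k.+1 <= mu j by rewrite (grid_le gm).
rewrite ej le_min => /andP[_ h].
have : i.+1%:R / n%:R <= mu k - kappa + n%:R^-1.
  rewrite -natr1 mulrDl mul1r lerD2r ler_pdivrMr//.
lra.
Qed.

End fine_grids.

(** * Choice of parameters for the two bounds *)

Section probability_bounds.
Context {R : realType} dW (TW : measurableType dW).
Variables (PW : lattice -> probability TW R) (W : nat -> TW -> lattice).
Hypothesis hW : forall u, simple_random_walk (PW u) u W.
Variables (d : nat -> measure_display) (T : forall N, measurableType (d N))
  (P : forall N, probability (T N) R)
  (phi : forall N, box N -> {RV (P N) >-> R}).
Hypothesis hphi : forall N, (1 <= N)%N -> GFF PW W (@phi N).
Variables (sig sbar : R -> R) (base : seq R) (S : R).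
Hypothesis b01 : all (fun x => 0 <= x <= 1) base.
Hypothesis steps_sig : steps base sig.
Hypothesis steps_sbar : steps base sbar.
Hypothesis sig0 : forall x, 0 < x <= 1 -> 0 < sig x.
Hypothesis sigS : forall x, 0 < x <= 1 -> sig x <= S.
Hypothesis eff : effective_profile sig sbar.
Variables (m : nat) (lam : nat -> R).
Hypothesis hlam : jump_subdivision sbar m lam.
Variables (l : nat) (hl : (1 <= l <= m)%N).
Variable gamma : R.
Hypothesis hgamma : critical_level sig sbar lam l.-1 <= gamma < critical_level sig sbar lam l.

Let A := J (fun s => sig s ^+ 2 / sbar s) 0 (lam l.-1).
Let B := J (fun s => sig s ^+ 2) (lam l.-1) 1.
Let V := lam l.-1 + (gamma - A) ^+ 2 / B.
Let c := (gamma - A) / B.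

Let points : seq R := [:: lam l.-1, lam l & base].

Let glam : grid m lam. Proof. by case: hlam. Qed.

Let lam01 j : (j <= m)%N -> 0 <= lam j <= 1.
Proof. by have [h0 h1 _] := glam => jm; rewrite -h0 -h1 !(grid_le glam). Qed.

Let points01 : all (fun x => 0 <= x <= 1) points.
Proof.
case/andP: hl => l0 lm; rewrite /points /= b01 !lam01//.
by rewrite (leq_trans (leq_pred l)).
Qed.

Let points_refine K mu : refines points K mu -> [/\ refines base K mu,
  exists2 kp, (kp <= K)%N & mu kp = lam l.-1 & exists2 kl, (kl <= K)%N & mu kl = lam l].
Proof.
move=> r; split; [move=> x xb| |]; apply: r; rewrite !inE ?xb ?eqxx ?orbT//.
Qed.

Let coarse : exists K mu kp kl, [/\ grid K mu, refines base K mu,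
  ((kp <= K)%N /\ mu kp = lam l.-1) & ((kl <= K)%N /\ mu kl = lam l)].
Proof.
have [|K [mu [gm r _ _]]] := refine_points points01 (s := [::]); first by [].
by have [rb [kp h1 h2] [kl h3 h4]] := points_refine r; exists K, mu, kp, kl.
Qed.

Let B0 : 0 < B.
Proof.
have [K [mu [kp [kl [gm rb [h1 h2] [h3 h4]]]]]] := coarse.
exact: (J_sqr_gt0 steps_sig sig0 hlam hl gm rb h1 h3 h2 h4).
Qed.

Let tiltP : [/\ 0 <= gamma, gamma = A + c * B, 0 <= c & c < (sbar (lam l))^-1].
Proof.
have [K [mu [kp [kl [gm rb [h1 h2] [h3 h4]]]]]] := coarse.
have [g0 gE] := grid_tilt_level steps_sig steps_sbar sig0 eff hlam hl gm rb h1 h3 h2 h4 hgamma.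
split => //.
  exact: (grid_tilt_ge0 steps_sig steps_sbar sig0 eff hlam hl gm rb h1 h3 h2 h4 hgamma).
exact: (grid_tilt_upper b01 steps_sig steps_sbar sig0 hlam hl gm rb h1 h3 h2 h4 hgamma).
Qed.

Let VE : V = lam l.-1 + c ^+ 2 * B.
Proof. by rewrite /V /c; congr (_ + _); field; rewrite lt0r_neq0. Qed.

Lemma level_upper (e eta : R) : 0 < e -> 0 < eta -> exists K mu, [/\ grid K mu, refines base K mu &
  exists N0, forall N, (N0 <= N)%N ->
  (P N [set t | (expR ((2 - 2 * V + 2 * e) * ln N%:R) <=
     #|[set v | (gamma * (2 * ln N%:R) <=
        lin (@phi N) (comb phi K mu (fun k => sig (mu k.+1)) v) t)%R]%SET|%:R)%R]
   <= eta%:E)%E].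
Proof.
move=> e0 eta0; have [K [mu [kp [kl [gm rb [kpK kpE] [klK klE]]]]]] := coarse.
exists K, mu; split => //; have [m0 m1 mlt] := gm.
have [g0 gE c0 c1] := tiltP.
have kpK' : (kp < K)%N by rewrite (leq_trans (grid_level_lt hlam hl gm kpK klK kpE klE)).
have := @upper_tail R _ _ _ _ hW _ _ _ _ hphi K mu m0 m1 mlt (fun k => sig (mu k.+1))
  (fun k => sbar (mu k.+1)) kp c (fun k => @grid_sbar_gt0 _ _ _ eff _ _ gm k)
  (fun k => @grid_sbar_le _ _ _ eff _ _ gm k) kpK' c0
  (grid_tilt_lower steps_sig steps_sbar sig0 eff hlam hl gm rb kpK klK kpE klE hgamma)
  (fun k kk => grid_slope b01 steps_sig steps_sbar sig0 sigS eff gm rb (leq_trans kk kpK))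
  (grid_slope_eq b01 steps_sig steps_sbar sig0 sigS eff hlam hl gm rb kpK klK kpE klE)
  (grid_level_eq b01 steps_sig steps_sbar sig0 sigS eff hlam hl gm rb kpK klK kpE klE)
  e e0 eta eta0.
rewrite -(J_ratio_grid steps_sig steps_sbar gm rb kpK kpE) -(J_sqr_grid steps_sig gm rb kpK kpE).
by rewrite -/A -/B -gE kpE -VE.
Qed.

(** The order of choices matters: [rho] and the excess height [tau0] it yields, then [eta'], then
    the length [kappa] of the first step, and finally the mesh [n], which depends on [kappa] and
    [eta']. *)
Lemma level_lower (e eta : R) : 0 < e -> 0 < eta -> exists K mu, [/\ grid K mu, refines base K mu &
  exists N0, forall N, (N0 <= N)%N ->
  (P N [set t | (#|[set v | (gamma * (2 * ln N%:R) <=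
        lin (@phi N) (comb phi K mu (fun k => sig (mu k.+1)) v) t)%R]%SET|%:R <
     expR ((2 - 2 * V - e) * ln N%:R))%R] <= eta%:E)%E].
Proof.
move=> e0 eta0; have [g0 gE c0 c1] := tiltP.
case: (eff) => spos sni _ _ _.
case/andP: (hl) => l0 lm.
have be0 : 0 < sbar (lam l) by apply: spos; rewrite in_itv/= lam01.
have b10 : 0 < sbar 1 by apply: spos; rewrite in_itv/= ler01 lexx.
set be := sbar (lam l) in be0 c1.
have S0 : 0 < S.
  by have h : 0 < (1 : R) <= 1 by [rewrite ltr01 lexx]; exact: lt_le_trans (sig0 h) (sigS h).
(* [c'] replaces [c] on the last pieces, which leaves the margin [tau0]. *)
have [rho [rho0 rho1 rho2]] : exists rho : R, [/\ 0 < rho, rho <= (be^-1 - c) / 2 & rho <= e * be / (8 * B)].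
  by apply: min_exists; [rewrite divr_gt0// subr_gt0|rewrite divr_gt0// mulr_gt0].
pose c' := c + rho; have c'0 : 0 < c' by rewrite ltr_wpDl.
have c'1 : c' <= be^-1 by rewrite /c'; lra.
have c'2 : c' ^+ 2 * B <= c ^+ 2 * B + e / 4.
  have -> : c' ^+ 2 * B = c ^+ 2 * B + rho * (c' + c) * B by rewrite /c'; ring.
  rewrite lerD2l.
  have : rho * (c' + c) * B <= e * be / (8 * B) * (2 * be^-1) * B.
    apply: ler_wpM2r; first exact: ltW.
    by apply: ler_pM => //; [exact: ltW|rewrite addr_ge0// ltW|lra].
  have -> : e * be / (8 * B) * (2 * be^-1) * B = e / 4 by field; rewrite !lt0r_neq0.
  by [].
pose tau0 := rho * B; have tau00 : 0 < tau0 by rewrite mulr_gt0.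
have gE' : A + c' * B = gamma + tau0 by rewrite gE /c' /tau0; ring.
have gt0 : 0 < gamma + tau0 by rewrite ltr_wpDl.
(* Thresholds are lowered by the factor [1 - eta'], which spends at most a quarter of the excess
   [tau0] and makes the slope condition strict, with [r2 < 1]. *)
have [eta' [et0 et1 et2]] : exists x : R, [/\ 0 < x, x <= 1 & x <= tau0 / (4 * (gamma + tau0))].
  by apply: min_exists => //; rewrite divr_gt0// mulr_gt0.
pose Th := (sbar 1)^-1; have Th0 : 0 < Th by rewrite invr_gt0.
pose tau := tau0 / 4; have tau1 : 0 < tau by rewrite divr_gt0.
have q1 : 0 < tau0 / 4 / (Th * S ^+ 2) by rewrite divr_gt0// mulr_gt0// exprn_gt0.
have q2 : 0 < tau ^+ 2 / (4 * S ^+ 2) by rewrite divr_gt0 ?mulr_gt0 ?exprn_gt0.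
(* The short first step has three duties: [1/2] keeps it below 1, the next value bounds the height
   lost by skipping increment 0, and the third bounds its variance as [first] requires. *)
have [kappa k0 kle] := positive_lower_bound
  [:: 2^-1, tau0 / 4 / (Th * S ^+ 2), tau ^+ 2 / (4 * S ^+ 2) & points].
have h2 : kappa <= 2^-1 by apply: kle; rewrite ?mem_head// invr_gt0.
have kq1 : kappa <= tau0 / 4 / (Th * S ^+ 2) by apply: kle; rewrite ?inE ?eqxx ?orbT.
have kq2 : kappa <= tau ^+ 2 / (4 * S ^+ 2) by apply: kle; rewrite ?inE ?eqxx ?orbT.
have kpts x : x \in points -> 0 < x -> kappa <= x.
  by move=> xp; apply: kle; rewrite 3!in_cons xp !orbT.
pose r2 := (1 - eta') ^+ 2.
have e10 : 0 <= 1 - eta' by rewrite subr_ge0.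
have r2lt : 0 < 1 - r2.
  by rewrite /r2 (_ : 1 - _ = eta' * (2 - eta')); [rewrite mulr_gt0//; lra|ring].
have r20 : 0 <= r2 by exact: sqr_ge0.
have r21 : r2 <= 1 by lra.
have kr : 0 < kappa * (1 - r2) by rewrite mulr_gt0.
(* A single step of length at most [1 / n] costs at most [Th ^ 2 * S ^ 2 / n]; [n] makes three of
   them cheaper than [kappa * (1 - r2)]. *)
pose n := (Num.truncn (3 * (Th ^+ 2 * S ^+ 2) / (kappa * (1 - r2)))).+1.
have n0 : 0 < n%:R :> R by rewrite ltr0n.
have nP : 3 * (Th ^+ 2 * S ^+ 2 / n%:R) < kappa * (1 - r2).
  have : 3 * (Th ^+ 2 * S ^+ 2) / (kappa * (1 - r2)) < n%:R by exact: truncnS_gt.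
  by rewrite ltr_pdivrMr// => hn; rewrite mulrA ltr_pdivrMr// [_ * n%:R]mulrC.
have klt1 : kappa < 1 by lra.
have [K [mu [gm r K0 mu1 mesh]]] := fine_grid points01 k0 klt1 kpts (ltn0Sn _ : (0 < n)%N).
have [rb [kp kpK kpE] [kl klK klE]] := points_refine r.
exists K, mu; split => //; have [m0 m1 mlt] := gm.
have kpkl := grid_level_lt hlam hl gm kpK klK kpE klE.
have kpK' : (kp < K)%N by rewrite (leq_trans kpkl).
have bpos k : (k < K)%N -> 0 < sbar (mu k.+1) by exact: (grid_sbar_gt0 eff gm).
have spos' k : (k < K)%N -> 0 < sig (mu k.+1) by exact: (grid_sig_gt0 sig0 gm).
have Dpos k : (k < K)%N -> 0 < mu k.+1 - mu k by exact: (grid_step_gt0 gm).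
have mu01 k : (k < K)%N -> 0 < mu k.+1 <= 1.
  by move=> kK; rewrite -m0 -m1 (grid_lt gm)// (grid_le gm).
have sgS k : (k < K)%N -> sig (mu k.+1) <= S by move=> kK; exact/sigS/mu01.
(* The optimal direction: [1 / sbar] before [lam l.-1] and [c'] afterwards. It never exceeds
   [1 / sbar], so every partial cost is controlled by [grid_slope]. *)
pose th k := if (k < kp)%N then (sbar (mu k.+1))^-1 else c'.
have th0 k : (k < K)%N -> 0 <= th k.
  by move=> kK; rewrite /th; case: ifP => _; [rewrite invr_ge0 ltW// bpos|exact: ltW].
have bge k : (k < K)%N -> sbar 1 <= sbar (mu k.+1).
  move=> kK; have /andP[h h'] := mu01 k kK.
  by apply: sni => //; rewrite in_itv/= ?h' ?(ltW h) ?ler01 ?lexx.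
have thb k : (k < K)%N -> th k <= (sbar (mu k.+1))^-1.
  move=> kK; rewrite /th; case: ifPn => // kk; rewrite -leqNgt in kk.
  apply: (le_trans c'1); rewrite lef_pV2 ?posrE ?bpos//.
  have <- : sbar (mu kp.+1) = be.
    by apply: (grid_piece b01 steps_sbar hlam hl gm rb kpK klK kpE klE); rewrite leqnn.
  have /andP[p1 p2] := mu01 k kK; have /andP[p3 p4] := mu01 kp kpK'.
  by apply: sni; rewrite ?in_itv/= ?p2 ?p4 ?(ltW p1) ?(ltW p3)// (grid_le gm).
have thTh k : (k < K)%N -> th k <= Th.
  by move=> kK; rewrite (le_trans (thb k kK))// /Th lef_pV2 ?posrE ?bpos ?bge.
pose y k := (1 - eta') * th k * sig (mu k.+1) * (mu k.+1 - mu k).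
have y0 k : (k < K)%N -> 0 <= y k.
  by move=> kK; rewrite /y !mulr_ge0 ?th0 ?(ltW (spos' k kK)) ?(ltW (Dpos k kK)).
have costE k : (k < K)%N -> y k ^+ 2 / (mu k.+1 - mu k) =
    r2 * ((th k * sig (mu k.+1)) ^+ 2 * (mu k.+1 - mu k)).
  by move=> kK; rewrite /y /r2; field; rewrite lt0r_neq0// Dpos.
have sq_th k : (k < K)%N -> (th k * sig (mu k.+1)) ^+ 2 <= (sig (mu k.+1) / sbar (mu k.+1)) ^+ 2.
  move=> kK; rewrite mulrC; apply: sqr_le.
    by rewrite mulr_ge0 ?th0// ltW// spos'.
  by rewrite ler_wpM2l ?thb// ltW// spos'.
pose h := Th ^+ 2 * S ^+ 2 / n%:R.
have h0 : 0 <= h by rewrite divr_ge0// mulr_ge0// sqr_ge0.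
have slope s : (s <= K)%N -> \sum_(k < s | (0 < k)%N) y k ^+ 2 / (mu k.+1 - mu k) <= r2 * mu s.
  move=> sK; apply: (@le_trans _ _ (r2 * \sum_(k < s) (sig (mu k.+1) / sbar (mu k.+1)) ^+ 2 * (mu k.+1 - mu k))).
    rewrite mulr_sumr big_mkcond/=; apply: ler_sum => k _; have kK := leq_trans (ltn_ord k) sK.
    case: ifP => _; last by rewrite mulr_ge0// mulr_ge0 ?sqr_ge0// ltW// Dpos.
    by rewrite costE// ler_wpM2l// ler_wpM2r ?sq_th// ltW// Dpos.
  by rewrite ler_wpM2l//; exact: (grid_slope b01 steps_sig steps_sbar sig0 sigS eff gm rb).
have meshc k : (0 < k < K)%N -> y k ^+ 2 / (mu k.+1 - mu k) <= h.
  move=> kK; have kK' : (k < K)%N by case/andP: kK.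
  rewrite costE// (le_trans (ler_wpM2r _ r21)) ?mul1r//.
    by rewrite mulr_ge0 ?sqr_ge0// ltW// Dpos.
  rewrite /h; apply: ler_pM; rewrite ?sqr_ge0//; [by rewrite ltW// Dpos| |exact: mesh].
  rewrite -exprMn; apply: sqr_le; first by rewrite mulr_ge0 ?th0// ltW// spos'.
  by apply: ler_pM; rewrite ?th0 ?thTh ?sgS// ltW// spos'.
have gap : 3 * h < mu 1 * (1 - r2) by rewrite mu1.
have first : 4 * sig (mu 1) ^+ 2 * mu 1 <= tau ^+ 2.
  rewrite [X in _ * X <= _]mu1; apply: (@le_trans _ _ (4 * S ^+ 2 * kappa)).
    apply: ler_wpM2r; first exact: ltW.
    by rewrite ler_pM2l//; apply: sqr_le; rewrite ?sgS// ltW// spos'.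
  by rewrite mulrC -ler_pdivlMr// mulr_gt0// exprn_gt0.
have AE := J_ratio_grid steps_sig steps_sbar gm rb kpK kpE; rewrite -/A in AE.
have BE := J_sqr_grid steps_sig gm rb kpK kpE; rewrite -/B in BE.
have split_sum (F : nat -> R) : \sum_(k < K) F k = \sum_(k < kp) F k + \sum_(kp <= k < K) F k.
  by rewrite -!(big_mkord xpredT F) (@big_cat_nat _ _ _ kp 0 K).
have th_sum : \sum_(k < K) th k * sig (mu k.+1) ^+ 2 * (mu k.+1 - mu k) = A + c' * B.
  rewrite (split_sum (fun k => th k * sig (mu k.+1) ^+ 2 * (mu k.+1 - mu k))) AE BE mulr_sumr.
  congr (_ + _).
    by apply: eq_bigr => k _; rewrite /th ltn_ord; congr (_ * _); rewrite mulrC.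
  rewrite !big_nat; apply: eq_bigr => k /andP[kk _].
  by rewrite /th ltnNge kk /= mulrA.
have gain : gamma + tau <= \sum_(k < K | (0 < k)%N) sig (mu k.+1) * y k.
  have yE k : sig (mu k.+1) * y k = (1 - eta') * (th k * sig (mu k.+1) ^+ 2 * (mu k.+1 - mu k)).
    by rewrite /y; ring.
  have t0 : th 0 * sig (mu 1) ^+ 2 * (mu 1 - mu 0) <= tau0 / 4.
    rewrite m0 subr0 [X in _ * X <= _]mu1.
    apply: (@le_trans _ _ (Th * S ^+ 2 * kappa)); last first.
      by rewrite mulrC -ler_pdivlMr// mulr_gt0// exprn_gt0.
    apply: ler_wpM2r; first exact: ltW.
    apply: ler_pM; rewrite ?th0 ?thTh ?sqr_ge0//; apply: sqr_le; rewrite ?sgS//.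
    by rewrite ltW// spos'.
  have -> : \sum_(k < K | (0 < k)%N) sig (mu k.+1) * y k =
      (1 - eta') * (A + c' * B - th 0 * sig (mu 1) ^+ 2 * (mu 1 - mu 0)).
    rewrite -th_sum [in RHS](bigID (fun k : 'I_K => (0 < k)%N))/=.
    rewrite [X in _ = _ * (_ + X - _)](big_pred1 (Ordinal K0)); last first.
      by move=> k; rewrite /= -leqNgt leqn0.
    by rewrite addrK mulr_sumr; apply: eq_bigr => k _; rewrite yE.
  rewrite gE'; move: t0; set t := th 0 * _ * _ => t0.
  have : (1 - eta') * (gamma + tau0 - tau0 / 4) <= (1 - eta') * (gamma + tau0 - t).
    by rewrite ler_wpM2l// lerD2l lerN2.
  have : eta' * (gamma + tau0) <= tau0 / 4.
    rewrite (le_trans (ler_wpM2r (ltW gt0) et2))// le_eqVlt; apply/orP; left; apply/eqP.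
    by field; rewrite lt0r_neq0.
  have : 0 <= eta' * tau0 by rewrite mulr_ge0// ltW.
  rewrite /tau; lra.
have cost_sum : \sum_(k < K | (0 < k)%N) y k ^+ 2 / (mu k.+1 - mu k) <= V + e / 4.
  have F0 k : (k < K)%N -> 0 <= (th k * sig (mu k.+1)) ^+ 2 * (mu k.+1 - mu k).
    by move=> kK; rewrite mulr_ge0 ?sqr_ge0// ltW// Dpos.
  apply: (@le_trans _ _ (\sum_(k < K) (th k * sig (mu k.+1)) ^+ 2 * (mu k.+1 - mu k))).
    rewrite big_mkcond/=; apply: ler_sum => k _; case: ifP => _; last exact: F0.
    by rewrite costE// ler_piMl// F0.
  rewrite (split_sum (fun k => (th k * sig (mu k.+1)) ^+ 2 * (mu k.+1 - mu k))).
  rewrite VE -addrA; apply: lerD.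
    rewrite -kpE -(grid_slope_eq b01 steps_sig steps_sbar sig0 sigS eff hlam hl gm rb kpK klK kpE klE).
    by apply: ler_sum => k _; rewrite /th ltn_ord [_ * sig _]mulrC.
  rewrite (le_trans _ c'2)// BE mulr_sumr !big_nat; apply: ler_sum => k /andP[kk _].
  by rewrite /th ltnNge kk /= exprMn mulrA.
have e2 : 0 < e / 2 by rewrite divr_gt0.
have [N0 hN] := lower_tail hW hphi m0 m1 mlt y0 K0 h0 r21 slope meshc gap
  (fun k kK => ltW (spos' k kK)) tau1 first gain e2 eta0.
exists (maxn 1 N0) => N; rewrite geq_max => /andP[N1 /hN]; apply: le_trans.
have lN : 0 <= ln N%:R :> R by rewrite ln_ge0// ler1n.
have mE (v : box N) : measurable [set t | gamma * (2 * ln N%:R) <=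
    lin (@phi N) (comb phi K mu (fun k => sig (mu k.+1)) v) t].
  exact: measurable_ge (measurable_lin _ _).
apply: le_measure; rewrite ?inE.
- exact: (measurable_finset mE (fun X => #|X|%:R < expR ((2 - 2 * V - e) * ln N%:R))).
- exact: (measurable_finset mE (fun X => #|X|%:R < expR _)).
move=> t /= /lt_le_trans; apply; rewrite ler_expR ler_wpM2r//.
move: cost_sum; set X := \sum_(k < K | _) _; lra.
Qed.

End probability_bounds.

Section variance_profile.
Context {R : realType}.
Variables (M : nat) (sigma lambda : nat -> R).
Hypothesis sigma0 : forall i, (1 <= i <= M)%N -> 0 < sigma i.
Hypothesis lambda0 : lambda 0%N = 0.
Hypothesis lambdaM : lambda M = 1.
Hypothesis lambda_lt : forall i, (i < M)%N -> lambda i < lambda i.+1.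

Local Notation sig := (variance_profile M sigma lambda).

Lemma variance_profileE i x : (i < M)%N -> lambda i < x <= lambda i.+1 -> sig x = sigma i.+1.
Proof.
move=> iM /andP[ix xi]; rewrite /variance_profile big_add1/= indicE memNset ?mulr0 ?add0r; last first.
  move=> /= x0; move: ix; rewrite x0 ltNge -lambda0 (mu_le lambda_lt)//; exact: ltnW.
rewrite (bigD1_seq i) ?mem_index_iota ?iota_uniq//= indicE mem_set ?mulr1/=; last first.
  by rewrite in_itv/= ix.
rewrite big_seq_cond big1 ?addr0// => j; rewrite mem_index_iota => /andP[/andP[_ jM] ji].
rewrite indicE memNset ?mulr0//= in_itv/= => /andP[l1 l2].
have [h|h] : (j < i \/ i < j)%N by move: ji; rewrite neq_ltn => /orP.
  have : lambda j.+1 <= lambda i by rewrite (mu_le lambda_lt)// h ltnW.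
  by rewrite leNgt (lt_le_trans ix).
have : lambda i.+1 <= lambda j by rewrite (mu_le lambda_lt)// h ltnW.
by rewrite leNgt (lt_le_trans l1).
Qed.

Lemma variance_profile_stepwise : stepwise M lambda sig.
Proof.
move=> i x iM hx; rewrite !(variance_profileE iM)// lexx andbT; exact: lambda_lt.
Qed.

Lemma variance_profile_bound x : 0 < x <= 1 -> 0 < sig x <= \sum_(i < M) sigma i.+1.
Proof.
rewrite -{1}lambda0 -lambdaM => hx; have [i [/andP[_ iM] hi]] := step_locate (leq0n M) hx.
rewrite (variance_profileE iM hi) sigma0 ?iM//= (bigD1 (Ordinal iM))//= lerDl sumr_ge0// => j _.
by rewrite ltW// sigma0// ltn_ord.
Qed.

(** The profile is constant between consecutive [lambda i], so the finer increments telescope to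
    those of the definition of the field. *)
Lemma telescope_grid K mu (r : R -> R) : grid K mu ->
  (forall i, (i <= M)%N -> exists2 k, (k <= K)%N & mu k = lambda i) ->
  \sum_(k < K) sig (mu k.+1) * (r (mu k) - r (mu k.+1)) =
  \sum_(1 <= i < M.+1) sigma i * (r (lambda i.-1) - r (lambda i)).
Proof.
move=> gm ref; have [m0 m1 mlt] := gm; rewrite big_add1/=.
suff main i k : (i <= M)%N -> (k <= K)%N -> mu k = lambda i ->
    \sum_(0 <= j < k) sig (mu j.+1) * (r (mu j) - r (mu j.+1)) =
    \sum_(0 <= j < i) sigma j.+1 * (r (lambda j) - r (lambda j.+1)).
  by rewrite -(main M K)// ?big_mkord// m1 lambdaM.
elim: i k => [|i IH] k iM kK ek.
  have -> : k = 0%N by apply/eqP; rewrite -leqn0 -(grid_le gm)// ek lambda0 m0.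
  by rewrite !big_nil.
have [k' k'K ek'] := ref i (ltnW iM).
have kk : (k' <= k)%N by rewrite -(grid_le gm)// ek ek' ltW// lambda_lt.
rewrite (@big_cat_nat _ _ _ k' 0 k)//= (IH k')// ?(ltnW iM)// big_nat_recr//=; congr (_ + _).
transitivity (\sum_(k' <= j < k) (- sigma i.+1) * (r (mu j.+1) - r (mu j))).
  rewrite big_nat [RHS]big_nat; apply: eq_bigr => j /andP[kj jk].
  rewrite (variance_profileE iM); first by ring.
  by rewrite -ek -ek' (grid_lt gm) ?(grid_le gm)// ?ltnS ?kj ?jk//; exact: leq_trans kK.
by rewrite -mulr_sumr telescope_sumr// ek ek' mulNr -mulrN opprB.
Qed.

End variance_profile.

(** Left-continuity extends the constant value from an open piece to its right end. *)
Lemma step_function_left (R : realType) (n : nat) (t c : nat -> R) (f : R -> R) :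
  grid n t -> (forall i, (i < n)%N -> {in `]t i, t i.+1[, forall s, f s = c i}) ->
  {in `]0, 1], forall s, f x @[x --> s^'-] --> f s} -> stepwise n t f.
Proof.
move=> gt fc fl i x iN /andP[ix xi]; have [t0 t1 tlt] := gt.
have last : f (t i.+1) = c i.
  have h1 : f x @[x --> (t i.+1)^'-] --> f (t i.+1).
    by apply: fl; rewrite in_itv/= -{1}t0 -t1 (grid_lt gt)// (grid_le gt).
  have h2 : f x @[x --> (t i.+1)^'-] --> c i.
    apply: cvg_near_cst; near=> z; apply: fc => //; rewrite in_itv/=; apply/andP; split.
      by near: z; apply: nbhs_left_gt; exact: tlt.
    by near: z; exact: nbhs_left_lt.
  exact: cvg_unique h1 h2.
move: xi; rewrite le_eqVlt => /predU1P[->//|xi]; rewrite last; apply: fc => //.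
by rewrite in_itv/= ix.
Unshelve. all: by end_near. Qed.

(** * The inhomogeneous field as a linear combination of increments *)

Section almost_sure_field.
Context {R : realType} dW (TW : measurableType dW).
Variables (PW : lattice -> probability TW R) (W : nat -> TW -> lattice).
Variables (M : nat) (sigma lambda : nat -> R).
Hypothesis lambda0 : lambda 0%N = 0.
Hypothesis lambdaM : lambda M = 1.
Hypothesis lambda_lt : forall i, (i < M)%N -> lambda i < lambda i.+1.
Variables (d : nat -> measure_display) (T : forall N, measurableType (d N))
  (P : forall N, probability (T N) R)
  (phi : forall N, box N -> {RV (P N) >-> R}) (psi : forall N, box N -> T N -> R).
Hypothesis hphi : forall N, (1 <= N)%N -> GFF PW W (@phi N).
Hypothesis hpsi : forall N, (1 <= N)%N -> inhomogeneous_GFF M sigma lambda (@phi N) (@psi N).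

Lemma measurable_inhomogeneous N (v : box N) : (1 <= N)%N -> measurable_fun setT (psi v).
Proof.
move=> N1; have [Phi [ce e]] := hpsi N1; have mPhi i : (i <= M)%N -> measurable_fun setT (Phi v (lambda i)).
  by move=> iM; have [_ h _] := ce v i iM; apply/measurable_EFinP; exact: measurable_int h.
rewrite (_ : @psi N v = fun t => \sum_(i < M) sigma i.+1 * (Phi v (lambda i.+1) t - Phi v (lambda i) t)).
  apply: measurable_sum => i; apply: measurable_funM => //.
  by apply: measurable_funB; apply: mPhi; rewrite ?ltn_ord// ltnW// ltn_ord.
by apply/funext => t; rewrite e big_add1/= big_mkord.
Qed.

(** Each conditional expectation is a version of a projection. Finitely many points and levels
    occur, so one null event covers all exceptions. *)
Lemma inhomogeneous_lin N K mu : (1 <= N)%N -> grid K mu ->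
  (forall i, (i <= M)%N -> exists2 k, (k <= K)%N & mu k = lambda i) ->
  exists2 bad : set (T N), measurable bad /\ P N bad = 0%E & forall t, ~ bad t -> forall v,
    psi v t = lin (@phi N) (comb phi K mu (fun k => variance_profile M sigma lambda (mu k.+1)) v) t.
Proof.
move=> N1 gm ref; have [Phi [ce e]] := hpsi N1; have [gv phi0 _] := hphi N1.
have gl : grid M lambda by split.
pose E (x : box N * 'I_M.+1) t := Phi x.1 (lambda x.2) t != lin (@phi N) (level_mean phi (lambda x.2) x.1) t.
have mE x : measurable [set t | E x t].
  have [_ h _] := ce x.1 x.2 (ltn_ord x.2 : (x.2 <= M)%N).
  have mPhi : measurable_fun setT (Phi x.1 (lambda x.2)).
    by apply/measurable_EFinP; exact: measurable_int h.
  rewrite (_ : [set t | _] = setT `&` [set t | (Phi x.1 (lambda x.2) t)%:E !=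
      (lin (@phi N) (level_mean phi (lambda x.2) x.1) t)%:E]); last by rewrite setTI.
  by apply: measurable_neqe => //; apply/measurable_EFinP => //; exact: measurable_lin.
have PE x : (P N [set t | E x t] <= 0%:E)%E.
  have iM : (x.2 <= M)%N by rewrite -ltnS ltn_ord.
  have l01 : 0 <= lambda x.2 <= 1 by rewrite -{1}lambda0 -lambdaM !(grid_le gl).
  have [rA rB] := residualP (hphi N1) (level N (lambda x.2) (point x.1)) x.1.
  have io (w : box N) : (~ inner (neighborhood N (lambda x.2) (point x.1)) (point w)) <->
      ~~ level N (lambda x.2) (point x.1) (point w).
    by split => [h|/negP h h']; [apply/negP => h'; apply: h|apply: h]; apply/inner_neighborhood.
  rewrite (cond_expectation_lin gv phi0 (S := [set w | ~ inner (neighborhood N (lambda x.2) (point x.1)) (point w)])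
    (a := coord x.1) (X := phi x.1))//.
  - move=> i /contrapT/inner_neighborhood => /(_ l01) h; rewrite /level_mean rA ?subrr//.
  - move=> w /io h; rewrite -[RHS](rB w h); congr gram.
    by apply/funext => i; rewrite /level_mean opprB addrC subrK.
  - by move=> t; rewrite /lin (bigD1 x.1)//= /coord eqxx mul1r big1 ?addr0// => i ix; rewrite (negbTE ix) mul0r.
  - exact: ce.
exists [set t | exists x, E x t]; first split.
- rewrite (_ : [set t | _] = \bigcup_(x in setT) [set t | E x t]).
    exact: fin_bigcup_measurable.
  by apply/seteqP; split => t /=; [move=> [i ?]; exists i|move=> [i _ ?]; exists i].
- apply/le_anti; rewrite measure_ge0 andbT; have := union_bound mE PE; by rewrite mulr0.
move=> t nb v.
have PhiE i : (i <= M)%N -> Phi v (lambda i) t = lin (@phi N) (level_mean phi (lambda i) v) t.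
  move=> iM; apply/eqP; apply: contrapT => /negP h; apply: nb.
  by have iM' : (i < M.+1)%N by []; exists (v, Ordinal iM').
rewrite e; pose r z (s : R) : R := residual (@phi N) (level N s (point v)) v z.
have -> : comb phi K mu (fun k => variance_profile M sigma lambda (mu k.+1)) v =
    fun z => \sum_(1 <= i < M.+1) sigma i * (r z (lambda i.-1) - r z (lambda i)).
  by apply/funext => z; exact: (telescope_grid sigma lambda0 lambdaM lambda_lt (r z) gm ref).
rewrite !big_add1/=.
rewrite /lin; under [RHS]eq_bigr do rewrite big_add1 mulr_suml/=.
rewrite [RHS]exchange_big/= big_nat [RHS]big_nat; apply: eq_bigr => i /andP[_ iM].
rewrite !PhiE ?(ltnW iM)// /lin -sumrB mulr_sumr; apply: eq_bigr => z _.
by rewrite /level_mean /r; ring.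
Qed.

Lemma high_points_le N K mu gamma (A : pred {set box N}) : (1 <= N)%N -> grid K mu ->
  (forall i, (i <= M)%N -> exists2 k, (k <= K)%N & mu k = lambda i) ->
  (P N [set t | A (high_points (@psi N) gamma t)] <=
   P N [set t | A [set v | (gamma * (2 * ln N%:R) <= lin (@phi N)
     (comb phi K mu (fun k => variance_profile M sigma lambda (mu k.+1)) v) t)%R]%SET])%E.
Proof.
move=> N1 gm ref; have [bad [mb Pb] h] := inhomogeneous_lin N1 gm ref.
set L := [set t | A [set v | _]%SET]; set H := [set t | _].
have mL : measurable L.
  apply: (measurable_finset _ A) => v; exact: measurable_ge (measurable_lin _ _).
have mH : measurable H.
  apply: (measurable_finset _ A) => v; apply: measurable_ge; exact: measurable_inhomogeneous.
apply: (@le_trans _ _ (P N (L `|` bad))).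
  apply: le_measure; rewrite ?inE//; first exact: measurableU.
  move=> t Ht; have [|nb] := pselect (bad t); [by right|left].
  rewrite /L /=; suff <- : high_points (@psi N) gamma t = [set v | gamma * (2 * ln N%:R) <= lin (@phi N)
     (comb phi K mu (fun k => variance_profile M sigma lambda (mu k.+1)) v) t]%SET by [].
  apply/setP => v; rewrite !inE lnXn ?ltr0n// h// mulr_natl//.
by apply: (@le_trans _ _ (P N L + P N bad)%E); [exact: measureU2|rewrite [X in (_ + X)%E]Pb adde0].
Qed.

End almost_sure_field.

Lemma vanishing_cvg (R : realType) (u : nat -> \bar R) :
  (forall eta, 0 < eta -> exists N0, forall N, (N0 <= N)%N -> (0 <= u N <= eta%:E)%E) ->
  u @ \oo --> 0%E.
Proof.
move=> h; apply/fine_cvgP; split.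
  have [N0 hN] := h 1 ltr01; exists N0 => // N /= /hN /andP[u0 u1].
  by rewrite ge0_fin_numE// (le_lt_trans u1)// ltry.
apply/cvgrPdist_le => e e0; have [N0 hN] := h e e0; exists N0 => // N /= /hN /andP[u0 u1].
have uf : u N \is a fin_num by rewrite ge0_fin_numE// (le_lt_trans u1)// ltry.
rewrite sub0r normrN ger0_norm ?fine_ge0//.
by rewrite -lee_fin fineK.
Qed.

(* For [n = 0] the logarithm is [-oo], and the lower bound on [n] fails. *)
Lemma log_count_close (R : realType) (n : nat) (x a eps : R) : 0 < x ->
  expR ((a - eps) * x) <= n%:R -> n%:R < expR ((a + eps) * x) ->
  (`|lne (n%:R)%:E / x%:E - a%:E| <= eps%:E)%E.
Proof.
move=> x0 h1 h2; have n0 : 0 < n%:R :> R by exact: lt_le_trans (expR_gt0 _) h1.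
rewrite lne_EFin// inver gt_eqF// -EFinM -EFinB abse_EFin lee_fin ler_norml.
rewrite -[X in expR _ <= X]lnK ?posrE// ler_expR -ler_pdivlMr// in h1.
rewrite -[X in X < expR _]lnK ?posrE// ltr_expR -ltr_pdivrMr// in h2.
by apply/andP; split; lra.
Qed.

Theorem theorem1p3 (R : realType)
  (dW : measure_display) (TW : measurableType dW)
  (PW : lattice -> probability TW R) (W : nat -> TW -> lattice)
  (hW : forall u, simple_random_walk (PW u) u W)
  (M : nat) (sigma lambda : nat -> R)
  (hsigma : forall i, (1 <= i <= M)%N -> 0 < sigma i)
  (hlambda0 : lambda 0%N = 0) (hlambdaM : lambda M = 1)
  (hlambda : forall i, (i < M)%N -> lambda i < lambda i.+1)
  (d : nat -> measure_display) (T : forall N, measurableType (d N))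
  (P : forall N, probability (T N) R)
  (phi : forall N, box N -> {RV (P N) >-> R})
  (psi : forall N, box N -> T N -> R)
  (hphi : forall N, (1 <= N)%N -> GFF PW W (@phi N))
  (hpsi : forall N, (1 <= N)%N ->
     inhomogeneous_GFF M sigma lambda (@phi N) (@psi N))
  (sbar : R -> R)
  (hsbar : effective_profile (variance_profile M sigma lambda) sbar)
  (m : nat) (lam : nat -> R) (hlam : jump_subdivision sbar m lam)
  (l : nat) (hl : (1 <= l <= m)%N) (gamma : R)
  (hgamma : critical_level (variance_profile M sigma lambda) sbar lam l.-1
              <= gamma
            < critical_level (variance_profile M sigma lambda) sbar lam l) :
  cvg_in_probability P
    (fun N t =>
       (lne (#|high_points (@psi N) gamma t|%:R)%:E
          / (ln (N%:R ^+ 2))%:E)%E)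
    ((1 - lam l.-1)
     - (gamma - J (fun s => variance_profile M sigma lambda s ^+ 2 / sbar s) 0 (lam l.-1)) ^+ 2
       / J (fun s => variance_profile M sigma lambda s ^+ 2) (lam l.-1) 1).
Proof.
set sig := variance_profile M sigma lambda in hsbar hgamma *.
have gl : grid M lambda by split.
have [_ _ hleft [n [t [c [t0 t1 tlt tc]]]] _] := hsbar.
have gt : grid n t by split.
pose base := [seq lambda i | i <- iota 0 M.+1] ++ [seq t i | i <- iota 0 n.+1].
have lb K mu : refines base K mu -> forall i, (i <= M)%N -> exists2 k, (k <= K)%N & mu k = lambda i.
  by move=> r i iM; apply: r; rewrite mem_cat map_f// mem_iota.
have tb K mu : refines base K mu -> forall i, (i <= n)%N -> exists2 k, (k <= K)%N & mu k = t i.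
  by move=> r i iM; apply: r; rewrite mem_cat orbC map_f// mem_iota.
have b01 : all (fun x => 0 <= x <= 1) base.
  apply/allP => x; rewrite mem_cat => /orP[] /mapP[i]; rewrite mem_iota add0n ltnS => /andP[_ iM] ->.
    by rewrite -{1}hlambda0 -hlambdaM !(grid_le gl).
  by rewrite -{1}t0 -t1 !(grid_le gt).
have ssig : steps base sig.
  move=> K mu [m0 m1 mlt] r.
  apply: (stepwise_refine mlt _ _ (lb K mu r)); rewrite ?hlambda0 ?hlambdaM ?m0 ?m1//.
  exact: variance_profile_stepwise.
have ssbar : steps base sbar.
  move=> K mu [m0 m1 mlt] r.
  apply: (stepwise_refine mlt _ _ (tb K mu r)); rewrite ?t0 ?t1 ?m0 ?m1//.
  exact: step_function_left gt tc hleft.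
have sbd x : 0 < x <= 1 -> 0 < sig x <= \sum_(i < M) sigma i.+1 by exact: variance_profile_bound.
have sig0 x : 0 < x <= 1 -> 0 < sig x by move=> /sbd/andP[].
have sigS x : 0 < x <= 1 -> sig x <= \sum_(i < M) sigma i.+1 by move=> /sbd/andP[].
move=> eps eps0; apply: vanishing_cvg => eta eta0.
have et2 : 0 < eta / 2 by rewrite divr_gt0.
have ep2 : 0 < 2 * eps by rewrite mulr_gt0.
(* The two tails use different grids; each compares the same field with its own linear combination.
   Their slacks are [2 * e] and [e], so [eps] and [2 * eps] both become [eps] on the scale
   [2 * ln N]. *)
have [K [mu [gm rb [N0 hup]]]] := level_upper hW hphi b01 ssig ssbar sig0 sigS hsbar hlam hl hgamma eps0 et2.
have [K' [mu' [gm' rb' [N1 hlo]]]] := level_lower hW hphi b01 ssig ssbar sig0 sigS hsbar hlam hl hgamma ep2 et2.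
set A := J (fun s => sig s ^+ 2 / sbar s) 0 (lam l.-1) in hup hlo *.
set B := J (fun s => sig s ^+ 2) (lam l.-1) 1 in hup hlo *.
set a := 1 - lam l.-1 - _.
(* From [N = 2] on the normalisation [ln (N ^ 2)] is positive. *)
exists (maxn 2 (maxn N0 N1)) => N; rewrite !geq_max => /and3P[N2 /hup {}hup /hlo {}hlo].
have Npos : (1 <= N)%N by exact: leq_trans N2.
rewrite measure_ge0 /=.
pose up (X : {set box N}) := expR ((a + eps) * (2 * ln N%:R)) <= #|X|%:R.
pose lo (X : {set box N}) := #|X|%:R < expR ((a - eps) * (2 * ln N%:R)).
have uE : (P N [set t | up (high_points (@psi N) gamma t)] <= (eta / 2)%:E)%E.
  apply: (le_trans (high_points_le hlambda0 hlambdaM hlambda hphi hpsi gamma up Npos gm (lb _ _ rb))).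
  move: hup; rewrite /up (_ : (2 - _ + _) * ln N%:R = (a + eps) * (2 * ln N%:R)) ?/a; last by ring.
  by [].
have lE : (P N [set t | lo (high_points (@psi N) gamma t)] <= (eta / 2)%:E)%E.
  apply: (le_trans (high_points_le hlambda0 hlambdaM hlambda hphi hpsi gamma lo Npos gm' (lb _ _ rb'))).
  move: hlo; rewrite /lo (_ : (2 - _ - _) * ln N%:R = (a - eps) * (2 * ln N%:R)) ?/a; last by ring.
  by [].
have mh (X : pred {set box N}) : measurable [set t | X (high_points (@psi N) gamma t)].
  apply: (measurable_finset _ X) => v; apply: measurable_ge; exact: (measurable_inhomogeneous hpsi).
have lN : 0 < 2 * ln N%:R :> R by rewrite mulr_gt0// ln_gt0// ltr1n.
apply: (@le_trans _ _ (P N ([set t | lo (high_points (@psi N) gamma t)] `|` [set t | up (high_points (@psi N) gamma t)]))).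
  apply: le_measure; rewrite ?inE; [|exact: measurableU|].
    exact: (mh (fun X => (eps%:E < `|lne (#|X|%:R)%:E / (ln (N%:R ^+ 2))%:E - a%:E|)%E)).
  move=> w Ew; have {}Ew : (eps%:E < `|lne (#|high_points (@psi N) gamma w|%:R)%:E /
    (ln (N%:R ^+ 2))%:E - a%:E|)%E by exact: Ew.
  have [lw|nlo] := boolP (lo (high_points (@psi N) gamma w)); first by left.
  have [uw|nup] := boolP (up (high_points (@psi N) gamma w)); first by right.
  rewrite -leNgt in nlo; rewrite -ltNge in nup.
  have := log_count_close lN nlo nup.
  have -> : 2 * ln N%:R = ln (N%:R ^+ 2) :> R by rewrite lnXn ?ltr0n// mulr_natl.
  by rewrite leNgt Ew.
apply: (le_trans (measureU2 _ _ _)); [exact: mh|exact: mh|].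
by rewrite (splitr eta) EFinD leeD.
Qed.
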